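(* With the notation of the context, let $L>0$, $T_{-L},T_{+L}\in L^2(\Omega)$, $\phi_{\pm L}=(T_{\pm L},0)$, and for $\psi\in\mathcal R(\mathcal A)$ and $c_1,c_2\in\mathbb R$ let, for $z\in[-L,L]$, $$T(z)=\sum_{i<0}(\psi|\phi_i)_{\mathcal H}e^{\lambda_i(z+L)}U_i+\sum_{i>0}(\psi|\phi_i)_{\mathcal H}e^{\lambda_i(z-L)}U_i+c_1+c_2(z+\Delta_\sigma^{-1}h),$$ where $c_1=c_2=0$ if the constants are controlled, and $c_2=0$ (the $c_2$ term being absent) if the constants are not controlled and $\int_\Omega h\ne0$. Then the Dirichlet inlet/outlet conditions $T|_{z=-L}=T_{-L}$ and $T|_{z=L}=T_{+L}$ are equivalent to the linear system $ZX=b$ (the map $(\psi,c_1,c_2)\mapsto X$ is a bijection from the data satisfying these conditions onto the solutions $X$ of $ZX=b$ with first two entries in $\mathcal R(P)$ and the other entries real), where: - if the constants are controlled, $$Z=\begin{pmatrix} Id & M_+ \\ M_- & Id \end{pmatrix},\quad X=\begin{pmatrix} P\pi_-\psi \\ P\pi_+\psi \end{pmatrix},\quad b=\begin{pmatrix} \phi_{-L} \\ \phi_{+L} \end{pmatrix};$$ - if the constants are not controlled and $\int_\Omega h>0$, $$Z=\begin{pmatrix} Id & M_+ & \Phi \\ M_- & Id & \Phi \\ 0 & (M_+\,\cdot\,|u_-)_{\mathcal H} & (\Phi|u_-)_{\mathcal H} \end{pmatrix},\quad X=\begin{pmatrix} P\pi_-\psi \\ P\pi_+\psi \\ c_1 \end{pmatrix},\quad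 b=\begin{pmatrix} \phi_{-L} \\ \phi_{+L} \\ (\phi_{-L}|u_-)_{\mathcal H} \end{pmatrix};$$ - in the balanced case, $$Z=\begin{pmatrix} Id & M_+ & \Phi & -L\Phi+\widetilde\Phi \\ M_- & Id & \Phi & L\Phi+\widetilde\Phi \\ 0 & (M_+\,\cdot\,|u_-)_{\mathcal H} & (\Phi|u_-)_{\mathcal H} & (-L\Phi+\widetilde\Phi|u_-)_{\mathcal H} \\ (M_-\,\cdot\,|u_+)_{\mathcal H} & 0 & (\Phi|u_+)_{\mathcal H} & (L\Phi+\widetilde\Phi|u_+)_{\mathcal H} \end{pmatrix},\quad X=\begin{pmatrix} P\pi_-\psi \\ P\pi_+\psi \\ c_1 \\ c_2 \end{pmatrix},\quad b=\begin{pmatrix} \phi_{-L} \\ \phi_{+L} \\ (\phi_{-L}|u_-)_{\mathcal H} \\ (\phi_{+L}|u_+)_{\mathcal H} \end{pmatrix}.$$ Moreover, in each case, for sufficiently large $L$ the system $ZX=b$ is invertible.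
   Context: Let $\Omega\subset\mathbb R^2$ be a bounded connected Lipschitz domain whose boundary is partitioned (up to null sets) into $\Gamma_N,\Gamma_D,\Gamma_R,\Gamma_\sharp$ (Neumann, Dirichlet, Robin, periodic parts), each possibly empty, the nonempty ones having positive measure; $\Gamma_\sharp$ consists of pairs of opposite pieces identified by translations, and ''periodic on $\Gamma_\sharp$'' means that traces agree under this identification. Let $h\in L^\infty(\Omega)$, let $c,\sigma>0$ be scalar functions in $L^\infty(\Omega)$ with bounded inverses, and let $a>0$ be a constant. (The functions $T$ considered are solutions of $c\,\partial_{zz}T+\operatorname{div}(\sigma\nabla T)-h\,\partial_zT=0$ on $\Omega\times[-L,L]$ with homogeneous lateral boundary conditions.) The constants are *controlled* if $\Gamma_D\cup\Gamma_R\neq\emptyset$, and *not controlled* otherwise. The *balanced case* is: constants not controlled and $\int_\Omega h=0$. Let $V=\{s\in H^1(\Omega): s=0\text{ on }\Gamma_D,\ s\text{ periodic on }\Gamma_\sharp\}$; let $H=V$ if the constants are controlled and $H=V/\mathbb R$ (quotient by constants) if not. Let $\mathcal H=L^2(\Omega)\times H$ with scalar product $$((u,s)|(u',s'))_{\mathcal H}=\int_\Omega (cuu'+\sigma\nabla s\cdot\nabla s')+\int_{\Gamma_R}a\,ss'.$$ Let $\mathcal A(u,s)=(c^{-1}hu-c^{-1}\operatorname{div}(\sigma\nabla s),\,u)$ (second component taken in $H$) with domain $\mathcal D(\mathcal A)$ the set of $(u,s)\in\mathcal H$ with $u\in V$, $\operatorname{div}(\sigma\nabla s)\in L^2(\Omega)$,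 $\sigma\nabla s\cdot n=0$ on $\Gamma_N$, $\sigma\nabla s\cdot n=-as$ on $\Gamma_R$, and $\sigma\nabla s$ having periodic flux on $\Gamma_\sharp$. $\mathcal A$ is self-adjoint and has an orthogonal Hilbert basis of eigenvectors of $\mathcal H$. Its nonzero eigenvalues, counted with multiplicity, are $\cdots\le\lambda_{-2}\le\lambda_{-1}<0<\lambda_1\le\lambda_2\le\cdots$, with $\lambda_{\pm n}\to\pm\infty$, and pairwise orthogonal eigenvectors $\phi_i=(U_i,\lambda_i^{-1}U_i)$, $i\in\mathbb Z\setminus\{0\}$, normalized by $\|\phi_i\|_{\mathcal H}=1$. In the balanced case $\mathcal A$ has kernel $\mathbb R\phi_0$, $\phi_0=(1,\Delta_\sigma^{-1}h)$; otherwise its kernel is $\{0\}$. $\mathcal R(\mathcal A)$ is the orthogonal complement of the kernel in $\mathcal H$. In the balanced case, $\Delta_\sigma^{-1}h$ denotes the solution $s$ (unique up to constants) of $\operatorname{div}(\sigma\nabla s)=h$ with $\sigma\nabla s\cdot n=0$ on $\Gamma_N$, $s$ and its flux periodic on $\Gamma_\sharp$; when it is used as a function, a representative modulo constants (e.g. the one with zero average) is fixed once and for all. $P$ is the orthogonal projection $P(u,s)=(u,0)$ of $\mathcal H$, with range $\mathcal R(P)$. $\pi_\pm$ is the orthogonal projection of $\mathcal H$ onto the closed span $\mathcal R(\pi_\pm)$ of $\{\phi_i:\pm i>0\}$. It is known that $\pi_\pm P\pi_\pm$ is invertible with bounded inverse on $\mathcal R(\pi_\pm)$, and $B_\pm=\pi_\pm(\pi_\pm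 P\pi_\pm)^{-1}\pi_\pm$. $M_\pm=Pe^{\mp2L\mathcal A}B_\pm:\mathcal R(P)\to\mathcal R(P)$, where $e^{\mp2L\mathcal A}$ acts on $\mathcal R(\pi_\pm)$ by $\phi_i\mapsto e^{\mp2L\lambda_i}\phi_i$. Further notation: $\Phi=(1,0)$, $\widetilde\Phi=(\Delta_\sigma^{-1}h,0)$, $u_-=\Phi-PB_-\Phi$, $u_+=\Phi-PB_+\Phi$. In the block matrices, an entry which is an element of $\mathcal R(P)$ acts on a real number by multiplication, and $(M_\pm\,\cdot\,|u_\mp)_{\mathcal H}$ denotes the linear form $v\mapsto(M_\pm v|u_\mp)_{\mathcal H}$ on $\mathcal R(P)$. *)

(* Defs.v *)
From HB Require Import structures.
From mathcomp Require Import all_boot all_order all_algebra.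
From mathcomp Require Import all_classical all_reals all_analysis.

Set Implicit Arguments.
Unset Strict Implicit.
Unset Printing Implicit Defensive.
Import Order.TTheory GRing.Theory Num.Theory.
Import numFieldNormedType.Exports.
Local Open Scope classical_set_scope.
Local Open Scope ring_scope.

Section Lebesgue_spaces.
Context (R : realType) d (T : measurableType d) (mu : {measure set T -> \bar R}).

Definition in_L2 (D : set T) (f : T -> R) : Prop :=
  measurable_fun D f /\ mu.-integrable D (EFin \o (fun x => f x ^+ 2)).

Definition in_Linf (D : set T) (f : T -> R) : Prop :=
  measurable_fun D f /\ exists K : R, {ae mu, forall x, D x -> `|f x| <= K}.

End Lebesgue_spaces.

Section plane.
Context (R : realType).
Implicit Types (x y n v : R * R) (A Om : set (R * R)) (f g w : R * R -> R).

Local Notation borel2 := (measurableTypeR R * measurableTypeR R)%type.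

Definition area : {measure set borel2 -> \bar R} :=
  (@lebesgue_measure R \x @lebesgue_measure R)%E.

(* The norm of the library on R * R is the sup norm, hence the explicit
   Euclidean structure. *)
Definition dotp x y : R := x.1 * y.1 + x.2 * y.2.
Definition enorm x : R := Num.sqrt (dotp x x).
Definition e1 : R * R := (1, 0).
Definition e2 : R * R := (0, 1).

(* 0 is added so that the empty set has diameter 0. *)
Definition diam A : \bar R :=
  ereal_sup (0%E |` [set (enorm (p.1 - p.2))%:E | p in A `*` A]).

Definition hgauge (d : R) A : \bar R := if (diam A <= d%:E)%E then diam A else +oo%E.

(* One-dimensional Hausdorff outer measure; mu_ext (hgauge d) A is the infimum of
   the sums of diameters over the countable covers of A by sets of diameter at
   most d, which may be taken Borel since a set and its closure have the same
   diameter. *)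
Definition hausdorff1 A : \bar R :=
  ereal_sup [set mu_ext (hgauge d : set borel2 -> _) A | d in [set d : R | 0 < d]].

Lemma diam_ge0 A : (0 <= diam A)%E.
Proof. by apply: ereal_sup_ubound; left. Qed.

Lemma diam0 : diam set0 = 0%E.
Proof.
rewrite /diam; have -> : [set (enorm (p.1 - p.2))%:E | p in set0 `*` set0] = set0.
  by apply/seteqP; split => // z [p [[]]].
by rewrite setU0 ereal_sup1.
Qed.

Lemma hgauge_ge0 d A : (0 <= hgauge d A)%E.
Proof. by rewrite /hgauge; case: ifP => _; rewrite ?diam_ge0 ?leey. Qed.

Lemma hgauge0 (d : R) : 0 < d -> hgauge d set0 = 0%E.
Proof. by move=> d0; rewrite /hgauge diam0 lee_fin ltW. Qed.

Lemma hausdorff10 : hausdorff1 set0 = 0%E.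
Proof.
rewrite /hausdorff1.
have -> : [set mu_ext (hgauge d : set borel2 -> _) set0 | d in [set d : R | 0 < d]]
          = [set 0%E].
  apply/seteqP; split => [z [d /= d0 <-]|z ->].
    by rewrite /= mu_ext0 ?hgauge0 // => X; exact: hgauge_ge0.
  by exists 1 => //=; rewrite mu_ext0 ?hgauge0 // => X; exact: hgauge_ge0.
by rewrite ereal_sup1.
Qed.

Lemma hausdorff1_ge0 A : (0 <= hausdorff1 A)%E.
Proof.
apply: (@le_trans _ _ (mu_ext (hgauge 1 : set borel2 -> _) A)).
  by apply: (@mu_ext_ge0 _ borel2) => X; exact: hgauge_ge0.
by apply: ereal_sup_ubound; exists 1 => //=.
Qed.

Lemma le_hausdorff1 : {homo hausdorff1 : A B / A `<=` B >-> (A <= B)%E}.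
Proof.
move=> A B AB; apply: ge_ereal_sup => _ [d d0 <-].
apply: (@le_trans _ _ (mu_ext (hgauge d : set borel2 -> _) B)); first exact: le_mu_ext.
by apply: ereal_sup_ubound; exists d.
Qed.

Lemma hausdorff1_sigma_subadditive : sigma_subadditive hausdorff1.
Proof.
move=> F; apply: ge_ereal_sup => _ [d d0 <-].
apply: (le_trans (mu_ext_sigma_subadditive (hgauge_ge0 d) F)).
apply: lee_nneseries => i _.
  by move=> *; apply: mu_ext_ge0 => X; exact: hgauge_ge0.
by apply: ereal_sup_ubound; exists d.
Qed.

HB.instance Definition _ := isOuterMeasure.Build R (R * R)%type hausdorff1
  hausdorff10 hausdorff1_ge0 le_hausdorff1 hausdorff1_sigma_subadditive.

Definition length_outer : {outer_measure set (R * R)%type -> \bar R} := hausdorff1.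

Definition surf : {measure set (caratheodory_type length_outer) -> \bar R} :=
  (length_outer : set (caratheodory_type length_outer) -> \bar R).

Definition bdry Om : set (R * R) := closure Om `\` Om.

Definition lipschitz_domain Om : Prop :=
  [/\ open Om, connected Om, Om !=set0, bounded_set Om &
   forall x, bdry Om x -> exists n (g : R -> R) (r : R),
     [/\ enorm n = 1, 0 < r,
      exists K : R, forall s t, `|g s - g t| <= K * `|s - t| &
      forall y, enorm (y - x) < r ->
        Om y <-> dotp (y - x) n < g (dotp (y - x) (- n.2, n.1))]].

(* At a point where the boundary graph is differentiable, Om fills up to first
   order the half-plane opposite to n. *)
Definition outward_normal Om x n : Prop :=
  enorm n = 1 /\
  forall e : R, 0 < e -> exists2 r : R, 0 < r & forall y, enorm (y - x) < r ->
    (dotp (y - x) n < - e * enorm (y - x) -> Om y) /\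
    (e * enorm (y - x) < dotp (y - x) n -> ~ Om y).

Fixpoint Ck (k : nat) f : Prop :=
  if k is k'.+1 then
    [/\ forall x, derivable f x e1, forall x, derivable f x e2,
        Ck k' (fun x => 'D_e1 f x) & Ck k' (fun x => 'D_e2 f x)]
  else continuous f.

Definition smooth f : Prop := forall k, Ck k f.

Definition test_fun Om f : Prop :=
  smooth f /\ exists K : set (R * R),
    [/\ compact K, K `<=` Om & forall x, ~ K x -> f x = 0].

Definition weak_partial Om v f g : Prop :=
  in_L2 area Om g /\
  forall w, test_fun Om w ->
    \int[area]_(x in Om) (f x * 'D_v w x) = - \int[area]_(x in Om) (g x * w x).

Definition in_H1 Om f : Prop :=
  [/\ in_L2 area Om f, exists g, weak_partial Om e1 f g &
      exists g, weak_partial Om e2 f g].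

(* Weak derivatives are unique up to a null set of Om. *)
Definition wpartial Om v f : R * R -> R := xget 0 [set g | weak_partial Om v f g].

Definition wgrad Om f (x : R * R) : R * R := (wpartial Om e1 f x, wpartial Om e2 f x).

(* On a bounded Lipschitz domain these properties determine tr f almost
   everywhere on the boundary, for every f in H^1, by density of the smooth
   functions. *)
Record trace_operator Om (tr : (R * R -> R) -> (R * R -> R)) : Prop := {
  tr_L2 : forall f, in_H1 Om f -> in_L2 surf (bdry Om) (tr f) ;
  tr_linear : forall (k : R) f g, in_H1 Om f -> in_H1 Om g ->
    {ae surf, forall x, bdry Om x -> tr (k *: f + g) x = k * tr f x + tr g x} ;
  tr_bounded : exists K : R, forall f, in_H1 Om f ->
    \int[surf]_(x in bdry Om) (tr f x ^+ 2) <=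
    K * \int[area]_(x in Om) (f x ^+ 2 + dotp (wgrad Om f x) (wgrad Om f x)) ;
  tr_smooth : forall f, smooth f ->
    {ae surf, forall x, bdry Om x -> tr f x = f x} }.

End plane.

Arguments area {R}.
Arguments surf {R}.
Arguments e1 {R}.
Arguments e2 {R}.

(* Bijections, and maps with a bounded inverse, between sets of
   representatives taken modulo the given equalities. *)
Definition bij_mod (S T : Type) (D : S -> Prop) (eqS : S -> S -> Prop)
    (E : T -> Prop) (eqT : T -> T -> Prop) (F : S -> T) : Prop :=
  [/\ forall x, D x -> E (F x),
      forall x y, D x -> D y -> eqS x y <-> eqT (F x) (F y) &
      forall y, E y -> exists2 x, D x & eqT (F x) y].

Definition bounded_invertible (R : realType) (T : Type) (D : T -> Prop)
    (eqT : T -> T -> Prop) (nrm : T -> R) (F : T -> T) : Prop :=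
  bij_mod D eqT D eqT F /\ exists K : R, forall x, D x -> nrm x <= K * nrm (F x).

Record graetz_data (R : realType) := GraetzData {
  omega : set (R * R) ;
  gam_N : set (R * R) ;
  gam_D : set (R * R) ;
  gam_R : set (R * R) ;
  per_pairs : seq (set (R * R) * (R * R)) ; (* (A, t) identifies x in A with x + t *)
  coef_h : R * R -> R ;
  coef_c : R * R -> R ;
  coef_sigma : R * R -> R ;
  coef_a : R }.

Section graetz.
Context (R : realType) (G : graetz_data R).
Local Notation fn := (R * R -> R).
Local Notation Om := (omega G).
Local Notation GN := (gam_N G).
Local Notation GD := (gam_D G).
Local Notation GR := (gam_R G).
Local Notation pairs := (per_pairs G).
Local Notation h := (coef_h G).
Local Notation c := (coef_c G).
Local Notation sig := (coef_sigma G).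
Local Notation a := (coef_a G).

Definition shift (A : set (R * R)) (t : R * R) : set (R * R) :=
  [set x + t | x in A].

Definition pieces : seq (set (R * R)) :=
  flatten [seq [:: p.1; shift p.1 p.2] | p <- pairs].

Definition gam_per : set (R * R) := \big[setU/set0]_(A <- pieces) A.

Definition parts : seq (set (R * R)) := [:: GN; GD; GR; gam_per].

Definition null_disjoint (s : seq (set (R * R))) : Prop :=
  forall i j, (i < j < size s)%N -> surf (nth set0 s i `&` nth set0 s j) = 0%E.

Record graetz_hyp : Prop := {
  domain_Om : lipschitz_domain Om ;
  parts_bdry : forall i, (i < 4)%N -> nth set0 parts i `<=` bdry Om ;
  parts_measurable : forall i, (i < 4)%N ->
    (@length_outer R).-cara.-measurable (nth set0 parts i) ;
  parts_cover : surf (bdry Om `\` \big[setU/set0]_(A <- parts) A) = 0%E ;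
  parts_disjoint : null_disjoint parts ;
  parts_pos : forall i, (i < 4)%N ->
    nth set0 parts i !=set0 -> (0 < surf (nth set0 parts i))%E ;
  pieces_measurable : forall i, (i < size pairs)%N ->
    (@length_outer R).-cara.-measurable (nth (set0, 0) pairs i).1 ;
  pieces_disjoint : null_disjoint pieces ;
  pieces_opposite : forall i, (i < size pairs)%N ->
    let p := nth (set0, 0) pairs i in
    {ae surf, forall x, p.1 x ->
      forall n, outward_normal Om x n -> outward_normal Om (x + p.2) (- n)} ;
  h_Linf : in_Linf area Om h ;
  c_Linf : in_Linf area Om c ;
  c_pos : {ae area, forall x, Om x -> 0 < c x} ;
  c_inv : in_Linf area Om (fun x => (c x)^-1) ;
  sig_Linf : in_Linf area Om sig ;
  sig_pos : {ae area, forall x, Om x -> 0 < sig x} ;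
  sig_inv : in_Linf area Om (fun x => (sig x)^-1) ;
  a_pos : 0 < a }.

Definition controlled : Prop := GD `|` GR !=set0.

Definition mean_h : R := \int[area]_(x in Om) h x.

Definition balanced : Prop := ~ controlled /\ mean_h = 0.

Context (tr : fn -> fn).

Definition spaceV (s : fn) : Prop :=
  [/\ in_H1 Om s, {ae surf, forall x, GD x -> tr s x = 0} &
   forall i, (i < size pairs)%N ->
     let p := nth (set0, 0) pairs i in
     {ae surf, forall x, p.1 x -> tr s (x + p.2) = tr s x}].

(* The elements of the quotient spaces are represented by functions; eqH is the
   equality of the space H, and Heq below that of L^2 x H. *)
Definition eqH (s s' : fn) : Prop :=
  (controlled -> s = s' %[ae area in Om]) /\
  (~ controlled -> exists k : R, s = (fun x => s' x + k) %[ae area in Om]).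

Local Notation HH := (fn * fn)%type.

Definition inH (x : HH) : Prop := in_L2 area Om x.1 /\ spaceV x.2.

Definition Heq (x y : HH) : Prop := x.1 = y.1 %[ae area in Om] /\ eqH x.2 y.2.

Definition ip (x y : HH) : R :=
  \int[area]_(z in Om) (c z * x.1 z * y.1 z
                         + sig z * dotp (wgrad Om x.2 z) (wgrad Om y.2 z))
  + \int[surf]_(z in GR) (a * tr x.2 z * tr y.2 z).

Definition Hnorm (x : HH) : R := Num.sqrt (ip x x).

Definition is_div (s f : fn) : Prop :=
  in_L2 area Om f /\
  forall w, test_fun Om w ->
    \int[area]_(x in Om) (sig x * dotp (wgrad Om s x) ('D_e1 w x, 'D_e2 w x)) =
    - \int[area]_(x in Om) (f x * w x).

Definition divs (s : fn) : fn := xget 0 [set f | is_div s f].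

(* The normal trace of the field sig grad s, tested against v: by Green's formula
   it is the integral of (sig grad s . n) v over the boundary. *)
Definition normal_flux (s f v : fn) : R :=
  \int[area]_(x in Om) (f x * v x + sig x * dotp (wgrad Om s x) (wgrad Om v x)).

(* The Neumann, Robin and periodic flux conditions, in the weak sense: sig grad s . n
   vanishes on gam_N and equals - a s on gam_R.  The functions v of spaceV vanish on
   gam_D and take equal values at identified points, where the outward normals are
   opposite: on gam_per the equation says that sig grad s has the same flux on both
   sides. *)
Definition lateral_flux (s f : fn) : Prop :=
  forall v, spaceV v ->
    normal_flux s f v = - \int[surf]_(x in GR) (a * tr s x * tr v x).

Definition domA (x : HH) : Prop :=
  [/\ inH x, spaceV x.1, exists f, is_div x.2 f & lateral_flux x.2 (divs x.2)].

Definition opA (x : HH) : HH :=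
  (fun z => (c z)^-1 * h z * x.1 z - (c z)^-1 * divs x.2 z, x.1).

Definition kerA (x : HH) : Prop := domA x /\ Heq (opA x) 0.

Definition ranA (x : HH) : Prop := inH x /\ forall k, kerA k -> ip x k = 0.

Definition is_Delta_inv_h (s : fn) : Prop :=
  [/\ spaceV s, is_div s h & lateral_flux s h].

Definition opP (x : HH) : HH := (x.1, 0).

Definition ranP (x : HH) : Prop := inH x /\ exists2 y, inH y & Heq x (opP y).

Context (lam : int -> R) (U : int -> fn).

Definition phi (i : int) : HH := (U i, (lam i)^-1 *: U i).

Record spectral_data : Prop := {
  lam_pos : forall i j : int, 0 < i -> i <= j -> 0 < lam i <= lam j ;
  lam_neg : forall i j : int, i <= j -> j < 0 -> lam i <= lam j < 0 ;
  lam_pinfty : lam n%:Z @[n --> \oo] --> +oo ;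
  lam_ninfty : lam (- n%:Z) @[n --> \oo] --> -oo ;
  phi_dom : forall i : int, i != 0 -> domA (phi i) ;
  phi_eigen : forall i : int, i != 0 -> Heq (opA (phi i)) (lam i *: phi i) ;
  phi_norm : forall i : int, i != 0 -> Hnorm (phi i) = 1 ;
  phi_orth : forall i j : int, i != 0 -> j != 0 -> i != j -> ip (phi i) (phi j) = 0 ;
  phi_basis : forall x, ranA x ->
    Hnorm (x - \sum_(n < N) (ip x (phi n.+1%:Z) *: phi n.+1%:Z
                            + ip x (phi (- n.+1%:Z)) *: phi (- n.+1%:Z)))
      @[N --> \oo] --> 0 }.

(* The signs + and - used as indices are the booleans true and false. *)
Definition pm (b : bool) : R := if b then 1 else -1.

Definition idx (b : bool) (n : nat) : int := if b then n.+1%:Z else - n.+1%:Z.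

Definition Rpi (b : bool) (x : HH) : Prop :=
  inH x /\ forall e : R, 0 < e -> exists N (k : nat -> R),
    Hnorm (x - \sum_(n < N) k n *: phi (idx b n)) < e.

Definition proj (b : bool) (x : HH) : HH :=
  xget 0 [set y | Rpi b y /\ forall z, Rpi b z -> ip (x - y) z = 0].

Definition piPpi (b : bool) (x : HH) : HH := proj b (opP (proj b x)).

(* The xget term is the preimage of proj b x under the restriction of piPpi b to the
   range of proj b. *)
Definition opB (b : bool) (x : HH) : HH :=
  proj b (xget 0 [set y | Rpi b y /\ Heq (piPpi b y) (proj b x)]).

Definition Hsum (x : nat -> HH) : HH :=
  xget 0 [set y | inH y /\ Hnorm (y - \sum_(n < N) x n) @[N --> \oo] --> 0].

(* The operator exp (t A) on the range of the projection proj b, for t lam_i <= 0. *)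
Definition expA (b : bool) (t : R) (x : HH) : HH :=
  Hsum (fun n => (ip x (phi (idx b n)) * expR (t * lam (idx b n))) *: phi (idx b n)).

Definition opM (b : bool) (L : R) (x : HH) : HH :=
  opP (expA b (- pm b * 2 * L) (opB b x)).

Definition Phi : HH := (cst 1, 0).

Definition u_ (b : bool) : HH := Phi - opP (opB b Phi).

Definition L2sum (f : nat -> fn) : fn :=
  xget 0 [set g | in_L2 area Om g /\
    \int[area]_(x in Om) ((g x - \sum_(n < N) f n x) ^+ 2) @[N --> \oo] --> 0].

(* The representative of Delta_sigma^-1 h; it only matters in the balanced case, as
   c2 = 0 otherwise. *)
Context (S0 : fn).

Definition Tsol (L : R) (psi : HH) (c1 c2 z : R) : fn := fun x =>
  L2sum (fun n => (ip psi (phi (idx false n)) * expR (lam (idx false n) * (z + L)))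
                  *: U (idx false n)) x
  + L2sum (fun n => (ip psi (phi (idx true n)) * expR (lam (idx true n) * (z - L)))
                    *: U (idx true n)) x
  + c1 + c2 * (z + S0 x).

Definition Data (d : HH * R * R) : Prop :=
  let: (psi, c1, c2) := d in
  [/\ ranA psi, controlled -> c1 = 0 /\ c2 = 0 &
      ~ controlled -> mean_h != 0 -> c2 = 0].

Definition Data_eq (d d' : HH * R * R) : Prop :=
  [/\ Heq d.1.1 d'.1.1, d.1.2 = d'.1.2 & d.2 = d'.2].

Definition dirichlet (L : R) (Tm Tp : fn) (d : HH * R * R) : Prop :=
  let: (psi, c1, c2) := d in
  Tsol L psi c1 c2 (- L) = Tm %[ae area in Om] /\
  Tsol L psi c1 c2 L = Tp %[ae area in Om].

Definition blk (k : nat) := (HH * HH * k.-tuple R)%type.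

Definition blk_in k (X : blk k) : Prop := ranP X.1.1 /\ ranP X.1.2.

Definition blk_eq k (X Y : blk k) : Prop :=
  [/\ Heq X.1.1 Y.1.1, Heq X.1.2 Y.1.2 & X.2 = Y.2].

Definition blk_norm k (X : blk k) : R :=
  Hnorm X.1.1 + Hnorm X.1.2 + \sum_(j < k) `|tnth X.2 j|.

Definition PhiT : HH := (S0, 0).

Definition Zcont (L : R) (X : blk 0) : blk 0 :=
  let: (v, w, _) := X in (v + opM true L w, opM false L v + w, [tuple]).

Definition Xcont (d : HH * R * R) : blk 0 :=
  let: (psi, _, _) := d in (opP (proj false psi), opP (proj true psi), [tuple]).

Definition bcont (Tm Tp : fn) : blk 0 := ((Tm, 0), (Tp, 0), [tuple]).

Definition Zpos (L : R) (X : blk 1) : blk 1 :=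
  let: (v, w, r) := X in
  let k1 := tnth r ord0 in
  (v + opM true L w + k1 *: Phi,
   opM false L v + w + k1 *: Phi,
   [tuple ip (opM true L w) (u_ false) + k1 * ip Phi (u_ false)]).

Definition Xpos (d : HH * R * R) : blk 1 :=
  let: (psi, c1, _) := d in (opP (proj false psi), opP (proj true psi), [tuple c1]).

Definition bpos (Tm Tp : fn) : blk 1 :=
  ((Tm, 0), (Tp, 0), [tuple ip (Tm, 0) (u_ false)]).

Definition Zbal (L : R) (X : blk 2) : blk 2 :=
  let: (v, w, r) := X in
  let k1 := tnth r ord0 in
  let k2 := tnth r ord_max in
  (v + opM true L w + k1 *: Phi + k2 *: (- L *: Phi + PhiT),
   opM false L v + w + k1 *: Phi + k2 *: (L *: Phi + PhiT),
   [tuple ip (opM true L w) (u_ false) + k1 * ip Phi (u_ false)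
            + k2 * ip (- L *: Phi + PhiT) (u_ false);
          ip (opM false L v) (u_ true) + k1 * ip Phi (u_ true)
            + k2 * ip (L *: Phi + PhiT) (u_ true)]).

Definition Xbal (d : HH * R * R) : blk 2 :=
  let: (psi, c1, c2) := d in (opP (proj false psi), opP (proj true psi), [tuple c1; c2]).

Definition bbal (Tm Tp : fn) : blk 2 :=
  ((Tm, 0), (Tp, 0), [tuple ip (Tm, 0) (u_ false); ip (Tp, 0) (u_ true)]).

Definition system_equiv k (L : R) (Tm Tp : fn)
    (Z : blk k -> blk k) (X : HH * R * R -> blk k) (b : blk k) : Prop :=
  (forall d, Data d -> dirichlet L Tm Tp d <-> blk_eq (Z (X d)) b) /\
  bij_mod (fun d => Data d /\ dirichlet L Tm Tp d) Data_eq
    (fun Y => blk_in Y /\ blk_eq (Z Y) b) (@blk_eq k) X.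

Definition system_invertible k (Z : blk k -> blk k) : Prop :=
  bounded_invertible (@blk_in k) (@blk_eq k) (@blk_norm k) Z.

End graetz.

(* Main.v *)
Require Import Defs.
From HB Require Import structures.
From mathcomp Require Import all_boot all_order all_algebra.
From mathcomp Require Import all_classical all_reals all_analysis.
From mathcomp Require Import measurable_realfun ring lra.

(* For psi in R(A), the traces of T at z = -L and z = L are the first components of
   pi_- psi + exp(-2 L A) pi_+ psi and exp(2 L A) pi_- psi + pi_+ psi, plus the
   contribution of the constants.  As B_b P psi = psi on R(pi_b), the inlet and outlet
   conditions are the first two rows of the system, and the scalar rows say that
   P pi_b psi is orthogonal to u_b.  Conversely v = P B_b v has to be recovered from
   (v | u_b) = 0, or for free when the constants are controlled or when the sign of the
   mean of h is right.  The residual v - P B_b v is a sum of a_n phi_n over the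
   eigenvalues of the other sign; the second component of the partial sums tends to a
   function of zero energy, i.e. a constant k, so that sum a_n^2 / lam_n = k (v | Phi),
   where (v | Phi) = k int h if the constants are not controlled: all a_n vanish.
   For large L the blocks M_b are small and the system is a perturbation of a system
   with an explicit inverse, provided that (Phi | u_b) = |u_b|^2 is nonzero.  If u_b
   were zero, some psi in R(pi_b) would have first component 1, and testing the
   equation satisfied by the resolvent (1 + eps A)^-1 psi or (1 - eps A)^-1 psi against
   itself would contradict the sign of the mean of h. *)

Set Implicit Arguments.
Unset Strict Implicit.
Unset Printing Implicit Defensive.
Import Order.TTheory GRing.Theory Num.Theory.
Import numFieldNormedType.Exports.
Local Open Scope classical_set_scope.
Local Open Scope ring_scope.

(** * Square integrable functions *)

(** It is obtained where it is needed: for sums of eigenvectors of one sign, because the second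
    component of phi_i is its first component divided by lam_i, and on R(P), where second components
    vanish. That zero energy forces a constant is proved from the weak definition of the gradient,
    with product test functions and the connectedness of the domain. Elements of the quotient spaces
    are functions, so identities hold modulo vectors of zero norm. The Hilbert space part is
    therefore carried out for an abstract vector space with a domain predicate and a semidefinite
    form, and then applied to L^2 x H. The three systems are instances of one block system with k =
    0, 1, 2 real unknowns. In the balanced case the last column grows like L; the scalar part is
    solved with bounds independent of L, so that smallness of the blocks M_b still suffices. *)

Lemma discriminant_le (R : realType) (a b c : R) : 0 <= c ->
  (forall t : R, 0 <= a + t * b *+ 2 + t ^+ 2 * c) -> b ^+ 2 <= a * c.
Proof.
move=> c0 H; have [c_eq|cN0] := eqVneq c 0.
  have [->|bN0] := eqVneq b 0; first by rewrite c_eq mulr0 expr0n.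
  (* With [c = 0] the form is affine in [t]; this value makes it equal to -1, so [b] has to
     vanish. *)
  have := H (- (a + 1) / (2 * b)); rewrite c_eq mulr0 addr0.
  by have -> : a + - (a + 1) / (2 * b) * b *+ 2 = -1; [field|rewrite oppr_ge0 ler10].
have cp : 0 < c by rewrite lt_def cN0.
have := H (- b / c).
have -> : a + - b / c * b *+ 2 + (- b / c) ^+ 2 * c = (a * c - b ^+ 2) / c by field.
by rewrite pmulr_lge0 ?invr_gt0// subr_ge0.
Qed.

Lemma cvg0P (R : realType) (a : nat -> R) : (forall n, 0 <= a n) ->
  (a @ \oo --> 0) <-> (forall e, 0 < e -> exists N, forall n, (N <= n)%N -> a n <= e).
Proof.
move=> a0; split=> [/cvgrPdist_le H e e0|H].
  have [N _ NH] := H e e0; exists N => n /NH /=.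
  by rewrite sub0r normrN ger0_norm.
apply/cvgrPdist_le => e e0; have [N NH] := H e e0.
by exists N => // n /NH /=; rewrite sub0r normrN ger0_norm.
Qed.

Lemma sum_half_le2 (R : realType) n : \sum_(k < n) (2^-1 ^+ k : R) <= 2.
Proof.
suff -> : \sum_(k < n) (2^-1 ^+ k : R) = 2 - 2 * 2^-1 ^+ n.
  by rewrite gerBl mulr_ge0// exprn_ge0// invr_ge0.
elim: n => [|n IH]; first by rewrite big_ord0 expr0 mulr1 subrr.
by rewrite big_ord_recr/= IH exprS; field.
Qed.

Section L2.
Context (R : realType) d (T : measurableType d) (mu : {measure set T -> \bar R}).
Variables (D : set T) (mD : measurable D).
Implicit Types f g w : T -> R.

Lemma EFin_Rintegral f : mu.-integrable D (EFin \o f) ->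
  (\int[mu]_(x in D) f x)%:E = (\int[mu]_(x in D) (f x)%:E)%E.
Proof. by move=> fi; rewrite fineK//; exact: integrable_fin_num. Qed.

Lemma ae_eq_Rintegral f g : measurable_fun D f -> measurable_fun D g ->
  f = g %[ae mu in D] -> \int[mu]_(x in D) f x = \int[mu]_(x in D) g x.
Proof.
move=> mf mg fg; congr fine; apply: ae_eq_integral => //.
- exact/measurable_EFinP.
- exact/measurable_EFinP.
- by apply: filterS fg => x /= H Dx; rewrite H.
Qed.

Lemma ae_le_integrable f g : measurable_fun D f ->
  {ae mu, forall x, D x -> `|f x| <= `|g x|} ->
  mu.-integrable D (EFin \o g) -> mu.-integrable D (EFin \o f).
Proof.
move=> mf fg /integrableP[mg goo]; apply/integrableP; split.
  exact/measurable_EFinP.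
apply: le_lt_trans goo; apply: ae_ge0_le_integral => //.
- by apply/measurable_EFinP; exact: measurableT_comp.
- exact: measurableT_comp.
Qed.

Lemma in_L2_meas f : in_L2 mu D f -> measurable_fun D f. Proof. by case. Qed.

Lemma in_L2_sq f : in_L2 mu D f -> mu.-integrable D (EFin \o (fun x => f x ^+ 2)).
Proof. by case. Qed.

Lemma in_L2M f g : in_L2 mu D f -> in_L2 mu D g ->
  mu.-integrable D (EFin \o (fun x => f x * g x)).
Proof.
move=> [mf f2] [mg g2].
apply: (@ae_le_integrable _ (fun x => f x ^+ 2 + g x ^+ 2)).
- exact: measurable_funM.
- apply: aeW => x _ /=.
  rewrite (ger0_norm (addr_ge0 (sqr_ge0 _) (sqr_ge0 _))) normrM.
  rewrite -(real_normK (num_real (f x))) -(real_normK (num_real (g x))).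
  by have := sqr_ge0 (`|f x| - `|g x|); nra.
- exact: (integrableD mD f2 g2).
Qed.

Lemma in_L2D f g : in_L2 mu D f -> in_L2 mu D g -> in_L2 mu D (f + g).
Proof.
move=> Lf Lg; split; first by apply: measurable_funD; [case: Lf|case: Lg].
have fg := in_L2M Lf Lg.
have := integrableD mD (integrableD mD (in_L2_sq Lf) (in_L2_sq Lg)) (integrableD mD fg fg).
apply: eq_integrable => // x _ /=; rewrite -!EFinD; congr EFin.
by rewrite fctE; ring.
Qed.

Lemma in_L2_Linf w f : in_Linf mu D w -> in_L2 mu D f -> in_L2 mu D (w \* f).
Proof.
move=> [mw [K wK]] [mf f2]; split; first exact: measurable_funM.
apply: (@ae_le_integrable _ (fun x => K ^+ 2 * f x ^+ 2)).
- by apply: measurable_funX; exact: measurable_funM.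
- apply: filterS wK => x H Dx /=.
  rewrite (ger0_norm (sqr_ge0 _)) (ger0_norm (mulr_ge0 (sqr_ge0 _) (sqr_ge0 _))).
  rewrite exprMn ler_wpM2r ?sqr_ge0//.
  by rewrite -real_normK ?num_real// lerXn2r ?nnegrE// ?(le_trans _ (H Dx)) ?H.
- exact: (integrableZl mD _ f2).
Qed.

Lemma in_Linf_cst (k : R) : in_Linf mu D (cst k).
Proof. by split => //; exists `|k|; apply: aeW. Qed.

Lemma in_L2Z k f : in_L2 mu D f -> in_L2 mu D (k *: f).
Proof. by move=> Lf; have := in_L2_Linf (in_Linf_cst k) Lf. Qed.

Lemma in_L2N f : in_L2 mu D f -> in_L2 mu D (- f).
Proof. by move=> Lf; rewrite -scaleN1r; exact: in_L2Z. Qed.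

Lemma in_L2B f g : in_L2 mu D f -> in_L2 mu D g -> in_L2 mu D (f - g).
Proof. by move=> Lf Lg; apply: in_L2D => //; exact: in_L2N. Qed.

Lemma in_L20 : in_L2 mu D 0.
Proof.
split; first exact: measurable_cst.
have := @integrable0 _ _ _ mu D; apply: eq_integrable => // x _ /=.
by rewrite expr0n.
Qed.

Definition sqn f : R := \int[mu]_(x in D) (f x ^+ 2).

Lemma sqn_ge0 f : 0 <= sqn f.
Proof. by apply: Rintegral_ge0 => x _; exact: sqr_ge0. Qed.

Lemma sqnN f : sqn (- f) = sqn f.
Proof. by apply: eq_Rintegral => x _; rewrite fctE sqrrN. Qed.

Lemma sqnBC f g : sqn (f - g) = sqn (g - f).
Proof. by rewrite -sqnN opprB. Qed.

Lemma sqnD_le f g : in_L2 mu D f -> in_L2 mu D g ->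
  sqn (f + g) <= 2 * sqn f + 2 * sqn g.
Proof.
move=> Lf Lg.
have i1 := integrableZl mD 2 (in_L2_sq Lf); have i2 := integrableZl mD 2 (in_L2_sq Lg).
rewrite /sqn -!RintegralZl//; try exact: in_L2_sq.
rewrite -RintegralD//; apply: le_Rintegral => //.
- by apply: in_L2_sq; exact: in_L2D.
- exact: (integrableD mD i1 i2).
- by move=> x _; rewrite -[(f + g) x]/(f x + g x); have := sqr_ge0 (f x - g x); nra.
Qed.

Lemma sqn_eq0 f : in_L2 mu D f -> sqn f = 0 -> f = 0 %[ae mu in D].
Proof.
move=> [mf fi] f0.
have H : (\int[mu]_(x in D) `|(f x ^+ 2)%:E| = 0)%E.
  rewrite -[RHS]/(0%:E) -f0 /sqn EFin_Rintegral//.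
  by apply: eq_integral => x _; rewrite /= ger0_norm ?sqr_ge0.
have mf2 : measurable_fun D (fun x => (f x ^+ 2)%:E).
  by apply/measurable_EFinP; exact: measurable_funX.
have := (ae_eq_integral_abs mu mD mf2).1 H.
by apply: filterS => x /= K Dx; have := K Dx => -[] /eqP; rewrite sqrf_eq0 => /eqP.
Qed.

Lemma ae_eq0_sqn f : f = 0 %[ae mu in D] -> measurable_fun D f -> sqn f = 0.
Proof.
move=> f0 mf; rewrite /sqn (@ae_eq_Rintegral _ (cst 0)).
- by rewrite Rintegral_cst// mul0r.
- exact: measurable_funX.
- exact: measurable_cst.
- by apply: filterS f0 => x H Dx /=; rewrite H// expr0n.
Qed.

Lemma L2_CS f g : in_L2 mu D f -> in_L2 mu D g ->
  (\int[mu]_(x in D) (f x * g x)) ^+ 2 <= sqn f * sqn g.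
Proof.
move=> Lf Lg; apply: discriminant_le => [|t]; first exact: sqn_ge0.
have : 0 <= sqn (f + t *: g) by exact: sqn_ge0.
have fg := in_L2M Lf Lg.
have f2 := in_L2_sq Lf; have g2 := in_L2_sq Lg.
have := integrableZl mD (t *+ 2) fg => i1; have := integrableZl mD (t ^+ 2) g2 => i2.
suff -> : sqn (f + t *: g) = sqn f + t * (\int[mu]_(x in D) (f x * g x)) *+ 2 + t ^+ 2 * sqn g by [].
rewrite /sqn -mulrnAl -!RintegralZl// -!RintegralD//.
  by apply: eq_Rintegral => x _; rewrite -[(f + t *: g) x]/(f x + t * g x); ring.
exact: (integrableD mD f2 i1).
Qed.

(** By monotone convergence the series of the [g k] has integral at most 2, hence is finite almost
    everywhere. This turns geometric decay of L^2 norms into pointwise convergence. *)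
Lemma ae_summable (g : nat -> T -> R) :
  (forall k x, 0 <= g k x) -> (forall k, mu.-integrable D (EFin \o g k)) ->
  (forall k, \int[mu]_(x in D) g k x <= 2^-1 ^+ k) ->
  {ae mu, forall x, D x -> exists M, forall n, \sum_(k < n) g k x <= M}.
Proof.
move=> g0 gi gle.
have mg k : measurable_fun D (fun x => (g k x)%:E) by have /integrableP[] := gi k.
have H : mu.-integrable D (fun x => \sum_(k <oo) (g k x)%:E)%E.
  apply/integrableP; split.
    apply: (@ge0_emeasurable_sum _ _ _ D (fun k x => (g k x)%:E) predT) => //.
    by move=> k x _ _; rewrite lee_fin.
  rewrite (_ : (\int[mu]_(x in D) _)%E =
      (\int[mu]_(x in D) \sum_(k <oo) (g k x)%:E)%E); last first.
    apply: eq_integral => x _; rewrite gee0_abs// nneseries_ge0// => n _ _.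
    by rewrite lee_fin.
  rewrite integral_nneseries//; last by move=> n x _; rewrite lee_fin.
  apply: (@le_lt_trans _ _ 2%:E); last exact: ltry.
  apply: lime_le.
    apply: is_cvg_nneseries => n _ _; apply: integral_ge0 => x _.
    by rewrite lee_fin.
  apply: nearW => n; rewrite big_mkord.
  rewrite (eq_bigr (fun k : 'I_n => (\int[mu]_(x in D) g k x)%:E)); last first.
    by move=> k _; rewrite EFin_Rintegral.
  rewrite sumEFin lee_fin; apply: le_trans (sum_half_le2 R n).
  exact: ler_sum.
apply: filterS (integrable_ae mD H) => x Hx Dx.
exists (fine (\sum_(k <oo) (g k x)%:E)%E) => n.
rewrite -lee_fin fineK; last exact: Hx.
rewrite -sumEFin.
have := @nneseries_lim_ge R (fun k => (g k x)%:E) predT 0 n.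
rewrite big_mkord; apply=> k _.
by rewrite lee_fin.
Qed.

Lemma bounded_sum_cvg0 (a : nat -> R) M : (forall n, 0 <= a n) ->
  (forall n, \sum_(k < n) a k <= M) -> a @ \oo --> 0.
Proof.
move=> a0 aM; apply: cvg_series_cvg_0; apply: nondecreasing_is_cvgn.
  by apply/nondecreasing_seqP => n; rewrite /series/= !big_mkord big_ord_recr/= lerDl.
by exists M => _ [n _ <-]; rewrite /series/= big_mkord.
Qed.

(** Taking the k-th index so that the squared distance is at most 2^-k makes the squared errors
    summable almost everywhere, hence infinitesimal. The use is to pass boundary conditions to the
    limit. *)
Lemma L2_subseq (u : nat -> T -> R) f : (forall n, in_L2 mu D (u n)) ->
  in_L2 mu D f -> sqn (u n - f) @[n --> \oo] --> 0 ->
  exists phi : nat -> nat, {ae mu, forall x, D x -> u (phi k) x @[k --> \oo] --> f x}.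
Proof.
move=> Lu Lf /cvg0P H.
have {}H := H (fun n => sqn_ge0 _).
have [phi Hphi] : exists phi : nat -> nat, forall k, sqn (u (phi k) - f) <= 2^-1 ^+ k.
  have E k : exists n, sqn (u n - f) <= 2^-1 ^+ k.
    by have [|N HN] := H (2^-1 ^+ k); [rewrite exprn_gt0|exists N; apply: HN].
  by have [phi Hphi] := choice E; exists phi.
exists phi.
have S : {ae mu, forall x, D x -> exists M, forall n, \sum_(k < n) (u (phi k) x - f x) ^+ 2 <= M}.
  apply: (@ae_summable (fun k x => (u (phi k) x - f x) ^+ 2)) => //.
  - by move=> k x; exact: sqr_ge0.
  - by move=> k; apply: in_L2_sq; exact: in_L2B.
apply: filterS S => x + Dx => /(_ Dx)[M HM].
have /cvg0P := bounded_sum_cvg0 (fun k => sqr_ge0 (u (phi k) x - f x)) HM.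
move=> /(_ (fun k => sqr_ge0 _)) C.
apply/cvgrPdist_le => e e0.
have [|N HN] := C (e ^+ 2); first by rewrite exprn_gt0.
exists N => // n /HN /= {}HN.
by rewrite distrC -(@ler_pXn2r _ 2) ?nnegrE ?(ltW e0)// real_normK ?num_real.
Qed.

(** Fatou's lemma for the squares of the [v k]. It yields membership in L^2 and the distance
    estimate at once; [L2_complete] applies it to differences of two terms of the sequence. *)
Lemma L2_fatou (v : nat -> T -> R) f e : (forall n, in_L2 mu D (v n)) ->
  measurable_fun D f ->
  {ae mu, forall x, D x -> v k x @[k --> \oo] --> f x} ->
  (exists K, forall k, (K <= k)%N -> sqn (v k) <= e) ->
  in_L2 mu D f /\ sqn f <= e.
Proof.
move=> Lv mf vf [K HK].
have mv k : measurable_fun D (fun x => (v k x ^+ 2)%:E).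
  by apply/measurable_EFinP; apply: measurable_funX; case: (Lv k).
have v0 k x : D x -> (0 <= (v k x ^+ 2)%:E)%E by rewrite lee_fin sqr_ge0.
have := fatou mu mD mv v0.
have -> : (\int[mu]_(x in D) limn_einf (fun k => (v k x ^+ 2)%:E) =
          \int[mu]_(x in D) (f x ^+ 2)%:E)%E.
  apply: ge0_ae_eq_integral => //.
  - apply: measurableT_comp => //; apply: measurable_fun_limn_esup => n; exact: measurableT_comp.
  - by apply/measurable_EFinP; exact: measurable_funX.
  - move=> x Dx; rewrite limn_einf_lim; apply: lime_ge; first exact: is_cvg_einfs.
    by apply: nearW => n; apply: le_ereal_inf_tmp => _ [m /= _ <-]; exact: v0.
  - by move=> x _; rewrite lee_fin sqr_ge0.
  - apply: filterS vf => x + Dx => /(_ Dx) vx.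
    have vx2 : (v k x ^+ 2)%:E @[k --> \oo] --> (f x ^+ 2)%:E.
      by apply: cvg_EFin; [apply: nearW|apply: cvgM].
    by rewrite is_cvg_limn_einfE; [exact/cvg_lim|apply/cvg_ex; eexists; exact: vx2].
move=> H.
have {}H : (\int[mu]_(x in D) (f x ^+ 2)%:E <= e%:E)%E.
  apply: le_trans H _.
  rewrite limn_einf_lim; apply: lime_le; first exact: is_cvg_einfs.
  near=> n.
  apply: (@le_trans _ _ (\int[mu]_(x in D) (v n x ^+ 2)%:E)%E).
    by apply: ereal_inf_lbound; exists n => /=.
  rewrite -EFin_Rintegral; last exact: in_L2_sq.
  by rewrite lee_fin HK//; near: n; exists K.
have Lf : in_L2 mu D f.
  split => //; apply/integrableP; split.
    by apply/measurable_EFinP; exact: measurable_funX.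
  rewrite (eq_integral (fun x => (f x ^+ 2)%:E)).
    by apply: le_lt_trans H _; exact: ltry.
  by move=> x _; rewrite /= ger0_norm ?sqr_ge0.
split => //; rewrite -lee_fin EFin_Rintegral//; exact: in_L2_sq.
Unshelve. all: by end_near. Qed.

Lemma L2_complete (u : nat -> T -> R) : (forall n, in_L2 mu D (u n)) ->
  (forall e, 0 < e -> exists N, forall m n, (N <= m)%N -> (N <= n)%N ->
     sqn (u m - u n) <= e) ->
  exists2 f, in_L2 mu D f & sqn (u n - f) @[n --> \oo] --> 0.
Proof.
move=> Lu C.
(* The rate 8^-k leaves room for a weight 4^k: the weighted squared increments have integrals at
   most 2^-k, and a pointwise bound on [4 ^+ k * dd k x ^+ 2] makes the increments themselves
   O(2^-k), thus summable. *)
have [N HN Nid] : exists2 N : nat -> nat, forall k m n, (N k <= m)%N -> (N k <= n)%N ->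
    sqn (u m - u n) <= 8^-1 ^+ k & forall k, (k <= N k)%N.
  have E k : exists N, forall m n, (N <= m)%N -> (N <= n)%N ->
      sqn (u m - u n) <= 8^-1 ^+ k.
    by apply: C; rewrite exprn_gt0.
  have [N H] := choice E; exists (fun k => N k + k)%N => [k m n mN nN|k].
    by apply: H; [apply: leq_trans mN|apply: leq_trans nN]; exact: leq_addr.
  exact: leq_addl.
(* Partial sums of [N] give a nondecreasing index sequence that stays above [N j] for every
   [j <= k]. *)
pose psi k := (\sum_(j < k.+1) N j)%N.
have psiN k : (N k <= psi k)%N by rewrite /psi big_ord_recr/= leq_addl.
have psiS k : (psi k <= psi k.+1)%N by rewrite /psi [leqRHS]big_ord_recr/= leq_addr.
have psi_ge j k : (j <= k)%N -> (N j <= psi k)%N.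
  move=> jk; apply: leq_trans (psiN j) _.
  by rewrite -(subnK jk); elim: (k - j)%N => // i IH; rewrite (leq_trans IH)// addSn.
pose dd k := u (psi k.+1) - u (psi k).
have Ldd k : in_L2 mu D (dd k) by exact: in_L2B.
have S : {ae mu, forall x, D x -> exists M, forall n, \sum_(k < n) (4 ^+ k * dd k x ^+ 2) <= M}.
  apply: (@ae_summable (fun k x => 4 ^+ k * dd k x ^+ 2)).
  - by move=> k x; rewrite mulr_ge0 ?sqr_ge0// exprn_ge0.
  - by move=> k; exact: (integrableZl mD _ (in_L2_sq (Ldd k))).
  - move=> k; rewrite RintegralZl//; last exact: in_L2_sq.
    apply: (@le_trans _ _ (4 ^+ k * 8^-1 ^+ k)).
      by rewrite ler_wpM2l ?exprn_ge0//; apply: HN => //; exact: leq_trans (psiN k) _.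
    by rewrite -exprMn; have -> : (4 * 8^-1 : R) = 2^-1 by field.
(* The upper limit is measurable on the whole of [D], whether or not the sequence converges there,
   and [fine] makes it real valued. *)
pose f x := fine (limn_esup (fun k => (u (psi k) x)%:E)).
have mf : measurable_fun D f.
  apply: measurableT_comp => //; apply: measurable_fun_limn_esup => n.
  by apply/measurable_EFinP; case: (Lu (psi n)).
have uf : {ae mu, forall x, D x -> u (psi k) x @[k --> \oo] --> f x}.
  apply: filterS S => x + Dx => /(_ Dx)[M HM].
  have M0 : 0 <= M by have := HM 0%N; rewrite big_ord0.
  have ddle k : `|dd k x| <= (1 + M) * 2^-1 ^+ k.
    have kM : 4 ^+ k * dd k x ^+ 2 <= M.
      apply: le_trans (HM k.+1); rewrite big_ord_recr/= lerDr sumr_ge0// => i _.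
      by rewrite mulr_ge0 ?sqr_ge0// exprn_ge0.
    rewrite -(@ler_pXn2r _ 2) ?nnegrE//; last by rewrite mulr_ge0 ?addr_ge0 ?exprn_ge0.
    rewrite real_normK ?num_real// exprMn -exprM mulnC exprM.
    have -> : (2^-1 ^+ 2 : R) = 4^-1 by field.
    rewrite exprVn -(ler_pM2l (exprn_gt0 k (ltr0n _ 4)))//.
    by rewrite [leRHS]mulrCA mulfV ?expf_neq0// mulr1; nra.
  have cdd : cvgn (series (fun k => dd k x)).
    apply: normed_cvg; apply: (@series_le_cvg _ _ (fun k => (1 + M) * 2^-1 ^+ k)) => //.
    - by move=> n; exact: normr_ge0.
    - by move=> n; rewrite mulr_ge0 ?addr_ge0 ?exprn_ge0.
    - apply: (@is_cvg_geometric_series R (1 + M) 2^-1).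
      by rewrite ger0_norm// invf_lt1// ltr1n.
  have cu : cvgn (fun k => u (psi k) x).
    have -> : (fun k => u (psi k) x) = (fun k => u (psi 0%N) x + series (fun k => dd k x) k).
      apply/funext => k; rewrite /series/= /dd.
      have -> : \sum_(0 <= i < k) (u (psi i.+1) - u (psi i)) x =
                \sum_(0 <= i < k) ((fun i => u (psi i) x) i.+1 - (fun i => u (psi i) x) i) by [].
      by rewrite telescope_sumr// addrC subrK.
    by apply: is_cvgD => //; exact: is_cvg_cst.
  rewrite /f.
  have cE : (u (psi k) x)%:E @[k --> \oo] --> (limn (fun k => u (psi k) x))%:E.
    by apply: cvg_EFin; [exact: nearW|exact: cu].
  rewrite is_cvg_limn_esupE; last by apply/cvg_ex; eexists; exact: cE.
  by rewrite (cvg_lim _ cE).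
(* Fatou in the first index with [n] fixed turns the Cauchy bound into a bound for the distance to
   the limit. *)
have key e n : 0 < e -> (exists K, forall k, (K <= k)%N -> sqn (u (psi k) - u n) <= e) ->
    in_L2 mu D (f - u n) /\ sqn (f - u n) <= e.
  move=> e0 HK; apply: (@L2_fatou (fun k => u (psi k) - u n)) => //.
  - by move=> k; exact: in_L2B.
  - by apply: measurable_funB => //; case: (Lu n).
  - apply: filterS uf => x + Dx => /(_ Dx) ux.
    by apply: cvgB => //; exact: cvg_cst.
have Lf : in_L2 mu D f.
  have [] := key 1 (N 0%N) ltr01; last first.
    by move=> L1 _; rewrite -(subrK (u (N 0%N)) f); exact: in_L2D.
  exists 0%N => k _; have := HN 0%N (psi k) (N 0%N); rewrite expr0; apply => //.
  exact: psi_ge.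
exists f => //; apply/cvg0P => [n|e e0]; first exact: sqn_ge0.
have [N1 HN1] := C e e0; exists N1 => n nN1.
rewrite sqnBC; have [] := key e n e0 => //.
exists N1 => k N1k; apply: HN1 => //.
exact: leq_trans N1k (leq_trans (Nid k) (psiN k)).
Qed.
End L2.

(** * Smooth bump functions *)

Lemma is_deriveP (R : realType) (V : normedModType R) (f : V -> R) (x v : V) (df : R) :
  (h^-1 * (f (h *: v + x) - f x) @[h --> 0^'] --> df) -> is_derive x v f df.
Proof.
move=> C; have D : derivable f x v by apply/cvg_ex; exists df.
by apply: DeriveDef => //; exact: cvg_lim.
Qed.

Section smooth_line.
Context (R : realType).
Implicit Types (f g : R -> R) (p q x : R) (P : {poly R}).

Fixpoint CkR (k : nat) f : Prop :=
  if k is k'.+1 then exists2 f' : R -> R, (forall x, is_derive x 1 f (f' x)) & CkR k' f'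
  else continuous f.

Lemma is_derive_continuous f (f' : R -> R) : (forall x, is_derive x 1 f (f' x)) -> continuous f.
Proof.
move=> H x; apply: differentiable_continuous; apply/derivable1_diffP.
by have := H x; case.
Qed.

Lemma CkRS k f : CkR k.+1 f -> CkR k f.
Proof.
elim: k f => [|k IH] f [f' Hf]; first by move=> _; exact: is_derive_continuous Hf.
by move=> /IH C; exists f'.
Qed.

Lemma CkRD k f g : CkR k f -> CkR k g -> CkR k (f + g).
Proof.
elim: k f g => [|k IH] f g.
  by move=> cf cg x; exact: (cvgD (cf x) (cg x)).
move=> [f' Hf Cf] [g' Hg Cg]; exists (f' + g'); last exact: IH.
by move=> x; exact: is_deriveD.
Qed.

Lemma CkRM k f g : CkR k f -> CkR k g -> CkR k (f * g).
Proof.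
elim: k f g => [|k IH] f g.
  by move=> cf cg x; exact: (cvgM (cf x) (cg x)).
move=> Cf Cg; have Df := CkRS Cf; have Dg := CkRS Cg.
case: Cf => f' Hf Cf; case: Cg => g' Hg Cg.
exists (f * g' + g * f'); last by apply: CkRD; apply: IH.
by move=> x; exact: (is_deriveM (Hf x) (Hg x)).
Qed.

Lemma CkR_cst k c : CkR k (fun=> c).
Proof.
elim: k c => [|k IH] c; first exact: cst_continuous.
exists (fun=> 0); [by move=> x; exact: is_derive_cst|exact: IH].
Qed.

Lemma CkRZ k c f : CkR k f -> CkR k (c *: f).
Proof. by move=> Cf; apply: (@CkRM k (fun=> c)) => //; exact: CkR_cst. Qed.

Lemma CkR_affine k a b f : CkR k f -> CkR k (fun x => f (a * x + b)).
Proof.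
elim: k f => [|k IH] f.
  move=> cf x; apply: (@continuous_comp _ _ _ (fun x => a * x + b) f); last exact: cf.
  by apply: cvgD; [apply: cvgM; [exact: cvg_cst|]|exact: cvg_cst].
case=> f' Hf Cf; exists (a *: (fun x => f' (a * x + b))); last first.
  by apply: CkRZ; exact: IH.
move=> x.
have D : is_derive x 1 (fun x => a * x + b) a.
  have H : is_derive x 1 (a \*: (id : R -> R) + cst b) (a *: 1 + 0).
    exact: (is_deriveD (is_deriveZ a (is_derive_id x 1)) (is_derive_cst b x 1)).
  by apply: is_derive_eq H _; rewrite addr0 /GRing.scale/= mulr1.
have H : is_derive x 1 (f \o (fun x : R => a * x + b)) (f' (a * x + b) * a).
  by apply: is_derive1_comp; exact: Hf.
by apply: is_derive_eq H _; rewrite mulrC.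
Qed.

Definition smoothR f : Prop := forall k, CkR k f.

Lemma smoothRM f g : smoothR f -> smoothR g -> smoothR (f * g).
Proof. by move=> sf sg k; exact: CkRM. Qed.

Lemma smoothRD f g : smoothR f -> smoothR g -> smoothR (f + g).
Proof. by move=> sf sg k; exact: CkRD. Qed.

Lemma smoothRZ c f : smoothR f -> smoothR (c *: f).
Proof. by move=> sf k; exact: CkRZ. Qed.

Lemma smoothR_continuous f : smoothR f -> continuous f.
Proof. by move/(_ 0%N). Qed.

(* The derivatives of exp (- 1 / x) 1_(x > 0) are all of this form. *)
Definition flat P x : R := if 0 < x then P.[x^-1] * expR (- x^-1) else 0.

(** Each monomial satisfies t^i <= i! exp t for t >= 0, so C can be the sum of the |P_i| i!. *)
Lemma horner_le_expR P : exists C : R, forall t, 0 <= t -> `|P.[t]| <= C * expR t.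
Proof.
exists (\sum_(i < size P) `|P`_i| * i`!%:R) => t t0.
rewrite horner_coef mulr_suml; apply: (le_trans (ler_norm_sum _ _ _)).
apply: ler_sum => i _; rewrite normrM -mulrA ler_wpM2l//.
rewrite ger0_norm ?exprn_ge0//; case: (nat_of_ord i) => [|j].
  by rewrite expr0 fact0 mul1r -expR0 ler_expR.
have F0 : 0 < (j.+1`!%:R : R) by rewrite ltr0n fact_gt0.
rewrite mulrC -ler_pdivrMr//; apply: le_trans (expR_ge1Dxn j t0).
by rewrite lerDr.
Qed.

(** In the variable t = 1/x the derivative of P(t) exp(-t) is (P' - P)(t) exp(-t), and dt/dx = -
    t^2, whence the polynomial X^2 (P - P'). *)
Lemma is_derive_flat P x : is_derive x 1 (flat P) (flat ('X^2 * (P - P^`())) x).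
Proof.
have [x0|x0|->] := ltgtP x 0.
- rewrite {2}/flat ltNge (ltW x0)/=.
  apply: (@near_eq_is_derive _ _ _ (cst 0)) => //.
  near=> y; rewrite /flat ifF//; apply/negP/negP; rewrite -leNgt; apply: ltW.
  by near: y; exact: lt_nbhsl.
- rewrite {2}/flat x0.
  have N : \near x, (fun y : R => P.[y^-1] * expR (- y^-1) : R) x = flat P x.
    near=> y; rewrite /flat.
    have -> // : 0 < y by near: y; exact: lt_nbhsr.
  apply: (near_eq_is_derive N).
  have xN0 : x != 0 by rewrite gt_eqF.
  have DV : is_derive x 1 (fun y : R => y^-1) (- x ^- 2).
    apply: is_derive_eq; first exact: (@is_deriveV _ id x 1 1).
    by rewrite /GRing.scale/= mulr1.
  have D1 := is_derive1_comp (is_derive_poly P x^-1) DV.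
  have dom_opp : is_derive x 1 (fun y : R => - y^-1) (x ^- 2).
    by have := is_deriveN DV; rewrite opprK.
  have D2 : is_derive x 1 (expR \o (fun y : R => - y^-1)) (expR (- x^-1) * x ^- 2).
    by apply: is_derive1_comp; exact: is_derive_expR.
  apply: (is_derive_eq (is_deriveM D1 D2)).
  rewrite hornerM hornerXn hornerD hornerN /GRing.scale/=.
  by field.
- rewrite {2}/flat ltxx.
  apply: is_deriveP; rewrite {2}/flat ltxx.
  (* The difference quotient at 0 is h^-1 P(h^-1) exp(- h^-1) = h (X^2 P)(h^-1) exp(- h^-1):
     bounding X^2 P instead of P leaves a factor [h]. *)
  have [C HC] := horner_le_expR ('X^2 * P).
  apply/cvgrPdist_le => e e0.
  have C1 : 0 < `|C| + 1 by rewrite ltr_wpDl.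
  near=> h.
  rewrite sub0r normrN subr0 addr0 /GRing.scale/= mulr1 /flat.
  case: ifPn => h0; last by rewrite mulr0 normr0 ltW.
  have := HC h^-1; rewrite invr_ge0 (ltW h0) => /(_ isT).
  rewrite !hornerE normrM ger0_norm ?sqr_ge0// => H.
  rewrite normrM normrM (ger0_norm (expR_ge0 _)) expRN (gtr0_norm (_ : 0 < h^-1)) ?invr_gt0//.
  rewrite ler_pdivrMr ?expR_gt0//.
  have : h * (`|C| + 1) <= e.
    rewrite -ler_pdivlMr//; near: h; apply: nbhs_dnbhs.
    by apply: filterS (lt_nbhsl (divr_gt0 e0 C1)) => y /ltW.
  move=> he.
  have -> : h^-1 * `|P.[h^-1]| = h * (h^-1 ^+ 2 * `|P.[h^-1]|) by field; rewrite gt_eqF.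
  apply: le_trans (ler_wpM2l (ltW h0) H) _.
  rewrite mulrA ler_wpM2r ?expR_ge0//; apply: le_trans he.
  by rewrite ler_pM2l//; apply: le_trans (ler_norm _) _; rewrite lerDl.
Unshelve. all: by end_near. Qed.

Lemma smoothR_flat P : smoothR (flat P).
Proof.
move=> k; elim: k P => [|k IH] P; first exact: is_derive_continuous (is_derive_flat P).
by exists (flat ('X^2 * (P - P^`()))) => //; exact: is_derive_flat.
Qed.

(** The integer is a steepness: [n = 1] gives a fixed bump on ]p, q[, and as [n] grows the bumps
    tend pointwise to the indicator of that interval while staying between 0 and 1. For [n = 0] the
    function vanishes identically. *)
Definition bumpf p q (n : nat) x : R := flat 1 (n%:R * (x - p)) * flat 1 (n%:R * (q - x)).

Lemma flat1E x : flat 1 x = if 0 < x then expR (- x^-1) else 0.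
Proof. by rewrite /flat hornerC mul1r. Qed.

Lemma flat1_itv x : 0 <= flat 1 x <= 1.
Proof.
rewrite flat1E; case: ifPn => x0; last by rewrite lexx ler01.
by rewrite expR_ge0 expR_le1 oppr_le0 invr_ge0 ltW.
Qed.

Lemma bump_itv p q n x : 0 <= bumpf p q n x <= 1.
Proof.
have /andP[a0 a1] := flat1_itv (n%:R * (x - p)).
have /andP[b0 b1] := flat1_itv (n%:R * (q - x)).
by rewrite mulr_ge0//= mulr_ile1.
Qed.

Lemma smoothR_bump p q n : smoothR (bumpf p q n).
Proof.
have -> : bumpf p q n = (fun x => flat 1 (n%:R * x + (- (n%:R * p)))) *
                       (fun x => flat 1 (- n%:R * x + n%:R * q)).
  apply/funext => x; rewrite -[RHS]/(flat 1 (_ * x + _) * flat 1 (_ * x + _)) /bumpf.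
  by congr (flat _ _ * flat _ _); ring.
by apply: smoothRM => k; apply: CkR_affine; exact: smoothR_flat.
Qed.

Lemma bump_out p q n x : x <= p \/ q <= x -> bumpf p q n x = 0.
Proof.
move=> [xp|qx]; rewrite /bumpf !flat1E.
  by rewrite ltNge mulr_ge0_le0 ?subr_le0// mul0r.
by rewrite [0 < _ * (q - _)]ltNge mulr_ge0_le0 ?subr_le0// mulr0.
Qed.

Lemma bump_gt0 p q n x : p < x < q -> 0 < bumpf p q n.+1 x.
Proof.
move=> /andP[px xq]; rewrite /bumpf !flat1E.
have n0 : 0 < n.+1%:R :> R by rewrite ltr0n.
by rewrite (pmulr_rgt0 _ n0) (pmulr_rgt0 _ n0) !subr_gt0 px xq mulr_gt0 ?expR_gt0.
Qed.

Lemma cvg_bump p q x : p < x < q -> bumpf p q n x @[n --> \oo] --> (1 : R).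
Proof.
move=> /andP[px xq].
have key t : 0 < t -> flat 1 (n%:R * t) @[n --> \oo] --> (1 : R).
  move=> t0; rewrite -(cvg_shiftS (fun n : nat => flat 1 (n%:R * t))).
  have -> : (fun n : nat => flat 1 (n.+1%:R * t)) =
            (fun n : nat => expR (- (n.+1%:R^-1 * t^-1))).
    by apply/funext => n; rewrite flat1E mulr_gt0 ?ltr0n// invfM.
  have C : - (n.+1%:R^-1 * t^-1) @[n --> \oo] --> (0 : R).
    rewrite -oppr0; apply: cvgN; rewrite -(mul0r t^-1).
    by apply: cvgM; [exact: cvg_harmonic|exact: cvg_cst].
  have C2 := continuous_cvg _ (@continuous_expR R 0) C; rewrite expR0 in C2.
  exact: C2.
have := cvgM (key _ (_ : 0 < x - p)) (key _ (_ : 0 < q - x)).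
by rewrite mulr1; apply; rewrite subr_gt0.
Qed.

Local Notation mu1 := (@lebesgue_measure R).

Lemma supp_integrable f p q : continuous f ->
  (forall x, x <= p \/ q <= x -> f x = 0) -> mu1.-integrable setT (EFin \o f).
Proof.
move=> cf f0.
have : mu1.-integrable `[p, q] (EFin \o f).
  by apply: continuous_compact_integrable; [exact: segment_compact|exact: continuous_subspaceT].
rewrite integrable_mkcond// => H; apply: eq_integrable H => // x _.
rewrite patchE; case: ifPn => //; rewrite notin_setE/= in_itv/= => /negP.
rewrite negb_and -!ltNge => /orP[/ltW ?|/ltW ?]; rewrite f0//; by [left|right].
Qed.

(** The primitive starting from -oo vanishes to the left of [p] by the support condition and to the
    right of [q] because the total integral is 0. It produces test functions with a prescribed
    derivative. *)
Lemma bump_primitive f p q : smoothR f -> (forall x, x <= p \/ q <= x -> f x = 0) ->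
  \int[mu1]_x f x = 0 -> exists F, [/\ smoothR F,
    forall x, x <= p \/ q <= x -> F x = 0 & forall x, is_derive x 1 F (f x)].
Proof.
move=> sf f0 if0.
have fi := supp_integrable (smoothR_continuous sf) f0.
pose F x := \int[mu1]_(t in [set` Interval -oo%O (BRight x)]) f t.
have DF x : is_derive x 1 F (f x).
  have [||||D1 D2] := @continuous_FTC1 R f -oo%O x (x + 1).
  - by rewrite ltrDl.
  - by apply: integrableS fi.
  - exact: ltNyr.
  - exact: smoothR_continuous.
  by apply: DeriveDef; [exact: D1|rewrite -D2 derive1E].
exists F; split => //.
  by case=> [|k]; [exact: is_derive_continuous DF|exists f].
move=> x [xp|qx].
  rewrite /F (@eq_Rintegral _ _ _ _ _ (cst 0)) ?Rintegral_cst ?mul0r// => t.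
  rewrite inE/= in_itv/= => tx; rewrite f0//; left; exact: le_trans xp.
rewrite /F -[RHS]if0 Rintegral_mkcond; apply: eq_Rintegral => t _.
rewrite patchE; case: ifPn => //; rewrite notin_setE/= in_itv/= => /negP.
by rewrite -ltNge => xt; rewrite f0//; right; apply: ltW; exact: le_lt_trans xt.
Qed.

Lemma bump_int_gt0 p q : p < q -> 0 < \int[mu1]_x bumpf p q 1 x.
Proof.
move=> pq.
have bi := supp_integrable (smoothR_continuous (smoothR_bump p q 1)) (@bump_out p q 1).
rewrite lt_def Rintegral_ge0 ?andbT//; last by move=> x _; case/andP: (bump_itv p q 1 x).
apply/eqP => H.
have : (\int[mu1]_x `|(bumpf p q 1 x)%:E| = 0)%E.
  rewrite -[RHS]/(0%:E) -H EFin_Rintegral//; apply: eq_integral => x _.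
  by rewrite gee0_abs// lee_fin; case/andP: (bump_itv p q 1 x).
move/(ae_eq_integral_abs _ measurableT) => [|N [mN N0 sub]].
  by case/integrableP: bi.
have : (mu1 `]p, q[ <= mu1 N)%E.
  apply: le_measure; rewrite ?inE//; apply: subset_trans sub => x /=.
  rewrite in_itv/= => pxq E; have := E I => -[]/eqP.
  by rewrite gt_eqF// bump_gt0.
by rewrite N0 lebesgue_measure_itv/= lte_fin pq lee_fin subr_le0 leNgt pq.
Qed.
End smooth_line.

(** * Product test functions and rational rectangles in the plane *)

Section test_functions.
Context (R : realType).
Local Notation borel2 := (measurableTypeR R * measurableTypeR R)%type.
Implicit Types (f g : R -> R) (w : R * R -> R) (z : R * R) (A Om : set (R * R)).

Definition tens f g (z : R * R) : R := f z.1 * g z.2.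

Lemma is_derive_tens1 f (f' : R) g z : is_derive z.1 1 f f' ->
  is_derive z e1 (tens f g) (f' * g z.2).
Proof.
case=> df vf; apply: is_deriveP.
have C : h^-1 * (f (h * 1 + z.1) - f z.1) @[h --> 0^'] --> f'.
  by rewrite -vf; exact: df.
have -> : (fun h : R => h^-1 * (tens f g (h *: e1 + z) - tens f g z)) =
          (fun h => h^-1 * (f (h * 1 + z.1) - f z.1) * g z.2).
  by apply/funext => h; rewrite /tens/= [h *: 0]mulr0 add0r; rewrite /GRing.scale/=; ring.
by apply: cvgM => //; exact: cvg_cst.
Qed.

Lemma is_derive_tens2 f g (g' : R) z : is_derive z.2 1 g g' ->
  is_derive z e2 (tens f g) (f z.1 * g').
Proof.
case=> df vf; apply: is_deriveP.
have C : h^-1 * (g (h * 1 + z.2) - g z.2) @[h --> 0^'] --> g'.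
  by rewrite -vf; exact: df.
have -> : (fun h : R => h^-1 * (tens f g (h *: e2 + z) - tens f g z)) =
          (fun h => f z.1 * (h^-1 * (g (h * 1 + z.2) - g z.2))).
  by apply/funext => h; rewrite /tens/= [h *: 0]mulr0 add0r; rewrite /GRing.scale/=; ring.
by apply: cvgM => //; exact: cvg_cst.
Qed.

Lemma tens_continuous f g : continuous f -> continuous g -> continuous (tens f g).
Proof.
move=> cf cg z; apply: cvgM.
  by apply: continuous_comp; [exact: cvg_fst|exact: cf].
by apply: continuous_comp; [exact: cvg_snd|exact: cg].
Qed.

Lemma Ck_tens k f g : CkR k f -> CkR k g -> Ck k (tens f g).
Proof.
elim: k f g => [|k IH] f g; first exact: tens_continuous.
move=> Cf Cg; have Df := CkRS Cf; have Dg := CkRS Cg.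
case: Cf => f' Hf Cf; case: Cg => g' Hg Cg.
have E1 z := is_derive_tens1 g (Hf z.1); have E2 z := is_derive_tens2 f (Hg z.2).
split.
- by move=> z; case: (E1 z).
- by move=> z; case: (E2 z).
- have -> : (fun x => 'D_e1 (tens f g) x) = tens f' g.
    by apply/funext => z; rewrite (@derive_val _ _ _ _ _ _ _ (E1 z)).
  exact: IH.
- have -> : (fun x => 'D_e2 (tens f g) x) = tens f g'.
    by apply/funext => z; rewrite (@derive_val _ _ _ _ _ _ _ (E2 z)).
  exact: IH.
Qed.

Definition orect (a b c d : R) : set (R * R) := `]a, b[%classic `*` `]c, d[%classic.
Definition crect (a b c d : R) : set (R * R) := `[a, b]%classic `*` `[c, d]%classic.

Lemma test_fun_tens Om f g a b c d : crect a b c d `<=` Om ->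
  smoothR f -> smoothR g -> (forall x, x <= a \/ b <= x -> f x = 0) ->
  (forall x, x <= c \/ d <= x -> g x = 0) -> test_fun Om (tens f g).
Proof.
move=> sub sf sg f0 g0; split; first by move=> k; apply: Ck_tens.
exists (crect a b c d); split => //.
  by apply: compact_setX; exact: segment_compact.
move=> z; rewrite /crect/= !in_itv/= /tens => /not_andP[|] /negP.
  by rewrite negb_and -!ltNge => /orP[] /ltW ?; rewrite f0 ?mul0r//; [left|right].
by rewrite negb_and -!ltNge => /orP[] /ltW ?; rewrite g0 ?mulr0//; [left|right].
Qed.

(** A countable base of the plane, through which local almost-everywhere statements become
    global. *)
Definition ratrect (q : (rat * rat) * (rat * rat)) : set (R * R) :=
  orect (ratr q.1.1) (ratr q.1.2) (ratr q.2.1) (ratr q.2.2).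

Lemma orect_measurable a b c d : measurable (orect a b c d : set borel2).
Proof. by apply: measurableX; exact: measurable_itv. Qed.

Lemma orect_open a b c d : open (orect a b c d).
Proof.
rewrite openE => z [/= z1 z2]; exists (`]a, b[%classic, `]c, d[%classic) => //.
by split; apply: open_nbhs_nbhs; split => //; exact: interval_open.
Qed.

Lemma crect_sub_ball a b c d z (r : R) : z.1 - r < a -> b < z.1 + r ->
  z.2 - r < c -> d < z.2 + r -> crect a b c d `<=` ball z r.
Proof.
move=> za zb zc zd y [/=]; rewrite !in_itv/= => /andP[ay yb] /andP[cy yd].
split; rewrite /= ball_itv/= in_itv/=.
  by rewrite (lt_le_trans za ay) (le_lt_trans yb zb).
by rewrite (lt_le_trans zc cy) (le_lt_trans yd zd).
Qed.

Lemma ratrect_nbhs A z : nbhs z A -> exists2 q, ratrect q z &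
  crect (ratr q.1.1) (ratr q.1.2) (ratr q.2.1) (ratr q.2.2) `<=` A.
Proof.
move=> /nbhs_ballP[r r0 rA].
have H (x : R) : x - r < x /\ x < x + r.
  by rewrite gtrDl ltrDl oppr_lt0; split; exact: r0.
have [q1 Q1] := rat_in_itvoo (H z.1).1; have [q2 Q2] := rat_in_itvoo (H z.1).2.
have [q3 Q3] := rat_in_itvoo (H z.2).1; have [q4 Q4] := rat_in_itvoo (H z.2).2.
move: Q1 Q2 Q3 Q4; rewrite !in_itv/=.
move=> /andP[a1 b1] /andP[a2 b2] /andP[a3 b3] /andP[a4 b4].
exists ((q1, q2), (q3, q4)); last by apply: subset_trans rA; exact: crect_sub_ball.
by split; rewrite /= in_itv/= ?b1 ?a2 ?b3 ?a4.
Qed.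

(** Measurability refers to the product sigma-algebra; an open set belongs to it as the union of the
    countably many rational rectangles that it contains. *)
Lemma open_measurable2 A : open A -> measurable (A : set borel2).
Proof.
move=> oA.
have -> : A = \bigcup_q (if `[< ratrect q `<=` A >] then ratrect q else set0).
  apply/seteqP; split => [z Az|z [q _]]; last by case: asboolP => // H; exact: H.
  have [|q qz qA] := @ratrect_nbhs A z; first by apply: open_nbhs_nbhs.
  exists q => //; case: asboolP => // -[]; apply: subset_trans qA.
  by move=> y [y1 y2]; split; apply: subset_itv_oo_cc.
apply: countable_bigcupT_measurable => [|q]; first exact: countableP.
by case: ifPn => _; [exact: orect_measurable|exact: measurable0].
Qed.

Lemma continuous_measurable2 w : continuous w ->
  measurable_fun setT (w : borel2 -> R).
Proof.
move=> cw; apply: (measurability _ (RGenOInfty.measurableE R)).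
move=> _ [_ [x ->] <-]; rewrite setTI; apply: open_measurable2.
by apply: open_comp; [move=> z _; exact: cw|exact: interval_open].
Qed.

Lemma bounded_in_crect Om : bounded_set Om ->
  exists2 M : R, 0 < M & Om `<=` orect (- M) M (- M) M.
Proof.
move=> [M [Mr HM]]; exists (`|M| + 2); first by rewrite ltr_wpDl.
move=> z /(HM (`|M| + 1)).
have -> : M < `|M| + 1 by apply: le_lt_trans (ler_norm _) _; rewrite ltrDl.
move=> /(_ isT)/=; rewrite prod_normE ge_max => /andP[z1 z2].
have L : `|M| + 1 < `|M| + 2 by rewrite ltrD2l ltr1n.
by split; rewrite /= in_itv/= -ltr_norml; exact: le_lt_trans L.
Qed.

Lemma continuous_bounded_on Om w : bounded_set Om -> continuous w ->
  exists M : R, forall z, Om z -> `|w z| <= M.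
Proof.
move=> /bounded_in_crect[M M0 OM] cw.
have cK : compact (crect (- M) M (- M) M) by apply: compact_setX; exact: segment_compact.
have := continuous_compact (continuous_subspaceT cw) cK.
move=> /compact_bounded[K [Kr HK]]; exists (K + 1) => z Oz.
apply: (HK (K + 1)); first by rewrite ltrDl.
exists z => //; have [z1 z2] := OM z Oz.
by split; apply: subset_itv_oo_cc.
Qed.

End test_functions.

(** * Test functions on the domain *)

Lemma is_deriveE (R : realType) (V : normedModType R) (f : V -> R) (x v : V) (df : R) :
  is_derive x v f df -> h^-1 * (f (h *: v + x) - f x) @[h --> 0^'] --> df.
Proof. by case=> D <-; exact: D. Qed.

#[local] Instance ae_area_filter (R : realType) :
  Filter (nbhs (almost_everywhere (@area R))).
Proof. exact: ae_filter_ringOfSetsType. Qed.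

#[local] Instance ae_surf_filter (R : realType) :
  Filter (nbhs (almost_everywhere (@surf R))).
Proof. exact: ae_filter_ringOfSetsType. Qed.

Section domain.
Context (R : realType).
Local Notation borel2 := (measurableTypeR R * measurableTypeR R)%type.
Local Notation mu1 := (@lebesgue_measure R).
Local Notation area := (@area R).
Implicit Types (f g w : R * R -> R) (z : R * R).

Lemma is_derive_slice1 w x y : derivable w (x, y) e1 ->
  is_derive x 1 (fun t => w (t, y)) ('D_e1 w (x, y)).
Proof.
move=> D; apply: is_deriveP.
have := is_deriveE (derivableP D).
suff -> : (fun h : R => h^-1 * (w (h *: e1 + (x, y)) - w (x, y))) =
          (fun h => h^-1 * (w (h *: 1 + x, y) - w (x, y))) by [].
apply/funext => h; congr (_ * (w _ - _)).
by rewrite /e1/=; congr pair => /=; rewrite [h *: 0]mulr0 add0r.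
Qed.

Lemma is_derive_slice2 w x y : derivable w (x, y) e2 ->
  is_derive y 1 (fun t => w (x, t)) ('D_e2 w (x, y)).
Proof.
move=> D; apply: is_deriveP.
have := is_deriveE (derivableP D).
suff -> : (fun h : R => h^-1 * (w (h *: e2 + (x, y)) - w (x, y))) =
          (fun h => h^-1 * (w (x, h *: 1 + y) - w (x, y))) by [].
apply/funext => h; congr (_ * (w _ - _)).
by rewrite /e2/=; congr pair => /=; rewrite [h *: 0]mulr0 add0r.
Qed.

Lemma slice_continuous1 w (y : R) : continuous w -> continuous (fun x => w (x, y)).
Proof.
move=> cw x; apply: (@continuous_comp _ _ _ (fun x : R => (x, y)) w); last exact: cw.
exact: (@cvg_pair _ R R (nbhs x) (nbhs x) (nbhs y) _ _ _ id (fun=> y) cvg_id (cvg_cst y)).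
Qed.

Lemma slice_continuous2 w (x : R) : continuous w -> continuous (fun y => w (x, y)).
Proof.
move=> cw y; apply: (@continuous_comp _ _ _ (fun y : R => (x, y)) w); last exact: cw.
exact: (@cvg_pair _ R R (nbhs y) (nbhs x) (nbhs y) _ _ _ (fun=> x) id (cvg_cst x) cvg_id).
Qed.

Lemma integral_derive0 (F f : R -> R) (M : R) : 0 < M ->
  (forall x : R, is_derive x 1 F (f x)) -> continuous f ->
  (forall x, x <= - M \/ M <= x -> F x = 0) ->
  (forall x, x <= - M \/ M <= x -> f x = 0) -> (\int[mu1]_x (f x)%:E = 0)%E.
Proof.
move=> M0 dF cf F0 f0.
have MM : - M < M by exact: gtrN.
have cF := is_derive_continuous dF.
have -> : (\int[mu1]_x (f x)%:E = \int[mu1]_(x in `[(- M)%R, M%R]) (f x)%:E)%E.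
  rewrite [RHS]integral_mkcond; apply: eq_integral => x _.
  rewrite patchE; case: ifPn => //; rewrite notin_setE/= in_itv/= => /negP.
  rewrite negb_and -!ltNge => /orP[/ltW ?|/ltW ?]; rewrite f0//; by [left|right].
rewrite (@continuous_FTC2 R f F _ _ MM).
- by rewrite !F0 ?subee//; [left|right].
- exact: continuous_subspaceT.
- split; first by move=> x _; case: (dF x).
  + by apply: cvg_at_right_filter; exact: cF.
  + by apply: cvg_at_left_filter; exact: cF.
- by move=> x _; rewrite derive1E; exact: (@derive_val _ _ _ _ _ _ _ (dF x)).
Qed.

Variable Om : set (R * R).
Hypothesis hOm : lipschitz_domain Om.

Lemma dom_open : open Om. Proof. by case: hOm. Qed.
Lemma dom_connected : connected Om. Proof. by case: hOm. Qed.
Lemma dom_neq0 : Om !=set0. Proof. by case: hOm. Qed.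
Lemma dom_bounded : bounded_set Om. Proof. by case: hOm. Qed.

Lemma dom_measurable : measurable (Om : set borel2).
Proof. exact: open_measurable2 dom_open. Qed.
Local Notation mOm := dom_measurable.

Lemma eq_area f g : (forall x, Om x -> f x = g x) ->
  \int[area]_(x in Om) f x = \int[area]_(x in Om) g x.
Proof. by move=> fg; apply: eq_Rintegral => x /set_mem; exact: fg. Qed.

Lemma area_orect (a b c d : R) : a < b -> c < d ->
  area (orect a b c d) = ((b - a) * (d - c))%:E.
Proof.
move=> ab cd; rewrite /area /= product_measure1E//.
transitivity (mu1 `]a, b[ * mu1 `]c, d[)%E; first by [].
by rewrite !lebesgue_measure_itv/= !lte_fin ab cd -!EFinB -EFinM.
Qed.

Lemma area_dom_fin : (area Om < +oo)%E.
Proof.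
have [M M0 OM] := bounded_in_crect dom_bounded.
have MM : - M < M by exact: gtrN.
apply: (@le_lt_trans _ _ (area (orect (- M) M (- M) M))).
  by apply: le_measure; rewrite ?inE//; [exact: mOm|exact: orect_measurable].
by rewrite area_orect// ltry.
Qed.

Lemma area_open_gt0 (A : set (R * R)) : open A -> A !=set0 -> (0 < area A)%E.
Proof.
move=> oA [z Az]; have [|q qz qA] := @ratrect_nbhs _ A z.
  by apply: open_nbhs_nbhs.
move: qz; rewrite /ratrect /orect/= !in_itv/= => -[/andP[a1 a2] /andP[b1 b2]].
have l1 := lt_trans a1 a2; have l2 := lt_trans b1 b2.
apply: (@lt_le_trans _ _ (area (ratrect q))).
  by rewrite area_orect// lte_fin mulr_gt0// subr_gt0.
apply: le_measure; rewrite ?inE; [exact: orect_measurable|exact: open_measurable2|].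
by apply: subset_trans qA => y [y1 y2]; split; apply: subset_itv_oo_cc.
Qed.

Lemma continuous_Linf w : continuous w -> in_Linf area Om w.
Proof.
move=> cw; split; first exact: measurable_funTS (continuous_measurable2 cw).
by have [M HM] := continuous_bounded_on dom_bounded cw; exists M; exact: aeW.
Qed.

Lemma dom_cst_L2 (k : R) : in_L2 area Om (cst k).
Proof.
split; first exact: measurable_cst.
apply/integrableP; split; first by apply/measurable_EFinP; exact: (measurable_cst (k ^+ 2)).
under eq_integral do rewrite /= ger0_norm ?sqr_ge0//.
rewrite integral_cst; last exact: mOm.
by rewrite lte_mul_pinfty ?lee_fin ?sqr_ge0// area_dom_fin.
Qed.

Lemma Linf_L2 w : in_Linf area Om w -> in_L2 area Om w.
Proof.
move=> wL; have := in_L2_Linf mOm wL (dom_cst_L2 1).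
by have -> : w \* cst 1 = w by apply/funext => x /=; rewrite mulr1.
Qed.

Lemma continuous_L2 w : continuous w -> in_L2 area Om w.
Proof. by move=> cw; apply: Linf_L2; exact: continuous_Linf. Qed.

Lemma L2_integrable f : in_L2 area Om f -> area.-integrable Om (EFin \o f).
Proof.
move=> Lf; have := in_L2M mOm Lf (dom_cst_L2 1).
by apply: eq_integrable => [|x _ /=]; [exact: mOm|rewrite mulr1].
Qed.

Section test.
Variables (w : R * R -> R).
Hypothesis tw : test_fun Om w.

Lemma test_continuous : continuous w. Proof. by case: tw => /(_ 0%N). Qed.

Lemma test_derivable1 z : derivable w z e1. Proof. by case: tw => /(_ 1%N)[]. Qed.
Lemma test_derivable2 z : derivable w z e2. Proof. by case: tw => /(_ 1%N)[]. Qed.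

Lemma test_derive_continuous v : v = e1 \/ v = e2 -> continuous (fun x => 'D_v w x).
Proof.
case: tw => s _; have [_ _ D1 D2] := s 1%N.
by case=> ->; [exact: D1|exact: D2].
Qed.

Lemma test_derive_out v z : v = e1 \/ v = e2 -> ~ Om z -> 'D_v w z = 0.
Proof.
move=> Hv nz; case: tw => _ [K [cK KO wK]].
have oK : open (~` K).
  by apply: closed_openC; apply: compact_closed => //; exact: norm_hausdorff.
have H : is_derive z v w 0.
  have N : \near z, (cst 0 : R * R -> R) z = w z.
    have : nbhs z (~` K) by apply: open_nbhs_nbhs; split => // /KO.
    by apply: filterS => y nKy /=; rewrite wK.
  exact: (near_eq_is_derive N (is_derive_cst _ _ _)).
exact: (@derive_val _ _ _ _ _ _ _ H).
Qed.

Lemma test_out z : ~ Om z -> w z = 0.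
Proof. by case: tw => _ [K [cK KO wK]] nz; apply: wK => /KO. Qed.

(** Fubini on the plane after extension by zero: along each line in the direction [v] the derivative
    integrates to 0, since the test function vanishes at both ends of a large interval. *)
Lemma integral_test_derive v : v = e1 \/ v = e2 -> \int[area]_(x in Om) 'D_v w x = 0.
Proof.
move=> Hv; rewrite /Rintegral.
have cD := test_derive_continuous Hv.
have iO : area.-integrable Om (EFin \o (fun x => 'D_v w x)).
  by apply: L2_integrable; exact: continuous_L2.
have E : EFin \o (fun x => 'D_v w x) = (EFin \o (fun x => 'D_v w x)) \_ Om.
  apply/funext => x; rewrite patchE; case: ifPn => //; rewrite notin_setE => nx /=.
  by rewrite test_derive_out.
have iT : area.-integrable setT (EFin \o (fun x => 'D_v w x)).
  by rewrite E -integrable_mkcond//; exact: mOm.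
have -> : (\int[area]_(x in Om) ('D_v w x)%:E = \int[area]_x ('D_v w x)%:E)%E.
  by rewrite integral_mkcond -[X in integral _ _ X]E.
have [M M0 OM] := bounded_in_crect dom_bounded.
have outM (x y : R) : (x <= - M \/ M <= x) \/ (y <= - M \/ M <= y) -> ~ Om (x, y).
  move=> H /OM[]; rewrite /= !in_itv/= => /andP[a b] /andP[c d].
  by case: H => -[]; rewrite leNgt ?a ?b ?c ?d.
case: Hv => Hv.
- rewrite -(@integral21_prod_meas1 _ _ _ _ _ mu1 mu1 (fun x => ('D_v w x)%:E) iT).
  rewrite (eq_integral (cst 0%E)) ?integral0// => y _.
  apply: (@integral_derive0 (fun x => w (x, y)) (fun x => 'D_v w (x, y)) M) => //.
  + by move=> x; rewrite Hv; apply: is_derive_slice1; exact: test_derivable1.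
  + exact: (@slice_continuous1 (fun z => 'D_v w z) y cD).
  + by move=> x H; apply: test_out; apply: outM; left.
  + by move=> x H; apply: test_derive_out; [left|apply: outM; left].
- rewrite -(@integral12_prod_meas1 _ _ _ _ _ mu1 mu1 (fun x => ('D_v w x)%:E) iT).
  rewrite (eq_integral (cst 0%E)) ?integral0// => x _.
  apply: (@integral_derive0 (fun y => w (x, y)) (fun y => 'D_v w (x, y)) M) => //.
  + by move=> y; rewrite Hv; apply: is_derive_slice2; exact: test_derivable2.
  + exact: (@slice_continuous2 (fun z => 'D_v w z) x cD).
  + by move=> y H; apply: test_out; apply: outM; right.
  + by move=> y H; apply: test_derive_out; [right|apply: outM; right].
Qed.

End test.

Definition orects : set (set (R * R)) :=
  [set A | exists a b c d, A = orect a b c d].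

(** This is what allows a pi-lambda argument to start from bounded open rectangles: the half-planes
    that generate the product sigma-algebra are countable unions of them. *)
Lemma orects_generate : @measurable _ borel2 = <<s orects >>.
Proof.
apply/seteqP; split; last first.
  apply: smallest_sub; first exact: sigma_algebra_measurable.
  by move=> _ [a [b [c [d ->]]]]; exact: orect_measurable.
rewrite measurable_prod_measurableType.
apply: smallest_sub; first exact: smallest_sigma_algebra.
pose S := g_sigma_algebraType orects.
have m1 : measurable_fun setT (fst : S -> measurableTypeR R).
  apply: (measurability _ (RGenOInfty.measurableE R)).
  move=> _ [_ [x ->] <-]; rewrite setTI.
  have -> : fst @^-1` `]x, +oo[%classic =
      \bigcup_n orect x n%:R (- n%:R) n%:R :> set (R * R).
    apply/seteqP; split => [[a b]|[a b] [n _ []]]; rewrite /= !in_itv/= ?andbT.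
      move=> xa; exists (Num.bound (`|a| + `|b|)) => //.
      have := archi_boundP (addr_ge0 (normr_ge0 a) (normr_ge0 b)).
      move=> H; split; rewrite /= in_itv/= ?xa/=.
        apply: le_lt_trans H; apply: le_trans (ler_norm a) _; by rewrite lerDl.
      by rewrite -ltr_norml; apply: le_lt_trans H; rewrite lerDr.
    by move=> /andP[].
  by apply: bigcupT_measurable => n; apply: sub_sigma_algebra; do 4 eexists.
have m2 : measurable_fun setT (snd : S -> measurableTypeR R).
  apply: (measurability _ (RGenOInfty.measurableE R)).
  move=> _ [_ [x ->] <-]; rewrite setTI.
  have -> : snd @^-1` `]x, +oo[%classic =
      \bigcup_n orect (- n%:R) n%:R x n%:R :> set (R * R).
    apply/seteqP; split => [[a b]|[a b] [n _ []]]; rewrite /= !in_itv/= ?andbT.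
      move=> xa; exists (Num.bound (`|a| + `|b|)) => //.
      have := archi_boundP (addr_ge0 (normr_ge0 a) (normr_ge0 b)).
      move=> H; split; rewrite /= in_itv/= ?xa/=.
        by rewrite -ltr_norml; apply: le_lt_trans H; rewrite lerDl.
      by apply: le_lt_trans H; apply: le_trans (ler_norm b) _; rewrite lerDr.
    by move=> _ /andP[].
  by apply: bigcupT_measurable => n; apply: sub_sigma_algebra; do 4 eexists.
move=> _ [A mA [B mB <-]].
have := measurableI _ _ (m1 measurableT A mA) (m2 measurableT B mB).
by rewrite !setTI.
Qed.

Lemma orectI (a b c d a' b' c' d' : R) :
  orect a b c d `&` orect a' b' c' d' =
  orect (Num.max a a') (Num.min b b') (Num.max c c') (Num.min d d').
Proof.
apply/seteqP; split => [z [[]]|z []]; rewrite /= !in_itv/=.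
  move=> /andP[? ?] /andP[? ?] [/andP[? ?] /andP[? ?]].
  by split; rewrite /= in_itv/= gt_max lt_min; apply/andP; split; apply/andP.
rewrite !gt_max !lt_min => /andP[/andP[? ?] /andP[? ?]] /andP[/andP[? ?] /andP[? ?]].
by split; split; rewrite /= in_itv/=; apply/andP.
Qed.

Lemma orects_setI : setI_closed orects.
Proof.
move=> _ _ [a [b [c [d ->]]]] [a' [b' [c' [d' ->]]]].
by rewrite orectI; do 4 eexists.
Qed.

Lemma cvg_bump_indic (p q x : R) : bumpf p q n x @[n --> \oo] --> (\1_(`]p, q[) x : R).
Proof.
rewrite indicE; case: (boolP (x \in _)) => [|H].
  by rewrite inE/= in_itv/=; exact: cvg_bump.
rewrite /=; apply: cvg_near_cst; apply: nearW => n; apply: bump_out.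
move: H; rewrite notin_setE/= in_itv/= => /negP.
by rewrite negb_and -!leNgt => /orP[]; [left|right].
Qed.

Lemma indic_orect (a b c d : R) z :
  \1_(orect a b c d) z = \1_(`]a, b[) z.1 * \1_(`]c, d[) z.2 :> R.
Proof. by rewrite !indicE /orect in_setX/=; case: (_ \in _); case: (_ \in _); rewrite ?mulr1 ?mulr0. Qed.

(* Testing against the bumps, which converge to the indicator of the rectangle. *)
Lemma integral_orect0 g (a b c d : R) : in_L2 area Om g -> crect a b c d `<=` Om ->
  (forall n, \int[area]_(x in Om) (g x * tens (bumpf a b n) (bumpf c d n) x) = 0) ->
  (\int[area]_(x in orect a b c d) (g x)%:E = 0)%E.
Proof.
move=> Lg cO H.
have gi := L2_integrable Lg.
have mg := in_L2_meas Lg.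
have oO : orect a b c d `<=` Om.
  by apply: subset_trans cO => y [y1 y2]; split; apply: subset_itv_oo_cc.
have mb n : measurable_fun Om (tens (bumpf a b n) (bumpf c d n)).
  apply: measurable_funTS; apply: continuous_measurable2.
  by apply: tens_continuous; apply: smoothR_continuous; exact: smoothR_bump.
have b01 n z : 0 <= tens (bumpf a b n) (bumpf c d n) z <= 1.
  have /andP[? ?] := bump_itv a b n z.1; have /andP[? ?] := bump_itv c d n z.2.
  by rewrite mulr_ge0//= mulr_ile1.
have := @dominated_convergence _ _ _ area Om mOm
  (fun n z => (g z * tens (bumpf a b n) (bumpf c d n) z)%:E)
  (fun z => (g z * \1_(orect a b c d) z)%:E) (fun z => (`|g z|)%:E).
case.
- by move=> n; apply/measurable_EFinP; apply: measurable_funM; [exact: mg|exact: mb].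
- apply/measurable_EFinP; apply: measurable_funM => //.
  by apply: measurable_funTS; apply: measurable_indic; exact: orect_measurable.
- apply: aeW => z _; apply: cvg_EFin; first exact: nearW.
  rewrite indic_orect; apply: cvgM; first exact: cvg_cst.
  by apply: cvgM; exact: cvg_bump_indic.
- exact: integrable_norm.
- apply: aeW => z n _; have /andP[? ?] := b01 n z.
  rewrite lee_fin normrM (ger0_norm (_ : 0 <= tens _ _ _))//.
  by rewrite ler_piMr.
move=> _ _.
have -> : (fun n => \int[area]_(x in Om) (g x * tens (bumpf a b n) (bumpf c d n) x)%:E)%E = cst 0%E.
  apply/funext => n; rewrite -(EFin_Rintegral mOm) ?H//.
  apply: (in_L2M mOm Lg); apply: continuous_L2.
  by apply: tens_continuous; apply: smoothR_continuous; exact: smoothR_bump.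
move=> C.
have : (\int[area]_(x in Om) (g x * \1_(orect a b c d) x)%:E = 0)%E.
  by apply: (@cvg_unique _ _ _ _ _ _ C); [exact: ereal_hausdorff|exact: cvg_cst].
move=> <-; rewrite integral_mkcond [RHS]integral_mkcond.
apply: eq_integral => z _; rewrite !patchE indicE.
case: (boolP (z \in orect a b c d)) => zo; last by rewrite mulr0; case: ifP.
by rewrite mulr1 ifT// inE; apply: oO; exact: set_mem.
Qed.

(** Pi-lambda theorem: the sets S such that [g] has zero integral over the part of S in the
    rectangle form a Dynkin class that contains the rectangles, a family stable under intersection.
    Hence every measurable S qualifies, and [g] vanishes almost everywhere on the rectangle. *)
Lemma integral_orects_ae0 g (a b c d : R) : in_L2 area Om g -> crect a b c d `<=` Om ->
  (forall a' b' c' d', a <= a' -> b' <= b -> c <= c' -> d' <= d ->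
     (\int[area]_(x in orect a' b' c' d') (g x)%:E = 0)%E) ->
  g = 0 %[ae area in orect a b c d].
Proof.
move=> Lg cO H; set B := orect a b c d.
have mB : measurable (B : set borel2) by exact: orect_measurable.
have oO : B `<=` Om.
  by apply: subset_trans cO => y [y1 y2]; split; apply: subset_itv_oo_cc.
have gi : area.-integrable B (EFin \o g).
  by apply: integrableS (L2_integrable Lg) => //; exact: mOm.
have giS (S : set borel2) : measurable S -> area.-integrable (S `&` B) (EFin \o g).
  by move=> mS; apply: integrableS gi; [exact: mB|exact: measurableI|exact: subIsetr].
have B0 : (\int[area]_(x in B) (g x)%:E = 0)%E by exact: H.
have key (S : set borel2) : measurable S -> (\int[area]_(x in S `&` B) (g x)%:E = 0)%E.
  move=> mS; have := mS; rewrite orects_generate => mS'.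
  apply: (@dynkin_induction _ borel2 orects
    (fun S => (\int[area]_(x in S `&` B) (g x)%:E = 0)%E)) mS'.
  - exact: orects_generate.
  - exact: orects_setI.
  - by rewrite setTI.
  - move=> _ [a' [b' [c' [d' ->]]]]; rewrite orectI.
    by apply: H; rewrite ?le_max ?ge_min lexx ?orbT.
  - move=> S' mS'' S0.
    have E : B = (S' `&` B) `|` (~` S' `&` B) by rewrite -setIUl setUv setTI.
    have := B0; rewrite {1}E integral_setU_EFin//.
    + by rewrite S0 add0e.
    + exact: measurableI.
    + by apply: measurableI => //; exact: measurableC.
    + by rewrite -E; case/integrableP: gi => /measurable_EFinP.
    + by apply/disj_setPS => z [[? _] [? _]].
  - move=> F mF tF F0.
    rewrite setI_bigcupl integral_bigcup.
    + by rewrite eseries0// => i _ _; rewrite F0.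
    + exact: trivIset_setIr.
    + by move=> k; exact: measurableI.
    + by rewrite -setI_bigcupl; apply: giS; exact: bigcupT_measurable.
have : ae_eq area B (EFin \o g) (cst 0%E).
  apply: integral_ae_eq => // E EB mE.
  by rewrite integral0 -(setIidl EB) -(key E mE).
by apply: filterS => x /= Hx Bx; have := Hx Bx => -[].
Qed.

Lemma ae_of_ratrect (P : R * R -> Prop) :
  (forall z, Om z -> exists2 A, nbhs z A & {ae area, forall x, A x -> P x}) ->
  {ae area, forall x, Om x -> P x}.
Proof.
move=> H.
pose Q q := {ae area, forall x, ratrect q x -> P x}.
(* Rectangles are enumerated by [unpickle]. An index that codes no rectangle, or codes one where the
   property is not known almost everywhere, contributes the empty set, so that a countable
   intersection can be taken over all integers. *)
pose Qc (n : nat) : set (R * R) := if unpickle n is Some q then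
  (if `[< Q q >] then ratrect q else set0) else set0.
have S : {ae area, forall x, forall n, Qc n x -> P x}.
  apply/ae_foralln => n; rewrite /Qc; case: (unpickle n) => [q|]; last exact: aeW.
  by case: asboolP => [//|_]; exact: aeW.
apply: filterS S => x Hx Ox; have [A zA AP] := H x Ox.
have [q qx qA] := ratrect_nbhs zA.
apply: (Hx (pickle q)); rewrite /Qc pickleK ifT//; apply/asboolP.
apply: filterS AP => y AyP qy; apply/AyP/qA.
by case: qy => y1 y2; split; apply: subset_itv_oo_cc.
Qed.

(** Fundamental lemma of the calculus of variations: products of bumps supported in small rectangles
    already separate the functions of L^2. *)
Lemma fundamental_lemma g : in_L2 area Om g ->
  (forall w, test_fun Om w -> \int[area]_(x in Om) (g x * w x) = 0) ->
  g = 0 %[ae area in Om].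
Proof.
move=> Lg H; apply: ae_of_ratrect => z Oz.
have [|q qz qO] := @ratrect_nbhs _ Om z.
  by apply: open_nbhs_nbhs; split => //; exact: dom_open.
exists (ratrect q); first by apply: open_nbhs_nbhs; split => //; exact: orect_open.
apply: integral_orects_ae0 => // a b c d la lb lc ld.
have cO : crect a b c d `<=` Om.
  apply: subset_trans qO => y [/=]; rewrite !in_itv/= => /andP[? ?] /andP[? ?].
  split; rewrite /= in_itv/=; apply/andP; split; by [apply: le_trans la _|apply: le_trans _ lb|apply: le_trans lc _|apply: le_trans _ ld].
apply: integral_orect0 => // n; apply: H.
apply: test_fun_tens cO _ _ _ _; try exact: smoothR_bump; exact: bump_out.
Qed.

Lemma Rintegral_dom_gt0 f (A : set (R * R)) : in_L2 area Om f ->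
  (forall z, Om z -> 0 <= f z) -> open A -> A !=set0 -> A `<=` Om ->
  (forall z, A z -> 0 < f z) -> 0 < \int[area]_(x in Om) f x.
Proof.
move=> Lf f0 oA A0 AO fA; rewrite lt_def Rintegral_ge0 ?andbT//.
apply/eqP => H.
have : (\int[area]_(x in Om) `|(f x)%:E| = 0)%E.
  rewrite -[RHS]/(0%:E) -H (EFin_Rintegral mOm); last exact: L2_integrable.
  by apply: eq_integral => x /set_mem Ox; rewrite gee0_abs// lee_fin f0.
move/(ae_eq_integral_abs _ mOm) => [|N [mN N0 sub]].
  by case: Lf => /measurable_EFinP.
have := area_open_gt0 oA A0; rewrite ltNge => /negP; apply.
rewrite -N0; apply: le_measure; rewrite ?inE//; first exact: open_measurable2.
apply: subset_trans sub => z Az /= E; have := E (AO z Az) => -[] /eqP.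
by rewrite gt_eqF// fA.
Qed.

Lemma weak_partial_cst (k : R) v : v = e1 \/ v = e2 -> weak_partial Om v (cst k) 0.
Proof.
move=> Hv; split; first exact: (in_L20 _ mOm).
move=> w tw.
rewrite RintegralZl; first last.
- by apply: L2_integrable; apply: continuous_L2; exact: test_derive_continuous.
- exact: mOm.
rewrite (integral_test_derive tw Hv) mulr0.
rewrite (@eq_area _ (cst 0)); last by move=> x _; rewrite /= mul0r.
by rewrite Rintegral_cst ?mul0r ?oppr0//; exact: mOm.
Qed.

Lemma bump_extend (a b A B : R) n : A <= a -> b <= B ->
  forall x, x <= A \/ B <= x -> bumpf a b n x = 0.
Proof.
move=> Aa bB x [xA|Bx]; apply: bump_out.
  by left; exact: le_trans Aa.
by right; exact: le_trans Bx.
Qed.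

Section zero_gradient.
Variables (A B C D : R).
Hypotheses (AB : A < B) (CD : C < D) (cO : crect A B C D `<=` Om).

Let I1 (al : R -> R) := (\int[mu1]_x al x) / (\int[mu1]_x bumpf A B 1 x).
Let I2 (be : R -> R) := (\int[mu1]_x be x) / (\int[mu1]_x bumpf C D 1 x).

Lemma tens_L2 (al be : R -> R) : smoothR al -> smoothR be -> in_L2 area Om (tens al be).
Proof.
by move=> sa sb; apply: continuous_L2; apply: tens_continuous; exact: smoothR_continuous.
Qed.

(** Subtracting from [al] the multiple [I1 al] of the reference bump leaves a function of zero mean,
    the derivative of some compactly supported [F]. Then [tens F be] is a test function for the
    vanishing weak derivative, so the integral depends on [al] only through its mean. *)
Lemma zero_partial1 f (al be : R -> R) : in_L2 area Om f -> weak_partial Om e1 f 0 ->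
  smoothR al -> smoothR be ->
  (forall x, x <= A \/ B <= x -> al x = 0) -> (forall x, x <= C \/ D <= x -> be x = 0) ->
  \int[area]_(x in Om) (f x * tens al be x) =
  I1 al * \int[area]_(x in Om) (f x * tens (bumpf A B 1) be x).
Proof.
move=> Lf [_ Hf] sa sb a0 b0.
have s0 := smoothR_bump A B 1; have z0 := @bump_out _ A B 1.
have I0 := bump_int_gt0 AB.
have ai := supp_integrable (smoothR_continuous sa) a0.
have bi := supp_integrable (smoothR_continuous s0) z0.
have si : smoothR (al + (- I1 al) *: bumpf A B 1) by apply: smoothRD => //; exact: smoothRZ.
have [||F [sF F0 dF]] := @bump_primitive _ (al + (- I1 al) *: bumpf A B 1) A B si.
- move=> x H; rewrite -[LHS]/(al x + - I1 al * bumpf A B 1 x).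
  by rewrite a0// z0// mulr0 addr0.
- rewrite (_ : \int[mu1]_x _ = \int[mu1]_x (al x + (- I1 al) * bumpf A B 1 x))//.
  rewrite RintegralD//; last exact: (integrableZl measurableT (- I1 al) bi).
  rewrite RintegralZl// /I1 mulNr -mulrA mulVf ?gt_eqF// mulr1 subrr.
  by [].
have tF : test_fun Om (tens F be) by exact: test_fun_tens cO sF sb F0 b0.
have := Hf _ tF.
rewrite [X in _ = - X](@eq_area _ (cst 0)); last by move=> x _; rewrite /= mul0r.
rewrite Rintegral_cst ?mul0r ?oppr0; last exact: mOm.
rewrite (@eq_area _
  (fun x => f x * tens al be x - I1 al * (f x * tens (bumpf A B 1) be x))); last first.
  move=> z _; rewrite (@derive_val _ _ _ _ _ _ _ (is_derive_tens1 be (dF z.1))) /tens.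
  rewrite -[X in _ * (X * _)]/(al z.1 + - I1 al * bumpf A B 1 z.1).
  by ring.
have i1 := in_L2M mOm Lf (tens_L2 sa sb); have i2 := in_L2M mOm Lf (tens_L2 s0 sb).
rewrite RintegralB; [|exact: mOm|exact: i1|exact: (integrableZl mOm (I1 al) i2)].
by rewrite (RintegralZl _ mOm i2) => /eqP; rewrite subr_eq0 => /eqP.
Qed.

Lemma zero_partial2 f (al be : R -> R) : in_L2 area Om f -> weak_partial Om e2 f 0 ->
  smoothR al -> smoothR be ->
  (forall x, x <= A \/ B <= x -> al x = 0) -> (forall x, x <= C \/ D <= x -> be x = 0) ->
  \int[area]_(x in Om) (f x * tens al be x) =
  I2 be * \int[area]_(x in Om) (f x * tens al (bumpf C D 1) x).
Proof.
move=> Lf [_ Hf] sa sb a0 b0.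
have s0 := smoothR_bump C D 1; have z0 := @bump_out _ C D 1.
have I0 := bump_int_gt0 CD.
have ai := supp_integrable (smoothR_continuous sb) b0.
have bi := supp_integrable (smoothR_continuous s0) z0.
have si : smoothR (be + (- I2 be) *: bumpf C D 1) by apply: smoothRD => //; exact: smoothRZ.
have [||F [sF F0 dF]] := @bump_primitive _ (be + (- I2 be) *: bumpf C D 1) C D si.
- move=> x H; rewrite -[LHS]/(be x + - I2 be * bumpf C D 1 x).
  by rewrite b0// z0// mulr0 addr0.
- rewrite (_ : \int[mu1]_x _ = \int[mu1]_x (be x + (- I2 be) * bumpf C D 1 x))//.
  rewrite RintegralD//; last exact: (integrableZl measurableT (- I2 be) bi).
  rewrite RintegralZl// /I2 mulNr -mulrA mulVf ?gt_eqF// mulr1 subrr.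
  by [].
have tF : test_fun Om (tens al F) by exact: test_fun_tens cO sa sF a0 F0.
have := Hf _ tF.
rewrite [X in _ = - X](@eq_area _ (cst 0)); last by move=> x _; rewrite /= mul0r.
rewrite Rintegral_cst ?mul0r ?oppr0; last exact: mOm.
rewrite (@eq_area _
  (fun x => f x * tens al be x - I2 be * (f x * tens al (bumpf C D 1) x))); last first.
  move=> z _; rewrite (@derive_val _ _ _ _ _ _ _ (is_derive_tens2 al (dF z.2))) /tens.
  rewrite -[X in _ * (_ * X)]/(be z.2 + - I2 be * bumpf C D 1 z.2).
  by ring.
have i1 := in_L2M mOm Lf (tens_L2 sa sb); have i2 := in_L2M mOm Lf (tens_L2 sa s0).
rewrite RintegralB; [|exact: mOm|exact: i1|exact: (integrableZl mOm (I2 be) i2)].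
by rewrite (RintegralZl _ mOm i2) => /eqP; rewrite subr_eq0 => /eqP.
Qed.

Lemma zero_gradient_rect f : in_L2 area Om f ->
  weak_partial Om e1 f 0 -> weak_partial Om e2 f 0 ->
  exists k : R, {ae area, forall x, orect A B C D x -> f x = k}.
Proof.
move=> Lf w1 w2.
have sA := smoothR_bump A B 1; have sC := smoothR_bump C D 1.
have zA := @bump_out _ A B 1; have zC := @bump_out _ C D 1.
have L0 := tens_L2 sA sC.
have Lk k : in_L2 area Om (cst k) := dom_cst_L2 k.
pose k1 := \int[area]_(x in Om) (cst 1 x * tens (bumpf A B 1) (bumpf C D 1) x).
have k10 : 0 < k1.
  rewrite /k1 (@eq_area _ (tens (bumpf A B 1) (bumpf C D 1))); last first.
    by move=> x _; rewrite /= mul1r.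
  apply: (@Rintegral_dom_gt0 _ (orect A B C D)) => //.
  - move=> z _; rewrite /tens mulr_ge0//.
      by case/andP: (bump_itv A B 1 z.1).
    by case/andP: (bump_itv C D 1 z.2).
  - exact: orect_open.
  - exists ((A + B) / 2, (C + D) / 2); split; rewrite /= in_itv/=.
      by have := midf_lt AB => -[-> ->].
    by have := midf_lt CD => -[-> ->].
  - by apply: subset_trans cO => y [y1 y2]; split; apply: subset_itv_oo_cc.
  - move=> z [/=]; rewrite !in_itv/= => z1 z2.
    by rewrite /tens mulr_gt0// bump_gt0.
pose k0 := \int[area]_(x in Om) (f x * tens (bumpf A B 1) (bumpf C D 1) x).
(* The quotient of the integrals of [f] and of 1 against the same bump is the only value that a
   constant [f] could have. *)
pose k := k0 / k1; exists k.
have : f - cst k = 0 %[ae area in orect A B C D].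
  apply: integral_orects_ae0 => //; first by apply: in_L2B => //; exact: mOm.
  move=> a b c d Aa bB Cc dD.
  apply: integral_orect0.
  - by apply: in_L2B => //; exact: mOm.
  - apply: subset_trans cO => y [/=]; rewrite !in_itv/= => /andP[? ?] /andP[? ?].
    split; rewrite /= in_itv/=; apply/andP; split; by [apply: le_trans Aa _|apply: le_trans _ bB|apply: le_trans Cc _|apply: le_trans _ dD].
  move=> n.
  have sa := smoothR_bump a b n; have sc := smoothR_bump c d n.
  have za := @bump_extend a b A B n Aa bB; have zc := @bump_extend c d C D n Cc dD.
  have ti := in_L2M mOm Lf (tens_L2 sa sc).
  have ki := in_L2M mOm (Lk 1) (tens_L2 sa sc).
  rewrite (@eq_area _ (fun x => f x * tens (bumpf a b n) (bumpf c d n) x -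
     k * (cst 1 x * tens (bumpf a b n) (bumpf c d n) x))); last first.
    by move=> x _; rewrite -[(f - cst k) x]/(f x - k) /=; ring.
  rewrite RintegralB; [|exact: mOm|exact: ti|exact: (integrableZl mOm k ki)].
  rewrite (RintegralZl _ mOm ki).
  (* Both [f] and the constant 1 have zero gradient, so against any smaller product bump their
     integrals are the same multiple of [k0] and of [k1]; the difference with [k] cancels. *)
  have E g : in_L2 area Om g -> weak_partial Om e1 g 0 -> weak_partial Om e2 g 0 ->
      \int[area]_(x in Om) (g x * tens (bumpf a b n) (bumpf c d n) x) =
      I1 (bumpf a b n) * (I2 (bumpf c d n) *
       \int[area]_(x in Om) (g x * tens (bumpf A B 1) (bumpf C D 1) x)).
    by move=> Lg g1 g2; rewrite zero_partial1// (@zero_partial2 g (bumpf A B 1)).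
  have p1 : weak_partial Om e1 (cst 1) (0 : R * R -> R) by apply: weak_partial_cst; left.
  have p2 : weak_partial Om e2 (cst 1) (0 : R * R -> R) by apply: weak_partial_cst; right.
  rewrite (E f Lf w1 w2) (E (cst 1) (Lk 1) p1 p2).
  rewrite -/k0 -/k1 /k; field; by rewrite gt_eqF.
apply: filterS => x Hx Ox; have := Hx Ox.
by rewrite -[(f - cst k) x]/(f x - k) => /eqP; rewrite subr_eq0 => /eqP.
Qed.

End zero_gradient.

(** Connectedness: [f] is locally almost everywhere constant, and the points near which the constant
    equals [k] form a nonempty subset that is open and closed in the domain. *)
Lemma zero_gradient_cst f : in_L2 area Om f ->
  weak_partial Om e1 f 0 -> weak_partial Om e2 f 0 ->
  exists k : R, f = cst k %[ae area in Om].
Proof.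
move=> Lf w1 w2.
have loc z : Om z -> exists q k, [/\ ratrect q z, ratrect q `<=` Om &
    {ae area, forall x, ratrect q x -> f x = k}].
  move=> Oz; have [|q qz qO] := @ratrect_nbhs _ Om z.
    by apply: open_nbhs_nbhs; split => //; exact: dom_open.
  move: (qz); rewrite /ratrect /orect/= !in_itv/= => -[/andP[a1 a2] /andP[b1 b2]].
  have [k Hk] := zero_gradient_rect (lt_trans a1 a2) (lt_trans b1 b2) qO Lf w1 w2.
  exists q, k; split => //.
  by apply: subset_trans qO => y [y1 y2]; split; apply: subset_itv_oo_cc.
have [z0 Oz0] := dom_neq0; have [q0 [k [q0z q0O Hk]]] := loc z0 Oz0.
exists k.
pose S : set (R * R) := [set z | exists q, [/\ ratrect q z, ratrect q `<=` Om &
    {ae area, forall x, ratrect q x -> f x = k}]].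
have oq q : open (ratrect q : set (R * R)) by exact: orect_open.
have nq q z : ratrect q z -> nbhs z (ratrect q : set (R * R)).
  by move=> qz; apply: open_nbhs_nbhs.
have oS : open S.
  rewrite openE => z [q [qz qO qk]]; apply: filterS (nq q z qz) => y qy.
  by exists q.
have SO : S `<=` Om by move=> z [q [qz qO _]]; exact: qO.
suff SE : S = Om.
  apply: ae_of_ratrect => z; rewrite -SE => -[q [qz _ Hq]].
  by exists (ratrect q); [exact: nq|].
apply: dom_connected.
- by exists z0, q0.
- by exists S => //; rewrite setIidr.
(* Relative closedness: the points with a rectangle carrying another constant form an open set. It
   does not meet [S], as two overlapping rectangles would share an open set of positive area. *)
- pose S' : set (R * R) := [set z | exists q, [/\ ratrect q z, ratrect q `<=` Om & exists2 k', k' != k &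
    {ae area, forall x, ratrect q x -> f x = k'}]].
  have oS' : open S'.
    rewrite openE => z [q [qz qO qk]]; apply: filterS (nq q z qz) => y qy.
    by exists q.
  exists (~` S'); first exact: open_closedC.
  apply/seteqP; split => z.
    move=> Sz; split; first exact: SO.
    case: Sz => q [qz qO Hq] [q' [q'z q'O [k' kk' Hq']]].
    have oI : open (ratrect q `&` ratrect q' : set (R * R)) by exact: openI.
    have : {ae area, forall x, ~ (ratrect q `&` ratrect q') x}.
      apply: filterS2 Hq Hq' => x h1 h2 [x1 x2].
      by move/eqP: kk'; apply; rewrite -(h1 x1) (h2 x2).
    move=> [N [mN N0 sub]].
    have := area_open_gt0 oI (ex_intro _ z (conj qz q'z)).
    rewrite ltNge => /negP; apply; rewrite -N0; apply: le_measure; rewrite ?inE//.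
      exact: open_measurable2.
    by apply: subset_trans sub => x Ix /=; apply.
  move=> [Oz nS']; have [q [k' [qz qO Hq]]] := loc z Oz.
  have [kk|kk] := eqVneq k' k; first by exists q; rewrite -kk.
  by exfalso; apply: nS'; exists q; split => //; exists k'.
Qed.

End domain.

(** * Sobolev functions *)

Section L2_limits.
Context (R : realType) d (T : measurableType d) (mu : {measure set T -> \bar R}).
Variables (D : set T) (mD : measurable D).
Implicit Types f g w : T -> R.

Lemma ae_eq_sqn f g : measurable_fun D f -> measurable_fun D g ->
  f = g %[ae mu in D] -> sqn mu D f = sqn mu D g.
Proof.
move=> mf mg fg; apply: (ae_eq_Rintegral mD).
- exact: measurable_funX.
- exact: measurable_funX.
- by apply: filterS fg => x H Dx; rewrite H.
Qed.

Lemma RintegralDM f g w : in_L2 mu D f -> in_L2 mu D g -> in_L2 mu D w ->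
  \int[mu]_(x in D) ((f + g) x * w x) =
  \int[mu]_(x in D) (f x * w x) + \int[mu]_(x in D) (g x * w x).
Proof.
move=> Lf Lg Lw; rewrite -(RintegralD mD (in_L2M mD Lf Lw) (in_L2M mD Lg Lw)).
by apply: eq_Rintegral => x _; rewrite -[(f + g) x]/(f x + g x) mulrDl.
Qed.

Lemma RintegralZM k f w : in_L2 mu D f -> in_L2 mu D w ->
  \int[mu]_(x in D) ((k *: f) x * w x) = k * \int[mu]_(x in D) (f x * w x).
Proof.
move=> Lf Lw; rewrite -(RintegralZl _ mD (in_L2M mD Lf Lw)).
by apply: eq_Rintegral => x _; rewrite -[(k *: f) x]/(k * f x) mulrA.
Qed.

Lemma RintegralBM f g w : in_L2 mu D f -> in_L2 mu D g -> in_L2 mu D w ->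
  \int[mu]_(x in D) ((f - g) x * w x) =
  \int[mu]_(x in D) (f x * w x) - \int[mu]_(x in D) (g x * w x).
Proof.
move=> Lf Lg Lw; rewrite RintegralDM//; last exact: in_L2N.
by rewrite -scaleN1r RintegralZM// mulN1r.
Qed.

Lemma cvg_L2_int (u : nat -> T -> R) f w : (forall n, in_L2 mu D (u n)) ->
  in_L2 mu D f -> in_L2 mu D w -> sqn mu D (u n - f) @[n --> \oo] --> 0 ->
  \int[mu]_(x in D) (u n x * w x) @[n --> \oo] --> \int[mu]_(x in D) (f x * w x).
Proof.
move=> Lu Lf Lw /cvg0P H.
have {}H := H (fun n => sqn_ge0 _ _ _).
apply/cvgrPdist_le => e e0.
have w0 := sqn_ge0 mu D w.
have c0 : 0 < sqn mu D w + 1 by rewrite ltr_wpDl.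
have [|N HN] := H (e ^+ 2 / (sqn mu D w + 1)); first by rewrite divr_gt0 ?exprn_gt0.
exists N => // n /HN /= {}HN.
rewrite distrC -RintegralBM// -(@ler_pXn2r _ 2) ?nnegrE ?(ltW e0)// real_normK ?num_real//.
apply: le_trans (L2_CS mD (in_L2B mD (Lu n) Lf) Lw) _.
apply: (@le_trans _ _ (sqn mu D (u n - f) * (sqn mu D w + 1))).
  by rewrite ler_wpM2l ?sqn_ge0// lerDl.
by rewrite -ler_pdivlMr.
Qed.

End L2_limits.

Lemma dotpE (R : realType) (x : R * R) : dotp x x = x.1 ^+ 2 + x.2 ^+ 2.
Proof. by rewrite /dotp -!expr2. Qed.

Section sobolev.
Context (R : realType) (Om : set (R * R)).
Hypothesis hOm : lipschitz_domain Om.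
Local Notation borel2 := (measurableTypeR R * measurableTypeR R)%type.
Local Notation area := (@area R).
Implicit Types (f g w : R * R -> R) (v : R * R).
Local Notation mOm := (dom_measurable hOm).
Local Notation L2 := (in_L2 area Om).
Local Notation N2 := (sqn area Om).
Local Notation wp := (weak_partial Om).

Lemma test_L2 w : test_fun Om w -> L2 w.
Proof. by move=> tw; apply: (continuous_L2 hOm); exact: test_continuous tw. Qed.

Lemma test_derive_L2 v w : v = e1 \/ v = e2 -> test_fun Om w -> L2 (fun x => 'D_v w x).
Proof. by move=> Hv tw; apply: (continuous_L2 hOm); exact: (test_derive_continuous tw). Qed.

Lemma wp_unique v f g g' : wp v f g -> wp v f g' -> g = g' %[ae area in Om].
Proof.
move=> [Lg Hg] [Lg' Hg'].
have : g - g' = 0 %[ae area in Om].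
  apply: (fundamental_lemma hOm); first exact: (in_L2B mOm).
  move=> w tw; rewrite (RintegralBM mOm)//; last exact: test_L2.
  by apply/eqP; rewrite subr_eq0 -eqr_opp -Hg// -Hg'.
by apply: filterS => x H Ox; apply/eqP; rewrite -subr_eq0; apply/eqP; exact: H.
Qed.

Lemma wp_lin v (k : R) f g f' g' : v = e1 \/ v = e2 -> L2 f -> L2 f' ->
  wp v f g -> wp v f' g' -> wp v (k *: f + f') (k *: g + g').
Proof.
move=> Hv Lf Lf' [Lg Hg] [Lg' Hg']; split.
  by apply: (in_L2D mOm) => //; exact: (in_L2Z mOm).
move=> w tw; have Lw := test_L2 tw; have Ld := test_derive_L2 Hv tw.
rewrite !(RintegralDM mOm)//; try exact: (in_L2Z mOm).
by rewrite !(RintegralZM mOm)// Hg// Hg'// opprD mulrN.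
Qed.

Lemma wp_ae v f f' g : v = e1 \/ v = e2 -> L2 f -> L2 f' ->
  f = f' %[ae area in Om] -> wp v f g -> wp v f' g.
Proof.
move=> Hv Lf Lf' ff' [Lg Hg]; split=> // w tw; rewrite -Hg//.
have Ld := test_derive_L2 Hv tw.
apply: (ae_eq_Rintegral mOm).
- by apply: measurable_funM; [exact: in_L2_meas Lf'|exact: in_L2_meas Ld].
- by apply: measurable_funM; [exact: in_L2_meas Lf|exact: in_L2_meas Ld].
- by apply: filterS ff' => x H Ox; rewrite H.
Qed.

(** For a fixed test function both sides of the defining identity are continuous in L^2, so the weak
    derivative is a closed operator. *)
Lemma wp_lim v (f_ g_ : nat -> R * R -> R) f g : v = e1 \/ v = e2 ->
  (forall n, L2 (f_ n)) -> L2 f -> L2 g -> (forall n, wp v (f_ n) (g_ n)) ->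
  N2 (f_ n - f) @[n --> \oo] --> 0 -> N2 (g_ n - g) @[n --> \oo] --> 0 ->
  wp v f g.
Proof.
move=> Hv Lf_ Lf Lg W cf cg; split=> // w tw.
have Lw := test_L2 tw; have Ld := test_derive_L2 Hv tw.
have C1 := cvg_L2_int mOm Lf_ Lf Ld cf.
have C2 := cvg_L2_int mOm (fun n => (W n).1) Lg Lw cg.
have C3 : (- \int[area]_(x in Om) (g_ n x * w x)) @[n --> \oo] -->
    - \int[area]_(x in Om) (g x * w x) by apply: cvgN.
move: C1; under eq_fun do rewrite (W _).2//.
by move=> C1; apply: (@cvg_unique _ _ _ _ _ _ C1 C3); exact: norm_hausdorff.
Qed.

Local Notation D1 := (wpartial Om e1).
Local Notation D2 := (wpartial Om e2).

Lemma H1_L2 f : in_H1 Om f -> L2 f. Proof. by case. Qed.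

Lemma wpartial1P f : in_H1 Om f -> wp e1 f (D1 f).
Proof. by case=> _ ex _; exact: xgetPex. Qed.

Lemma wpartial2P f : in_H1 Om f -> wp e2 f (D2 f).
Proof. by case=> _ _ ex; exact: xgetPex. Qed.

Lemma wpartialP v f : v = e1 \/ v = e2 -> in_H1 Om f -> wp v f (wpartial Om v f).
Proof. by case=> -> Hf; [exact: wpartial1P|exact: wpartial2P]. Qed.

Lemma wpartial_L2 v f : v = e1 \/ v = e2 -> in_H1 Om f -> L2 (wpartial Om v f).
Proof. by move=> Hv Hf; have [] := wpartialP Hv Hf. Qed.

Lemma H1_lin (k : R) f f' : in_H1 Om f -> in_H1 Om f' -> in_H1 Om (k *: f + f').
Proof.
move=> Hf Hf'; have Lf := H1_L2 Hf; have Lf' := H1_L2 Hf'; split.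
- by apply: (in_L2D mOm) => //; exact: (in_L2Z mOm).
- by eexists; apply: wp_lin (wpartial1P Hf) (wpartial1P Hf') => //; left.
- by eexists; apply: wp_lin (wpartial2P Hf) (wpartial2P Hf') => //; right.
Qed.

Lemma wpartial_lin v (k : R) f f' : v = e1 \/ v = e2 -> in_H1 Om f -> in_H1 Om f' ->
  wpartial Om v (k *: f + f') = k *: wpartial Om v f + wpartial Om v f' %[ae area in Om].
Proof.
move=> Hv Hf Hf'; apply: (@wp_unique v (k *: f + f')).
  by apply: wpartialP => //; exact: H1_lin.
by apply: wp_lin (wpartialP Hv Hf) (wpartialP Hv Hf') => //; exact: H1_L2.
Qed.

Lemma H1_cst (k : R) : in_H1 Om (cst k).
Proof.
split; first exact: dom_cst_L2.
  by exists 0; apply: (weak_partial_cst hOm); left.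
by exists 0; apply: (weak_partial_cst hOm); right.
Qed.

Lemma H1_0 : in_H1 Om 0. Proof. exact: (H1_cst 0). Qed.

(** The square of the H^1 norm, the quantity by which traces are bounded. *)
Definition hn f : R := N2 f + N2 (D1 f) + N2 (D2 f).

Lemma hn_ge0 f : 0 <= hn f.
Proof. by rewrite !addr_ge0 ?sqn_ge0. Qed.

Lemma hnE f : in_H1 Om f ->
  \int[area]_(x in Om) (f x ^+ 2 + dotp (wgrad Om f x) (wgrad Om f x)) = hn f.
Proof.
move=> Hf; have L0 := H1_L2 Hf.
have L1 := wpartial_L2 (or_introl erefl) Hf; have L2' := wpartial_L2 (or_intror erefl) Hf.
rewrite /hn /sqn -RintegralD; [|exact: mOm|exact: in_L2_sq L0|exact: in_L2_sq L1].
rewrite -RintegralD; [|exact: mOm| |exact: in_L2_sq L2'].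
  by apply: eq_area => x _; rewrite dotpE addrA.
exact: (integrableD mOm (in_L2_sq L0) (in_L2_sq L1)).
Qed.

Lemma hn_lim (f_ : nat -> R * R -> R) (f g1 g2 : R * R -> R) :
  (forall n, in_H1 Om (f_ n)) -> L2 f -> L2 g1 -> L2 g2 ->
  N2 (f_ n - f) @[n --> \oo] --> 0 -> N2 (D1 (f_ n) - g1) @[n --> \oo] --> 0 ->
  N2 (D2 (f_ n) - g2) @[n --> \oo] --> 0 ->
  [/\ in_H1 Om f, D1 f = g1 %[ae area in Om], D2 f = g2 %[ae area in Om] &
      hn (f_ n - f) @[n --> \oo] --> 0].
Proof.
move=> H Lf Lg1 Lg2 c0 c1 c2.
have W1 : wp e1 f g1.
  apply: (@wp_lim e1 f_ (fun n => D1 (f_ n))) => //; first by left.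
    by move=> n; exact: H1_L2.
  by move=> n; exact: wpartial1P.
have W2 : wp e2 f g2.
  apply: (@wp_lim e2 f_ (fun n => D2 (f_ n))) => //; first by right.
    by move=> n; exact: H1_L2.
  by move=> n; exact: wpartial2P.
have Hf : in_H1 Om f by split => //; [exists g1|exists g2].
have E1 := wp_unique (wpartial1P Hf) W1; have E2 := wp_unique (wpartial2P Hf) W2.
have E v n g : v = e1 \/ v = e2 -> L2 g -> wpartial Om v f = g %[ae area in Om] ->
    N2 (wpartial Om v (f_ n - f)) = N2 (wpartial Om v (f_ n) - g).
  move=> Hv Lg Eg; have -> : f_ n - f = (-1) *: f + f_ n by rewrite scaleN1r addrC.
  have Lv := wpartial_L2 Hv.
  apply: (ae_eq_sqn mOm).
  - by apply: in_L2_meas; apply: Lv; exact: H1_lin.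
  - exact: (in_L2_meas (in_L2B mOm (Lv _ (H n)) Lg)).
  - apply: filterS2 (wpartial_lin (-1) Hv Hf (H n)) Eg => x A1 A2 Ox.
    rewrite (A1 Ox) -[LHS]/(-1 * wpartial Om v f x + wpartial Om v (f_ n) x) (A2 Ox).
    by rewrite mulN1r addrC.
split => //; rewrite /hn.
rewrite -[X in _ --> X]addr0 -[X in _ --> X + _]addr0; apply: cvgD; first apply: cvgD => //.
  by under eq_fun do rewrite (E e1 _ g1 (or_introl erefl) Lg1 E1).
by under eq_fun do rewrite (E e2 _ g2 (or_intror erefl) Lg2 E2).
Qed.

End sobolev.

(** * Behaviour of the boundary measure under translations *)

Section hausdorff_translation.
Context (R : realType).
Local Notation borel2 := (measurableTypeR R * measurableTypeR R)%type.

Definition trans (t : R * R) (A : set (R * R)) : set (R * R) := [set x | A (x + t)].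

Lemma trans_measurable t (A : set borel2) : measurable A -> measurable (trans t A : set borel2).
Proof.
move=> mA.
have H : measurable_fun setT (fun x : borel2 => ((x.1 + t.1, x.2 + t.2) : borel2)).
  apply: measurable_fun_pair.
    by apply: measurable_funD => //; exact: measurable_fst.
  by apply: measurable_funD => //; exact: measurable_snd.
by have := H measurableT A mA; rewrite setTI.
Qed.

Lemma diam_trans t (A : set (R * R)) : (diam (trans t A) <= diam A)%E.
Proof.
apply: ge_ereal_sup => _ [->|[[x y] [/= Ax Ay] <-]]; first exact: diam_ge0.
apply: ereal_sup_ubound; right; exists (x + t, y + t) => //=.
by rewrite opprD addrACA subrr addr0.
Qed.

Lemma hgauge_trans d t (A : set (R * R)) : (hgauge d (trans t A) <= hgauge d A)%E.
Proof.
rewrite /hgauge; case: (ifP (diam A <= d%:E)%E) => H; last by rewrite leey.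
by rewrite (le_trans (diam_trans t A) H) diam_trans.
Qed.

Lemma hausdorff1_trans t (A : set (R * R)) : (hausdorff1 (trans t A) <= hausdorff1 A)%E.
Proof.
apply: ge_ereal_sup => _ [d d0 <-].
apply: (@le_trans _ _ (mu_ext (hgauge d : set borel2 -> _) A)); last first.
  by apply: ereal_sup_ubound; exists d.
apply: le_ereal_inf_tmp => _ [F [mF AF] <-].
apply: (@le_trans _ _ (\sum_(k <oo) hgauge d (trans t (F k)))%E).
  apply: ereal_inf_lbound; exists (fun k => trans t (F k)) => //; split.
    by move=> i; exact: trans_measurable.
  by move=> x /AF[k _ Fk]; exists k.
apply: lee_nneseries => k _; first by move=> *; exact: hgauge_ge0.
exact: hgauge_trans.
Qed.

(** [surf] lives on the Caratheodory sigma-algebra, which is complete. This covers translated null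
    sets and the part of the boundary left out by the partition. *)
Lemma hausdorff1_null_measurable (N : set (R * R)) : (hausdorff1 N <= 0)%E ->
  (@length_outer R).-cara.-measurable N.
Proof.
move=> N0; apply: le_caratheodory_measurable => X.
have XN : length_outer R (X `&` N) = 0%E.
  apply/eqP; rewrite eq_le hausdorff1_ge0 andbT; apply: le_trans N0.
  exact: le_hausdorff1.
by rewrite XN add0e; apply: le_hausdorff1.
Qed.

(** Translations preserve covers and diameters, hence null sets. Periodicity compares traces at [x]
    and [x + t], so the almost-everywhere rules for traces are needed at both points. *)
Lemma ae_surf_trans t (P : R * R -> Prop) :
  {ae (@surf R), forall x, P x} -> {ae (@surf R), forall x, P (x + t)}.
Proof.
move=> [N [mN N0 sub]].
have N0' : (hausdorff1 (trans t N) <= 0)%E.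
  by apply: le_trans (hausdorff1_trans t N) _; rewrite -N0.
exists (trans t N); split; first exact: hausdorff1_null_measurable.
  by apply/eqP; rewrite eq_le N0' hausdorff1_ge0.
by move=> x nP; exact: sub.
Qed.

End hausdorff_translation.

(** * The energy space *)

#[local] Opaque wpartial xget Rintegral.

Lemma mulr_dotp (R : realType) (s : R) (u v : R * R) :
  s * dotp u v = s * u.1 * v.1 + s * u.2 * v.2.
Proof. by rewrite /dotp mulrDr !mulrA. Qed.

Section weighted_integral.
Context (R : realType) d (T : measurableType d) (mu : {measure set T -> \bar R}).
Variables (D : set T) (mD : measurable D).
Implicit Types f g w : T -> R.

Lemma ae_le_Rintegral f g : mu.-integrable D (EFin \o f) -> mu.-integrable D (EFin \o g) ->
  {ae mu, forall x, D x -> f x <= g x} ->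
  \int[mu]_(x in D) f x <= \int[mu]_(x in D) g x.
Proof.
move=> fi gi fg; rewrite -subr_ge0 -RintegralB//.
have mf : measurable_fun D f by apply/measurable_EFinP; exact: measurable_int fi.
have mg : measurable_fun D g by apply/measurable_EFinP; exact: measurable_int gi.
rewrite (@ae_eq_Rintegral _ _ _ _ _ mD _ (fun x => `|g x - f x|)).
- by apply: Rintegral_ge0 => x _; exact: normr_ge0.
- exact: measurable_funB.
- by apply: measurableT_comp => //; exact: measurable_funB.
- by apply: filterS fg => x H Dx; rewrite ger0_norm// subr_ge0 H.
Qed.

Definition wint w f g : R := \int[mu]_(x in D) (w x * f x * g x).

Lemma wint_integrable w f g : in_Linf mu D w -> in_L2 mu D f -> in_L2 mu D g ->
  mu.-integrable D (EFin \o (fun x => w x * f x * g x)).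
Proof. by move=> Lw Lf Lg; exact: (in_L2M mD (in_L2_Linf mD Lw Lf) Lg). Qed.

Lemma wintC w f g : wint w f g = wint w g f.
Proof. by apply: eq_Rintegral => x _; rewrite -!mulrA (mulrC (f x)). Qed.

Lemma wint_lin w k f f' g : in_Linf mu D w -> in_L2 mu D f -> in_L2 mu D f' ->
  in_L2 mu D g -> wint w (k *: f + f') g = k * wint w f g + wint w f' g.
Proof.
move=> Lw Lf Lf' Lg.
have i1 := wint_integrable Lw Lf Lg; have i2 := wint_integrable Lw Lf' Lg.
rewrite /wint -(RintegralZl _ mD i1) -RintegralD//.
  by apply: eq_Rintegral => x _; rewrite -[(k *: f + f') x]/(k * f x + f' x); ring.
exact: (integrableZl mD k i1).
Qed.

Lemma wint_ae w f f' g : measurable_fun D w -> measurable_fun D f ->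
  measurable_fun D f' -> measurable_fun D g -> f = f' %[ae mu in D] ->
  wint w f g = wint w f' g.
Proof.
move=> mw mf mf' mg ff'; apply: (ae_eq_Rintegral mD).
- by apply: measurable_funM => //; exact: measurable_funM.
- by apply: measurable_funM => //; exact: measurable_funM.
- by apply: filterS ff' => x H Dx; rewrite H.
Qed.

Lemma wint_ge0 w f : in_Linf mu D w -> in_L2 mu D f ->
  {ae mu, forall x, D x -> 0 < w x} -> 0 <= wint w f f.
Proof.
move=> Lw Lf w0; have i0 := wint_integrable Lw Lf Lf.
have z : \int[mu]_(x in D) (cst 0 x) = 0 :> R by rewrite Rintegral_cst// mul0r.
rewrite -z; apply: ae_le_Rintegral => //; first exact: integrable0.
by apply: filterS w0 => x H Dx; rewrite -mulrA -expr2 mulr_ge0 ?sqr_ge0// ltW// H.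
Qed.

Lemma wint_le w : in_Linf mu D w -> exists2 K : R, 0 <= K &
  forall f, in_L2 mu D f -> wint w f f <= K * sqn mu D f.
Proof.
move=> Lw; have [mw [K HK]] := Lw; exists `|K| => // f Lf.
rewrite /sqn -(RintegralZl _ mD (in_L2_sq Lf)); apply: ae_le_Rintegral.
- exact: wint_integrable.
- exact: (integrableZl mD _ (in_L2_sq Lf)).
- apply: filterS HK => x H Dx; rewrite -mulrA -expr2 ler_wpM2r ?sqr_ge0//.
  by apply: le_trans (ler_norm _) _; apply: le_trans (H Dx) (ler_norm _).
Qed.

Lemma wint_coercive w : in_Linf mu D w -> in_Linf mu D (fun x => (w x)^-1) ->
  {ae mu, forall x, D x -> 0 < w x} -> exists2 K : R, 0 <= K &
  forall f, in_L2 mu D f -> sqn mu D f <= K * wint w f f.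
Proof.
move=> Lw [_ [K HK]] w0; exists `|K| => // f Lf.
have i0 := wint_integrable Lw Lf Lf.
rewrite /wint -(RintegralZl _ mD i0); apply: ae_le_Rintegral.
- exact: in_L2_sq.
- exact: (integrableZl mD _ i0).
- apply: filterS2 HK w0 => x H W Dx; rewrite -(mulrA (w x)) -expr2 mulrA.
  rewrite ler_peMl ?sqr_ge0// -ler_pdivrMr ?W// mul1r.
  by apply: le_trans (ler_norm _) _; apply: le_trans (H Dx) (ler_norm _).
Qed.

End weighted_integral.

(* The terms of the scalar product are locked to keep conversion from unfolding the
   integrals. *)
HB.lock Definition ipc (R : realType) (G : graetz_data R) (x y : (R * R -> R) * (R * R -> R)) : R :=
  wint area (omega G) (coef_c G) x.1 y.1.
HB.lock Definition ips1 (R : realType) (G : graetz_data R) (x y : (R * R -> R) * (R * R -> R)) : R :=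
  wint area (omega G) (coef_sigma G) (wpartial (omega G) e1 x.2) (wpartial (omega G) e1 y.2).
HB.lock Definition ips2 (R : realType) (G : graetz_data R) (x y : (R * R -> R) * (R * R -> R)) : R :=
  wint area (omega G) (coef_sigma G) (wpartial (omega G) e2 x.2) (wpartial (omega G) e2 y.2).
HB.lock Definition ipr (R : realType) (G : graetz_data R) (tr : (R * R -> R) -> (R * R -> R))
  (x y : (R * R -> R) * (R * R -> R)) : R :=
  wint surf (gam_R G) (cst (coef_a G)) (tr x.2) (tr y.2).
HB.lock Definition nr0 (R : realType) (G : graetz_data R) (x : (R * R -> R) * (R * R -> R)) : R :=
  sqn area (omega G) x.1.
HB.lock Definition nr1 (R : realType) (G : graetz_data R) (x : (R * R -> R) * (R * R -> R)) : R :=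
  sqn area (omega G) (wpartial (omega G) e1 x.2).
HB.lock Definition nr2 (R : realType) (G : graetz_data R) (x : (R * R -> R) * (R * R -> R)) : R :=
  sqn area (omega G) (wpartial (omega G) e2 x.2).
HB.lock Definition nr3 (R : realType) (G : graetz_data R) (x : (R * R -> R) * (R * R -> R)) : R :=
  sqn area (omega G) x.2.
HB.lock Definition nrr (R : realType) (G : graetz_data R) (tr : (R * R -> R) -> (R * R -> R))
  (x : (R * R -> R) * (R * R -> R)) : R :=
  sqn surf (gam_R G) (tr x.2).
HB.lock Definition lip (R : realType) (G : graetz_data R) (tr : (R * R -> R) -> (R * R -> R))
  (x y : (R * R -> R) * (R * R -> R)) : R := ip G tr x y.

Section graetz_concrete.
Context (R : realType) (G : graetz_data R) (hG : graetz_hyp G).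
Context (tr : (R * R -> R) -> (R * R -> R)) (htr : trace_operator (omega G) tr).
Local Notation fn := (R * R -> R).
Local Notation HH := (fn * fn)%type.
Local Notation Om := (omega G).
Local Notation GD := (gam_D G).
Local Notation GR := (gam_R G).
Local Notation pairs := (per_pairs G).
Local Notation h := (coef_h G).
Local Notation c := (coef_c G).
Local Notation sig := (coef_sigma G).
Local Notation a := (coef_a G).
Local Notation area := (@area R).
Local Notation surf := (@surf R).
Local Notation cara := (caratheodory_type (@length_outer R)).
Local Notation hOm := (domain_Om hG).
Local Notation mOm := (dom_measurable hOm).
Local Notation L2 := (in_L2 area Om).
Local Notation N2 := (sqn area Om).
Local Notation V := (spaceV G tr).
Local Notation inH := (inH G tr).
Local Notation ip := (ip G tr).
Local Notation Heq := (Heq G).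
Local Notation Hnorm := (Hnorm G tr).
Local Notation D1 := (wpartial Om e1).
Local Notation D2 := (wpartial Om e2).
Implicit Types (f g s : fn).

(** Up to the null set of [parts_cover], the boundary is the union of the four measurable parts. *)
Lemma bdry_measurable : measurable (bdry Om : set cara).
Proof.
have -> : bdry Om = (bdry Om `\` \big[setU/set0]_(A <- parts G) A) `|`
                    \big[setU/set0]_(A <- parts G) A.
  rewrite setUC setDUK//.
  have P i : (i < 4)%N -> nth set0 (parts G) i `<=` bdry Om by exact: parts_bdry.
  rewrite /parts !big_cons big_nil => z [|[|[|[|//]]]].
  - exact: (P 0%N).
  - exact: (P 1%N).
  - exact: (P 2%N).
  - exact: (P 3%N).
apply: measurableU.
  apply: hausdorff1_null_measurable.
  by have E := parts_cover hG; rewrite (_ : hausdorff1 _ = 0%E).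
have P i : (i < 4)%N -> measurable (nth set0 (parts G) i : set cara).
  exact: parts_measurable.
rewrite /parts !big_cons big_nil; repeat apply: measurableU.
- exact: (P 0%N).
- exact: (P 1%N).
- exact: (P 2%N).
- exact: (P 3%N).
- exact: measurable0.
Qed.
Local Notation mbd := bdry_measurable.

Lemma GR_measurable : measurable (GR : set cara).
Proof. exact: (parts_measurable hG (isT : 2 < 4)%N). Qed.
Local Notation mGR := GR_measurable.

Lemma GR_bdry : GR `<=` bdry Om. Proof. exact: (parts_bdry hG (isT : 2 < 4)%N). Qed.
Lemma GD_bdry : GD `<=` bdry Om. Proof. exact: (parts_bdry hG (isT : 1 < 4)%N). Qed.

Lemma pair_bdry i : (i < size pairs)%N -> let p := nth (set0, 0) pairs i in
  forall x, p.1 x -> bdry Om x /\ bdry Om (x + p.2).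
Proof.
move=> ip p x px.
have pp : p \in pairs by exact: mem_nth.
have sub A : A \in pieces G -> A `<=` bdry Om.
  move=> HA; apply: subset_trans (parts_bdry hG (isT : 3 < 4)%N) => z Az.
  by rewrite /= /gam_per -bigcup_seq; exists A.
split.
  apply: (sub p.1) => //; apply/flatten_mapP; exists p => //.
  by rewrite inE eqxx.
apply: (sub (Defs.shift p.1 p.2)); last by exists x.
by apply/flatten_mapP; exists p => //; rewrite !inE eqxx orbT.
Qed.

Lemma uncontrolled_GD : ~ controlled G -> GD = set0.
Proof.
move=> nc; apply/seteqP; split => // z Dz; exfalso; apply: nc.
by exists z; left.
Qed.

Lemma uncontrolled_GR : ~ controlled G -> GR = set0.
Proof.
move=> nc; apply/seteqP; split => // z Dz; exfalso; apply: nc.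
by exists z; right.
Qed.

Lemma smooth_cst (k : R) : smooth (cst k : fn).
Proof.
have -> : (cst k : fn) = tens (fun=> k) (fun=> 1).
  by apply/funext => z; rewrite /tens mulr1.
by move=> n; apply: Ck_tens; exact: CkR_cst.
Qed.

Lemma tr_cst (k : R) : {ae surf, forall x, bdry Om x -> tr (cst k) x = k}.
Proof. exact: (tr_smooth htr (smooth_cst k)). Qed.

Lemma tr_L2S f : in_H1 Om f -> in_L2 surf (bdry Om) (tr f).
Proof. exact: tr_L2. Qed.

Lemma tr_L2GR f : in_H1 Om f -> in_L2 surf GR (tr f).
Proof.
move=> Hf; have [mf fi] := tr_L2S Hf; split.
  by apply: measurable_funS mf; [exact: mbd|exact: GR_bdry].
by apply: integrableS fi; [exact: mbd|exact: mGR|exact: GR_bdry].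
Qed.

Lemma tr_hn : exists2 K : R, 0 <= K & forall f, in_H1 Om f ->
  sqn surf (bdry Om) (tr f) <= K * hn Om f.
Proof.
have [K HK] := tr_bounded htr; exists `|K| => // f Hf.
apply: le_trans (HK f Hf) _; rewrite (hnE hOm)// ler_wpM2r ?hn_ge0//.
exact: ler_norm.
Qed.

Lemma sqnGR_le f : in_H1 Om f -> sqn surf GR (tr f) <= sqn surf (bdry Om) (tr f).
Proof.
move=> Hf; have [_ fi] := tr_L2S Hf; have [_ gi] := tr_L2GR Hf.
rewrite -lee_fin /sqn (EFin_Rintegral mGR gi) (EFin_Rintegral mbd fi).
apply: ge0_subset_integral; [exact: mGR|exact: mbd| | |exact: GR_bdry].
  by case/integrableP: fi.
by move=> x _; rewrite lee_fin sqr_ge0.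
Qed.

Lemma trB f g : in_H1 Om f -> in_H1 Om g ->
  {ae surf, forall x, bdry Om x -> tr (f - g) x = tr f x - tr g x}.
Proof.
move=> Hf Hg; have := tr_linear htr (-1) Hg Hf.
rewrite scaleN1r addrC; apply: filterS => x H bx.
by rewrite H// mulN1r addrC.
Qed.

Lemma tr_lim (u : nat -> fn) f : (forall n, in_H1 Om (u n)) -> in_H1 Om f ->
  hn Om (u n - f) @[n --> \oo] --> 0 ->
  sqn surf (bdry Om) (tr (u n) - tr f) @[n --> \oo] --> 0.
Proof.
move=> Hu Hf /(cvg0P (fun n => hn_ge0 _ _)) C.
have HB n : in_H1 Om (u n - f).
  by rewrite addrC -scaleN1r; exact: (H1_lin hOm).
have [K K0 HK] := tr_hn.
have K1 : 0 < K + 1 by rewrite ltr_wpDl.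
apply/cvg0P => [n|e e0]; first exact: sqn_ge0.
have [|N HN] := C (e / (K + 1)); first by rewrite divr_gt0.
exists N => n /HN Hn.
rewrite (@ae_eq_sqn _ _ _ _ _ mbd _ (tr (u n - f))).
- apply: le_trans (HK _ (HB n)) _.
  apply: (@le_trans _ _ ((K + 1) * hn Om (u n - f))).
    by rewrite ler_wpM2r ?hn_ge0// lerDl.
  by rewrite mulrC -ler_pdivlMr.
- apply: (@in_L2_meas _ _ _ surf); apply: (in_L2B mbd); exact: tr_L2S.
- by apply: (@in_L2_meas _ _ _ surf); exact: tr_L2S.
- by apply: filterS (trB (Hu n) Hf) => x H bx; rewrite H.
Qed.

Lemma spaceV_H1 f : V f -> in_H1 Om f. Proof. by case. Qed.

Lemma spaceV_lin (k : R) f g : V f -> V g -> V (k *: f + g).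
Proof.
move=> [Hf f0 fp] [Hg g0 gp]; have T := tr_linear htr k Hf Hg; split.
- exact: (H1_lin hOm).
- apply: filterS3 T f0 g0 => x H1 H2 H3 Dx.
  by rewrite H1 ?H2 ?H3 ?mulr0 ?addr0//; exact: GD_bdry.
- move=> i ip p.
  have T2 : {ae surf, forall x, (bdry Om x -> tr (k *: f + g) x = k * tr f x + tr g x) /\
      (bdry Om (x + p.2) -> tr (k *: f + g) (x + p.2) = k * tr f (x + p.2) + tr g (x + p.2))}.
    by apply: filterS2 T (ae_surf_trans p.2 T).
  apply: filterS3 T2 (fp i ip) (gp i ip) => x [H1 H1'] H2 H3 px.
  have [b1 b2] := pair_bdry ip px.
  by rewrite H1// H1'// H2// H3.
Qed.

Lemma spaceV_0 : V 0.
Proof.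
have T := tr_cst 0; split; first exact: (H1_0 hOm).
  by apply: filterS T => x H Dx; apply: H; exact: GD_bdry.
move=> i ip p; apply: filterS2 T (ae_surf_trans p.2 T) => x H1 H2 px.
have [b1 b2] := pair_bdry ip px.
by rewrite (H1 b1) (H2 b2).
Qed.

Lemma spaceV_cst (k : R) : ~ controlled G -> V (cst k).
Proof.
move=> nc; have T := tr_cst k; split; first exact: (H1_cst hOm).
  by apply: aeW => x; rewrite (uncontrolled_GD nc).
move=> i ip p; apply: filterS2 T (ae_surf_trans p.2 T) => x H1 H2 px.
have [b1 b2] := pair_bdry ip px.
by rewrite (H1 b1) (H2 b2).
Qed.

(** Convergence in H^1 gives convergence of the traces in L^2 of the boundary, then almost
    everywhere along suitable indices; there the Dirichlet and periodicity conditions pass to the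
    limit. *)
Lemma spaceV_lim (u : nat -> fn) f : (forall n, V (u n)) -> in_H1 Om f ->
  hn Om (u n - f) @[n --> \oo] --> 0 -> V f.
Proof.
move=> Vu Hf C.
have C' := tr_lim (fun n => spaceV_H1 (Vu n)) Hf C.
have [phi cphi] := L2_subseq mbd (fun n => tr_L2S (spaceV_H1 (Vu n))) (tr_L2S Hf) C'.
split => //.
- have : {ae surf, forall x n, GD x -> tr (u n) x = 0}.
    by apply/ae_foralln => n; case: (Vu n).
  apply: filterS2 cphi => x cx ux Dx.
  apply: (@cvg_unique _ _ (tr (u (phi k)) x @[k --> \oo])); [exact: norm_hausdorff|..].
    by apply: cx; exact: GD_bdry.
  by apply: cvg_near_cst; apply: nearW => n; exact: ux.
- move=> i ip p.
  have : {ae surf, forall x n, p.1 x -> tr (u n) (x + p.2) = tr (u n) x}.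
    by apply/ae_foralln => n; case: (Vu n) => _ _; exact.
  apply: filterS3 cphi (ae_surf_trans p.2 cphi) => x cx cx' ux px.
  have [b1 b2] := pair_bdry ip px.
  apply: (@cvg_unique _ _ (tr (u (phi k)) x @[k --> \oo])); [exact: norm_hausdorff| |exact: cx].
  have := cx' b2; under eq_fun do rewrite ux//.
  by [].
Qed.

Lemma inH_L2 (x : HH) : inH x -> L2 x.1. Proof. by case. Qed.
Lemma inH_V (x : HH) : inH x -> V x.2. Proof. by case. Qed.
Lemma inH_H1 (x : HH) : inH x -> in_H1 Om x.2. Proof. by case=> _ /spaceV_H1. Qed.
Lemma inH_D1 (x : HH) : inH x -> L2 (D1 x.2).
Proof. by move=> /inH_H1; apply: wpartial_L2; left. Qed.
Lemma inH_D2 (x : HH) : inH x -> L2 (D2 x.2).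
Proof. by move=> /inH_H1; apply: wpartial_L2; right. Qed.

Lemma inH_lin (k : R) (x y : HH) : inH x -> inH y -> inH (k *: x + y).
Proof.
move=> [Lx Vx] [Ly Vy]; split; last exact: spaceV_lin.
by apply: (in_L2D mOm) => //; exact: (in_L2Z mOm).
Qed.

Lemma inH0 : inH 0. Proof. by split; [exact: (in_L20 _ mOm)|exact: spaceV_0]. Qed.

Local Notation Ic := (wint area Om c).
Local Notation Is := (wint area Om sig).
Local Notation Ir := (wint surf GR (cst a)).
Local Notation Lc := (c_Linf hG).
Local Notation Lsig := (sig_Linf hG).
Local Notation La := (@in_Linf_cst R _ _ surf GR a).

Local Notation ipc := (ipc G).
Local Notation ips1 := (ips1 G).
Local Notation ips2 := (ips2 G).
Local Notation ipr := (ipr G tr).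
Local Notation nr0 := (nr0 G).
Local Notation nr1 := (nr1 G).
Local Notation nr2 := (nr2 G).
Local Notation nr3 := (nr3 G).
Local Notation nrr := (nrr G tr).
Local Notation lip := (lip G tr).

Lemma ipE (x y : HH) : inH x -> inH y ->
  lip x y = ipc x y + (ips1 x y + ips2 x y) + ipr x y.
Proof.
move=> Hx Hy; rewrite lip.unlock ipc.unlock ips1.unlock ips2.unlock ipr.unlock; congr (_ + _).
have i0 := wint_integrable mOm Lc (inH_L2 Hx) (inH_L2 Hy).
have i1 := wint_integrable mOm Lsig (inH_D1 Hx) (inH_D1 Hy).
have i2 := wint_integrable mOm Lsig (inH_D2 Hx) (inH_D2 Hy).
rewrite /wint -(RintegralD mOm i1 i2) -(RintegralD mOm i0 (integrableD mOm i1 i2)).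
apply: eq_area => z _; congr (_ + _).
exact: mulr_dotp.
Qed.

Lemma ipc_ge0 (x : HH) : inH x -> 0 <= ipc x x.
Proof. by move=> Hx; rewrite ipc.unlock; exact: (wint_ge0 mOm Lc (inH_L2 Hx) (c_pos hG)). Qed.

Lemma ips1_ge0 (x : HH) : inH x -> 0 <= ips1 x x.
Proof. by move=> Hx; rewrite ips1.unlock; exact: (wint_ge0 mOm Lsig (inH_D1 Hx) (sig_pos hG)). Qed.

Lemma ips2_ge0 (x : HH) : inH x -> 0 <= ips2 x x.
Proof. by move=> Hx; rewrite ips2.unlock; exact: (wint_ge0 mOm Lsig (inH_D2 Hx) (sig_pos hG)). Qed.

Lemma ipr_ge0 (x : HH) : inH x -> 0 <= ipr x x.
Proof.
move=> Hx; rewrite ipr.unlock; apply: (wint_ge0 mGR La (tr_L2GR (inH_H1 Hx))).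
by apply: aeW => z _ /=; exact: (a_pos hG).
Qed.

Lemma ipcC x y : ipc x y = ipc y x. Proof. by rewrite ipc.unlock; exact: wintC. Qed.
Lemma ips1C x y : ips1 x y = ips1 y x. Proof. by rewrite ips1.unlock; exact: wintC. Qed.
Lemma ips2C x y : ips2 x y = ips2 y x. Proof. by rewrite ips2.unlock; exact: wintC. Qed.
Lemma iprC x y : ipr x y = ipr y x. Proof. by rewrite ipr.unlock; exact: wintC. Qed.

Lemma ipc_lin (k : R) (x x' y : HH) : inH x -> inH x' -> inH y ->
  ipc (k *: x + x') y = k * ipc x y + ipc x' y.
Proof.
by move=> Hx Hx' Hy; rewrite ipc.unlock; exact: (wint_lin mOm k Lc (inH_L2 Hx) (inH_L2 Hx') (inH_L2 Hy)).
Qed.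

Lemma wints_lin v (k : R) (x x' y : HH) : v = e1 \/ v = e2 -> inH x -> inH x' -> inH y ->
  Is (wpartial Om v (k *: x + x').2) (wpartial Om v y.2) =
  k * Is (wpartial Om v x.2) (wpartial Om v y.2) + Is (wpartial Om v x'.2) (wpartial Om v y.2).
Proof.
move=> Hv Hx Hx' Hy; have Hz := inH_lin k Hx Hx'.
have Lv z (Hz' : inH z) : L2 (wpartial Om v z.2) := wpartial_L2 Hv (inH_H1 Hz').
rewrite -(wint_lin mOm k Lsig (Lv _ Hx) (Lv _ Hx') (Lv _ Hy)).
apply: (wint_ae mOm).
- exact: Lsig.1.
- exact: (in_L2_meas (Lv _ Hz)).
- apply: (@in_L2_meas _ _ _ area); apply: (in_L2D mOm); last exact: Lv.
  by apply: (in_L2Z mOm); exact: Lv.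
- exact: (in_L2_meas (Lv _ Hy)).
- exact: (wpartial_lin hOm k Hv (inH_H1 Hx) (inH_H1 Hx')).
Qed.

Lemma ips1_lin (k : R) (x x' y : HH) : inH x -> inH x' -> inH y ->
  ips1 (k *: x + x') y = k * ips1 x y + ips1 x' y.
Proof. by rewrite ips1.unlock; apply: wints_lin; left. Qed.

Lemma ips2_lin (k : R) (x x' y : HH) : inH x -> inH x' -> inH y ->
  ips2 (k *: x + x') y = k * ips2 x y + ips2 x' y.
Proof. by rewrite ips2.unlock; apply: wints_lin; right. Qed.

Lemma ipr_lin (k : R) (x x' y : HH) : inH x -> inH x' -> inH y ->
  ipr (k *: x + x') y = k * ipr x y + ipr x' y.
Proof.
move=> Hx Hx' Hy; have Hz := inH_lin k Hx Hx'.
have Lt z (Hz' : inH z) := tr_L2GR (inH_H1 Hz').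
rewrite ipr.unlock -(wint_lin mGR k La (Lt _ Hx) (Lt _ Hx') (Lt _ Hy)).
apply: (wint_ae mGR).
- exact: measurable_cst.
- exact: (in_L2_meas (Lt _ Hz)).
- apply: (@in_L2_meas _ _ _ surf); apply: (in_L2D mGR); last exact: Lt.
  by apply: (in_L2Z mGR); exact: Lt.
- exact: (in_L2_meas (Lt _ Hy)).
- apply: filterS (tr_linear htr k (inH_H1 Hx) (inH_H1 Hx')) => z H Rz.
  by rewrite H//; exact: GR_bdry.
Qed.

(** The weights have bounded inverses, so each term of the scalar product controls its own L^2
    quantity. The L^2 norm [nr3] of the second component does not appear: the energy gives no direct
    bound for it. *)
Lemma nr_coercive : exists2 K : R, 0 <= K & forall x : HH, inH x ->
  [/\ nr0 x <= K * ipc x x, nr1 x <= K * ips1 x x, nr2 x <= K * ips2 x x &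
      nrr x <= K * ipr x x].
Proof.
have Ip := c_pos hG; have Sp := sig_pos hG.
have [K1 K10 H1] := wint_coercive mOm Lc (c_inv hG) Ip.
have [K2 K20 H2] := wint_coercive mOm Lsig (sig_inv hG) Sp.
have a0 := a_pos hG.
have [K3 K30 H3] := @wint_coercive _ _ _ surf _ mGR (cst a) La (@in_Linf_cst R _ _ surf GR a^-1)
   (aeW _ (fun z _ => a0)).
exists (K1 + K2 + K3) => [|x Hx]; first by rewrite !addr_ge0.
have q0 := H1 _ (inH_L2 Hx); have q1 := H2 _ (inH_D1 Hx); have q2 := H2 _ (inH_D2 Hx).
have q3 := H3 _ (tr_L2GR (inH_H1 Hx)).
have P_zero := ipc_ge0 Hx; have P1 := ips1_ge0 Hx; have P2 := ips2_ge0 Hx; have P3 := ipr_ge0 Hx.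
have [k1 k2 k3] : [/\ K1 <= K1 + K2 + K3, K2 <= K1 + K2 + K3 & K3 <= K1 + K2 + K3].
  by clear - K10 K20 K30; split; lra.
rewrite ipc.unlock in P_zero *; rewrite ips1.unlock in P1 *; rewrite ips2.unlock in P2 *.
rewrite ipr.unlock in P3 *; rewrite nr0.unlock nr1.unlock nr2.unlock nrr.unlock.
split.
- exact: (le_trans q0 (ler_wpM2r P_zero k1)).
- exact: (le_trans q1 (ler_wpM2r P1 k2)).
- exact: (le_trans q2 (ler_wpM2r P2 k2)).
- exact: (le_trans q3 (ler_wpM2r P3 k3)).
Qed.

Lemma nr_upper : exists2 K : R, 0 <= K & forall x : HH, inH x ->
  [/\ ipc x x <= K * nr0 x, ips1 x x <= K * nr1 x, ips2 x x <= K * nr2 x &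
      ipr x x <= K * hn Om x.2].
Proof.
have [K1 K10 H1] := wint_le mOm Lc; have [K2 K20 H2] := wint_le mOm Lsig.
have [K3 K30 H3] := @wint_le _ _ _ surf _ mGR (cst a) La.
have [K4 K40 H4] := tr_hn.
have K340 : 0 <= K3 * K4 by rewrite mulr_ge0.
exists (K1 + K2 + K3 * K4) => [|x Hx]; first by rewrite !addr_ge0.
have q0 := H1 _ (inH_L2 Hx); have q1 := H2 _ (inH_D1 Hx); have q2 := H2 _ (inH_D2 Hx).
have q3 := H3 _ (tr_L2GR (inH_H1 Hx)).
have q4 := le_trans (sqnGR_le (inH_H1 Hx)) (H4 _ (inH_H1 Hx)).
have q5 := le_trans q3 (ler_wpM2l K30 q4).
have [k1 k2 k3] : [/\ K1 <= K1 + K2 + K3 * K4, K2 <= K1 + K2 + K3 * K4 & K3 * K4 <= K1 + K2 + K3 * K4].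
  by clear - K10 K20 K340; split; lra.
rewrite mulrA in q5.
rewrite ipc.unlock ips1.unlock ips2.unlock ipr.unlock nr0.unlock nr1.unlock nr2.unlock.
split.
- exact: (le_trans q0 (ler_wpM2r (sqn_ge0 _ _ _) k1)).
- exact: (le_trans q1 (ler_wpM2r (sqn_ge0 _ _ _) k2)).
- exact: (le_trans q2 (ler_wpM2r (sqn_ge0 _ _ _) k2)).
- exact: (le_trans q5 (ler_wpM2r (hn_ge0 _ _) k3)).
Qed.

Lemma hn_nr (x : HH) : hn Om x.2 = nr3 x + nr1 x + nr2 x.
Proof. by rewrite nr1.unlock nr2.unlock nr3.unlock. Qed.

Lemma nr_ge0 (x : HH) : [/\ 0 <= nr0 x, 0 <= nr1 x, 0 <= nr2 x, 0 <= nr3 x & 0 <= nrr x].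
Proof.
rewrite nr0.unlock nr1.unlock nr2.unlock nr3.unlock nrr.unlock.
by split; exact: sqn_ge0.
Qed.

Lemma ipC (x y : HH) : inH x -> inH y -> lip x y = lip y x.
Proof.
by move=> Hx Hy; rewrite (ipE Hx Hy) (ipE Hy Hx) ipcC ips1C ips2C iprC.
Qed.

Lemma ip_lin (k : R) (x x' y : HH) : inH x -> inH x' -> inH y ->
  lip (k *: x + x') y = k * lip x y + lip x' y.
Proof.
move=> Hx Hx' Hy; have Hz := inH_lin k Hx Hx'.
rewrite (ipE Hz Hy) (ipE Hx Hy) (ipE Hx' Hy).
rewrite (ipc_lin k Hx Hx' Hy) (ips1_lin k Hx Hx' Hy) (ips2_lin k Hx Hx' Hy) (ipr_lin k Hx Hx' Hy).
ring.
Qed.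

Lemma ip_ge0 (x : HH) : inH x -> 0 <= lip x x.
Proof.
move=> Hx; rewrite (ipE Hx Hx).
have := ipc_ge0 Hx; have := ips1_ge0 Hx; have := ips2_ge0 Hx; have := ipr_ge0 Hx.
lra.
Qed.

Lemma ip_coercive : exists2 K : R, 0 <= K & forall x : HH, inH x ->
  [/\ nr0 x <= K * lip x x, nr1 x <= K * lip x x, nr2 x <= K * lip x x &
      nrr x <= K * lip x x].
Proof.
have [K K0 HK] := nr_coercive; exists K => // x Hx; rewrite (ipE Hx Hx).
have := ipc_ge0 Hx; have := ips1_ge0 Hx; have := ips2_ge0 Hx; have := ipr_ge0 Hx.
case: (HK x Hx) => h0 h1 h2 h3 p3 p2 p1 p0.
by split; [apply: (le_trans h0)|apply: (le_trans h1)|apply: (le_trans h2)|apply: (le_trans h3)];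
  apply: ler_wpM2l => //; lra.
Qed.

Lemma ip_upper : exists2 K : R, 0 <= K & forall x : HH, inH x ->
  lip x x <= K * (nr0 x + hn Om x.2).
Proof.
have [K K0 HK] := nr_upper; exists (K + K) => [|x Hx]; first by rewrite addr_ge0.
rewrite (ipE Hx Hx); case: (HK x Hx) (nr_ge0 x); rewrite (hn_nr x) => h0 h1 h2 h3 [p0 p1 p2 p3 _].
have m0 := mulr_ge0 K0 p0; have m3 := mulr_ge0 K0 p3.
have m1 := mulr_ge0 K0 p1; have m2 := mulr_ge0 K0 p2.
nra.
Qed.

End graetz_concrete.

(** * The operator *)

HB.lock Definition hint (R : realType) (G : graetz_data R) (f g : R * R -> R) : R :=
  wint area (omega G) (coef_h G) f g.
HB.lock Definition dint (R : realType) (G : graetz_data R) (s g : R * R -> R) : R :=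
  \int[area]_(x in omega G) (divs G s x * g x).

Lemma addr3_0 (R : realType) (a b c : R) : a = 0 -> b = 0 -> c = 0 -> a + b + c = 0.
Proof. by move=> -> -> ->; rewrite !addr0. Qed.

Lemma green_aux (R : realType) (d p q r : R) : d + (p + q) = - r -> p + q + r = - d.
Proof. by move=> E; lra. Qed.

Lemma cvg0_le (R : realType) (a b : nat -> R) : (forall n, 0 <= a n <= b n) ->
  b @ \oo --> 0 -> a @ \oo --> 0.
Proof.
move=> H; have a0 n : 0 <= a n by have /andP[] := H n.
have b0 n : 0 <= b n by have /andP[x0 xb] := H n; exact: le_trans xb.
move=> /(cvg0P b0) C; apply/(cvg0P a0) => e /C[N HN]; exists N => n /HN.
by have /andP[_ ab] := H n; exact: le_trans ab.
Qed.

Section graetz_operator.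
Context (R : realType) (G : graetz_data R) (hG : graetz_hyp G).
Context (tr : (R * R -> R) -> (R * R -> R)) (htr : trace_operator (omega G) tr).
Local Notation fn := (R * R -> R).
Local Notation HH := (fn * fn)%type.
Local Notation Om := (omega G).
Local Notation GD := (gam_D G).
Local Notation GR := (gam_R G).
Local Notation h := (coef_h G).
Local Notation c := (coef_c G).
Local Notation sig := (coef_sigma G).
Local Notation a := (coef_a G).
Local Notation area := (@area R).
Local Notation surf := (@surf R).
Local Notation cara := (caratheodory_type (@length_outer R)).
Local Notation hOm := (domain_Om hG).
Local Notation mOm := (dom_measurable hOm).
Local Notation mGR := (GR_measurable hG).
Local Notation mbd := (bdry_measurable hG).
Local Notation L2 := (in_L2 area Om).
Local Notation N2 := (sqn area Om).
Local Notation V := (spaceV G tr).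
Local Notation inH := (inH G tr).
Local Notation Heq := (Heq G).
Local Notation D1 := (wpartial Om e1).
Local Notation D2 := (wpartial Om e2).
Local Notation lip := (lip G tr).
Local Notation ipc := (ipc G).
Local Notation ipr := (ipr G tr).
Local Notation hint := (hint G).
Local Notation dint := (dint G).
Local Notation domA := (domA G tr).
Local Notation opA := (opA G).
Implicit Types (f g s : fn).

Lemma ae_cst_D v s (k : R) : v = e1 \/ v = e2 -> in_H1 Om s -> s = cst k %[ae area in Om] ->
  wpartial Om v s = 0 %[ae area in Om].
Proof.
move=> Hv Hs sk; apply: (wp_unique hOm (wpartialP Hv Hs)).
apply: (wp_ae hOm Hv _ (H1_L2 Hs) _ (weak_partial_cst hOm k Hv)).
  exact: (dom_cst_L2 hOm).
exact: ae_eq_sym.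
Qed.

Lemma H1B f g : in_H1 Om f -> in_H1 Om g -> in_H1 Om (f - g).
Proof. by move=> Hf Hg; rewrite addrC -scaleN1r; exact: (H1_lin hOm). Qed.

Lemma ae_cst0_hn s : in_H1 Om s -> s = cst 0 %[ae area in Om] -> hn Om s = 0.
Proof.
move=> Hs s0; rewrite /hn.
have z f : L2 f -> f = 0 %[ae area in Om] -> N2 f = 0.
  by move=> Lf f0; apply: (ae_eq0_sqn mOm f0); exact: in_L2_meas Lf.
have n1 := z _ (wpartial_L2 (or_introl erefl) Hs) (ae_cst_D (or_introl erefl) Hs s0).
have n2 := z _ (wpartial_L2 (or_intror erefl) Hs) (ae_cst_D (or_intror erefl) Hs s0).
exact: (addr3_0 (z s (H1_L2 Hs) s0) n1 n2).
Qed.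

(** The difference with the constant has zero H^1 norm, so the trace bound annihilates its trace,
    and the trace of the constant is known because constants are smooth. *)
Lemma ae_cst_tr s (k : R) : in_H1 Om s -> s = cst k %[ae area in Om] ->
  {ae surf, forall x, bdry Om x -> tr s x = k}.
Proof.
move=> Hs sk; have Hc := H1_cst hOm k; have Ht := H1B Hs Hc.
have t0 : s - cst k = cst 0 %[ae area in Om].
  apply: filterS sk => x H Ox; rewrite -[LHS]/(s x - k) (H Ox).
  by rewrite /= subrr.
have [K K0 HK] := tr_hn hG htr.
have := HK _ Ht; rewrite (ae_cst0_hn Ht t0) mulr0 => le0.
have e0 : sqn surf (bdry Om) (tr (s - cst k)) = 0.
  by apply/eqP; rewrite eq_le le0 sqn_ge0.
have := sqn_eq0 mbd (tr_L2S htr Ht) e0.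
apply: filterS3 (trB htr Hs Hc) (tr_cst htr k) => x h1 h2 h3 bx.
have := h1 bx; rewrite (h2 bx) (h3 bx) => /esym/eqP.
by rewrite subr_eq0 => /eqP.
Qed.

Lemma surf_ae_absurd (A : set (R * R)) : (0 < surf A)%E ->
  ~ {ae surf, forall x, ~ A x}.
Proof.
move=> A0 [N [mN N0 sub]]; move: A0; rewrite ltNge => /negP; apply.
rewrite -N0; apply: le_hausdorff1.
by apply: subset_trans sub => x Ax /=; apply.
Qed.

Lemma wp_aeR v f g g' : weak_partial Om v f g -> L2 g' -> g = g' %[ae area in Om] ->
  weak_partial Om v f g'.
Proof.
move=> [Lg Hg] Lg' gg'; split => // w tw; rewrite Hg//; congr (- _).
have Lw := test_L2 hOm tw.
apply: (ae_eq_Rintegral mOm).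
- by apply: measurable_funM; [exact: in_L2_meas Lg|exact: in_L2_meas Lw].
- by apply: measurable_funM; [exact: in_L2_meas Lg'|exact: in_L2_meas Lw].
- by apply: filterS gg' => x H Ox; rewrite H.
Qed.

(** Zero gradient makes [s] a constant. If the constants are controlled, the Dirichlet or the Robin
    part has positive length and the trace of [s] vanishes on it, so the constant is 0. *)
Lemma grad0_eqH s : V s -> N2 (D1 s) = 0 -> N2 (D2 s) = 0 -> sqn surf GR (tr s) = 0 ->
  eqH G s 0.
Proof.
move=> Vs n1 n2 nr; have Hs := spaceV_H1 Vs.
have z v : v = e1 \/ v = e2 -> N2 (wpartial Om v s) = 0 -> weak_partial Om v s 0.
  move=> Hv nv; apply: (wp_aeR (wpartialP Hv Hs)); first exact: (in_L20 _ mOm).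
  by apply: (sqn_eq0 mOm) => //; exact: wpartial_L2.
have [k sk] := zero_gradient_cst hOm (H1_L2 Hs) (z _ (or_introl erefl) n1) (z _ (or_intror erefl) n2).
have tk := ae_cst_tr Hs sk.
split=> [ctl|_]; last first.
  by exists k; apply: filterS sk => x H Ox; rewrite (H Ox) /= add0r.
suff k0 : k = 0 by rewrite k0 in sk.
apply: contrapT => /eqP kN0.
case: ctl => z0 [Dz|Rz].
- apply: (@surf_ae_absurd GD).
    by apply: (parts_pos hG (isT : 1 < 4)%N); exists z0.
  case: Vs => _ d0 _; apply: filterS2 d0 tk => x h1 h2 Dx.
  by move/eqP: kN0; apply; rewrite -(h2 (GD_bdry hG Dx)) (h1 Dx).
- apply: (@surf_ae_absurd GR).
    by apply: (parts_pos hG (isT : 2 < 4)%N); exists z0.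
  have := sqn_eq0 mGR (tr_L2GR hG htr Hs) nr.
  apply: filterS2 tk => x h2 h1 Rx.
  by move/eqP: kN0; apply; rewrite -(h2 (GR_bdry hG Rx)) (h1 Rx).
Qed.

Lemma inHB (x y : HH) : inH x -> inH y -> inH (x - y).
Proof. by move=> Hx Hy; rewrite addrC -scaleN1r; exact: (inH_lin hG htr). Qed.

Lemma lip0_Heq (x : HH) : inH x -> lip x x = 0 -> Heq x 0.
Proof.
move=> Hx x0; have [K K0 HK] := ip_coercive hG htr.
have := HK x Hx; rewrite x0 mulr0 => -[h0 h1 h2 hr].
have [g0 g1 g2 _ gr] := nr_ge0 G tr x.
have z (r : R) : r <= 0 -> 0 <= r -> r = 0 by move=> r1 r2; apply/eqP; rewrite eq_le r1 r2.
move: (z _ h0 g0) (z _ h1 g1) (z _ h2 g2) (z _ hr gr).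
rewrite nr0.unlock nr1.unlock nr2.unlock nrr.unlock => e0 e1' e2' er.
split; first by apply: (sqn_eq0 mOm) => //; exact: inH_L2 Hx.
by apply: grad0_eqH => //; exact: inH_V Hx.
Qed.

Lemma lip_ge0E (x : HH) : inH x -> lip x x <= 0 -> lip x x = 0.
Proof. by move=> Hx le; apply/eqP; rewrite eq_le le (ip_ge0 hG htr Hx). Qed.

Lemma Heq0_lip (x : HH) : inH x -> Heq x 0 -> lip x x = 0.
Proof.
move=> Hx [x0 [ec eu]]; apply: (lip_ge0E Hx).
have [K K0 HK] := nr_upper hG htr; have [h0 h1 h2 hr] := HK x Hx.
have Lx := inH_L2 Hx; have H1 := inH_H1 Hx.
have z0 : nr0 G x = 0 by rewrite nr0.unlock; apply: (ae_eq0_sqn mOm x0); exact: in_L2_meas Lx.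
have [k sk kz] : exists2 k : R, x.2 = cst k %[ae area in Om] & controlled G -> k = 0.
  have [ct|nc] := pselect (controlled G); first by exists 0 => //; exact: ec.
  have [k sk] := eu nc; exists k => //.
  by apply: filterS sk => z H Oz; rewrite (H Oz) /= add0r.
have z1 : nr1 G x = 0.
  rewrite nr1.unlock; apply: (ae_eq0_sqn mOm (ae_cst_D (or_introl erefl) H1 sk)).
  exact: in_L2_meas (inH_D1 Hx).
have z2 : nr2 G x = 0.
  rewrite nr2.unlock; apply: (ae_eq0_sqn mOm (ae_cst_D (or_intror erefl) H1 sk)).
  exact: in_L2_meas (inH_D2 Hx).
have zr : ipr x x <= 0.
  have [ct|nc] := pselect (controlled G).
    apply: (le_trans hr); rewrite (ae_cst0_hn H1) ?mulr0//.
    by rewrite (kz ct) in sk.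
  by rewrite ipr.unlock /wint (uncontrolled_GR nc) Rintegral_set0.
rewrite (ipE hG Hx Hx).
rewrite z0 mulr0 in h0; rewrite z1 mulr0 in h1; rewrite z2 mulr0 in h2.
lra.
Qed.

(** The equality of the quotient space is thereby a null-vector relation of the form, which is the
    only equality that the abstract pre-Hilbert part knows. *)
Lemma HeqP (x y : HH) : inH x -> inH y -> Heq x y <-> lip (x - y) (x - y) = 0.
Proof.
move=> Hx Hy; have Hz := inHB Hx Hy.
have E f g : f = g %[ae area in Om] <-> f - g = 0 %[ae area in Om].
  split; apply: filterS => z H Oz.
    by rewrite -[LHS]/(f z - g z) (H Oz) subrr.
  by apply/eqP; rewrite -subr_eq0; apply/eqP; exact: H.
suff -> : Heq x y <-> Heq (x - y) 0.
  by split; [exact: Heq0_lip|exact: lip0_Heq].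
have E2 f g (k : R) : f = (fun z => g z + k) %[ae area in Om] <->
    f - g = (fun z => 0 + k) %[ae area in Om].
  split; apply: filterS => z H Oz.
    by rewrite -[LHS]/(f z - g z) (H Oz) /= addrC addKr add0r.
  have := H Oz; rewrite -[LHS]/(f z - g z) add0r => <-.
  by rewrite addrC subrK.
split=> -[h1 [h2 h3]]; split.
- exact: (E x.1 y.1).1.
- split=> [ct|nc]; first exact: (E x.2 y.2).1 (h2 ct).
  by have [k Hk] := h3 nc; exists k; exact: (E2 x.2 y.2 k).1.
- exact: (E x.1 y.1).2.
- split=> [ct|nc]; first exact: (E x.2 y.2).2 (h2 ct).
  by have [k Hk] := h3 nc; exists k; exact: (E2 x.2 y.2 k).2.
Qed.

(* Convergence of the second components in L^2 replaces the Poincare inequality. *)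
Lemma H_complete (u : nat -> HH) : (forall n, inH (u n)) ->
  (forall e, 0 < e -> exists N, forall m n, (N <= m)%N -> (N <= n)%N ->
     lip (u m - u n) (u m - u n) <= e) ->
  (forall e, 0 < e -> exists N, forall m n, (N <= m)%N -> (N <= n)%N ->
     nr3 G (u m - u n) <= e) ->
  exists2 x, inH x & lip (u n - x) (u n - x) @[n --> \oo] --> 0 /\
    nr3 G (u n - x) @[n --> \oo] --> 0.
Proof.
move=> Hu C C3.
have [K K0 HK] := ip_coercive hG htr.
have K1 : 0 < K + 1 by rewrite ltr_wpDl.
have Hd m n : inH (u m - u n) by exact: inHB.
have CC (nr : HH -> R) : (forall m n, nr (u m - u n) <= K * lip (u m - u n) (u m - u n)) ->
    forall e, 0 < e -> exists N, forall m n, (N <= m)%N -> (N <= n)%N -> nr (u m - u n) <= e.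
  move=> H e e0; have [|N HN] := C (e / (K + 1)); first by rewrite divr_gt0.
  exists N => m n mN nN; apply: (le_trans (H m n)).
  apply: (@le_trans _ _ ((K + 1) * (e / (K + 1)))).
    apply: ler_pM => //; [exact: (ip_ge0 hG htr (Hd m n))|by rewrite lerDl|exact: HN].
  by rewrite mulrCA divff ?gt_eqF// mulr1.
have C0 := CC (nr0 G) (fun m n => let: And4 p _ _ _ := HK _ (Hd m n) in p).
have C1 := CC (nr1 G) (fun m n => let: And4 _ p _ _ := HK _ (Hd m n) in p).
have C2 := CC (nr2 G) (fun m n => let: And4 _ _ p _ := HK _ (Hd m n) in p).
have dom_sub v m n : v = e1 \/ v = e2 -> N2 (wpartial Om v (u m).2 - wpartial Om v (u n).2) =
    N2 (wpartial Om v (u m - u n).2).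
  move=> Hv; have Hm := inH_H1 (Hu m); have Hn := inH_H1 (Hu n).
  apply: (ae_eq_sqn mOm).
  - by apply: (@in_L2_meas _ _ _ area); apply: (in_L2B mOm); exact: wpartial_L2.
  - by apply: (@in_L2_meas _ _ _ area); apply: wpartial_L2 => //; exact: (inH_H1 (Hd m n)).
  - have := wpartial_lin hOm (-1) Hv Hn Hm.
    rewrite scaleN1r addrC; apply: filterS => z H Oz; rewrite (H Oz).
    by rewrite -[RHS]/(-1 * wpartial Om v (u n).2 z + wpartial Om v (u m).2 z) mulN1r addrC.
have [f Lf cf] : exists2 f, L2 f & N2 ((u n).1 - f) @[n --> \oo] --> 0.
  apply: (L2_complete mOm) => [n|e e0]; first exact: inH_L2.
  by have [N HN] := C0 e e0; exists N => m n mN nN; have := HN m n mN nN; rewrite nr0.unlock.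
have [s Ls cs] : exists2 s, L2 s & N2 ((u n).2 - s) @[n --> \oo] --> 0.
  apply: (L2_complete mOm) => [n|e e0]; first exact: H1_L2 (inH_H1 (Hu n)).
  by have [N HN] := C3 e e0; exists N => m n mN nN; have := HN m n mN nN; rewrite nr3.unlock.
have [g1 Lg1 cg1] : exists2 g, L2 g & N2 (D1 (u n).2 - g) @[n --> \oo] --> 0.
  apply: (L2_complete mOm) => [n|e e0]; first exact: inH_D1.
  have [N HN] := C1 e e0; exists N => m n mN nN; have := HN m n mN nN; rewrite nr1.unlock.
  by rewrite (dom_sub e1)//; left.
have [g2 Lg2 cg2] : exists2 g, L2 g & N2 (D2 (u n).2 - g) @[n --> \oo] --> 0.
  apply: (L2_complete mOm) => [n|e e0]; first exact: inH_D2.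
  have [N HN] := C2 e e0; exists N => m n mN nN; have := HN m n mN nN; rewrite nr2.unlock.
  by rewrite (dom_sub e2)//; right.
have [Hs _ _ ch] := hn_lim hOm (fun n => inH_H1 (Hu n)) Ls Lg1 Lg2 cs cg1 cg2.
have Vs := spaceV_lim hG htr (fun n => inH_V (Hu n)) Hs ch.
have Hx : inH (f, s) by split.
exists (f, s) => //; split; last by rewrite nr3.unlock.
have [K' K'0 HK'] := ip_upper hG htr.
apply: (@cvg0_le _ _ (fun n => K' * (N2 ((u n).1 - f) + hn Om ((u n).2 - s)))).
  move=> n; apply/andP; split; first exact: (ip_ge0 hG htr (inHB (Hu n) Hx)).
  by have := HK' _ (inHB (Hu n) Hx); rewrite nr0.unlock.
rewrite -[X in _ --> X](mulr0 K') -(addr0 (0 : R)).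
apply: cvgM; first exact: cvg_cst.
by apply: cvgD.
Qed.

Lemma inH_fst f : L2 f -> inH (f, 0).
Proof. by move=> Lf; split => //; exact: (spaceV_0 hG htr). Qed.

Lemma inH_opP (x : HH) : inH x -> inH (opP x).
Proof. by move=> Hx; apply: inH_fst; exact: inH_L2 Hx. Qed.

Lemma inH_cst (k : R) : inH (cst k, 0).
Proof. by apply: inH_fst; exact: (dom_cst_L2 hOm). Qed.

(** The derivatives and the trace of the function 0 are values of chosen representatives, so they
    vanish only almost everywhere; the energy and Robin terms disappear for that reason. *)
Lemma lip_fst f (y : HH) : L2 f -> inH y -> lip (f, 0) y = ipc (f, 0) y.
Proof.
move=> Lf Hy; have Hx := inH_fst Lf; rewrite (ipE hG Hx Hy).
have z v : v = e1 \/ v = e2 -> wint area Om sig (wpartial Om v 0) (wpartial Om v y.2) = 0.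
  move=> Hv; rewrite (@wint_ae _ _ _ _ _ mOm _ _ 0).
  - rewrite /wint (@eq_area _ _ _ (cst 0)); last by move=> x _; rewrite mulr0 mul0r.
    by rewrite Rintegral_cst ?mul0r//; exact: mOm.
  - by case: (sig_Linf hG).
  - by apply: (@in_L2_meas _ _ _ area); apply: wpartial_L2 => //; exact: (H1_0 hOm).
  - exact: measurable_cst.
  - by apply: (@in_L2_meas _ _ _ area); apply: wpartial_L2 => //; exact: inH_H1 Hy.
  - by apply: (@ae_cst_D _ _ 0) => //; [exact: (H1_0 hOm)|exact: aeW].
have -> : ips1 G (f, 0) y = 0 by rewrite ips1.unlock; apply: z; left.
have -> : ips2 G (f, 0) y = 0 by rewrite ips2.unlock; apply: z; right.
have -> : ipr (f, 0) y = 0.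
  rewrite ipr.unlock (@wint_ae _ _ _ _ _ mGR _ _ 0).
  - rewrite /wint (@eq_Rintegral _ _ _ _ _ (cst 0)); last by move=> x _; rewrite mulr0 mul0r.
    by rewrite Rintegral_cst ?mul0r//; exact: mGR.
  - exact: measurable_cst.
  - by apply: (@in_L2_meas _ _ _ surf); apply: (tr_L2GR hG htr); exact: (H1_0 hOm).
  - exact: measurable_cst.
  - by apply: (@in_L2_meas _ _ _ surf); apply: (tr_L2GR hG htr); exact: inH_H1 Hy.
  - by apply: filterS (tr_cst htr 0) => x H Rx; apply: H; exact: GR_bdry Rx.
by rewrite !addr0.
Qed.

Lemma ipc_eq1 (x x' y : HH) : x.1 = x'.1 -> ipc x y = ipc x' y.
Proof. by rewrite ipc.unlock => ->. Qed.

Lemma lip_opP (x y : HH) : inH x -> inH y -> lip (opP x) y = ipc x y.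
Proof. by move=> Hx Hy; rewrite lip_fst ?(ipc_eq1 (x' := x))//; exact: inH_L2 Hx. Qed.

Lemma lip_opPC (x y : HH) : inH x -> inH y -> lip (opP x) y = lip x (opP y).
Proof.
move=> Hx Hy; rewrite lip_opP// ipcC -lip_opP// (ipC hG)//.
exact: inH_opP.
Qed.

Lemma lip_CS (x y : HH) : inH x -> inH y -> lip x y ^+ 2 <= lip x x * lip y y.
Proof.
move=> Hx Hy; apply: discriminant_le => [|t]; first exact: (ip_ge0 hG htr Hy).
have Hz := inH_lin hG htr t Hy Hx.
have := ip_ge0 hG htr Hz.
rewrite (ip_lin hG htr t Hy Hx Hz) (ipC hG Hy Hz) (ipC hG Hx Hz).
rewrite (ip_lin hG htr t Hy Hx Hy) (ip_lin hG htr t Hy Hx Hx) (ipC hG Hy Hx).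
move: (lip x x) (lip x y) (lip y y) => p q r; have -> // : t * (t * r + q) + (t * q + p) = p + t * q *+ 2 + t ^+ 2 * r.
by ring.
Qed.

Lemma lip_null (x y : HH) : inH x -> inH y -> lip y y = 0 -> lip x y = 0.
Proof.
move=> Hx Hy y0; have := lip_CS Hx Hy; rewrite y0 mulr0.
by move=> le; apply/eqP; rewrite -sqrf_eq0 eq_le le sqr_ge0.
Qed.

Lemma domA_inH (x : HH) : domA x -> inH x. Proof. by case. Qed.
Lemma domA_V (x : HH) : domA x -> V x.1. Proof. by case. Qed.

Lemma divs_L2 (x : HH) : domA x -> L2 (divs G x.2).
Proof.
case=> _ _ ex _; have : is_div G x.2 (divs G x.2) by exact: (xgetPex 0 ex).
by case.
Qed.

Lemma cinv_L2 f : L2 f -> L2 (fun z => (c z)^-1 * f z).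
Proof. by move=> Lf; exact: (in_L2_Linf mOm (c_inv hG) Lf). Qed.

Lemma opA_inH (x : HH) : domA x -> inH (opA x).
Proof.
move=> dx; split; last exact: domA_V.
have Lh := in_L2_Linf mOm (h_Linf hG) (inH_L2 (domA_inH dx)).
have := in_L2B mOm (cinv_L2 Lh) (cinv_L2 (divs_L2 dx)).
suff -> : (fun z => (c z)^-1 * (h \* x.1) z) - (fun z => (c z)^-1 * divs G x.2 z) =
  (opA x).1 by [].
by apply/funext => z; rewrite /opA/= -mulrA.
Qed.

Lemma dint_integrable (x : HH) g : domA x -> L2 g ->
  area.-integrable Om (EFin \o (fun z => divs G x.2 z * g z)).
Proof. by move=> dx Lg; apply: (in_L2M mOm) => //; exact: divs_L2. Qed.

(** The [lateral_flux] clause of [domA], tested with the second component of [y], is Green's formula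
    with the Robin condition built in. *)
Lemma green (x y : HH) : domA x -> inH y ->
  ips1 G x y + ips2 G x y + ipr x y = - dint x.2 y.2.
Proof.
move=> dx Hy; have Hx := domA_inH dx; case: (dx) => _ _ _ /(_ y.2 (inH_V Hy)).
rewrite ips1.unlock ips2.unlock ipr.unlock dint.unlock /normal_flux => E.
have i0 := dint_integrable dx (H1_L2 (inH_H1 Hy)).
have i1 := wint_integrable mOm (sig_Linf hG) (inH_D1 Hx) (inH_D1 Hy).
have i2 := wint_integrable mOm (sig_Linf hG) (inH_D2 Hx) (inH_D2 Hy).
move: E; rewrite (@eq_area _ _ _ (fun z => divs G x.2 z * y.2 z +
  (sig z * D1 x.2 z * D1 y.2 z + sig z * D2 x.2 z * D2 y.2 z))); last first.
  by move=> z _; congr (_ + _); exact: mulr_dotp.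
rewrite (RintegralD mOm i0 (integrableD mOm i1 i2)) (RintegralD mOm i1 i2) => E.
apply: (green_aux E).
Qed.

Lemma ipc_opA (x y : HH) : domA x -> inH y ->
  ipc (opA x) y = hint x.1 y.1 - dint x.2 y.1.
Proof.
move=> dx Hy; have Hx := domA_inH dx.
rewrite ipc.unlock hint.unlock dint.unlock /wint.
have i0 := wint_integrable mOm (h_Linf hG) (inH_L2 Hx) (inH_L2 Hy).
have i1 := dint_integrable dx (inH_L2 Hy).
rewrite -(RintegralB mOm i0 i1); apply: (ae_eq_Rintegral mOm).
- have := measurable_int _ (wint_integrable mOm (c_Linf hG) (inH_L2 (opA_inH dx)) (inH_L2 Hy)).
  by move/measurable_EFinP.
- by have /measurable_EFinP := measurable_int _ (integrableB mOm i0 i1).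
- have cp := c_pos hG; apply: filterS cp => z cz Oz; have c0 := cz Oz.
  rewrite /opA/=; field.
  by rewrite gt_eqF.
Qed.

(** The second component of A x is [x.1], so Green's formula for [y] converts the energy terms into
    a divergence of [y.2] tested against [x.1]. The outcome is symmetric in [x] and [y], whence the
    symmetry of A. *)
Lemma lip_opA (x y : HH) : domA x -> domA y ->
  lip (opA x) y = hint x.1 y.1 - dint x.2 y.1 - dint y.2 x.1.
Proof.
move=> dx dy; have HA := opA_inH dx; have Hy := domA_inH dy.
have := green dy HA; rewrite (ips1C _ y) (ips2C _ y) (iprC _ _ y) => E.
rewrite (ipE hG HA Hy) (ipc_opA dx Hy).
move: E; rewrite -[(opA x).2]/(x.1).
move: (ips1 G _ _) (ips2 G _ _) (ipr _ _) (dint _ _) (dint _ _) (hint _ _).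
by move=> p q r s t u E; lra.
Qed.

Lemma hintC f g : hint f g = hint g f.
Proof. by rewrite hint.unlock; exact: wintC. Qed.

Lemma opA_sym (x y : HH) : domA x -> domA y -> lip (opA x) y = lip x (opA y).
Proof.
move=> dx dy; rewrite (ipC hG (domA_inH dx) (opA_inH dy)) (lip_opA dx dy) (lip_opA dy dx).
rewrite (hintC y.1); move: (dint _ _) (dint _ _) (hint _ _) => p q r.
by ring.
Qed.

Lemma inH_cst2 (k : R) : ~ controlled G -> inH (0, cst k).
Proof. by move=> nc; split; [exact: (in_L20 _ mOm)|exact: (spaceV_cst hG htr)]. Qed.

(** If the constants are not controlled, (0, 1) is an admissible test vector of zero norm, and
    Green's formula against it says that the total flux vanishes. *)
Lemma dint_mean (x : HH) : ~ controlled G -> domA x -> dint x.2 (cst 1) = 0.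
Proof.
move=> nc dx; have Hy := inH_cst2 1 nc; have Hx := domA_inH dx.
have y0 : lip (0, cst 1) (0, cst 1) = 0.
  apply: (Heq0_lip Hy); split; first exact: aeW.
  split=> // _; exists 1; apply: aeW => z _ /=.
  by rewrite add0r.
have := lip_null Hx Hy y0; rewrite (ipE hG Hx Hy).
have -> : ipc x (0, cst 1) = 0.
  rewrite ipc.unlock /wint (@eq_area _ _ _ (cst 0)); last by move=> z _; rewrite /= mulr0.
  by rewrite Rintegral_cst ?mul0r//; exact: mOm.
have /= := green dx Hy.
by move: (ips1 G _ _) (ips2 G _ _) (ipr _ _) (dint _ _) => p q r s E1 E2; lra.
Qed.

(** In the product of A x with Phi the divergence term has zero mean, so only the term in h
    survives. *)
Lemma lip_opA_cst1 (x : HH) : ~ controlled G -> domA x ->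
  lip (opA x) (cst 1, 0) = hint x.1 (cst 1).
Proof.
move=> nc dx; have HA := opA_inH dx; have H1 := inH_cst 1.
rewrite (ipC hG HA H1) (lip_fst (dom_cst_L2 hOm 1) HA) ipcC (ipc_opA dx H1).
by rewrite (dint_mean nc dx) subr0.
Qed.

Lemma hint_CS : exists2 K : R, 0 <= K & forall x y : HH, inH x -> inH y ->
  hint x.1 y.1 ^+ 2 <= K * (lip x x * lip y y).
Proof.
have [mh [M HM]] := h_Linf hG.
have [K K0 HK] := ip_coercive hG htr.
exists (M ^+ 2 * (K * K)) => [|x y Hx Hy]; first by rewrite mulr_ge0 ?sqr_ge0// mulr_ge0.
have Lx := inH_L2 Hx; have Ly := inH_L2 Hy.
have Lhx := in_L2_Linf mOm (h_Linf hG) Lx.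
have [kx _ _ _] := HK x Hx; have [ky _ _ _] := HK y Hy.
rewrite nr0.unlock in kx; rewrite nr0.unlock in ky.
have e1' : hint x.1 y.1 ^+ 2 <= N2 (h \* x.1) * N2 y.1.
  by rewrite hint.unlock; exact: (L2_CS mOm Lhx Ly).
have e2' : N2 (h \* x.1) <= M ^+ 2 * N2 x.1.
  rewrite /sqn -(RintegralZl _ mOm (in_L2_sq Lx)); apply: (ae_le_Rintegral mOm).
  - exact: in_L2_sq Lhx.
  - exact: (integrableZl mOm _ (in_L2_sq Lx)).
  - apply: filterS HM => z H Oz; rewrite /= exprMn ler_wpM2r ?sqr_ge0//.
    by rewrite -(real_normK (num_real (h z))) lerXn2r ?nnegrE// ?(le_trans _ (H Oz)) ?H.
apply: (le_trans e1').
have nx := sqn_ge0 area Om x.1; have ny := sqn_ge0 area Om y.1.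
have e3 := ler_wpM2l (sqr_ge0 M) kx.
have e4 := le_trans e2' e3.
have e5 := ler_pM (sqn_ge0 area Om (h \* x.1)) ny e4 ky.
apply: (le_trans e5).
by move: (lip x x) (lip y y) => p q; rewrite le_eqVlt; apply/orP; left; apply/eqP; ring.
Qed.

Lemma mean_hE : mean_h G = hint (cst 1) (cst 1).
Proof.
by rewrite hint.unlock /mean_h /wint; apply: eq_area => z _; rewrite /= !mulr1.
Qed.

Lemma hint_ae f f' g : L2 f -> L2 f' -> L2 g -> f = f' %[ae area in Om] ->
  hint f g = hint f' g.
Proof.
move=> Lf Lf' Lg ff; rewrite hint.unlock; apply: (wint_ae mOm) => //.
- by case: (h_Linf hG).
- exact: in_L2_meas Lf.
- exact: in_L2_meas Lf'.
- exact: in_L2_meas Lg.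
Qed.

Lemma hint_lin (k : R) f f' g : L2 f -> L2 f' -> L2 g ->
  hint (k *: f + f') g = k * hint f g + hint f' g.
Proof. by move=> Lf Lf' Lg; rewrite hint.unlock; exact: (wint_lin mOm k (h_Linf hG) Lf Lf' Lg). Qed.

(** The second component of A k is [k.1]; its vanishing in H makes [k.1] a constant, equal to 0 if
    the constants are controlled. Pairing A k = 0 with Phi then leaves kappa times the integral of
    h. *)
Lemma ker_first (k : HH) : kerA G tr k -> exists kappa : R,
  [/\ k.1 = cst kappa %[ae area in Om], controlled G -> kappa = 0 &
      ~ controlled G -> kappa * mean_h G = 0].
Proof.
move=> [dk [z1 [zc zn]]].
have [ct|nc] := pselect (controlled G); first by exists 0; split => //; exact: zc.
have [kappa Hk] := zn nc.
have kk : k.1 = cst kappa %[ae area in Om].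
  by apply: filterS Hk => z H Oz; have := H Oz; rewrite /= add0r.
exists kappa; split => // _.
have HA := opA_inH dk.
have A0 : lip (opA k) (opA k) = 0 by apply: Heq0_lip => //; split.
have := lip_null (inH_cst 1) HA A0; rewrite (ipC hG (inH_cst 1) HA) (lip_opA_cst1 nc dk).
have L1 := dom_cst_L2 hOm 1; have Lk := dom_cst_L2 hOm kappa.
rewrite (hint_ae (inH_L2 (domA_inH dk)) Lk L1 kk) mean_hE => E.
have -> : kappa * hint (cst 1) (cst 1) = hint (cst kappa) (cst 1); last exact: E.
have -> : cst kappa = kappa *: cst 1 + 0 :> fn.
  by apply/funext => z; rewrite addr0 -[RHS]/(kappa * 1) mulr1.
rewrite (hint_lin kappa L1 (in_L20 _ mOm) L1).
have -> : hint 0 (cst 1) = 0; last by rewrite addr0.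
rewrite hint.unlock /wint (@eq_area _ _ _ (cst 0)); last by move=> z _; rewrite /= mulr0 mul0r.
by rewrite Rintegral_cst ?mul0r//; exact: mOm.
Qed.

Lemma lip_fst_cst f (k : HH) (kappa : R) : L2 f -> inH k ->
  k.1 = cst kappa %[ae area in Om] -> lip (f, 0) k = kappa * lip (f, 0) (cst 1, 0).
Proof.
move=> Lf Hk kk; have L1 := dom_cst_L2 hOm 1; have Hf := inH_fst Lf.
rewrite (lip_fst Lf Hk) (lip_fst Lf (inH_cst 1)) ipcC [in RHS]ipcC ipc.unlock.
change (wint area Om c k.1 f = kappa * wint area Om c (cst 1) f).
have Lk := dom_cst_L2 hOm kappa.
rewrite (wint_ae mOm _ _ _ _ kk).
- have -> : cst kappa = kappa *: cst 1 + 0 :> fn.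
    by apply/funext => z; rewrite addr0 -[RHS]/(kappa * 1) mulr1.
  rewrite (wint_lin mOm kappa (c_Linf hG) L1 (in_L20 _ mOm) Lf).
  have -> : wint area Om c 0 f = 0; last by rewrite addr0.
  rewrite /wint (@eq_area _ _ _ (cst 0)); last by move=> z _; rewrite /= mulr0 mul0r.
  by rewrite Rintegral_cst ?mul0r//; exact: mOm.
- by case: (c_Linf hG).
- exact: in_L2_meas (inH_L2 Hk).
- exact: in_L2_meas Lk.
- exact: in_L2_meas Lf.
Qed.

End graetz_operator.

(** * Sums of eigenvectors in a pre-Hilbert space *)

Lemma squeeze0 (R : realType) (a b : nat -> R) : (forall n, 0 <= a n <= b n) ->
  b @ \oo --> 0 -> a @ \oo --> 0.
Proof.
move=> H B; apply/cvgrPdist_le => e e0.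
move/cvgrPdist_le: B => /(_ e e0)[N _ NH]; exists N => // n /NH /=.
have /andP[a0 ab] := H n; rewrite !sub0r !normrN !ger0_norm//; last exact: le_trans ab.
exact: le_trans.
Qed.

Lemma geometric_cvg (R : realType) (v : nat -> R) (C : R) :
  (forall n, `|v n - v n.+1| <= C * 2^-1 ^+ n) -> exists l : R, v n @[n --> \oo] --> l.
Proof.
move=> H; pose w n := v n.+1 - v n.
have cw : cvgn (series w).
  apply: normed_cvg; apply: (@series_le_cvg _ _ (geometric C 2^-1)) => // [n|n|n|].
  - exact: normr_ge0.
  - by apply: le_trans (H n).
  - by rewrite /= distrC; exact: H.
  - by apply: is_cvg_geometric_series; rewrite ger0_norm ?invf_lt1 ?ltr1n.
exists (v 0%N + limn (series w)).
apply: cvg_trans (cvgD (cvg_cst (v 0%N)) cw); apply: near_eq_cvg; apply: nearW => n /=.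
by rewrite -[LHS]/(v 0%N + series w n) seriesEnat/= telescope_sumr// addrC subrK.
Qed.

Lemma cvg_sum_ord (R : realType) k (f : nat -> 'I_k -> R) (l : 'I_k -> R) :
  (forall j, f n j @[n --> \oo] --> l j) ->
  \sum_j f n j @[n --> \oo] --> \sum_j l j.
Proof.
elim: k f l => [|k IH] f l H.
  by under eq_fun do rewrite big_ord0; rewrite big_ord0; exact: cvg_cst.
under eq_fun do rewrite big_ord_recl; rewrite big_ord_recl.
by apply: cvgD => //; apply: (IH (fun n j => f n (lift ord0 j))).
Qed.

(* The coefficients of the difference of the partial sums of orders m and n. *)
Definition window (R : realType) (m n : nat) (a : nat -> R) (i : nat) : R :=
  ((i < m)%:R - (i < n)%:R) * a i.

(** The coefficients of a window are 0 or, up to sign, those of [a], and they vanish below [N], so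
    their squares are dominated by a tail of a convergent series. *)
Lemma window_small (R : realType) (a : nat -> R) (e : R) : 0 < e ->
  (exists M, forall N, \sum_(n < N) a n ^+ 2 <= M) -> exists N, forall m n,
    (N <= m)%N -> (N <= n)%N -> \sum_(i < maxn m n) window m n a i ^+ 2 <= e.
Proof.
move=> e0 [M HM]; pose S n := \sum_(i < n) a i ^+ 2.
have nd : nondecreasing_seq S.
  by apply/nondecreasing_seqP => n; rewrite /S big_ord_recr/= lerDl sqr_ge0.
have cS : cvgn S.
  by apply: nondecreasing_is_cvgn => //; exists M => _ [n _ <-]; exact: HM.
have [N _ HN] := (cvgrPdist_le _ _).1 cS e e0; exists N => m n Nm Nn.
set K := maxn m n; have NK : (N <= K)%N by rewrite leq_max Nm.
apply: (@le_trans _ _ (S K - S N)); last first.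
  have SK := nondecreasing_cvgn_le nd cS K; have := HN N (leqnn N).
  by move=> /= /(le_trans (ler_norm _)); lra.
have -> : S K - S N = \sum_(N <= i < K) a i ^+ 2.
  by rewrite /S -!(big_mkord xpredT (fun i => a i ^+ 2)) (@big_cat_nat _ _ _ N 0 K)//= addrAC subrr add0r.
rewrite -(big_mkord xpredT (fun i => window m n a i ^+ 2)) (@big_cat_nat _ _ _ N)//=.
rewrite [X in X + _]big_nat_cond [X in X + _]big1 ?add0r; last first.
  move=> i /andP[/andP[_ iN] _]; rewrite /window (leq_trans iN Nm) (leq_trans iN Nn).
  by rewrite subrr mul0r expr0n.
apply: ler_sum => i _; rewrite /window exprMn ler_piMl ?sqr_ge0//.
by case: (i < m)%N; case: (i < n)%N; rewrite ?subrr ?subr0 ?sub0r ?sqrrN ?expr1n ?expr0n/= ?ler01.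
Qed.

(** * Contraction principle for a pseudo-distance *)

Section contraction.
Context (R : realType) (T : Type) (D : T -> Prop) (dist : T -> T -> R).
Hypothesis dist_ge0 : forall x y, D x -> D y -> 0 <= dist x y.
Hypothesis distC : forall x y, D x -> D y -> dist x y = dist y x.
Hypothesis dist_tri : forall x y z, D x -> D y -> D z -> dist x z <= dist x y + dist y z.
Hypothesis complete : forall u : nat -> T, (forall n, D (u n)) ->
  (exists C : R, forall n, dist (u n) (u n.+1) <= C * 2^-1 ^+ n) ->
  exists2 x, D x & dist (u n) x @[n --> \oo] --> 0.
Variable F : T -> T.
Hypothesis DF : forall x, D x -> D (F x).
Hypothesis Fcontr : forall x y, D x -> D y -> dist (F x) (F y) <= 2^-1 * dist x y.

(** The iterates have increments of order 2^-n, the kind of sequence for which completeness is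
    assumed. Distinct points may be at distance 0, so the fixed point is one up to zero distance. *)
Lemma contraction_fixpoint x0 : D x0 -> exists2 x, D x & dist (F x) x = 0.
Proof.
move=> Dx0; pose u n := iter n F x0.
have Du n : D (u n) by elim: n => //= n IH; exact: DF.
have [|x Dx C] := complete Du.
  exists (dist x0 (F x0)); elim=> [|n IH]; first by rewrite expr0 mulr1.
  apply: le_trans (Fcontr (Du n) (Du n.+1)) _.
  by rewrite exprS mulrCA ler_wpM2l ?invr_ge0.
exists x => //; have DFx := DF Dx.
have C' : 2^-1 * dist (u n) x + dist (u n.+1) x @[n --> \oo] --> (0 : R).
  rewrite -(addr0 0); apply: cvgD.
    by rewrite -(mulr0 2^-1); apply: cvgM => //; exact: cvg_cst.
  by rewrite (cvg_shiftS (fun n => dist (u n) x)).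
apply: (@cvg_unique _ _ (dist (F x) x @[n --> \oo])); [exact: norm_hausdorff|exact: cvg_cst|].
apply: squeeze0 C' => n; rewrite dist_ge0//=.
apply: le_trans (dist_tri DFx (Du n.+1) Dx) _; rewrite lerD2r distC//.
by apply: Fcontr.
Qed.

End contraction.

(** * Vector spaces with a domain predicate and a semidefinite form *)

Section prehilbert.
Context (R : realType) (E : lmodType R) (D : E -> Prop) (ip : E -> E -> R).
Hypothesis D0 : D 0.
Hypothesis Dlin : forall k x y, D x -> D y -> D (k *: x + y).
Hypothesis ipC : forall x y, D x -> D y -> ip x y = ip y x.
Hypothesis ip_lin : forall k x x' y, D x -> D x' -> D y ->
  ip (k *: x + x') y = k * ip x y + ip x' y.
Hypothesis ip_ge0 : forall x, D x -> 0 <= ip x x.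

Lemma dom_add x y : D x -> D y -> D (x + y).
Proof. by move=> Dx Dy; rewrite -[x]scale1r; exact: Dlin. Qed.

Lemma dom_scale k x : D x -> D (k *: x).
Proof. by move=> Dx; rewrite -[k *: x]addr0; exact: Dlin. Qed.

Lemma dom_opp x : D x -> D (- x).
Proof. by move=> Dx; rewrite -scaleN1r; exact: dom_scale. Qed.

Lemma dom_sub x y : D x -> D y -> D (x - y).
Proof. by move=> Dx Dy; apply: dom_add => //; exact: dom_opp. Qed.

Lemma dom_sum n (F : nat -> E) : (forall i, D (F i)) -> D (\sum_(i < n) F i).
Proof.
move=> H; elim: n => [|n IH]; first by rewrite big_ord0.
by rewrite big_ord_recr; exact: dom_add.
Qed.

Lemma ip0l y : D y -> ip 0 y = 0.
Proof.
move=> Dy; have := ip_lin (-1) D0 D0 Dy.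
by rewrite scaler0 add0r mulN1r addNr.
Qed.

Lemma ipDl x x' y : D x -> D x' -> D y -> ip (x + x') y = ip x y + ip x' y.
Proof. by move=> *; rewrite -[x]scale1r ip_lin// mul1r scale1r. Qed.

Lemma ipZl k x y : D x -> D y -> ip (k *: x) y = k * ip x y.
Proof. by move=> *; rewrite -[k *: x]addr0 ip_lin// ip0l// addr0. Qed.

Lemma ipNl x y : D x -> D y -> ip (- x) y = - ip x y.
Proof. by move=> *; rewrite -scaleN1r ipZl// mulN1r. Qed.

Lemma ipBl x x' y : D x -> D x' -> D y -> ip (x - x') y = ip x y - ip x' y.
Proof. by move=> Dx Dx' Dy; rewrite ipDl ?ipNl//; exact: dom_opp. Qed.

Lemma ipDr x y y' : D x -> D y -> D y' -> ip x (y + y') = ip x y + ip x y'.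
Proof. by move=> Dx Dy Dy'; rewrite ipC ?ipDl ?(ipC Dx)//; exact: dom_add. Qed.

Lemma ipZr k x y : D x -> D y -> ip x (k *: y) = k * ip x y.
Proof. by move=> Dx Dy; rewrite ipC ?ipZl ?(ipC Dx)//; exact: dom_scale. Qed.

Lemma ipBr x y y' : D x -> D y -> D y' -> ip x (y - y') = ip x y - ip x y'.
Proof. by move=> Dx Dy Dy'; rewrite ipC ?ipBl ?(ipC Dx)//; exact: dom_sub. Qed.

Lemma ip_suml n (F : nat -> E) y : (forall i, D (F i)) -> D y ->
  ip (\sum_(i < n) F i) y = \sum_(i < n) ip (F i) y.
Proof.
move=> H Dy; elim: n => [|n IH]; first by rewrite !big_ord0 ip0l.
by rewrite !big_ord_recr/= ipDl ?IH//; exact: dom_sum.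
Qed.

Definition nrm x : R := Num.sqrt (ip x x).

Lemma nrm_ge0 x : 0 <= nrm x. Proof. exact: sqrtr_ge0. Qed.

Lemma nrm_sq x : D x -> nrm x ^+ 2 = ip x x.
Proof. by move=> Dx; rewrite sqr_sqrtr// ip_ge0. Qed.

Lemma ip_CS2 x y : D x -> D y -> ip x y ^+ 2 <= ip x x * ip y y.
Proof.
move=> Dx Dy.
have H (t : R) : 0 <= ip x x + t * ip x y *+ 2 + t ^+ 2 * ip y y.
  have := ip_ge0 (Dlin t Dy Dx); rewrite ip_lin//; last exact: Dlin.
  rewrite ipDr ?ipZr//; try exact: dom_scale.
  rewrite ipDr ?ipZr//; try exact: dom_scale.
  rewrite (ipC Dy Dx); move: (ip x x) (ip x y) (ip y y) => p q r.
  by have -> // : t * (t * r + q) + (t * q + p) = p + t * q *+ 2 + t ^+ 2 * r by ring.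
have [y0|yN0] := eqVneq (ip y y) 0.
  have [->|xyN0] := eqVneq (ip x y) 0; first by rewrite expr0n mulr_ge0 ?ip_ge0.
  have := H (- (ip x x + 1) / (2 * ip x y)); rewrite y0 mulr0 addr0.
  have -> : ip x x + - (ip x x + 1) / (2 * ip x y) * ip x y *+ 2 = -1 by field.
  by rewrite oppr_ge0 ler10.
have yp : 0 < ip y y by rewrite lt_def yN0 ip_ge0.
have := H (- ip x y / ip y y).
have -> : ip x x + - ip x y / ip y y * ip x y *+ 2 + (- ip x y / ip y y) ^+ 2 * ip y y =
  (ip x x * ip y y - ip x y ^+ 2) / ip y y by field.
by rewrite pmulr_lge0 ?invr_gt0// subr_ge0.
Qed.

Lemma ip_CS x y : D x -> D y -> `|ip x y| <= nrm x * nrm y.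
Proof.
move=> Dx Dy; rewrite -(@ler_pXn2r _ 2) ?nnegrE ?mulr_ge0 ?nrm_ge0//.
by rewrite real_normK ?num_real// exprMn !nrm_sq// ip_CS2.
Qed.

Lemma nrmD x y : D x -> D y -> nrm (x + y) <= nrm x + nrm y.
Proof.
move=> Dx Dy; have Dxy := dom_add Dx Dy.
rewrite -(@ler_pXn2r _ 2) ?nnegrE ?addr_ge0 ?nrm_ge0//.
rewrite nrm_sq// sqrrD !nrm_sq// ipDl// !ipDr// (ipC Dy Dx).
have := le_trans (ler_norm _) (ip_CS Dx Dy).
by move: (ip x x) (ip x y) (ip y y) (nrm x * nrm y) => p q r s H; lra.
Qed.

Lemma nrmZ k x : D x -> nrm (k *: x) = `|k| * nrm x.
Proof.
move=> Dx; rewrite /nrm ipZl ?ipZr//; last exact: dom_scale.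
by rewrite mulrA -expr2 sqrtrM ?sqr_ge0// sqrtr_sqr.
Qed.

Lemma nrmN x : D x -> nrm (- x) = nrm x.
Proof. by move=> Dx; rewrite -scaleN1r nrmZ// normrN1 mul1r. Qed.

Lemma nrmB x y : D x -> D y -> nrm (x - y) = nrm (y - x).
Proof. by move=> Dx Dy; rewrite -opprB nrmN//; exact: dom_sub. Qed.

Lemma nrm_triangle z x y : D x -> D y -> D z -> nrm (x - y) <= nrm (x - z) + nrm (z - y).
Proof.
move=> Dx Dy Dz; have -> : x - y = (x - z) + (z - y) by rewrite addrA subrK.
by apply: nrmD; exact: dom_sub.
Qed.

Lemma nrm_eq0 x : D x -> nrm x = 0 <-> ip x x = 0.
Proof.
move=> Dx; split=> [H|H]; first by rewrite -nrm_sq// H expr0n.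
by rewrite /nrm H sqrtr0.
Qed.

Lemma ip_null x y : D x -> D y -> ip x x = 0 -> ip x y = 0.
Proof.
move=> Dx Dy x0; have := ip_CS2 Dx Dy; rewrite x0 mul0r => H.
by apply/eqP; rewrite -sqrf_eq0 eq_le H sqr_ge0.
Qed.

Definition tendsto (u : nat -> E) x := nrm (u n - x) @[n --> \oo] --> 0.

Lemma tendsto_ip u x y : (forall n, D (u n)) -> D x -> D y -> tendsto u x ->
  ip (u n) y @[n --> \oo] --> ip x y.
Proof.
move=> Du Dx Dy C; apply/cvgrPdist_le => e e0.
have c1 : 0 < nrm y + 1 by rewrite ltr_wpDl ?nrm_ge0.
move/cvgrPdist_le: C => /(_ (e / (nrm y + 1)) (divr_gt0 e0 c1))[N _ NH].
exists N => // n /NH /=; rewrite sub0r normrN ger0_norm ?nrm_ge0// => H.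
rewrite distrC -ipBl//; apply: le_trans (ip_CS (dom_sub (Du n) Dx) Dy) _.
apply: (@le_trans _ _ (nrm (u n - x) * (nrm y + 1))).
  by rewrite ler_wpM2l ?nrm_ge0// lerDl.
by rewrite -ler_pdivlMr.
Qed.

Lemma tendsto_nrm u x : (forall n, D (u n)) -> D x -> tendsto u x ->
  nrm (u n) @[n --> \oo] --> nrm x.
Proof.
move=> Du Dx C; apply/cvgrPdist_le => e e0.
move/cvgrPdist_le: C => /(_ e e0)[N _ NH]; exists N => // n /NH /=.
rewrite sub0r normrN ger0_norm ?nrm_ge0// => H; apply: le_trans H.
have h1 : nrm (u n) <= nrm (u n - x) + nrm x.
  by rewrite -{1}[u n](subrK x); apply: nrmD => //; exact: dom_sub.
have h2 : nrm x <= nrm (u n - x) + nrm (u n).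
  by rewrite nrmB// -{1}[x](subrK (u n)); apply: nrmD => //; exact: dom_sub.
by rewrite ler_norml; lra.
Qed.

Lemma tendsto_ip2 u v x y : (forall n, D (u n)) -> (forall n, D (v n)) -> D x -> D y ->
  tendsto u x -> tendsto v y -> ip (u n) (v n) @[n --> \oo] --> ip x y.
Proof.
move=> Du Dv Dx Dy cu cv.
have -> : (fun n => ip (u n) (v n)) = (fun n => ip (u n) y + ip (u n) (v n - y)).
  by apply/funext => n; rewrite ipBr// addrC subrK.
rewrite -[X in _ --> X]addr0; apply: cvgD; first exact: tendsto_ip.
apply/cvgr0Pnorm_le => e e0.
have C : nrm (u n) * nrm (v n - y) @[n --> \oo] --> (0 : R).
  by rewrite -(mulr0 (nrm x)); apply: cvgM; [exact: tendsto_nrm|exact: cv].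
move/cvgrPdist_le: C => /(_ e e0)[N _ NH]; exists N => // n /NH /=.
rewrite sub0r normrN ger0_norm ?mulr_ge0 ?nrm_ge0//; apply: le_trans.
by apply: ip_CS => //; exact: dom_sub.
Qed.

Lemma tendsto_unique u x y : (forall n, D (u n)) -> D x -> D y ->
  tendsto u x -> tendsto u y -> ip (x - y) (x - y) = 0.
Proof.
move=> Du Dx Dy cx cy; apply/nrm_eq0; first exact: dom_sub.
have C : nrm (u n - x) + nrm (u n - y) @[n --> \oo] --> (0 : R).
  by rewrite -(addr0 0); exact: cvgD.
apply: (@cvg_unique _ _ (nrm (x - y) @[n --> \oo])); [exact: norm_hausdorff|exact: cvg_cst|].
apply: squeeze0 C => n; rewrite nrm_ge0/=.
rewrite (nrmB (Du n) Dx); exact: nrm_triangle.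
Qed.

Lemma tendstoD u v x y : (forall n, D (u n)) -> (forall n, D (v n)) -> D x -> D y ->
  tendsto u x -> tendsto v y -> tendsto (fun n => u n + v n) (x + y).
Proof.
move=> Du Dv Dx Dy cu cv.
have C : nrm (u n - x) + nrm (v n - y) @[n --> \oo] --> (0 : R).
  by rewrite -(addr0 0); exact: cvgD.
apply: squeeze0 C => n; rewrite nrm_ge0/= opprD addrACA.
by apply: nrmD; exact: dom_sub.
Qed.

Lemma tendsto_nrm_le u x (K : R) : (forall n, D (u n)) -> D x -> tendsto u x ->
  (forall n, nrm (u n) <= K) -> nrm x <= K.
Proof.
move=> Du Dx C H; have C2 := tendsto_nrm Du Dx C.
rewrite -(cvg_lim _ C2)//; apply: limr_le; first by apply/cvg_ex; eexists; exact: C2.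
exact: nearW.
Qed.

Lemma geometric_cauchy u (C : R) : (forall n, D (u n)) ->
  (forall n, nrm (u n - u n.+1) <= C * 2^-1 ^+ n) ->
  forall e, 0 < e -> exists N, forall m n, (N <= m)%N -> (N <= n)%N -> nrm (u m - u n) <= e.
Proof.
move=> Du H e e0.
have C0 : 0 <= C by have := le_trans (nrm_ge0 _) (H 0%N); rewrite expr0 mulr1.
(* The geometric sum in closed form: keeping the difference of the two powers, rather than its
   bound, makes the induction close. *)
have step N k : nrm (u N - u (N + k)%N) <= 2 * C * (2^-1 ^+ N - 2^-1 ^+ (N + k)).
  elim: k => [|k IH]; first by rewrite addn0 !subrr mulr0 /nrm ip0l// sqrtr0.
  apply: le_trans (nrm_triangle (Du N) (Du (N + k.+1)%N) (Du (N + k)%N)) _.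
  rewrite addnS; have := H (N + k)%N; rewrite exprS.
  by move: (_ ^+ N) (_ ^+ (N + k)) IH => p q; nra.
have small : geometric (4 * C) 2^-1 @ \oo --> (0 : R).
  by apply: cvg_geometric; rewrite ger0_norm ?invf_lt1 ?ltr1n.
have [N _ HN] := (cvgrPdist_le _ _).1 small e e0; exists N => m n Nm Nn.
have half k : (N <= k)%N -> nrm (u N - u k) <= 2 * C * 2^-1 ^+ N.
  move=> /subnKC <-; apply: le_trans (step _ _) _; apply: ler_wpM2l.
    by rewrite mulr_ge0.
  by rewrite gerBl exprn_ge0// invr_ge0.
have := HN N (leqnn N); rewrite /= sub0r normrN => /(le_trans (ler_norm _)) h.
apply: le_trans (nrm_triangle (Du m) (Du n) (Du N)) _; rewrite (nrmB (Du m) (Du N)).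
by have := half m Nm; have := half n Nn; lra.
Qed.

(** * Orthonormal families of two signs and their closed spans *)

Section orthonormal.
Variable ph : bool -> nat -> E.
Hypothesis Dph : forall b n, D (ph b n).
Hypothesis ph_orth : forall b b' n m, ip (ph b n) (ph b' m) = ((b == b') && (n == m))%:R.
Hypothesis series_complete : forall b (a : nat -> R),
  (exists M, forall N, \sum_(n < N) a n ^+ 2 <= M) ->
  exists2 x, D x & tendsto (fun N => \sum_(n < N) a n *: ph b n) x.

Definition psum b (a : nat -> R) N := \sum_(n < N) a n *: ph b n.

Definition coef b x n := ip x (ph b n).

Lemma D_psum b a N : D (psum b a N).
Proof. by apply: (@dom_sum _ (fun n => a n *: ph b n)) => i; exact: dom_scale. Qed.

Lemma ip_psum b a N x : D x -> ip (psum b a N) x = \sum_(n < N) a n * coef b x n.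
Proof.
move=> Dx; rewrite (ip_suml _ (F := fun n => a n *: ph b n))//; last first.
  by move=> i; exact: dom_scale.
by apply: eq_bigr => i _; rewrite ipZl// /coef (ipC Dx).
Qed.

Lemma coef_psum b b' a N m :
  coef b' (psum b a N) m = if (b == b') && (m < N)%N then a m else 0.
Proof.
rewrite /coef ip_psum//.
under eq_bigr do rewrite /coef ph_orth.
have [bb|bb] := eqVneq b b'; last first.
  by rewrite big1// => i _; rewrite /= mulr0.
subst b'; rewrite /=; case: ltnP => mN.
  rewrite (bigD1 (Ordinal mN))//= eqxx mulr1 big1 ?addr0// => i im.
  case: eqP => [e|_]; last by rewrite mulr0.
  by case/eqP: im; apply: val_inj; rewrite /= e.
rewrite big1// => i _; case: eqP => [e|_]; last by rewrite mulr0.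
by have := ltn_ord i; rewrite ltnNge -?e mN.
Qed.

Lemma sq_psum b a N : ip (psum b a N) (psum b a N) = \sum_(n < N) a n ^+ 2.
Proof.
rewrite ip_psum; last exact: D_psum.
by apply: eq_bigr => i _; rewrite coef_psum eqxx ltn_ord.
Qed.

(** Completing the square: among the combinations of the first [N] vectors, the one with the
    coefficients of [x] is the closest. Bessel's inequality and the convergence of Fourier sums both
    come from here. *)
Lemma sq_sub_psum b k N x : D x -> ip (x - psum b k N) (x - psum b k N) =
  ip x x - \sum_(n < N) coef b x n ^+ 2 + \sum_(n < N) (k n - coef b x n) ^+ 2.
Proof.
move=> Dx; have DS := D_psum b k N.
rewrite ipBl//; last exact: dom_sub.
rewrite !ipBr// (ipC Dx DS) sq_psum ip_psum//.
have -> : \sum_(n < N) (k n - coef b x n) ^+ 2 = \sum_(n < N) k n ^+ 2 -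
    \sum_(n < N) k n * coef b x n *+ 2 + \sum_(n < N) coef b x n ^+ 2.
  rewrite -sumrB -big_split/=; apply: eq_bigr => i _.
  by rewrite sqrrB.
rewrite sumrMnl; move: (\sum_(n < N) k n ^+ 2) (\sum_(n < N) coef b x n ^+ 2).
by move: (\sum_(i < N) k i * coef b x i) (ip x x) => p q r s; ring.
Qed.

Lemma bessel b x N : D x -> \sum_(n < N) coef b x n ^+ 2 <= ip x x.
Proof.
move=> Dx; have := ip_ge0 (dom_sub Dx (D_psum b (coef b x) N)).
rewrite sq_sub_psum// [X in _ + X]big1 ?addr0 ?subr_ge0// => i _.
by rewrite subrr expr0n.
Qed.

Lemma psum_diff b a m n :
  psum b a m - psum b a n = psum b (window m n a) (maxn m n).
Proof.
have ext k : (k <= maxn m n)%N ->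
    psum b a k = \sum_(i < maxn m n) ((i < k)%:R * a i) *: ph b i.
  move=> kK; rewrite /psum -(big_mkord xpredT (fun i => a i *: ph b i)).
  rewrite -(big_mkord xpredT (fun i => ((i < k)%:R * a i) *: ph b i)).
  rewrite [RHS](@big_cat_nat _ _ _ k)//= [X in _ + X]big_nat_cond [X in _ + X]big1 ?addr0.
    by apply: eq_big_nat => i /andP[_ ->]; rewrite mul1r.
  by move=> i /andP[/andP[ki _] _]; rewrite ltnNge ki mul0r scale0r.
rewrite (ext m) ?leq_maxl// (ext n) ?leq_maxr// -sumrB; apply: eq_bigr => i _.
by rewrite -scalerBl -mulrBl.
Qed.

Definition spanned b x := D x /\ forall e : R, 0 < e -> exists N k, nrm (x - psum b k N) < e.

Lemma spanned_D b x : spanned b x -> D x. Proof. by case. Qed.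

Lemma spanned_tendsto b x : spanned b x -> tendsto (psum b (coef b x)) x.
Proof.
move=> [Dx H]; apply/cvgrPdist_le => e e0; have [N [k Hk]] := H e e0.
exists N => // M /= NM; rewrite sub0r normrN ger0_norm ?nrm_ge0//.
apply: le_trans (ltW Hk); rewrite nrmB//; last exact: D_psum.
(* Padding with zeros lets an approximation of length [N] be compared with the partial sum of any
   larger order [M]. *)
pose k' n := if (n < N)%N then k n else 0.
have -> : psum b k N = psum b k' M.
  rewrite /psum -!(big_mkord xpredT (fun n => _ n *: ph b n)) [RHS](@big_cat_nat _ _ _ N)//=.
  rewrite [X in _ + X]big_nat_cond [X in _ + X]big1 ?addr0; last first.
    by move=> i /andP[/andP[Ni _] _]; rewrite /k' ltnNge Ni scale0r.
  by apply: eq_big_nat => i /andP[_ iN]; rewrite /k' iN.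
rewrite /nrm ler_sqrt; last by apply: ip_ge0; apply: dom_sub => //; exact: D_psum.
rewrite !sq_sub_psum// lerD2l big1 ?sumr_ge0// => i _; first by rewrite sqr_ge0.
by rewrite subrr expr0n.
Qed.

Lemma tendsto_spanned b a x : D x -> tendsto (psum b a) x -> spanned b x.
Proof.
move=> Dx C; split=> // e e0.
move/cvgrPdist_lt: C => /(_ e e0)[N _ NH]; exists N, a.
have := NH N (leqnn N); rewrite /= sub0r normrN ger0_norm ?nrm_ge0//.
by rewrite nrmB//; exact: D_psum.
Qed.

Lemma tendsto_coef b a x : D x -> tendsto (psum b a) x ->
  (forall n, coef b x n = a n) /\ (forall n, coef (~~ b) x n = 0).
Proof.
move=> Dx C; split=> n.
- have C1 := tendsto_ip (D_psum b a) Dx (Dph b n) C.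
  apply: (@cvg_unique _ _ _ _ _ _ C1); first exact: norm_hausdorff.
  apply: cvg_near_cst; exists n.+1 => // m /= nm.
  by have := coef_psum b b a m n; rewrite /coef eqxx nm.
- have C1 := tendsto_ip (D_psum b a) Dx (Dph (~~ b) n) C.
  apply: (@cvg_unique _ _ _ _ _ _ C1); first exact: norm_hausdorff.
  apply: cvg_near_cst; apply: nearW => m.
  by have := coef_psum b (~~ b) a m n; rewrite /coef; case: (b).
Qed.

Lemma coef_other b x n : spanned b x -> coef (~~ b) x n = 0.
Proof. by move=> Hx; have [_ ->] := tendsto_coef (spanned_D Hx) (spanned_tendsto Hx). Qed.

Lemma spanned_orth b x z : D x -> (forall n, coef b x n = 0) -> spanned b z -> ip x z = 0.
Proof.
move=> Dx H Hz; have Dz := spanned_D Hz; rewrite ipC//.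
have C := tendsto_ip (D_psum b (coef b z)) Dz Dx (spanned_tendsto Hz).
apply: (@cvg_unique _ _ _ _ _ _ C); first exact: norm_hausdorff.
apply: cvg_near_cst; apply: nearW => N; rewrite ip_psum// big1// => i _.
by rewrite H mulr0.
Qed.

Lemma spanned_coef0 b x : spanned b x -> (forall n, coef b x n = 0) -> ip x x = 0.
Proof. by move=> Hx H; apply: (spanned_orth (spanned_D Hx) H). Qed.

Lemma spanned_ph b n : spanned b (ph b n).
Proof.
split=> // e e0; exists n.+1, (fun m => (m == n)%:R).
have -> : psum b (fun m => (m == n)%:R) n.+1 = ph b n.
  rewrite /psum big_ord_recr/= eqxx scale1r big1 ?add0r// => i _.
  by rewrite (ltn_eqF (ltn_ord i)) scale0r.
by rewrite subrr /nrm ip0l// sqrtr0.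
Qed.

Lemma series_spanned b (a : nat -> R) : (exists M, forall N, \sum_(n < N) a n ^+ 2 <= M) ->
  exists x, [/\ spanned b x, tendsto (psum b a) x & forall n, coef b x n = a n].
Proof.
move=> H; have [x Dx C] := series_complete b H; exists x; split => //.
  exact: tendsto_spanned C.
by have [] := tendsto_coef Dx C.
Qed.

Lemma spanned_lin b k x y : spanned b x -> spanned b y -> spanned b (k *: x + y).
Proof.
move=> Hx Hy; have Dx := spanned_D Hx; have Dy := spanned_D Hy.
apply: (@tendsto_spanned _ (fun n => k * coef b x n + coef b y n)); first exact: Dlin.
have C : `|k| * nrm (psum b (coef b x) n - x) + nrm (psum b (coef b y) n - y)
    @[n --> \oo] --> (0 : R).
  rewrite -(addr0 0); apply: cvgD; last exact: spanned_tendsto.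
  rewrite -(mulr0 `|k|); apply: cvgM; first exact: cvg_cst.
  exact: spanned_tendsto.
apply: squeeze0 C => n; rewrite nrm_ge0/=.
have -> : psum b (fun n => k * coef b x n + coef b y n) n - (k *: x + y) =
    k *: (psum b (coef b x) n - x) + (psum b (coef b y) n - y).
  rewrite scalerBr opprD addrACA; congr (_ + _).
  rewrite /psum scaler_sumr -big_split/=; apply: eq_bigr => i _.
  by rewrite scalerDl scalerA.
have DSx := dom_sub (D_psum b (coef b x) n) Dx; have DSy := dom_sub (D_psum b (coef b y) n) Dy.
by rewrite -nrmZ//; apply: nrmD => //; exact: dom_scale.
Qed.

Lemma spanned_nrm_le b x y (eta : R) : 0 <= eta -> spanned b x -> D y ->
  (forall n, `|coef b x n| <= eta * `|coef b y n|) -> nrm x <= eta * nrm y.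
Proof.
move=> eta0 Hx Dy H; have Dx := spanned_D Hx.
apply: (tendsto_nrm_le (D_psum b (coef b x)) Dx (spanned_tendsto Hx)) => N.
rewrite -(@ler_pXn2r _ 2) ?nnegrE ?mulr_ge0 ?nrm_ge0//.
rewrite nrm_sq ?sq_psum; last exact: D_psum.
rewrite exprMn nrm_sq//; apply: (@le_trans _ _ (eta ^+ 2 * \sum_(n < N) coef b y n ^+ 2)).
  rewrite mulr_sumr; apply: ler_sum => i _.
  rewrite -(real_normK (num_real (coef b x i))) -(real_normK (num_real (coef b y i))).
  rewrite -exprMn lerXn2r ?nnegrE ?mulr_ge0//; exact: H.
by rewrite ler_wpM2l ?sqr_ge0//; exact: bessel.
Qed.

(** Bounded diagonal operators on a closed span. The multipliers 1, 1 / lam, 1 / (1 + s eps lam) and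
    [decay] give the projection, the inverse of A, a resolvent and the exponential. *)
Lemma multiplier b (m : nat -> R) (eta : R) x : D x -> (forall n, `|m n| <= eta) ->
  exists y, [/\ spanned b y, tendsto (psum b (fun n => coef b x n * m n)) y,
    forall n, coef b y n = coef b x n * m n & nrm y <= eta * nrm x].
Proof.
move=> Dx H.
have eta0 : 0 <= eta by apply: le_trans (H 0%N).
have [|y [Hy C cy]] := @series_spanned b (fun n => coef b x n * m n).
  exists (eta ^+ 2 * ip x x) => N.
  apply: (@le_trans _ _ (eta ^+ 2 * \sum_(n < N) coef b x n ^+ 2)).
    rewrite mulr_sumr; apply: ler_sum => i _; rewrite exprMn mulrC ler_wpM2r ?sqr_ge0//.
    by rewrite -(real_normK (num_real (m i))) lerXn2r ?nnegrE//; exact: H.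
  by rewrite ler_wpM2l ?sqr_ge0//; exact: bessel.
exists y; split => //; apply: (spanned_nrm_le eta0 Hy Dx) => n.
by rewrite cy normrM mulrC ler_wpM2r.
Qed.

Definition is_proj b x y := spanned b y /\ forall z, spanned b z -> ip (x - y) z = 0.

Lemma is_proj_exists b x : D x -> exists y, is_proj b x y.
Proof.
move=> Dx; have [|y [Hy _ cy _]] := @multiplier b (fun=> 1) 1 x Dx.
  by move=> n; rewrite normr1.
exists y; split => // z Hz; have Dy := spanned_D Hy.
apply: (spanned_orth (dom_sub Dx Dy) _ Hz) => n.
by rewrite /coef ipBl// -/(coef b y n) cy mulr1 subrr.
Qed.

Lemma is_proj_coef b x y n : D x -> is_proj b x y -> coef b y n = coef b x n.
Proof.
move=> Dx [Hy H]; have Dy := spanned_D Hy; have := H _ (spanned_ph b n).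
by rewrite ipBl// => /eqP; rewrite subr_eq0 => /eqP.
Qed.

Lemma coef_sub b x y n : D x -> D y -> coef b (x - y) n = coef b x n - coef b y n.
Proof. by move=> Dx Dy; rewrite /coef ipBl. Qed.

Lemma spannedB b x y : spanned b x -> spanned b y -> spanned b (x - y).
Proof. by move=> Hx Hy; rewrite addrC -scaleN1r; exact: spanned_lin. Qed.

Lemma spanned_eq b x y : spanned b x -> spanned b y -> (forall n, coef b x n = coef b y n) ->
  ip (x - y) (x - y) = 0.
Proof.
move=> Hx Hy H; apply: (spanned_coef0 (spannedB Hx Hy)) => n.
by rewrite coef_sub ?H ?subrr; [|exact: spanned_D Hx|exact: spanned_D Hy].
Qed.

Lemma is_proj_nrm b x y : D x -> is_proj b x y -> nrm y <= nrm x.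
Proof.
move=> Dx Hp; rewrite -[nrm x]mul1r; apply: (spanned_nrm_le ler01 Hp.1 Dx) => n.
by rewrite mul1r (is_proj_coef _ Dx Hp).
Qed.

Lemma is_proj_ip b x y z : D x -> is_proj b x y -> spanned b z -> ip y z = ip x z.
Proof.
move=> Dx [Hy H] Hz; have Dy := spanned_D Hy; have Dz := spanned_D Hz.
have := H z Hz; rewrite ipBl//.
by move/eqP; rewrite subr_eq0 => /eqP.
Qed.

Lemma is_proj_id b x y : spanned b x -> is_proj b x y -> ip (y - x) (y - x) = 0.
Proof.
move=> Hx Hp; apply: (spanned_eq Hp.1 Hx) => n.
by rewrite (is_proj_coef _ (spanned_D Hx) Hp).
Qed.

Lemma proj_decomp x y y' : D x -> is_proj false x y -> is_proj true x y' ->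
  tendsto (fun N => \sum_(n < N) (coef true x n *: ph true n + coef false x n *: ph false n)) x ->
  ip (x - (y + y')) (x - (y + y')) = 0.
Proof.
move=> Dx Hy Hy' C; have Dy := spanned_D Hy.1; have Dy' := spanned_D Hy'.1.
have Ds b N : D (psum b (coef b x) N) := D_psum _ _ _.
have Es : (fun N => \sum_(n < N) (coef true x n *: ph true n + coef false x n *: ph false n)) =
    (fun N => psum false (coef false x) N + psum true (coef true x) N).
  by apply/funext => N; rewrite big_split/= addrC.
rewrite Es in C.
have T b z : is_proj b x z -> tendsto (psum b (coef b x)) z.
  move=> Hz; have -> : coef b x = coef b z.
    by apply/funext => n; rewrite (is_proj_coef _ Dx Hz).
  exact: spanned_tendsto Hz.1.
have C2 := tendstoD (Ds false) (Ds true) Dy Dy' (T _ _ Hy) (T _ _ Hy').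
apply: (tendsto_unique _ Dx (dom_add Dy Dy') C C2) => N.
exact: dom_add.
Qed.

(** Equality modulo null vectors, which for the energy space is equality in the quotient. *)
Definition eqv x y := ip (x - y) (x - y) = 0.

Lemma eqv_nrm x y : D x -> D y -> eqv x y <-> nrm (x - y) = 0.
Proof. by move=> Dx Dy; rewrite /eqv (nrm_eq0 (dom_sub Dx Dy)). Qed.

Lemma eqv_refl x : eqv x x. Proof. by rewrite /eqv subrr ip0l. Qed.

Lemma eqv_sym x y : D x -> D y -> eqv x y -> eqv y x.
Proof. by move=> Dx Dy; rewrite !eqv_nrm// nrmB. Qed.

Lemma eqv_trans y x z : D x -> D y -> D z -> eqv x y -> eqv y z -> eqv x z.
Proof.
move=> Dx Dy Dz; rewrite !eqv_nrm// => H1 H2.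
by apply/eqP; rewrite eq_le nrm_ge0 andbT (le_trans (nrm_triangle Dx Dz Dy))// H1 H2 addr0.
Qed.

Lemma eqv_ipl x y z : D x -> D y -> D z -> eqv x y -> ip x z = ip y z.
Proof.
move=> Dx Dy Dz H; apply/eqP; rewrite -subr_eq0 -ipBl//; apply/eqP.
exact: (ip_null (dom_sub Dx Dy) Dz H).
Qed.

Lemma eqv_lin k x x' y y' : D x -> D y -> D x' -> D y' -> eqv x y -> eqv x' y' ->
  eqv (k *: x + x') (k *: y + y').
Proof.
move=> Dx Dy Dx' Dy'; have Da := Dlin k Dx Dx'; have Db := Dlin k Dy Dy'.
rewrite !eqv_nrm// => H1 H2.
have -> : k *: x + x' - (k *: y + y') = k *: (x - y) + (x' - y').
  by rewrite scalerBr opprD addrACA.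
have D1 := dom_sub Dx Dy; have D2 := dom_sub Dx' Dy'.
apply/eqP; rewrite eq_le nrm_ge0 andbT (le_trans (nrmD (dom_scale k D1) D2))//.
by rewrite nrmZ// H1 H2 mulr0 addr0.
Qed.

Lemma eqvD x x' y y' : D x -> D y -> D x' -> D y' -> eqv x y -> eqv x' y' ->
  eqv (x + x') (y + y').
Proof. by move=> *; rewrite -[x]scale1r -[y]scale1r; exact: eqv_lin. Qed.

Lemma subN1 (x y : E) : x - y = (-1 : R) *: y + x. Proof. by rewrite scaleN1r addrC. Qed.

Lemma eqvB x x' y y' : D x -> D y -> D x' -> D y' -> eqv x y -> eqv x' y' ->
  eqv (x - x') (y - y').
Proof. by move=> *; rewrite (subN1 x) (subN1 y); exact: eqv_lin. Qed.

Lemma eqv_nrmE x y : D x -> D y -> eqv x y -> nrm x = nrm y.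
Proof.
move=> Dx Dy H; rewrite /nrm (eqv_ipl Dx Dy Dx H) (ipC Dy Dx).
by rewrite (eqv_ipl Dx Dy Dy H).
Qed.

Lemma pos_series0 (t : nat -> R) (l : R) : (forall n, 0 <= t n) ->
  \sum_(i < n) t i @[n --> \oo] --> l -> l <= 0 -> forall n, t n = 0.
Proof.
move=> t0 C l0 n; pose S n := \sum_(i < n) t i.
have nd : nondecreasing_seq S.
  by apply/nondecreasing_seqP => i; rewrite /S big_ord_recr/= lerDl.
have Sl m : S m <= l.
  rewrite -(cvg_lim _ C)//; apply: nondecreasing_cvgn_le => //.
  by apply/cvg_ex; exists l.
have S0 : 0 <= S n by rewrite sumr_ge0.
have := le_trans (Sl n.+1) l0; rewrite /S big_ord_recr/= -/(S n) => H.
by apply/eqP; rewrite eq_le t0 andbT; apply: le_trans H; rewrite lerDr.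
Qed.

(** * The projection P and the operators B_b *)

Section projection.
Variable P : E -> E.
Hypothesis DP : forall x, D x -> D (P x).
Hypothesis P_lin : forall k x y, P (k *: x + y) = k *: P x + P y.
Hypothesis PP : forall x, P (P x) = P x.
Hypothesis Psym : forall x y, D x -> D y -> ip (P x) y = ip x (P y).

Lemma P_zero : P 0 = 0.
Proof. by have := P_lin (-1) 0 0; rewrite scaler0 addr0 scaleN1r addNr. Qed.

Lemma P_scale k x : P (k *: x) = k *: P x.
Proof. by rewrite -[k *: x]addr0 P_lin P_zero addr0. Qed.

Lemma P_sub x y : P (x - y) = P x - P y.
Proof. by rewrite !subN1 P_lin. Qed.

Lemma nrmP x : D x -> nrm (P x) <= nrm x.
Proof.
move=> Dx; have [->|z] := eqVneq (nrm (P x)) 0; first exact: nrm_ge0.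
have zp : 0 < nrm (P x) by rewrite lt_def z nrm_ge0.
rewrite -(ler_pM2l zp) -expr2 nrm_sq ?Psym ?PP//; try exact: DP.
by rewrite ipC//; [apply: le_trans (ip_CS _ _); [exact: ler_norm|exact: DP|]|exact: DP].
Qed.

Lemma P_eqv x y : D x -> D y -> eqv x y -> eqv (P x) (P y).
Proof.
move=> Dx Dy; rewrite !eqv_nrm//; try exact: DP.
move=> H; apply/eqP; rewrite eq_le nrm_ge0 andbT -P_sub -H.
exact: nrmP (dom_sub Dx Dy).
Qed.

Lemma tendstoP u x : (forall n, D (u n)) -> D x -> tendsto u x ->
  tendsto (fun n => P (u n)) (P x).
Proof.
move=> Du Dx C; apply: squeeze0 C => n; rewrite nrm_ge0/= -P_sub.
exact: nrmP (dom_sub (Du n) Dx).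
Qed.

Definition RP x := D x /\ eqv x (P x).

Lemma RP_P x : D x -> RP (P x).
Proof. by move=> Dx; split; [exact: DP|rewrite PP; exact: eqv_refl]. Qed.

Lemma RP_lin k x y : RP x -> RP y -> RP (k *: x + y).
Proof.
move=> [Dx ex] [Dy ey]; split; first exact: Dlin.
by rewrite P_lin; apply: eqv_lin => //; exact: DP.
Qed.

Lemma RP_0 : RP 0. Proof. by split => //; rewrite P_zero; exact: eqv_refl. Qed.

Lemma RPB x y : RP x -> RP y -> RP (x - y).
Proof. by move=> Hx Hy; rewrite addrC -scaleN1r; exact: RP_lin. Qed.

Lemma RPD x y : RP x -> RP y -> RP (x + y).
Proof. by move=> Hx Hy; rewrite -[x]scale1r; exact: RP_lin. Qed.

Lemma RPZ k x : RP x -> RP (k *: x).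
Proof. by move=> Hx; rewrite -[k *: x]addr0; apply: RP_lin => //; exact: RP_0. Qed.

Lemma RP_ip x y : RP x -> D y -> ip x y = ip x (P y).
Proof. by move=> [Dx ex] Dy; rewrite -Psym//; apply: eqv_ipl => //; exact: DP. Qed.

Hypothesis coercive : forall b, exists K : R, forall x, spanned b x ->
  forall y, is_proj b (P x) y -> nrm x <= K * nrm y.

(** The weak form of pi_b P y = pi_b x with y in the range of pi_b, that is of y = B_b x, written
    without projections. It determines y up to null vectors. *)
Definition isB b x y := spanned b y /\ forall z, spanned b z -> ip (P y) z = ip x z.

Lemma isB_nrm : exists2 K : R, 0 <= K &
  forall b x y, D x -> isB b x y -> nrm y <= K * nrm x.
Proof.
have H b : exists2 K : R, 0 <= K & forall x y, D x -> isB b x y -> nrm y <= K * nrm x.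
  have [K HK] := coercive b; exists `|K| => // x y Dx [Hy H].
  have [q Hq] := is_proj_exists b Dx; have Dy := spanned_D Hy; have Dq := spanned_D Hq.1.
  have Hpq : is_proj b (P y) q.
    split; first by case: Hq.
    move=> z Hz; have Dz := spanned_D Hz; rewrite ipBl//; last exact: DP.
    by rewrite H// (is_proj_ip Dx Hq Hz) subrr.
  apply: le_trans (HK _ Hy _ Hpq) _.
  apply: (@le_trans _ _ (`|K| * nrm q)).
    by rewrite ler_wpM2r ?nrm_ge0 ?ler_norm.
  by rewrite ler_wpM2l//; exact: is_proj_nrm Hq.
have [K1 K10 H1] := H true; have [K2 K20 H2] := H false.
exists (K1 + K2) => [|[] x y Dx Hy]; first exact: addr_ge0.
- by apply: le_trans (H1 _ _ Dx Hy) _; rewrite ler_wpM2r ?nrm_ge0// lerDl.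
- by apply: le_trans (H2 _ _ Dx Hy) _; rewrite ler_wpM2r ?nrm_ge0// lerDr.
Qed.

Lemma isB_lin b k x y x' y' : D x -> D x' -> isB b x y -> isB b x' y' ->
  isB b (k *: x + x') (k *: y + y').
Proof.
move=> Dx Dx' [Hy H] [Hy' H']; split=> [|z Hz]; first exact: spanned_lin.
have Dz := spanned_D Hz; have Dy := DP (spanned_D Hy); have Dy' := DP (spanned_D Hy').
by rewrite P_lin !ip_lin// H// H'.
Qed.

Lemma isBB b x y x' y' : D x -> D x' -> isB b x y -> isB b x' y' ->
  isB b (x - x') (y - y').
Proof. by move=> *; rewrite (subN1 x) (subN1 y); exact: isB_lin. Qed.

Lemma isB_eqv b x x' y y' : D x -> D x' -> eqv x x' -> isB b x y -> isB b x' y' -> eqv y y'.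
Proof.
move=> Dx Dx' e Hy Hy'; have [K K0 HK] := isB_nrm.
have Dy := spanned_D Hy.1; have Dy' := spanned_D Hy'.1; apply/eqv_nrm => //.
apply/eqP; rewrite eq_le nrm_ge0 andbT.
apply: le_trans (HK _ _ _ (dom_sub Dx Dx') (isBB Dx Dx' Hy Hy')) _.
by move/eqv_nrm: e => -> //; rewrite mulr0.
Qed.

Lemma isB_P b x : spanned b x -> isB b (P x) x. Proof. by []. Qed.

(** On the range of pi_b the vector [x] is recovered from [P x] by B_b, and B_b respects null
    vectors. *)
Lemma P_inj b x y : spanned b x -> spanned b y -> eqv (P x) (P y) -> eqv x y.
Proof.
move=> Hx Hy e; have Dx := spanned_D Hx; have Dy := spanned_D Hy.
exact: (isB_eqv (DP Dx) (DP Dy) e (isB_P Hx) (isB_P Hy)).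
Qed.

Variable B : bool -> E -> E.
Hypothesis HB : forall b x, D x -> isB b x (B b x).
Variable Ph : E.
Hypothesis DPh : D Ph.
Hypothesis PPh : P Ph = Ph.

Lemma B_spanned b x : D x -> spanned b (B b x). Proof. by move=> Dx; case: (HB b Dx). Qed.

Lemma D_B b x : D x -> D (B b x). Proof. by move=> Dx; exact: spanned_D (B_spanned b Dx). Qed.

Lemma B_P b x : spanned b x -> eqv (B b (P x)) x.
Proof.
move=> Hx; have Dx := DP (spanned_D Hx).
exact: (isB_eqv Dx Dx (eqv_refl _) (HB b Dx) (isB_P Hx)).
Qed.

Lemma B_eqv b x y : D x -> D y -> eqv x y -> eqv (B b x) (B b y).
Proof. by move=> Dx Dy e; exact: (isB_eqv Dx Dy e (HB b Dx) (HB b Dy)). Qed.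

(* uu false and uu true are u_- and u_+. *)
Definition uu b := Ph - P (B b Ph).

Lemma D_uu b : D (uu b). Proof. by apply: dom_sub => //; apply: DP; exact: D_B. Qed.

(** P fixes Ph, so (P z | Ph) = (z | Ph); and (P z | P B_b Ph) = (z | P B_b Ph) = (z | Ph) by the
    defining property of B_b. *)
Lemma uu_orth b z : spanned b z -> ip (P z) (uu b) = 0.
Proof.
move=> Hz; have Dz := spanned_D Hz; have DBP := D_B b DPh.
rewrite ipBr//; try exact: DP.
rewrite (Psym Dz DPh) PPh -(Psym (DP Dz) DBP) PP (ipC Dz DPh).
rewrite [X in _ - X]Psym// -(ipC _ Dz); last exact: DP.
by case: (HB b DPh) => _ /(_ z Hz) ->; rewrite subrr.
Qed.

Lemma ip_Ph_uu b : ip Ph (uu b) = ip (uu b) (uu b).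
Proof.
have DBP := DP (D_B b DPh); have Du := D_uu b.
by rewrite {2}/uu ipBl// (uu_orth (B_spanned b DPh)) subr0.
Qed.

(** P B_b is symmetric on the range of P; moved onto Ph it turns Ph into [uu b]. The scalar rows
    thus say that residuals are orthogonal to the constants. *)
Lemma residual_uu b v : RP v -> ip (v - P (B b v)) Ph = ip v (uu b).
Proof.
move=> Hv; have Dv := Hv.1; have Dy := D_B b Dv; have DBP := D_B b DPh.
have [Sy Hy] := HB b Dv; have [SB HBP] := HB b DPh.
rewrite ipBl//; last exact: DP.
rewrite ipBr//; last exact: DP.
congr (_ - _); rewrite (Psym Dy DPh) PPh (ipC Dy DPh) -(HBP _ Sy) (Psym DBP Dy).
rewrite (ipC DBP (DP Dy)) (Hy _ SB) -(Psym Dv DBP).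
by apply: eqv_ipl => //; [exact: DP|case: Hv].
Qed.

Lemma residual_orth b v z : D v -> spanned b z -> ip (v - P (B b v)) z = 0.
Proof.
move=> Dv Hz; have [Sy Hy] := HB b Dv.
by rewrite ipBl ?(Hy _ Hz) ?subrr//; [apply: DP; exact: D_B|exact: spanned_D Hz].
Qed.

(** * Sign of the eigenvalues, residuals, and positivity of u_b *)

Section eigenvalues.
Variable lam : bool -> nat -> R.
Hypothesis lam_sign : forall b n, 0 < pm R b * lam b n.
Hypothesis lam_far : forall b n, pm R b * lam b 0%N <= pm R b * lam b n.
Variables (hh : E -> E -> R) (ctl : Prop).
Hypothesis hh_lin : forall k x x' y, D x -> D x' -> D y ->
  hh (k *: x + x') y = k * hh x y + hh x' y.
Hypothesis hhC : forall x y, hh x y = hh y x.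
Hypothesis hhP : forall x y, hh (P x) y = hh x y.
Hypothesis hh_bound : exists2 K : R, 0 <= K & forall x y, D x -> D y ->
  hh x y ^+ 2 <= K * (ip x x * ip y y).
(** All that the abstract part retains of the differential operator and of its lateral conditions:
    Green's formula for A on pairs of eigenvectors. *)
Hypothesis eigen_identity : forall b n m, lam b n * (n == m)%:R =
  lam b n * ip (P (ph b n)) (ph b m) + lam b m * ip (P (ph b m)) (ph b n)
  - hh (ph b n) (ph b m).
Hypothesis eigen_Ph : ~ ctl -> forall b n, hh (ph b n) Ph = lam b n * ip (ph b n) Ph.
Hypothesis null_limit : forall b a v w, D v -> D w -> eqv v (P v) ->
  tendsto (psum b a) v -> tendsto (psum b (fun n => a n / lam b n)) w ->
  exists2 k : R, eqv (P w) (k *: Ph) & ctl -> k = 0.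
Hypothesis in_range : forall v, RP v -> [\/ ctl, hh Ph Ph != 0 | ip v Ph = 0] ->
  tendsto (fun N => \sum_(n < N) (coef true v n *: ph true n + coef false v n *: ph false n)) v.
Hypothesis Ph_gt0 : 0 < ip Ph Ph.

Lemma lam_neq0 b n : lam b n != 0.
Proof. by apply/eqP => H; have := lam_sign b n; rewrite H mulr0 ltxx. Qed.

Lemma pmpm b : pm R b * pm R b = 1. Proof. by case: b; rewrite /pm ?mulrNN mulr1. Qed.

Lemma normM_pm b (x : R) : `|pm R b * x| = `|x|.
Proof. by case: b; rewrite /pm ?mul1r ?mulN1r ?normrN. Qed.

Lemma hh_abs : exists2 K : R, 0 <= K & forall x y, D x -> D y ->
  `|hh x y| <= K * nrm x * nrm y.
Proof.
have [K K0 HK] := hh_bound; exists (Num.sqrt K) => [|x y Dx Dy]; first exact: sqrtr_ge0.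
rewrite /nrm -!sqrtrM//; last by rewrite mulr_ge0// ip_ge0.
by rewrite -sqrtr_sqr ler_sqrt -?mulrA ?HK// !mulr_ge0 ?ip_ge0.
Qed.

Lemma hh_sub x x' y : D x -> D x' -> D y -> hh (x - x') y = hh x y - hh x' y.
Proof. by move=> Dx Dx' Dy; rewrite subN1 hh_lin// mulN1r addrC. Qed.

Lemma hh_eqv x x' y : D x -> D x' -> D y -> eqv x x' -> hh x y = hh x' y.
Proof.
move=> Dx Dx' Dy /eqv_nrm e; have [K K0 HK] := hh_abs.
apply/eqP; rewrite -subr_eq0 -hh_sub// -normr_le0.
by apply: le_trans (HK _ _ (dom_sub Dx Dx') Dy) _; rewrite e// mulr0 mul0r.
Qed.

Lemma tendsto_hh2 u v x y : (forall n, D (u n)) -> (forall n, D (v n)) -> D x -> D y ->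
  tendsto u x -> tendsto v y -> hh (u n) (v n) @[n --> \oo] --> hh x y.
Proof.
move=> Du Dv Dx Dy cu cv; have [K K0 HK] := hh_abs.
have C : K * nrm (u n - x) * nrm (v n) + K * nrm (v n - y) * nrm x @[n --> \oo] --> (0 : R).
  rewrite -(addr0 0); apply: cvgD.
    rewrite -(mul0r (nrm y)); apply: cvgM; last exact: tendsto_nrm.
    by rewrite -(mulr0 K); apply: cvgM => //; exact: cvg_cst.
  rewrite -(mul0r (nrm x)); apply: cvgM; last exact: cvg_cst.
  by rewrite -(mulr0 K); apply: cvgM => //; exact: cvg_cst.
apply/cvgrPdist_le => e e0; move/cvgrPdist_le: C => /(_ e e0)[N _ NH].
exists N => // n /NH /=; rewrite sub0r normrN ger0_norm; last first.
  by rewrite addr_ge0// !mulr_ge0 ?nrm_ge0.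
apply: le_trans; have Dz := dom_sub (Du n) Dx; have Dt := dom_sub (Dv n) Dy.
have -> : hh x y - hh (u n) (v n) = - (hh (u n - x) (v n) + hh (v n - y) x).
  by rewrite !hh_sub// (hhC (v n)) (hhC y) addrA subrK opprB.
rewrite normrN; apply: le_trans (ler_normD _ _) _.
by apply: lerD; exact: HK.
Qed.

Lemma tendsto_hh u x y : (forall n, D (u n)) -> D x -> D y -> tendsto u x ->
  hh (u n) y @[n --> \oo] --> hh x y.
Proof.
move=> Du Dx Dy C; apply: tendsto_hh2 => //.
by rewrite /tendsto subrr /nrm ip0l// sqrtr0; exact: cvg_cst.
Qed.

Lemma lin_psum (f : E -> R) b a N :
  (forall k x y, D x -> D y -> f (k *: x + y) = k * f x + f y) ->
  f (psum b a N) = \sum_(n < N) a n * f (ph b n).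
Proof.
move=> fl; elim: N => [|N IH].
  have := fl (-1) 0 0 D0 D0; rewrite scaler0 addr0 /psum !big_ord0 => H; lra.
rewrite /psum !big_ord_recr/= -/(psum b a N) addrC fl//; last exact: D_psum.
by rewrite IH addrC.
Qed.

(** [g] plays the role of A y. For finite sums this is [eigen_Ph], and both sides are continuous
    along the partial sums. *)
Lemma ip_Ph_hh b y g : ~ ctl -> spanned b y -> spanned b g ->
  (forall n, coef b g n = lam b n * coef b y n) -> ip g Ph = hh y Ph.
Proof.
move=> nc Hy Hg cg; have Dy := spanned_D Hy; have Dg := spanned_D Hg.
have C1 := tendsto_hh (D_psum b (coef b y)) Dy DPh (spanned_tendsto Hy).
have C2 := tendsto_ip (D_psum b (coef b g)) Dg DPh (spanned_tendsto Hg).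
apply: (@cvg_unique _ _ _ _ _ _ C2); first exact: norm_hausdorff.
apply: cvg_trans C1; apply: near_eq_cvg; apply: nearW => N /=.
rewrite (@lin_psum (fun x => ip x Ph)); last by move=> *; rewrite ip_lin.
rewrite (@lin_psum (fun x => hh x Ph)); last by move=> *; rewrite hh_lin.
by apply: eq_bigr => i _; rewrite eigen_Ph// cg; ring.
Qed.

Lemma spanned_of_range b v : RP v -> (forall n, coef b v n = 0) ->
  tendsto (fun N => \sum_(n < N) (coef true v n *: ph true n + coef false v n *: ph false n)) v ->
  tendsto (psum (~~ b) (coef (~~ b) v)) v.
Proof.
move=> Hv H C; apply: cvg_trans C; apply: near_eq_cvg; apply: nearW => N /=.
congr (nrm (_ - _)); apply: eq_bigr => i _.
by case: b H => H; rewrite H scale0r ?add0r ?addr0.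
Qed.

(* With w the sum of (a_n / lam_n) phi_n, whose first component is the constant k of
   null_limit, the scalar product of w with v is both sum a_n^2 / lam_n and k (Ph | v). *)
Lemma null_residual b v : RP v -> (forall n, coef b v n = 0) ->
  [\/ ctl, ip v Ph = 0 | ~ ctl /\ 0 < pm R b * hh Ph Ph] -> eqv v 0.
Proof.
move=> Hv H Hc; have Dv := Hv.1; set b' := ~~ b.
have C : tendsto (psum b' (coef b' v)) v.
  apply: spanned_of_range => //; apply: in_range => //.
  case: Hc => [?|?|[_ h0]]; [exact: Or31|exact: Or33|apply: Or32].
  by apply/eqP => h1; move: h0; rewrite h1 mulr0 ltxx.
(* [w] is A^-1 v; its multipliers are bounded by the inverse of the eigenvalue of sign [b'] nearest
   to 0. *)
have [|w [Hw Cw cw _]] := @multiplier b' (fun n => (lam b' n)^-1) `|lam b' 0%N|^-1 v Dv.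
  move=> n; rewrite normfV lef_pV2 ?posrE ?normr_gt0 ?lam_neq0//.
  have := lam_far b' n; have := lam_sign b' n; have := lam_sign b' 0%N.
  move=> /ltW/ger0_norm <- /ltW/ger0_norm <-.
  by rewrite !normM_pm.
have Dw := spanned_D Hw.
have [k ek kc] := null_limit Dv Dw Hv.2 C Cw.
have DkP := dom_scale k DPh.
have ipwv : ip w v = k * ip Ph v.
  rewrite (ipC Dw Dv) (RP_ip Hv Dw) (ipC Dv (DP Dw)) (eqv_ipl (DP Dw) DkP Dv ek).
  by rewrite ipZl.
have Cs : \sum_(i < n) pm R b' * (coef b' v i ^+ 2 / lam b' i) @[n --> \oo] -->
    pm R b' * (k * ip Ph v).
  under eq_fun do rewrite -mulr_sumr; apply: cvgM; first exact: cvg_cst.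
  rewrite -ipwv; have := tendsto_ip (D_psum _ _) Dw Dv Cw.
  apply: cvg_trans; apply: near_eq_cvg; apply: nearW => N /=.
  by rewrite ip_psum//; apply: eq_bigr => i _; rewrite mulrAC expr2.
have le0 : pm R b' * (k * ip Ph v) <= 0.
  case: Hc => [ct|z|[nc h0]].
  - by rewrite (kc ct) mul0r mulr0.
  - by rewrite (ipC DPh Dv) z !mulr0.
  (* As v = A w in coefficients, (v | Ph) equals the form hh at w and Ph, where the first component
     of w may be replaced by that of k Ph. *)
  - have E1 : ip v Ph = k * hh Ph Ph.
      have Sv : spanned b' v := tendsto_spanned Dv C.
      rewrite (ip_Ph_hh nc Hw Sv) => [|n]; last first.
        by rewrite cw mulrC divfK// lam_neq0.
      rewrite -hhP (hh_eqv (DP Dw) DkP DPh ek) -[k *: Ph]addr0 hh_lin//.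
      have := hh_lin (-1) D0 D0 DPh; rewrite scaler0 addr0 => H0.
      have -> : hh 0 Ph = 0 by lra.
      by rewrite addr0.
    (* The residual lives on the sign opposite to [b]: this change of sign makes the limit the
       opposite of k^2 times a positive number. *)
    have -> : pm R b' = - pm R b by rewrite /b' /pm; case: (b); rewrite ?opprK.
    rewrite (ipC DPh Dv) E1.
    have -> : - pm R b * (k * (k * hh Ph Ph)) = - (k ^+ 2 * (pm R b * hh Ph Ph)) by ring.
    by rewrite oppr_le0 mulr_ge0 ?sqr_ge0// ltW.
have Z n : coef b' v n = 0.
  have t0 i : 0 <= pm R b' * (coef b' v i ^+ 2 / lam b' i).
    rewrite mulrCA mulr_ge0 ?sqr_ge0//.
    have -> : pm R b' / lam b' i = (pm R b' * lam b' i)^-1.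
      by rewrite invfM; congr (_ * _); rewrite /pm; case: ifP; rewrite ?invr1 ?invrN1.
    by rewrite invr_ge0 ltW.
  have /eqP := pos_series0 t0 Cs le0 n.
  rewrite mulf_eq0 mulf_eq0 invr_eq0 (negbTE (lam_neq0 _ _)) orbF sqrf_eq0.
  case/orP => /eqP // p0; have := pmpm b'; rewrite p0 mulr0 => /eqP.
  by rewrite eq_sym oner_eq0.
rewrite /eqv subr0; exact: (spanned_coef0 (tendsto_spanned Dv C) Z).
Qed.

(** The residual is in the range of P and orthogonal to the range of pi_b, so [null_residual]
    applies; its product with Ph is (v | u_b). *)
Lemma PB_id b v : RP v ->
  [\/ ctl, ip v (uu b) = 0 | ~ ctl /\ 0 < pm R b * hh Ph Ph] -> eqv (P (B b v)) v.
Proof.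
move=> Hv Hc; have Dv := Hv.1; have DBv := DP (D_B b Dv).
apply: eqv_sym => //.
have := @null_residual b (v - P (B b v)) _ _ _; rewrite /eqv !subr0; apply.
- by apply: RPB => //; apply: RP_P; exact: D_B.
- by move=> n; apply: residual_orth => //; exact: spanned_ph.
- by rewrite residual_uu.
Qed.

(* The quadratic form of A on a finite sum y, that is (A y | y) = 2 (P A y | y) - int h y^2. *)
Lemma eigen_sum b (a : nat -> R) N : \sum_(n < N) lam b n * a n ^+ 2 =
  2 * ip (P (psum b (fun n => lam b n * a n) N)) (psum b a N)
  - hh (psum b a N) (psum b a N).
Proof.
have Dy := D_psum b a N; have Dg := D_psum b (fun n => lam b n * a n) N.
set y := psum b a N in Dy *; set g := psum b _ N in Dg *.
(* After expanding g and y, [eigen_identity] cancels all terms of index different from m. *)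
have A m : (m < N)%N -> lam b m * ip (P (ph b m)) y + ip (P g) (ph b m) - hh (ph b m) y =
    lam b m * a m.
  move=> mN.
  rewrite (@lin_psum (fun x => ip (P x) (ph b m))); last first.
    by move=> k x z Dx Dz; rewrite P_lin ip_lin//; exact: DP.
  rewrite (@lin_psum (fun x => ip (P (ph b m)) x)); last first.
    by move=> k x z Dx Dz; rewrite ipDr ?ipZr//; [exact: DP|exact: DP|exact: dom_scale].
  rewrite (@lin_psum (fun x => hh (ph b m) x)); last first.
    by move=> k x z Dx Dz; rewrite !(hhC (ph b m)) hh_lin.
  rewrite mulr_sumr -big_split -sumrB/= (bigD1 (Ordinal mN))//=.
  rewrite [X in _ + X]big1 ?addr0 => [|i im].
    have := eigen_identity b m m; rewrite eqxx mulr1 => e.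
    rewrite [in RHS]e; ring.
  have := eigen_identity b m i; have -> : (m == i :> nat) = false.
    by apply/negbTE; apply: contra im => /eqP e; apply/eqP; apply: val_inj.
  rewrite mulr0 => e; have -> : lam b m * (a i * ip (P (ph b m)) (ph b i)) +
    lam b i * a i * ip (P (ph b i)) (ph b m) - a i * hh (ph b m) (ph b i) = a i *
    (lam b m * ip (P (ph b m)) (ph b i) + lam b i * ip (P (ph b i)) (ph b m) -
      hh (ph b m) (ph b i)) by ring.
  by rewrite -e mulr0.
transitivity (\sum_(m < N) a m *
    (lam b m * ip (P (ph b m)) y + ip (P g) (ph b m) - hh (ph b m) y)).
  by apply: eq_bigr => i _; rewrite A//; ring.
have E1 : ip (P g) y = \sum_(m < N) lam b m * a m * ip (P (ph b m)) y.
  rewrite (@lin_psum (fun x => ip (P x) y))//.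
  by move=> k x z Dx Dz; rewrite P_lin ip_lin//; exact: DP.
have E2 : ip (P g) y = \sum_(m < N) a m * ip (P g) (ph b m).
  rewrite [in LHS]/y (@lin_psum (fun x => ip (P g) x))//.
  by move=> k x z Dx Dz; rewrite ipDr ?ipZr//; [exact: DP|exact: DP|exact: dom_scale].
have E3 : hh y y = \sum_(m < N) a m * hh (ph b m) y.
  by rewrite [in X in hh X _]/y (@lin_psum (fun x => hh x y))// => *; rewrite hh_lin.
rewrite mulr2n mulrDl mul1r {1}E1 E2 E3 -big_split -sumrB/=.
by apply: eq_bigr => i _; ring.
Qed.

(* Otherwise Ph = P psi with psi spanned; y solves y + s eps A y = psi, g = A y, and the
   limit of eigen_sum gives eps (P g | g) <= s (Ph, Ph)_h <= 0. *)
Lemma uu_gt0 b : ~ ctl -> pm R b * hh Ph Ph <= 0 -> 0 < ip (uu b) (uu b).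
Proof.
move=> nc hs; rewrite lt_def ip_ge0 ?andbT; last exact: D_uu.
apply/eqP => u0; set s := pm R b in hs.
have ss : s * s = 1 := pmpm b.
pose psi := B b Ph; have Hpsi : spanned b psi := B_spanned b DPh.
have Dpsi := spanned_D Hpsi; have e1 : eqv Ph (P psi) by exact: u0.
have [K K0 HK] := hh_abs.
(* K bounds the form hh, and [eps * K < 1] lets the term in h be absorbed by (P g | g). *)
pose eps := (K + 1)^-1; have ep : 0 < eps by rewrite invr_gt0 ltr_wpDl.
have sl n : 0 < s * lam b n := lam_sign b n.
have m1 n : 1 < 1 + s * eps * lam b n by rewrite ltrDl mulrAC mulr_gt0.
have m0 n : 1 + s * eps * lam b n != 0 by rewrite gt_eqF// (lt_trans ltr01).
have [|y [Hy Cy cy _]] := @multiplier b (fun n => (1 + s * eps * lam b n)^-1) 1 psi Dpsi.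
  by move=> n; rewrite ger0_norm ?invr_ge0 ?invf_le1 ?ltW ?(lt_trans ltr01).
have Dy := spanned_D Hy.
(* This is A y, read off from y + s eps A y = psi with s^2 = 1. *)
pose g := (s / eps) *: (psi - y).
have Hg : spanned b g.
  rewrite /g -[_ *: _]addr0; apply: spanned_lin; first exact: spannedB.
  by split => // e e0; exists 0%N, (fun=> 0); rewrite /psum big_ord0 subr0 /nrm ip0l// sqrtr0.
have Dg := spanned_D Hg.
have cg n : coef b g n = lam b n * coef b y n.
  have Dpy := dom_sub Dpsi Dy; rewrite /coef /g ipZl// ipBl// -!/(coef b _ n) cy; field: ss.
  by rewrite m0 gt_eqF.
have yE : y = (- (s * eps)) *: g + psi.
  rewrite /g scalerA mulNr; have -> : s * eps * (s / eps) = 1.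
    by rewrite mulrACA ss mul1r divff// gt_eqF.
  by rewrite scaleN1r opprB subrK.
clearbody g.
have IE := ip_Ph_hh nc Hy Hg cg.
have hpsi z : D z -> hh psi z = hh Ph z.
  by move=> Dz; rewrite -hhP; apply/esym; apply: hh_eqv => //; exact: DP.
(* Each term s lam_n a_n^2 of [eigen_sum] is nonnegative, and the right-hand side of that identity
   passes to the limit. *)
have ineq : 0 <= s * (2 * ip (P g) y - hh y y).
  have Dgn := D_psum b (fun n => lam b n * coef b y n).
  have Dyn := D_psum b (coef b y).
  have Cg : tendsto (psum b (fun n => lam b n * coef b y n)) g.
    have -> : (fun n => lam b n * coef b y n) = coef b g by apply/funext => n.
    exact: spanned_tendsto Hg.
  have C : s * (2 * ip (P (psum b (fun n => lam b n * coef b y n) N)) (psum b (coef b y) N)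
      - hh (psum b (coef b y) N) (psum b (coef b y) N)) @[N --> \oo] -->
      s * (2 * ip (P g) y - hh y y).
    apply: cvgM; first exact: cvg_cst.
    apply: cvgB; last by apply: tendsto_hh2 => //; exact: spanned_tendsto.
    apply: cvgM; first exact: cvg_cst.
    apply: tendsto_ip2 => //; [by move=> n; exact: DP|exact: DP| |exact: spanned_tendsto].
    exact: tendstoP.
  rewrite -(cvg_lim _ C)//; apply: limr_ge; first by apply/cvg_ex; eexists; exact: C.
  apply: nearW => N; rewrite -eigen_sum mulr_sumr sumr_ge0// => i _.
  by rewrite mulrA mulr_ge0 ?sqr_ge0// ltW.
have E0 : ip (P g) y = ip g Ph - s * eps * ip (P g) g.
  rewrite {1}yE ipDr ?ipZr//; try exact: DP; last exact: dom_scale.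
  rewrite (Psym Dg Dpsi) [X in _ + X](_ : _ = ip g Ph); first by ring.
  by rewrite !(ipC Dg) ?(eqv_ipl DPh (DP Dpsi) Dg e1)//; exact: DP.
have E1 : hh y Ph = hh Ph Ph - s * eps * hh g Ph.
  by rewrite {1}yE hh_lin// hpsi//; ring.
have E2 : hh y y = hh Ph Ph - 2 * (s * eps) * hh g Ph + (s * eps) ^+ 2 * hh g g.
  rewrite {1}yE hh_lin// hpsi// hhC {1}yE hh_lin// (hhC Ph) [in X in _ + X]yE hh_lin//.
  by rewrite !hpsi// (hhC Ph g); ring.
have c0 : 0 <= ip (P g) g.
  rewrite -{1}(PP g) (Psym (DP Dg) Dg); apply: ip_ge0; exact: DP.
have hg : `|hh g g| <= K * ip (P g) g.
  rewrite -hhP hhC -hhP; apply: le_trans (HK _ _ (DP Dg) (DP Dg)) _.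
  by rewrite -mulrA -expr2 nrm_sq ?(Psym Dg (DP Dg)) ?PP -?Psym//; exact: DP.
(* With y = psi - s eps g, [ineq] becomes 0 <= s (Ph, Ph)_h - 2 eps (P g | g) - eps^2 s (g, g)_h,
   and the last term is at most eps (P g | g) in absolute value. *)
have c00 : ip (P g) g = 0.
  apply/eqP; rewrite eq_le c0 andbT.
  move: ineq; rewrite E0 IE E1 E2; move: hg c0 hs.
  move: (hh Ph Ph) (ip (P g) g) (hh g Ph) (hh g g) => m c q r hr c0 sm.
  have -> : s * (2 * (m - s * eps * q - s * eps * c) - (m - 2 * (s * eps) * q + (s * eps) ^+ 2 * r))
      = s * m - (s * s) * eps * (2 * c) - (s * s) * eps * (eps * (s * r)) by ring.
  rewrite ss !mul1r => H.
  have hsr : - (eps * (s * r)) <= c.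
    rewrite -mulrN; apply: le_trans (_ : eps * (K * c) <= _).
      rewrite ler_wpM2l ?(ltW ep)//; apply: le_trans hr; rewrite -(normM_pm b) -/s -normrN.
      exact: ler_norm.
    by rewrite mulrA ler_piMl// /eps mulrC ler_pdivrMr ?ltr_wpDl// mul1r lerDl.
  have : eps * c <= 0 by nra.
  by rewrite pmulr_rle0.
(* P g = 0 gives P psi = P y, hence psi = y. The multipliers 1 / (1 + s eps lam_n) are strictly
   below 1, so all coefficients of psi vanish, against (Ph | Ph) > 0. *)
have ePy : eqv (P psi) (P y).
  rewrite /eqv -P_sub; have -> : psi - y = (s * eps) *: g.
    by rewrite yE opprD addrCA subrr addr0 -scaleNr opprK.
  rewrite P_scale ipZl ?ipZr//; try exact: DP; last by apply: dom_scale; exact: DP.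
  by rewrite (Psym Dg (DP Dg)) PP -Psym// c00 !mulr0.
have epy := P_inj Hpsi Hy ePy.
have z n : coef b psi n = 0.
  have : coef b psi n = coef b psi n / (1 + s * eps * lam b n).
    by rewrite -cy; exact: eqv_ipl.
  move/eqP; rewrite -subr_eq0 -{1}[coef b psi n]mulr1 -mulrBr mulf_eq0 => /orP[/eqP//|].
  rewrite subr_eq0 -(inj_eq invr_inj) invr1 invrK => /eqP e.
  by have := m1 n; rewrite -e ltxx.
have p0 := spanned_coef0 Hpsi z.
have PP0 : ip (P psi) (P psi) = 0.
  have : eqv psi 0 by rewrite /eqv subr0.
  by move/(P_eqv Dpsi D0); rewrite P_zero /eqv subr0.
have := Ph_gt0; rewrite (eqv_ipl DPh (DP Dpsi) DPh e1) (ipC (DP Dpsi) DPh).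
by rewrite (eqv_ipl DPh (DP Dpsi) (DP Dpsi) e1) PP0 ltxx.
Qed.

(** * The exponentially small blocks M_b *)

Section evolution.
Variable M : bool -> R -> E -> E.
Definition decay b L n := expR (- pm R b * 2 * L * lam b n).
(** [e] is exp(- 2 L A) y for b = true and exp(2 L A) y for b = false, specified through its
    coefficients and hence up to null vectors. *)
Definition evolved b L y e := spanned b e /\ forall n, coef b e n = coef b y n * decay b L n.
Hypothesis HM : forall b L x, 0 < L -> D x -> exists2 e, evolved b L (B b x) e & M b L x = P e.

Lemma decay_le : exists2 mu : R, 0 < mu & forall b L n, 0 < L ->
  decay b L n <= expR (- (2 * L * mu)).
Proof.
pose mu := Order.min (pm R true * lam true 0%N) (pm R false * lam false 0%N).
have mub b : mu <= pm R b * lam b 0%N by rewrite /mu; case: b; rewrite ge_min lexx ?orbT.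
exists mu => [|b L n L0]; first by rewrite /mu lt_min !lam_sign.
rewrite /decay ler_expR.
have -> : - pm R b * 2 * L * lam b n = - (2 * L * (pm R b * lam b n)) by ring.
rewrite lerN2; apply: ler_wpM2l; first by rewrite mulr_ge0 ?ltW.
exact: le_trans (mub b) (lam_far b n).
Qed.

Lemma M_contracting (eps : R) : 0 < eps -> exists L0 : R, forall b L, 0 < L -> L0 < L ->
  (forall x, D x -> nrm (M b L x) <= eps * nrm x) /\
  (forall x y, D x -> D y -> nrm (M b L x - M b L y) <= eps * nrm (x - y)).
Proof.
move=> e0; have [mu mu0 Hmu] := decay_le; have [K K0 HK] := isB_nrm.
(* Since exp(- t) <= 1 / t, taken at t = 2 L mu, beyond this length the product of the decay factor
   with the bound K of B_b is at most eps. *)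
exists (K / (2 * mu * eps)) => b L L0 LL.
have eta0 n : 0 <= decay b L n := expR_ge0 _.
have small : expR (- (2 * L * mu)) * K <= eps.
  rewrite expRN mulrC ler_pdivrMr ?expR_gt0//.
  apply: (@le_trans _ _ (eps * (2 * L * mu))).
    move: LL; rewrite ltr_pdivrMr ?mulr_gt0// => /ltW H.
    by apply: le_trans H _; rewrite le_eqVlt; apply/orP; left; apply/eqP; ring.
  apply: ler_wpM2l; first exact: ltW.
  by apply: le_trans (expR_ge1Dx _); rewrite lerDr.
have key x y e : D x -> isB b x y -> evolved b L y e -> nrm e <= eps * nrm x.
  move=> Dx Hy [He ce]; have Dy := spanned_D Hy.1.
  apply: (@le_trans _ _ (expR (- (2 * L * mu)) * nrm y)).
    apply: spanned_nrm_le He Dy _ => [|n]; first exact: expR_ge0.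
    by rewrite ce normrM mulrC ler_wpM2r// ger0_norm// Hmu.
  apply: le_trans (ler_wpM2l (expR_ge0 _) (HK _ _ _ Dx Hy)) _.
  by rewrite mulrA ler_wpM2r// nrm_ge0.
split=> [x Dx|x y Dx Dy].
- have [e He ->] := HM b L0 Dx; apply: le_trans (nrmP (spanned_D He.1)) _.
  exact: key (HB b Dx) He.
- have [e He ->] := HM b L0 Dx; have [f Hf ->] := HM b L0 Dy.
  have De := spanned_D He.1; have Df := spanned_D Hf.1.
  rewrite -P_sub; apply: le_trans (nrmP (dom_sub De Df)) _.
  apply: (key _ _ _ (dom_sub Dx Dy) (isBB Dx Dy (HB b Dx) (HB b Dy))).
  split=> [|n]; first exact: spannedB He.1 Hf.1.
  rewrite !coef_sub//; try exact: D_B.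
  by rewrite He.2 Hf.2 mulrBl.
Qed.

Lemma RP_M b L x : 0 < L -> D x -> RP (M b L x).
Proof.
by move=> L0 Dx; have [e [He _] ->] := HM b L0 Dx; apply: RP_P; exact: spanned_D He.
Qed.

Lemma evolved_eqv b L y y' e e' : D y -> D y' -> eqv y y' -> evolved b L y e ->
  evolved b L y' e' -> eqv e e'.
Proof.
move=> Dy Dy' yy' [He ce] [He' ce']; apply: (spanned_eq He He') => n.
by rewrite ce ce'; congr (_ * _); exact: eqv_ipl.
Qed.

Lemma M_eqv b L x y : 0 < L -> D x -> D y -> eqv x y -> eqv (M b L x) (M b L y).
Proof.
move=> L0 Dx Dy e; have [e1 H1 ->] := HM b L0 Dx; have [e2 H2 ->] := HM b L0 Dy.
apply: P_eqv; [exact: spanned_D H1.1|exact: spanned_D H2.1|].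
by apply: (evolved_eqv _ _ _ H1 H2); [exact: D_B|exact: D_B|exact: B_eqv].
Qed.

(** B_b P is the identity on the range of pi_b, so M_b acts on P y as the exponential on y followed
    by P. *)
Lemma M_P b L y e : 0 < L -> spanned b y -> evolved b L y e -> eqv (M b L (P y)) (P e).
Proof.
move=> L0 Hy He; have Dy := spanned_D Hy; have [e1 H1 ->] := HM b L0 (DP Dy).
apply: P_eqv; [exact: spanned_D H1.1|exact: spanned_D He.1|].
by apply: (evolved_eqv _ _ _ H1 He); [apply: D_B; exact: DP|done|exact: B_P].
Qed.

Lemma sub_row (x m c x' m' c' : E) :
  x - x' = (x + m + c - (x' + m' + c')) - (m - m') - (c - c').
Proof.
have -> : x + m + c - (x' + m' + c') = (x - x') + (m - m') + (c - c').
  by rewrite opprD addrACA; congr (_ + _); rewrite opprD addrACA.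
by rewrite addrAC !addrK.
Qed.

(** * The block system with k real unknowns *)

Section block.
Variables (k : nat) (sg : 'I_k -> bool) (g : bool -> 'I_k -> E) (L : R).
Hypothesis L0 : 0 < L.
Hypothesis RPg : forall b j, RP (g b j).

(** The upper right block of Z, applied to the real unknowns; [smat] is the lower right one. *)
Definition cc b (r : 'I_k -> R) : E := \sum_j r j *: g b j.
Definition smat (r : 'I_k -> R) j : R := \sum_i r i * ip (g (sg j) i) (uu (sg j)).
Definition zrow (X : bool -> E) r b := X b + M (~~ b) L (X (~~ b)) + cc b r.
Definition zscal (X : bool -> E) r j :=
  ip (M (~~ sg j) L (X (~~ sg j))) (uu (sg j)) + smat r j.
(* The two rows and the scalar rows of ZX = b, indexed by signs: X false and X true are
   the first two entries of X, p false and p true those of b; g b j is the coefficient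
   of the j-th real unknown in row b and the j-th scalar row is tested against uu (sg j). *)
Definition sysm X r (p : bool -> E) := (forall b, eqv (zrow X r b) (p b)) /\
  forall j, zscal X r j = ip (p (sg j)) (uu (sg j)).

Lemma RP_cc b r : RP (cc b r).
Proof.
apply: (@big_ind _ RP); [exact: RP_0|by move=> *; exact: RPD|].
by move=> j _; exact: RPZ.
Qed.

Lemma ip_cc b r y : D y -> ip (cc b r) y = \sum_j r j * ip (g b j) y.
Proof.
move=> Dy; rewrite /cc.
suff : D (\sum_j r j *: g b j) /\ ip (\sum_j r j *: g b j) y = \sum_j r j * ip (g b j) y.
  by case.
apply: (@big_rec2 _ _ (fun x z => D x /\ ip x y = z)); first by rewrite ip0l.
move=> j x z _ [Dx <-]; have Dg := (RPg b j).1.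
by split; [exact: Dlin|rewrite ip_lin].
Qed.

Lemma ccB b r r' : cc b r - cc b r' = cc b (fun j => r j - r' j).
Proof. by rewrite /cc -sumrB; apply: eq_bigr => j _; rewrite scalerBl. Qed.

Lemma smatB r r' j : smat r j - smat r' j = smat (fun j => r j - r' j) j.
Proof. by rewrite /smat -sumrB; apply: eq_bigr => i _; rewrite mulrBl. Qed.

Lemma RP_zrow X r b : (forall b, RP (X b)) -> RP (zrow X r b).
Proof.
move=> HX; apply: RPD; last exact: RP_cc.
by apply: RPD => //; apply: RP_M => //; case: (HX (~~ b)).
Qed.

Lemma ip_zrow X r j : (forall b, D (X b)) -> ip (zrow X r (sg j)) (uu (sg j)) =
  ip (X (sg j)) (uu (sg j)) + zscal X r j.
Proof.
move=> DX; have Du := D_uu (sg j); have DM := (RP_M (~~ sg j) L0 (DX (~~ sg j))).1.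
by rewrite /zrow /zscal ipDl ?ipDl ?ip_cc ?addrA//; [exact: dom_add|case: (RP_cc (sg j) r)].
Qed.

(** By [ip_zrow] the product of row [sg j] with u is scalar row j plus (X | u). Once the rows hold,
    the scalar rows amount to the vanishing of that extra term. *)
Lemma sysmP X r p : (forall b, D (X b)) -> (forall b, D (p b)) -> sysm X r p <->
  (forall b, eqv (zrow X r b) (p b)) /\ forall j, ip (X (sg j)) (uu (sg j)) = 0.
Proof.
move=> DX Dp.
have Dz b : D (zrow X r b).
  apply: dom_add; last by case: (RP_cc b r).
  by apply: dom_add => //; case: (RP_M (~~ b) L0 (DX (~~ b))).
split=> -[H1 H2]; split=> // j; have Du := D_uu (sg j);
  have := ip_zrow r j DX; rewrite (eqv_ipl (Dz _) (Dp _) Du (H1 _)) => e.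
- by move: e; rewrite H2 => /eqP; rewrite -subr_eq subrr eq_sym => /eqP.
- by rewrite e H2 add0r.
Qed.

Lemma zrow_eqv X X' r b : (forall b, D (X b)) -> (forall b, D (X' b)) ->
  (forall b, eqv (X b) (X' b)) -> eqv (zrow X r b) (zrow X' r b).
Proof.
move=> DX DX' e; have DM Y (DY : forall b, D (Y b)) := (RP_M (~~ b) L0 (DY (~~ b))).1.
have Dc := (RP_cc b r).1.
apply: eqvD => //; [exact: dom_add (DX b) (DM X DX)|exact: dom_add (DX' b) (DM X' DX')| |exact: eqv_refl].
by apply: eqvD => //; [exact: DM|exact: DM|exact: M_eqv].
Qed.

Lemma sysm_eqv X X' r p : (forall b, D (X b)) -> (forall b, D (X' b)) -> (forall b, D (p b)) ->
  (forall b, eqv (X b) (X' b)) -> sysm X r p -> sysm X' r p.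
Proof.
move=> DX DX' Dp e /(sysmP r DX Dp)[H1 H2]; apply/(sysmP r DX' Dp); split=> [b|j].
- have Dz Y (DY : forall b, D (Y b)) : D (zrow Y r b).
    by apply: dom_add; [apply: dom_add => //; case: (RP_M (~~ b) L0 (DY (~~ b)))|case: (RP_cc b r)].
  apply: (@eqv_trans (zrow X r b)) => //; try exact: Dz.
  by apply: eqv_sym; [exact: Dz|exact: Dz|exact: zrow_eqv].
- by rewrite -(eqv_ipl (DX _) (DX' _) (D_uu _) (e _)).
Qed.

(** For entries P y with y in the range of pi_b the scalar rows hold automatically by [uu_orth], and
    M_b P y = P e makes the two rows explicit. *)
Lemma sysm_evolved y e r p : (forall b, spanned b (y b)) ->
  (forall b, evolved b L (y b) (e b)) -> (forall b, D (p b)) ->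
  sysm (fun b => P (y b)) r p <-> forall b, eqv (P (y b) + P (e (~~ b)) + cc b r) (p b).
Proof.
move=> Hy He Dp; have Dy b := DP (spanned_D (Hy b)); have De b := DP (spanned_D (He b).1).
have Dc b := (RP_cc b r).1.
have Dz b : D (zrow (fun b => P (y b)) r b).
  by apply: dom_add => //; apply: dom_add => //; case: (RP_M (~~ b) L0 (Dy (~~ b))).
have Dt b : D (P (y b) + P (e (~~ b)) + cc b r) by apply: dom_add => //; exact: dom_add.
have E1 b : eqv (zrow (fun b => P (y b)) r b) (P (y b) + P (e (~~ b)) + cc b r).
  have DM := (RP_M (~~ b) L0 (Dy (~~ b))).1.
  apply: eqvD => //; [exact: dom_add|exact: dom_add| |exact: eqv_refl].
  by apply: eqvD => //; [exact: eqv_refl|exact: M_P].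
split=> [/(sysmP _ Dy Dp)[H _] b|H].
- by apply: (@eqv_trans (zrow (fun b => P (y b)) r b)) => //; exact: eqv_sym.
- apply/(sysmP _ Dy Dp); split=> [b|j]; last exact: uu_orth.
  exact: eqv_trans (E1 b) (H b).
Qed.

Lemma sysm_PB X r p : (forall b, RP (X b)) -> (forall b, D (p b)) ->
  (forall b, [\/ ctl, (exists j, sg j = b) | ~ ctl /\ 0 < pm R b * hh Ph Ph]) ->
  sysm X r p -> forall b, eqv (P (B b (X b))) (X b).
Proof.
move=> HX Dp Hc /(sysmP _ (fun b => (HX b).1) Dp)[_ H] b; apply: PB_id => //.
by case: (Hc b) => [?|[j <-]|?]; [exact: Or31|exact: Or32|exact: Or33].
Qed.

(** * Perturbation argument for small M_b *)

Section invertibility.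
Hypothesis RP_complete : forall u : nat -> E, (forall n, RP (u n)) ->
  (exists C : R, forall n, nrm (u n - u n.+1) <= C * 2^-1 ^+ n) ->
  exists2 x, RP x & tendsto u x.
Variables (eta K U : R).
Hypothesis eta0 : 0 <= eta.
Hypothesis K0 : 0 <= K.
Hypothesis U0 : 0 <= U.
Hypothesis M_eta : forall b x y, D x -> D y ->
  nrm (M b L x - M b L y) <= eta * nrm (x - y).
Hypothesis uu_U : forall b, nrm (uu b) <= U.
Hypothesis smat_onto : forall t, exists r, forall j, smat r j = t j.
Hypothesis smat_inj : forall r, \sum_j `|r j| <= K * \sum_j `|smat r j|.
Hypothesis cc_bound : forall b r, nrm (cc b r) <= K * \sum_j `|smat r j|.
(** The variation of the real unknowns counts three times, for itself and in the two columns [cc].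
    Each time it is at most K times a sum over the k scalar rows, of size eta U times the variation
    of X. *)
Hypothesis small : eta * (1 + 3 * K * k%:R * U) <= 2^-1.

Definition bdist (X Y : (bool -> E) * ('I_k -> R)) : R :=
  nrm (X.1 false - Y.1 false) + nrm (X.1 true - Y.1 true) + \sum_j `|X.2 j - Y.2 j|.

(** The scalar rows determine r from their right-hand side and the M terms. The slack [tau] is 0 in
    the fixed point iteration, and the defect of the scalar rows in the a priori estimate. *)
Lemma smat_M_bound X X' r r' (t : 'I_k -> R) (tau : R) :
  (forall b, RP (X b)) -> (forall b, RP (X' b)) ->
  (forall j, smat r j - smat r' j = t j -
    ip (M (~~ sg j) L (X (~~ sg j)) - M (~~ sg j) L (X' (~~ sg j))) (uu (sg j))) ->
  \sum_j `|t j| <= tau ->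
  \sum_j `|smat (fun j => r j - r' j) j| <=
    tau + k%:R * (eta * U * (nrm (X false - X' false) + nrm (X true - X' true))).
Proof.
move=> HX HX' Hs Ht; set d := nrm _ + nrm _.
apply: (@le_trans _ _ (\sum_(j < k) (`|t j| + eta * U * d))); last first.
  by rewrite big_split/= sumr_const card_ord; apply: lerD => //; rewrite mulr_natl.
apply: ler_sum => j _; rewrite -smatB Hs; apply: le_trans (ler_normB _ _) _.
rewrite lerD2l; set b := ~~ sg j; have DM Y (HY : forall b, RP (Y b)) := (RP_M b L0 (HY b).1).1.
apply: le_trans (ip_CS (dom_sub (DM X HX) (DM X' HX')) (D_uu _)) _.
apply: (@le_trans _ _ (eta * nrm (X b - X' b) * U)).
  by apply: ler_pM => //; rewrite ?nrm_ge0//; apply: M_eta; [case: (HX b)|case: (HX' b)].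
rewrite mulrAC ler_wpM2l ?mulr_ge0//.
by rewrite /d; case: (b); rewrite ?lerDl ?lerDr nrm_ge0.
Qed.

Lemma bdist_combine (df dt rho ds1 ds2 tau : R) :
  0 <= df -> 0 <= dt ->
  rho <= K * (tau + k%:R * (eta * U * (df + dt))) ->
  ds1 <= K * (tau + k%:R * (eta * U * (df + dt))) ->
  ds2 <= K * (tau + k%:R * (eta * U * (df + dt))) ->
  eta * df + eta * dt + (rho + ds1 + ds2) <= 2^-1 * (df + dt) + 3 * K * tau.
Proof.
move=> d1 d2; rewrite -mulrDr; move: (df + dt) (addr_ge0 d1 d2) => d d0.
rewrite (mulrDr K) => h1 h2 h3; have := ler_wpM2r d0 small.
have -> : eta * (1 + 3 * K * k%:R * U) * d = eta * d + 3 * (K * (k%:R * (eta * U * d))) by ring.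
have -> : 3 * K * tau = 3 * (K * tau) by ring.
move: h1 h2 h3; move: (K * (k%:R * (eta * U * d))) (K * tau) (eta * d) (2^-1 * d) => p q r' s.
by move=> h1 h2 h3 h4; lra.
Qed.

(** Adding the two row estimates leaves half of df + dt on the right, which is absorbed on the left;
    this doubles the constant. *)
Lemma bdist_final (df dt zf zt tau rho cf ct : R) : 0 <= tau -> 0 <= zf -> 0 <= zt ->
  0 <= rho -> dt <= zt + eta * df + ct -> df <= zf + eta * dt + cf ->
  eta * df + eta * dt + (rho + cf + ct) <= 2^-1 * (df + dt) + 3 * K * tau ->
  df + dt + rho <= 2 * (1 + 3 * K) * (zf + zt + tau).
Proof.
move=> t0 f0 g0 r0 h1 h2 h3.
have k1 : 0 <= K * zf := mulr_ge0 K0 f0; have k2 : 0 <= K * zt := mulr_ge0 K0 g0.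
have -> : 2 * (1 + 3 * K) * (zf + zt + tau) =
  2 * (zf + zt + tau) + 6 * (K * zf) + 6 * (K * zt) + 2 * (3 * K * tau) by ring.
lra.
Qed.

Lemma bdist_apriori X X' r r' : (forall b, RP (X b)) -> (forall b, RP (X' b)) ->
  bdist (X, r) (X', r') <= 2 * (1 + 3 * K) *
    bdist (zrow X r, zscal X r) (zrow X' r', zscal X' r').
Proof.
move=> HX HX'; rewrite /bdist/=.
set df := nrm (X false - X' false); set dt := nrm (X true - X' true).
set zf := nrm (zrow X r false - _); set zt := nrm (zrow X r true - _).
set tau := \sum_j `|zscal X r j - zscal X' r' j|.
have Hs := @smat_M_bound X X' r r' (fun j => zscal X r j - zscal X' r' j) tau HX HX' _ (lexx _).
have {}Hs := Hs _.
have {}Hs : \sum_j `|smat (fun j => r j - r' j) j| <= tau + k%:R * (eta * U * (df + dt)).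
  apply: Hs => j; rewrite ipBl; last exact: D_uu.
  - by rewrite /zscal; ring.
  - by case: (RP_M (~~ sg j) L0 (HX (~~ sg j)).1).
  - by case: (RP_M (~~ sg j) L0 (HX' (~~ sg j)).1).
have Hk x : x <= K * \sum_j `|smat (fun j => r j - r' j) j| ->
    x <= K * (tau + k%:R * (eta * U * (df + dt))).
  by move=> H; apply: le_trans H _; rewrite ler_wpM2l.
have row b : nrm (X b - X' b) <= nrm (zrow X r b - zrow X' r' b) +
    eta * nrm (X (~~ b) - X' (~~ b)) + nrm (cc b (fun j => r j - r' j)).
  have DM Y (HY : forall b, RP (Y b)) := (RP_M (~~ b) L0 (HY (~~ b)).1).1.
  have Dz Y s (HY : forall b, RP (Y b)) := (RP_zrow s b HY).1.
  have -> : X b - X' b = (zrow X r b - zrow X' r' b) -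
      (M (~~ b) L (X (~~ b)) - M (~~ b) L (X' (~~ b))) - cc b (fun j => r j - r' j).
    by rewrite -ccB /zrow; exact: sub_row.
  have D1 := dom_sub (Dz X r HX) (Dz X' r' HX'); have D2 := dom_sub (DM X HX) (DM X' HX').
  have D3 := (RP_cc b (fun j => r j - r' j)).1.
  apply: le_trans (nrmD (dom_sub D1 D2) (dom_opp D3)) _; rewrite nrmN// lerD2r.
  apply: le_trans (nrmD D1 (dom_opp D2)) _; rewrite nrmN// lerD2l.
  by apply: M_eta; [case: (HX (~~ b))|case: (HX' (~~ b))].
have h3 := bdist_combine (nrm_ge0 _ : 0 <= df) (nrm_ge0 _ : 0 <= dt) (Hk _ (smat_inj _))
  (Hk _ (cc_bound false _)) (Hk _ (cc_bound true _)).
apply: (bdist_final _ _ _ _ (row true) (row false) h3); rewrite ?nrm_ge0//; exact: sumr_ge0.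
Qed.

Lemma bdist_ge0 X Y : 0 <= bdist X Y.
Proof. by rewrite !addr_ge0 ?nrm_ge0// sumr_ge0. Qed.

Lemma block_onto q t : (forall b, RP (q b)) -> exists X r,
  [/\ forall b, RP (X b), forall b, eqv (zrow X r b) (q b) & forall j, zscal X r j = t j].
Proof.
move=> Hq; have [S HS] := boolp.choice smat_onto.
pose T := ((bool -> E) * ('I_k -> R))%type.
pose cond (Y : T) := forall b, RP (Y.1 b).
(* The iteration: the scalar rows are solved for the real unknowns with the old X, then each row
   gives its own new entry. The choice function [S] enters only through differences of [smat], which
   [smat_inj] and [cc_bound] control. *)
pose sol (Y : T) := S (fun j => t j - ip (M (~~ sg j) L (Y.1 (~~ sg j))) (uu (sg j))).
pose F (Y : T) : T :=
  (fun b => q b - M (~~ b) L (Y.1 (~~ b)) - cc b (sol Y), sol Y).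
have RM b Y : cond Y -> RP (M b L (Y.1 b)) by move=> HY; apply: RP_M => //; case: (HY b).
have condF Y : cond Y -> cond (F Y).
  by move=> HY b /=; apply: RPB; [apply: RPB => //; exact: RM|exact: RP_cc].
have d0 Y Z : cond Y -> cond Z -> 0 <= bdist Y Z by move=> _ _; exact: bdist_ge0.
have dC Y Z : cond Y -> cond Z -> bdist Y Z = bdist Z Y.
  move=> HY HZ; rewrite /bdist; congr (_ + _ + _).
  + by rewrite nrmB//; [case: (HY false)|case: (HZ false)].
  + by rewrite nrmB//; [case: (HY true)|case: (HZ true)].
  + by apply: eq_bigr => j _; rewrite distrC.
have dT Y Z W : cond Y -> cond Z -> cond W -> bdist Y W <= bdist Y Z + bdist Z W.
  move=> HY HZ HW; rewrite /bdist.
  have := nrm_triangle (HY false).1 (HW false).1 (HZ false).1.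
  have := nrm_triangle (HY true).1 (HW true).1 (HZ true).1.
  have : \sum_j `|Y.2 j - W.2 j| <= \sum_j `|Y.2 j - Z.2 j| + \sum_j `|Z.2 j - W.2 j|.
    by rewrite -big_split; apply: ler_sum => j _; exact: ler_distD.
  move: (nrm _) (nrm _) (nrm _) (nrm _) (nrm _) (nrm _) => *; lra.
have dcompl (u : nat -> T) : (forall n, cond (u n)) ->
    (exists C : R, forall n, bdist (u n) (u n.+1) <= C * 2^-1 ^+ n) ->
    exists2 x, cond x & bdist (u n) x @[n --> \oo] --> 0.
  move=> Hu [C HC].
  have hb b n : nrm ((u n).1 b - (u n.+1).1 b) <= bdist (u n) (u n.+1).
    by rewrite /bdist; case: b; [rewrite addrAC lerDr|rewrite -addrA lerDl];
      rewrite addr_ge0 ?nrm_ge0 ?sumr_ge0.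
  have hr j n : `|(u n).2 j - (u n.+1).2 j| <= bdist (u n) (u n.+1).
    rewrite /bdist (bigD1 j)//= addrCA lerDl.
    by rewrite !addr_ge0 ?nrm_ge0 ?sumr_ge0.
  have xE b : exists x, RP x /\ tendsto (fun n => (u n).1 b) x.
    have [|x ? ?] := RP_complete (fun n => Hu n b); last by exists x.
    by exists C => n; exact: le_trans (hb b n) (HC n).
  have rE j : exists l : R, (u n).2 j @[n --> \oo] --> l.
    by apply: (@geometric_cvg _ _ C) => n; exact: le_trans (hr j n) (HC n).
  have [x Hx] := boolp.choice xE; have [l Hl] := boolp.choice rE.
  exists (x, l); first by move=> b; case: (Hx b).
  rewrite /bdist -[X in _ --> X]addr0; apply: cvgD.
    by rewrite -[X in _ --> X]addr0; apply: cvgD; [case: (Hx false)|case: (Hx true)].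
  suff H j : `|(u n).2 j - l j| @[n --> \oo] --> (0 : R).
    by have := @cvg_sum_ord R k (fun n j => `|(u n).2 j - l j|) (fun=> 0) H; rewrite big1_eq.
  have := Hl j; move/cvgrPdist_le => H.
  apply/cvgrPdist_le => e /H [N _ NH]; exists N => // n /NH /=.
  by rewrite sub0r normrN normr_id distrC.
have dF Y Z : cond Y -> cond Z -> bdist (F Y) (F Z) <= 2^-1 * bdist Y Z.
  move=> HY HZ; rewrite /F /bdist /=.
  set df := nrm (Y.1 false - Z.1 false); set dt := nrm (Y.1 true - Z.1 true).
  have Hs : \sum_j `|smat (fun j => sol Y j - sol Z j) j| <=
      0 + k%:R * (eta * U * (df + dt)).
    apply: (@smat_M_bound Y.1 Z.1 (sol Y) (sol Z) (fun=> 0) 0) => // [j|]; last first.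
      by rewrite big1// => j _; rewrite normr0.
    rewrite !HS ipBl; [by ring|by case: (RM (~~ sg j) Y HY)|by case: (RM (~~ sg j) Z HZ)|].
    exact: D_uu.
  have Hk x : x <= K * \sum_j `|smat (fun j => sol Y j - sol Z j) j| ->
      x <= K * (0 + k%:R * (eta * U * (df + dt))).
    by move=> H; apply: le_trans H _; rewrite ler_wpM2l.
  have row b : nrm (q b - M (~~ b) L (Y.1 (~~ b)) - cc b (sol Y) -
      (q b - M (~~ b) L (Z.1 (~~ b)) - cc b (sol Z))) <=
      eta * nrm (Y.1 (~~ b) - Z.1 (~~ b)) + nrm (cc b (fun j => sol Y j - sol Z j)).
    have DY := (RM (~~ b) Y HY).1; have DZ' := (RM (~~ b) Z HZ).1.
    rewrite -ccB; set cY := cc b (sol Y); set cZ := cc b (sol Z).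
    have Dc := (RP_cc b (sol Y)).1; have Dc' := (RP_cc b (sol Z)).1.
    have -> : q b - M (~~ b) L (Y.1 (~~ b)) - cY - (q b - M (~~ b) L (Z.1 (~~ b)) - cZ) =
      - (M (~~ b) L (Y.1 (~~ b)) - M (~~ b) L (Z.1 (~~ b))) - (cY - cZ).
      rewrite opprD addrACA -(opprD cY); congr (_ + _).
      by rewrite opprD addrACA subrr add0r opprD.
    apply: le_trans (nrmD (dom_opp (dom_sub DY DZ')) (dom_opp (dom_sub Dc Dc'))) _.
    rewrite !nrmN//; try exact: dom_sub.
    by rewrite lerD2r; apply: M_eta; [case: (HY (~~ b))|case: (HZ (~~ b))].
  have := bdist_combine (nrm_ge0 _ : 0 <= df) (nrm_ge0 _ : 0 <= dt) (Hk _ (smat_inj _))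
    (Hk _ (cc_bound false _)) (Hk _ (cc_bound true _)).
  have := row false; have := row true; rewrite /= -/df -/dt !mulr0 addr0.
  set rho := \sum_j _; have r0 : 0 <= rho by exact: sumr_ge0.
  rewrite (mulrDr 2^-1).
  move: (nrm _) (nrm _) (nrm _) (nrm _) => a1 a2 a3 a4 h1 h2 h3.
  apply: (@le_trans _ _ (2^-1 * (df + dt))); first by rewrite mulrDr; lra.
  by apply: ler_wpM2l; [rewrite invr_ge0|rewrite lerDl sumr_ge0].
have c0 : cond (fun=> 0, fun=> 0) by move=> b; exact: RP_0.
have [Y HY F0] := contraction_fixpoint d0 dC dT dcompl condF dF c0.
have Z3 (x y z : R) : 0 <= x -> 0 <= y -> 0 <= z -> x + y + z = 0 -> [/\ x = 0, y = 0 & z = 0].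
  by move=> *; split; lra.
have [n1 n2 n3] := Z3 _ _ _ (nrm_ge0 _) (nrm_ge0 _) (sumr_ge0 _ (fun j _ => normr_ge0 _)) F0.
have HF := condF Y HY.
have eX b : eqv ((F Y).1 b) (Y.1 b).
  by apply/eqv_nrm; [case: (HF b)|case: (HY b)|case: b].
have er j : sol Y j = Y.2 j.
  move/eqP: n3; rewrite psumr_eq0// => /allP /(_ j).
  by rewrite mem_index_enum => /(_ isT) /eqP/normr0_eq0/eqP; rewrite subr_eq0 => /eqP.
(* [sol Y] is taken instead of [Y.2], to which it is equal, because it satisfies the scalar rows by
   construction. *)
exists Y.1, (sol Y); split => // [b|j]; last first.
  by rewrite /zscal HS addrC subrK.
have Dm := (RM (~~ b) Y HY).1; have Dc := (RP_cc b (sol Y)).1; have Db := (HF b).1.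
have DY := (HY b).1.
have -> : q b = (F Y).1 b + M (~~ b) L (Y.1 (~~ b)) + cc b (sol Y).
  by rewrite /= [_ - cc _ _ + _]addrAC !subrK.
apply: eqvD => //; [exact: dom_add|exact: dom_add| |exact: eqv_refl].
by apply: eqvD => //; [apply: eqv_sym|exact: eqv_refl].
Qed.

End invertibility.
End block.
Definition well_posed k (sg : 'I_k -> bool) (g : bool -> 'I_k -> E) L :=
  (exists C : R, forall X X' r r', (forall b, RP (X b)) -> (forall b, RP (X' b)) ->
    bdist (X, r) (X', r') <= C *
    bdist (zrow g L X r, zscal sg g L X r) (zrow g L X' r', zscal sg g L X' r')) /\
  forall q t, (forall b, RP (q b)) -> exists X r,
    [/\ forall b, RP (X b), forall b, eqv (zrow g L X r b) (q b) &
        forall j, zscal sg g L X r j = t j].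

(** The last clause bounds the columns directly in terms of the scalar rows, and not through r,
    because in the balanced case their entries grow like L while K has to be independent of L. *)
Definition solvable k (sg : 'I_k -> bool) (g : bool -> 'I_k -> E) (K : R) :=
  [/\ forall t, exists r, forall j, smat sg g r j = t j,
      forall r, \sum_j `|r j| <= K * \sum_j `|smat sg g r j| &
      forall b r, nrm (cc g b r) <= K * \sum_j `|smat sg g r j|].

Hypothesis RP_complete : forall u : nat -> E, (forall n, RP (u n)) ->
  (exists C : R, forall n, nrm (u n - u n.+1) <= C * 2^-1 ^+ n) ->
  exists2 x, RP x & tendsto u x.

Lemma well_posed_large k (sg : 'I_k -> bool) (g : R -> bool -> 'I_k -> E) (K L1 : R) :
  0 <= K -> (forall L b j, RP (g L b j)) -> (forall L, L1 < L -> solvable sg (g L) K) ->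
  exists L0 : R, forall L, 0 < L -> L0 < L -> well_posed sg (g L) L.
Proof.
move=> K0 Hg Hs; pose U := nrm (uu false) + nrm (uu true).
have U0 : 0 <= U by rewrite addr_ge0 ?nrm_ge0.
have uU b : nrm (uu b) <= U by rewrite /U; case: b; rewrite ?lerDl ?lerDr nrm_ge0.
pose c := 1 + 3 * K * k%:R * U.
have c0 : 0 < c by rewrite ltr_wpDr// !mulr_ge0.
have e0 : 0 < 2^-1 / c by rewrite divr_gt0// invr_gt0.
have [L0 HL0] := M_contracting e0; exists (Order.max L0 L1) => L Lp.
rewrite gt_max => /andP[LL0 LL1]; have [onto inj ccb] := Hs L LL1.
have Me b x y : D x -> D y -> nrm (M b L x - M b L y) <= 2^-1 / c * nrm (x - y).
  by have [_] := HL0 b L Lp LL0; apply.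
have small : 2^-1 / c * (1 + 3 * K * k%:R * U) <= 2^-1 by rewrite -/c divfK// gt_eqF.
split.
- exists (2 * (1 + 3 * K)) => X X' r r' HX HX'.
  by apply: (bdist_apriori Lp (Hg L) (ltW e0) K0 U0 Me uU inj ccb small).
- move=> q t Hq.
  by apply: (block_onto Lp (Hg L) RP_complete (ltW e0) K0 U0 Me uU onto inj ccb small).
Qed.

Lemma solvable0 (sg : 'I_0 -> bool) g : solvable sg g 0.
Proof.
split=> [t|r|b r]; first by exists t => -[].
  by rewrite big_ord0 mul0r.
by rewrite mul0r /cc big_ord0 /nrm ip0l// sqrtr0.
Qed.

(** The scalar part is the single number (Ph | u) = (u | u), and the column is a multiple of Ph
    whatever L is. *)
Lemma solvable1 (b0 : bool) : 0 < ip (uu b0) (uu b0) ->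
  exists2 K : R, 0 <= K & solvable (fun _ : 'I_1 => b0) (fun _ _ => Ph) K.
Proof.
move=> u0; have a0 := u0; rewrite -ip_Ph_uu in a0.
set al := ip Ph (uu b0) in a0; have aN : al != 0 by rewrite gt_eqF.
have sE (r : 'I_1 -> R) j : smat (fun=> b0) (fun _ _ => Ph) r j = r ord0 * al.
  by rewrite /smat big_ord1.
have n0 := nrm_ge0 Ph.
have rE (r : 'I_1 -> R) : `|r ord0| = al^-1 * `|r ord0 * al|.
  by rewrite normrM (ger0_norm (ltW a0)) mulrC mulfK.
have a1 : 0 <= al^-1 by rewrite invr_ge0 ltW.
exists (al^-1 * (1 + nrm Ph)); first by rewrite mulr_ge0 ?addr_ge0.
split=> [t|r|b r].
- by exists (fun=> t ord0 / al) => j; rewrite sE divfK// (ord1 j).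
- rewrite !big_ord1 sE {1}rE; apply: ler_wpM2r => //.
  by rewrite ler_peMr// lerDl.
- rewrite /cc !big_ord1 sE nrmZ// rE mulrAC; apply: ler_wpM2r => //.
  by rewrite ler_wpM2l// lerDr.
Qed.

Lemma M_0 b L : 0 < L -> eqv (M b L 0) 0.
Proof.
move=> L0; have S0 : spanned b 0.
  by split => // e e0; exists 0%N, (fun=> 0); rewrite /psum big_ord0 subr0 /nrm ip0l// sqrtr0.
have E0 : evolved b L 0 0 by split=> // n; rewrite /coef ip0l// mul0r.
by have := M_P L0 S0 E0; rewrite P_zero.
Qed.

Lemma zrow_0 k (g : bool -> 'I_k -> E) L b : 0 < L ->
  (forall b j, RP (g b j)) -> eqv (zrow g L (fun=> 0) (fun=> 0) b) 0.
Proof.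
move=> L0 Hg; rewrite /zrow add0r.
have -> : cc g b (fun=> 0) = 0 by rewrite /cc big1// => j _; rewrite scale0r.
by rewrite addr0; exact: M_0.
Qed.

Lemma zscal_eqv k (sg : 'I_k -> bool) (g : bool -> 'I_k -> E) L X X' r j : 0 < L ->
  (forall b, D (X b)) -> (forall b, D (X' b)) -> (forall b, eqv (X b) (X' b)) ->
  zscal sg g L X r j = zscal sg g L X' r j.
Proof.
move=> L0 DX DX' e; rewrite /zscal; congr (_ + _); apply: eqv_ipl; last exact: M_eqv.
- by case: (RP_M (~~ sg j) L0 (DX (~~ sg j))).
- by case: (RP_M (~~ sg j) L0 (DX' (~~ sg j))).
- exact: D_uu.
Qed.

Lemma bdist_eq0 k (X X' : bool -> E) (r r' : 'I_k -> R) :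
  (forall b, D (X b)) -> (forall b, D (X' b)) ->
  bdist (X, r) (X', r') <= 0 <-> (forall b, eqv (X b) (X' b)) /\ forall j, r j = r' j.
Proof.
move=> DX DX'; rewrite /bdist/=; have s0 : 0 <= \sum_j `|r j - r' j| by exact: sumr_ge0.
split=> [H|[e er]]; last first.
  have n b : nrm (X b - X' b) = 0 by apply/eqv_nrm.
  by rewrite !n !add0r big1// => j _; rewrite er subrr normr0.
have n0 := nrm_ge0 (X false - X' false); have n1 := nrm_ge0 (X true - X' true).
have [e0 e1 e2] : [/\ nrm (X false - X' false) = 0, nrm (X true - X' true) = 0 &
    \sum_j `|r j - r' j| = 0] by split; lra.
split=> [b|j]; first by apply/eqv_nrm => //; case: b.
move/eqP: e2; rewrite psumr_eq0// => /allP /(_ j).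
by rewrite mem_index_enum => /(_ isT) /eqP/normr0_eq0/eqP; rewrite subr_eq0 => /eqP.
Qed.

Lemma well_posed_inj k (sg : 'I_k -> bool) (g : bool -> 'I_k -> E) L X X' r r' : 0 < L ->
  (forall b j, RP (g b j)) -> well_posed sg g L -> (forall b, RP (X b)) -> (forall b, RP (X' b)) ->
  (forall b, eqv (zrow g L X r b) (zrow g L X' r' b)) /\
    (forall j, zscal sg g L X r j = zscal sg g L X' r' j) <->
  (forall b, eqv (X b) (X' b)) /\ forall j, r j = r' j.
Proof.
move=> L0 Hg [[C HC] _] HX HX'; have DX b := (HX b).1; have DX' b := (HX' b).1.
split=> [H|[e er]]; last first.
  have -> : r = r' by apply/funext.
  by split=> [b|j]; [exact: zrow_eqv|exact: zscal_eqv].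
apply/(bdist_eq0 r r' DX DX'); apply: le_trans (HC _ _ _ _ HX HX') _.
have D1 b := (RP_zrow L0 Hg r b HX).1; have D2 b := (RP_zrow L0 Hg r' b HX').1.
have h := (bdist_eq0 (zscal sg g L X r) (zscal sg g L X' r') D1 D2).2 H.
have -> : bdist (zrow g L X r, zscal sg g L X r) (zrow g L X' r', zscal sg g L X' r') = 0.
  by apply/eqP; rewrite eq_le h bdist_ge0.
by rewrite mulr0.
Qed.

(** The a priori estimate against the zero entry, whose image is zero up to null vectors. *)
Lemma well_posed_bound k (sg : 'I_k -> bool) (g : bool -> 'I_k -> E) L : 0 < L ->
  (forall b j, RP (g b j)) -> well_posed sg g L -> exists C : R, forall X r,
  (forall b, RP (X b)) -> nrm (X false) + nrm (X true) + \sum_j `|r j| <=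
  C * (nrm (zrow g L X r false) + nrm (zrow g L X r true) + \sum_j `|zscal sg g L X r j|).
Proof.
move=> L0 Hg [[C HC] _]; exists C => X r HX.
have H0 (b : bool) : RP ((fun=> 0) b) by exact: RP_0.
have := HC X (fun=> 0) r (fun=> 0) HX H0; rewrite /bdist/= !subr0.
have Dz b : D (zrow g L X r b) := (RP_zrow L0 Hg r b HX).1.
have Dz0 b : D (zrow g L (fun=> 0) (fun=> 0) b) := (RP_zrow L0 Hg (fun=> 0) b H0).1.
have z b : nrm (zrow g L X r b - zrow g L (fun=> 0) (fun=> 0) b) = nrm (zrow g L X r b).
  apply: eqv_nrmE => //; [exact: dom_sub|].
  rewrite -[X in eqv _ X]subr0; apply: eqvB => //; [exact: eqv_refl|exact: zrow_0].
have s j : zscal sg g L (fun=> 0) (fun=> 0) j = 0.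
  rewrite /zscal /smat big1 ?addr0; last by move=> i _; rewrite mul0r.
  have Dm : D (M (~~ sg j) L 0) by case: (RP_M (~~ sg j) L0 D0).
  by rewrite (eqv_ipl Dm D0 (D_uu _) (M_0 _ L0)) ip0l//; exact: D_uu.
rewrite !z; under eq_bigr do rewrite subr0; under [in X in _ <= X -> _]eq_bigr do rewrite s subr0.
by [].
Qed.

Variable T : E.
Hypothesis RPT : RP T.

Definition sg2 (j : 'I_2) : bool := j != ord0.
(** The second column is the trace of z + Delta_sigma^-1 h at the end of sign [b], with T standing
    for (Delta_sigma^-1 h, 0). *)
Definition g2 L b (j : 'I_2) : E := if j == ord0 then Ph else (pm R b * L) *: Ph + T.

Lemma sum2 (V : nmodType) (F : 'I_2 -> V) : \sum_j F j = F ord0 + F ord_max.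
Proof.
by rewrite big_ord_recl big_ord1; congr (_ + F _); apply: val_inj.
Qed.

(** Dividing the rows by a0 and a1 gives r1 - L r2 and r1 + L r2 up to errors C^2 |r2|. Their
    difference is 2 L r2, and L > 2 C^2 absorbs the errors. The combinations r1 -+ L r2 are the
    coefficients of Ph in the two columns, which is why they are bounded uniformly in L. *)
Lemma solve2_bound (L a0 a1 b0 b1 r1 r2 s0 s1 C : R) : 0 < a0 -> 0 < a1 ->
  a0^-1 <= C -> a1^-1 <= C -> `|b0| <= C -> `|b1| <= C -> 2 * C * C + 1 < L ->
  s0 = r1 * a0 + r2 * (- L * a0 + b0) -> s1 = r1 * a1 + r2 * (L * a1 + b1) ->
  [/\ L * `|r2| <= C * (`|s0| + `|s1|),
      `|r1 - L * r2| <= C * `|s0| + C * C * `|r2| &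
      `|r1 + L * r2| <= C * `|s1| + C * C * `|r2|].
Proof.
move=> a00 a10 c0 c1 B0 B1 HL E0 E1.
have C0 : 0 <= C by apply: le_trans c0; rewrite invr_ge0 ltW.
have F0 : r1 - L * r2 = s0 / a0 - b0 / a0 * r2 by rewrite E0; field; rewrite gt_eqF.
have F1 : r1 + L * r2 = s1 / a1 - b1 / a1 * r2 by rewrite E1; field; rewrite gt_eqF.
have n (s a : R) : 0 < a -> a^-1 <= C -> `|s / a| <= C * `|s|.
  move=> ap ac; rewrite normrM mulrC [X in X * _]ger0_norm ?invr_ge0 ?(ltW ap)//.
  exact: ler_wpM2r.
have m (b a : R) : 0 < a -> a^-1 <= C -> `|b| <= C -> `|b / a * r2| <= C * C * `|r2|.
  move=> ap ac bc; rewrite normrM ler_wpM2r//; apply: le_trans (n _ _ ap ac) _.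
  by rewrite ler_wpM2l.
have G0 : `|r1 - L * r2| <= C * `|s0| + C * C * `|r2|.
  by rewrite F0; apply: le_trans (ler_normB _ _) _; apply: lerD; [exact: n|exact: m].
have G1 : `|r1 + L * r2| <= C * `|s1| + C * C * `|r2|.
  by rewrite F1; apply: le_trans (ler_normB _ _) _; apply: lerD; [exact: n|exact: m].
split => //.
have : `|2 * L * r2| <= `|r1 + L * r2| + `|r1 - L * r2|.
  have -> : 2 * L * r2 = (r1 + L * r2) - (r1 - L * r2) by ring.
  exact: ler_normB.
have L0 : 0 <= L by apply: le_trans (ltW HL); rewrite addr_ge0// !mulr_ge0.
rewrite !normrM (ger0_norm L0) normr_nat => H.
have CC : 2 * C * C * `|r2| <= L * `|r2|.
  by rewrite ler_wpM2r//; apply: le_trans (ltW HL); rewrite lerDl.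
move: H G0 G1 CC; rewrite -!mulrA (mulrDr C); move: (C * `|s0|) (C * `|s1|) (C * (C * `|r2|)) (L * `|r2|).
move=> p q r s; move: `|r1 + L * r2| `|r1 - L * r2| => x y.
by lra.
Qed.

Lemma solvable2 : 0 < ip (uu false) (uu false) -> 0 < ip (uu true) (uu true) ->
  exists2 K : R, 0 <= K & exists L1 : R, forall L, L1 < L -> solvable sg2 (g2 L) K.
Proof.
move=> u0 u1; have a0 := u0; have a1 := u1; rewrite -ip_Ph_uu in a0; rewrite -ip_Ph_uu in a1.
set al0 := ip Ph (uu false) in a0; set al1 := ip Ph (uu true) in a1.
pose b0 := ip T (uu false); pose b1 := ip T (uu true); have DT := RPT.1.
pose C := al0^-1 + al1^-1 + `|b0| + `|b1| + 1.
have i0 : 0 < al0^-1 by rewrite invr_gt0.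
have i1 : 0 < al1^-1 by rewrite invr_gt0.
have n0 := normr_ge0 b0; have n1 := normr_ge0 b1.
have C1 : 1 <= C by rewrite /C; lra.
have C0 : 0 <= C by lra.
have c0 : al0^-1 <= C by rewrite /C; lra.
have c1 : al1^-1 <= C by rewrite /C; lra.
have c2 : `|b0| <= C by rewrite /C; lra.
have c3 : `|b1| <= C by rewrite /C; lra.
clearbody C.
have sE0 L r : smat sg2 (g2 L) r ord0 = r ord0 * al0 + r ord_max * (- L * al0 + b0).
  by rewrite /smat sum2 /g2/= /sg2 eqxx/= /pm mulN1r ip_lin//; exact: D_uu.
have sE1 L r : smat sg2 (g2 L) r ord_max = r ord0 * al1 + r ord_max * (L * al1 + b1).
  by rewrite /smat sum2 /g2/= /sg2/= /pm mul1r ip_lin//; exact: D_uu.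
have N0 := nrm_ge0 Ph; have NT := nrm_ge0 T.
(* The bound C s + C^2 |r2| of [solve2_bound] with |r2| <= C s, which holds since L >= 1. *)
pose W := C + C * C * C.
have CC0 : 0 <= C * C := mulr_ge0 C0 C0.
have W0 : 0 <= W by rewrite /W addr_ge0// mulr_ge0.
have K0 : 0 <= W * nrm Ph + C * nrm T + W + C + C.
  by have := mulr_ge0 W0 N0; have := mulr_ge0 C0 NT; lra.
exists (W * nrm Ph + C * nrm T + W + C + C) => //.
exists (2 * C * C + 1) => L HL.
have L1 : 1 <= L by apply: le_trans (ltW HL); rewrite lerDr !mulr_ge0.
have main r : let s := \sum_j `|smat sg2 (g2 L) r j| in
  [/\ `|r ord_max| <= C * s, L * `|r ord_max| <= C * s, `|r ord0 - L * r ord_max| <= W * s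
    & `|r ord0 + L * r ord_max| <= W * s].
  move=> s; have sE : s = `|smat sg2 (g2 L) r ord0| + `|smat sg2 (g2 L) r ord_max|.
    by rewrite /s sum2.
  have [h1 h2 h3] := solve2_bound a0 a1 c0 c1 c2 c3 HL (sE0 L r) (sE1 L r).
  rewrite -sE in h1.
  have p0 := normr_ge0 (smat sg2 (g2 L) r ord0); have p1 := normr_ge0 (smat sg2 (g2 L) r ord_max).
  have k1 : `|r ord_max| <= C * s by apply: le_trans h1; rewrite ler_peMl.
  have k2 : C * C * `|r ord_max| <= C * C * C * s.
    by rewrite -[X in _ <= X]mulrA; exact: ler_wpM2l.
  split => //.
  - apply: le_trans h2 _; rewrite /W mulrDl; apply: lerD => //.
    by apply: ler_wpM2l => //; rewrite sE lerDl.
  - apply: le_trans h3 _; rewrite /W mulrDl; apply: lerD => //.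
    by apply: ler_wpM2l => //; rewrite sE lerDr.
clearbody W; split=> [t|r|b r].
(* The determinant of the scalar part. If it were 0, the pair (L al0 - b0, al0) would be a kernel
   vector with nonzero second entry, against the first bound of [solve2_bound]. *)
- pose d := 2 * L * al0 * al1 + (al0 * b1 - al1 * b0).
  have dN : d != 0.
    apply/eqP => d0.
    have e0 : 0 = - (- L * al0 + b0) * al0 + al0 * (- L * al0 + b0) by ring.
    have [h _ _] := solve2_bound a0 a1 c0 c1 c2 c3 HL e0 (erefl _).
    move: h.
    have -> : - (- L * al0 + b0) * al1 + al0 * (L * al1 + b1) = d by rewrite /d; ring.
    rewrite d0 !normr0 addr0 mulr0 leNgt => /negP; apply.
    by rewrite mulr_gt0 ?normr_gt0 ?gt_eqF// (lt_le_trans ltr01).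
  (* Cramer's rule for the second unknown; the first one is then read off from the first row. *)
  pose x2 := (al0 * t ord_max - al1 * t ord0) / d.
  pose x1 := (t ord0 - x2 * (- L * al0 + b0)) / al0.
  exists (fun j => if j == ord0 then x1 else x2) => j.
  have [->|jN] := eqVneq j ord0.
    by rewrite sE0 eqxx/= /x1; field; rewrite gt_eqF.
  have -> : j = ord_max by apply: val_inj => /=; case: j jN => -[|[|]].
  rewrite sE1 eqxx/=; apply: (mulfI (lt0r_neq0 a0)).
  have x2d : x2 * d = al0 * t ord_max - al1 * t ord0 by rewrite divfK.
  have x1a : x1 * al0 = t ord0 - x2 * (- L * al0 + b0) by rewrite divfK ?lt0r_neq0.
  transitivity (al1 * (x1 * al0) + x2 * (al0 * (L * al1 + b1))); first by ring.
  rewrite x1a; transitivity (al1 * t ord0 + x2 * d); first by rewrite /d; ring.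
  by rewrite x2d; ring.
- rewrite [X in X <= _]sum2; have [h1 h2 h3 h4] := main r.
  move: h1 h2 h3 h4; set s := \sum_j _; move=> h1 h2 h3 h4.
  have s0 : 0 <= s by exact: sumr_ge0.
  have h5 : `|r ord0| <= W * s + C * s.
    have -> : r ord0 = (r ord0 - L * r ord_max) + L * r ord_max by ring.
    apply: le_trans (ler_normD _ _) _; apply: lerD => //.
    by rewrite normrM (ger0_norm (le_trans ler01 L1)).
  have x1 : 0 <= W * nrm Ph * s by rewrite !mulr_ge0.
  have x2 : 0 <= C * nrm T * s by rewrite !mulr_ge0.
  rewrite !mulrDl; move: h1 h5 x1 x2; move: (W * nrm Ph * s) (C * nrm T * s) (C * s) (W * s) => *; lra.
- have [h1 h2 h3 h4] := main r; move: h1 h2 h3 h4; set s := \sum_j _; move=> h1 h2 h3 h4.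
  have s0 : 0 <= s by exact: sumr_ge0.
  have -> : cc (g2 L) b r = (r ord0 + pm R b * L * r ord_max) *: Ph + r ord_max *: T.
    rewrite /cc sum2 /g2/= scalerDr scalerA addrA -scalerDl; congr (_ *: _ + _).
    by rewrite mulrC.
  have h : `|r ord0 + pm R b * L * r ord_max| <= W * s.
    by case: (b); rewrite /pm ?mul1r// mulN1r mulNr.
  apply: le_trans (nrmD (dom_scale _ DPh) (dom_scale _ DT)) _; rewrite !nrmZ//.
  have := ler_wpM2r N0 h; have := ler_wpM2r NT h1.
  have x1 : 0 <= W * s by rewrite mulr_ge0.
  have x2 : 0 <= C * s by rewrite mulr_ge0.
  rewrite !mulrDl ![_ * s * _]mulrAC; move: x1 x2.
  move: (W * nrm Ph * s) (C * nrm T * s) (C * s) (W * s) => *; lra.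
Qed.

Variable pr : bool -> E -> E.
Hypothesis prP : forall b x, D x -> is_proj b x (pr b x).
Variable ran : E -> Prop.
Hypothesis ran_D : forall x, ran x -> D x.
Hypothesis ranD : forall x y, ran x -> ran y -> ran (x + y).
Hypothesis spanned_ran : forall b x, spanned b x -> ran x.
Hypothesis ran_decomp : forall x, ran x -> tendsto
  (fun N => \sum_(n < N) (coef true x n *: ph true n + coef false x n *: ph false n)) x.

Lemma pr_spanned b x : D x -> spanned b (pr b x). Proof. by move=> Dx; case: (prP b Dx). Qed.

Lemma pr_eqv b x y : D x -> D y -> eqv x y -> eqv (pr b x) (pr b y).
Proof.
move=> Dx Dy e; apply: (spanned_eq (pr_spanned b Dx) (pr_spanned b Dy)) => n.
by rewrite (is_proj_coef _ Dx (prP b Dx)) (is_proj_coef _ Dy (prP b Dy)); exact: eqv_ipl.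
Qed.

(** P is injective on each range of pi_b, and a vector of the range of A is the sum of its two
    projections. *)
Lemma pr_inj x y : ran x -> ran y -> (forall b, eqv (P (pr b x)) (P (pr b y))) <-> eqv x y.
Proof.
move=> /[dup] Rx /ran_D Dx /[dup] Ry /ran_D Dy; split=> [H|e b]; last first.
  by apply: P_eqv (pr_eqv b Dx Dy e); exact: spanned_D (pr_spanned _ _).
have dec z (Rz : ran z) (Dz : D z) := proj_decomp Dz (prP false Dz) (prP true Dz) (ran_decomp Rz).
have Dp z b (Dz : D z) := spanned_D (pr_spanned b Dz).
have e b : eqv (pr b x) (pr b y) by apply: P_inj (H b); exact: pr_spanned.
apply: (@eqv_trans (pr false x + pr true x)) => //; [by apply: dom_add; exact: Dp|exact: dec|].
apply: (@eqv_trans (pr false y + pr true y)) => //; try by apply: dom_add; exact: Dp.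
  by apply: eqvD => //; exact: Dp.
by apply: eqv_sym => //; [apply: dom_add; exact: Dp|exact: dec].
Qed.

Lemma pr_add y : (forall b, spanned b (y b)) -> forall b, eqv (pr b (y false + y true)) (y b).
Proof.
move=> Hy b; have Dy c := spanned_D (Hy c); have Ds := dom_add (Dy false) (Dy true).
apply: (spanned_eq (pr_spanned b Ds) (Hy b)) => n.
rewrite (is_proj_coef _ Ds (prP b Ds)) /coef ipDl// -!/(coef _ _ _).
by case: b; [rewrite (coef_other n (Hy false)) add0r|rewrite (coef_other n (Hy true)) addr0].
Qed.

(** The vector [e] that reaches the end of sign [b] comes from the modes of the opposite sign. It is
    known only up to null vectors, hence the quantification over all such [e]. *)
Lemma sysm_dirichlet k (sg : 'I_k -> bool) g L r p x : 0 < L -> (forall b j, RP (g b j)) ->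
  (forall b, D (p b)) -> D x -> sysm sg g L (fun b => P (pr b x)) r p <->
  forall b e, evolved (~~ b) L (pr (~~ b) x) e -> eqv (P (pr b x) + P e + cc g b r) (p b).
Proof.
move=> L0 Hg Dp Dx; have Hy b := pr_spanned b Dx.
have ev b : exists e, evolved b L (pr b x) e.
  have [e [He ee] _] := HM b L0 (DP (spanned_D (Hy b))); exists e; split => // n.
  rewrite ee; congr (_ * _); apply: eqv_ipl => //; [|exact: spanned_D (Hy b)|exact: B_P].
  by apply: D_B; apply: DP; exact: spanned_D (Hy b).
have [e He] := boolp.choice ev.
apply: (iff_trans (sysm_evolved sg L0 Hg r Hy He Dp)); split=> H b; last exact: H.
move=> e' He'; have De c := DP (spanned_D (He c).1); have De' := DP (spanned_D He'.1).
have Dy c := DP (spanned_D (Hy c)); have Dc := (RP_cc Hg b r).1.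
apply: eqv_trans (H b) => //; try by apply: dom_add => //; exact: dom_add.
apply: eqvD => //; try exact: dom_add; last exact: eqv_refl.
apply: eqvD => //; first exact: eqv_refl.
apply: P_eqv; [exact: spanned_D He'.1|exact: spanned_D (He (~~ b)).1|].
exact: (evolved_eqv (spanned_D (Hy _)) (spanned_D (Hy _)) (eqv_refl _) He' (He _)).
Qed.

(** The preimage is the sum of the B_b X_b: its projections are these two terms, and P B_b X_b = X_b
    because each sign is settled by control, by a scalar row, or by the sign of the form at Ph. *)
Lemma sysm_onto k (sg : 'I_k -> bool) g L r p X : 0 < L -> (forall b j, RP (g b j)) ->
  (forall b, RP (X b)) -> (forall b, D (p b)) ->
  (forall b, [\/ ctl, (exists j, sg j = b) | ~ ctl /\ 0 < pm R b * hh Ph Ph]) ->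
  sysm sg g L X r p ->
  exists x, [/\ ran x, forall b, eqv (P (pr b x)) (X b) &
                sysm sg g L (fun b => P (pr b x)) r p].
Proof.
move=> L0 Hg HX Dp Hc Hs; pose y b := B b (X b); have DX b := (HX b).1.
have Hy b : spanned b (y b) by exact: B_spanned.
have Dy b := spanned_D (Hy b); have Dx := dom_add (Dy false) (Dy true).
have e b : eqv (P (pr b (y false + y true))) (X b).
  apply: (@eqv_trans (P (y b))) => //; try exact: DP.
  - by apply: DP; exact: spanned_D (pr_spanned b Dx).
  - by apply: P_eqv => //; [exact: spanned_D (pr_spanned b Dx)|exact: pr_add].
  - exact: sysm_PB Hs b.
exists (y false + y true); split => //; first by apply: ranD; exact: spanned_ran (Hy _).
have Dz b : D (P (pr b (y false + y true))).
  by apply: DP; exact: spanned_D (pr_spanned b Dx).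
by apply: sysm_eqv Hs => // b; exact: eqv_sym.
Qed.

End evolution.

End eigenvalues.
End projection.
End orthonormal.
End prehilbert.

(** * Spectral decomposition of the operator *)

#[local] Opaque wpartial xget Rintegral ip.

Lemma cvg_sqrt0 (R : realType) (a : nat -> R) : (forall n, 0 <= a n) ->
  a @ \oo --> 0 -> Num.sqrt (a n) @[n --> \oo] --> 0.
Proof.
move=> a0 C; apply/cvg0P => [n|e e0]; first exact: sqrtr_ge0.
have [N HN] := (cvg0P a0).1 C (e ^+ 2) (exprn_gt0 _ e0); exists N => n /HN H.
by rewrite -(ger0_norm (ltW e0)) -sqrtr_sqr ler_sqrt// sqr_ge0.
Qed.

Section graetz_hilbert.
Context (R : realType) (G : graetz_data R) (hG : graetz_hyp G).
Context (tr : (R * R -> R) -> (R * R -> R)) (htr : trace_operator (omega G) tr).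
Local Notation fn := (R * R -> R).
Local Notation HH := (fn * fn)%type.
Local Notation Om := (omega G).
Local Notation h := (coef_h G).
Local Notation c := (coef_c G).
Local Notation area := (@area R).
Local Notation surf := (@surf R).
Local Notation hOm := (domain_Om hG).
Local Notation mOm := (dom_measurable hOm).
Local Notation L2 := (in_L2 area Om).
Local Notation N2 := (sqn area Om).
Local Notation V := (spaceV G tr).
Local Notation inH := (inH G tr).
Local Notation Heq := (Heq G).
Local Notation ip := (ip G tr).
Local Notation Hnorm := (Hnorm G tr).
Local Notation opP := (@opP R).
Implicit Types (f g s : fn) (x y z : HH).

Lemma lipE : lip G tr = ip.
Proof. by apply/funext => x; apply/funext => y; rewrite lip.unlock. Qed.

Lemma inH_0 : inH 0. Proof. exact: (inH0 hG htr). Qed.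

Lemma inH_linear k x y : inH x -> inH y -> inH (k *: x + y).
Proof. exact: (inH_lin hG htr). Qed.

Lemma ip_sym x y : inH x -> inH y -> ip x y = ip y x.
Proof. by rewrite -lipE; exact: (ipC hG). Qed.

Lemma ip_linear k x x' y : inH x -> inH x' -> inH y ->
  ip (k *: x + x') y = k * ip x y + ip x' y.
Proof. by rewrite -lipE; exact: (ip_lin hG htr). Qed.

Lemma ip_nneg x : inH x -> 0 <= ip x x.
Proof. by rewrite -lipE; exact: (ip_ge0 hG htr). Qed.

Local Notation eqv := (eqv ip).

Lemma heqv_refl x : eqv x x. Proof. exact: (eqv_refl inH_0 ip_linear). Qed.

Lemma heqv_sym x y : inH x -> inH y -> eqv x y -> eqv y x.
Proof. exact: (eqv_sym inH_0 inH_linear ip_sym ip_linear ip_nneg). Qed.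

Lemma heqv_trans y x z : inH x -> inH y -> inH z -> eqv x y -> eqv y z -> eqv x z.
Proof. exact: (eqv_trans inH_0 inH_linear ip_sym ip_linear ip_nneg). Qed.

Lemma heqv_ipl x y z : inH x -> inH y -> inH z -> eqv x y -> ip x z = ip y z.
Proof. exact: (eqv_ipl inH_0 inH_linear ip_sym ip_linear ip_nneg). Qed.

Lemma heqvB x x' y y' : inH x -> inH y -> inH x' -> inH y' -> eqv x y -> eqv x' y' ->
  eqv (x - x') (y - y').
Proof. exact: (eqvB inH_0 inH_linear ip_sym ip_linear ip_nneg). Qed.

Lemma heqv_nrmE x y : inH x -> inH y -> eqv x y -> nrm ip x = nrm ip y.
Proof. exact: (eqv_nrmE inH_0 inH_linear ip_sym ip_linear ip_nneg). Qed.

Lemma Heq_eqv x y : inH x -> inH y -> Heq x y <-> eqv x y.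
Proof. by move=> Hx Hy; have := HeqP hG htr Hx Hy; rewrite lipE. Qed.

Lemma opP_lin k x y : opP (k *: x + y) = k *: opP x + opP y.
Proof. by congr (_, _); rewrite /= scaler0 addr0. Qed.

Lemma opP_selfadjoint x y : inH x -> inH y -> ip (opP x) y = ip x (opP y).
Proof. by rewrite -lipE; exact: (lip_opPC hG htr). Qed.

Lemma opP_idem x : opP (opP x) = opP x. Proof. by []. Qed.

Lemma opP_stable x : inH x -> inH (opP x). Proof. exact: (inH_opP hG htr). Qed.

Lemma opP_Heq f g : L2 f -> L2 g -> eqv (f, 0) (g, 0) <-> f = g %[ae area in Om].
Proof.
move=> Lf Lg; rewrite -Heq_eqv; [|exact: (inH_fst hG htr)|exact: (inH_fst hG htr)].
split=> [[//]|fg]; split => //.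
by split=> _; [exact: aeW|exists 0; apply: aeW => z _; rewrite addr0].
Qed.

Lemma L2_unique (u : nat -> fn) f g : (forall n, L2 (u n)) -> L2 f -> L2 g ->
  N2 (u n - f) @[n --> \oo] --> 0 -> N2 (u n - g) @[n --> \oo] --> 0 ->
  f = g %[ae area in Om].
Proof.
move=> Lu Lf Lg cf cg.
have C : 2 * N2 (u n - f) + 2 * N2 (u n - g) @[n --> \oo] --> (0 : R).
  rewrite -(addr0 0); apply: cvgD.
    by rewrite -(mulr0 2); apply: cvgM => //; exact: cvg_cst.
  by rewrite -(mulr0 2); apply: cvgM => //; exact: cvg_cst.
have : N2 (f - g) = 0.
  apply: (@cvg_unique _ _ (N2 (f - g) @[_ --> \oo])); [exact: norm_hausdorff|exact: cvg_cst|].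
  apply: squeeze0 C => n; rewrite sqn_ge0/= sqnBC.
  have -> : g - f = (g - u n) + (u n - f) by rewrite addrA subrK.
  apply: le_trans (sqnD_le mOm (in_L2B mOm Lg (Lu n)) (in_L2B mOm (Lu n) Lf)) _.
  by rewrite (sqnBC area Om g) addrC.
move=> /(sqn_eq0 mOm (in_L2B mOm Lf Lg)); apply: filterS => z H Oz.
by have := H Oz => /eqP; rewrite subr_eq0 => /eqP.
Qed.

Lemma nrm_le_sqr x (e : R) : 0 <= e -> nrm ip x <= e <-> ip x x <= e ^+ 2.
Proof.
by move=> e0; rewrite /nrm -{1}(ger0_norm e0) -sqrtr_sqr ler_sqrt// sqr_ge0.
Qed.

Lemma tendsto_lip (u : nat -> HH) x : (forall n, inH (u n)) -> inH x ->
  lip G tr (u n - x) (u n - x) @[n --> \oo] --> 0 -> tendsto ip u x.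
Proof.
move=> Hu Hx; rewrite lipE => C; apply: cvg_sqrt0 C => n; apply: ip_nneg.
exact: (inHB hG htr).
Qed.

Lemma nr0_tendsto (u : nat -> HH) x : (forall n, inH (u n)) -> inH x ->
  tendsto ip u x -> N2 ((u n).1 - x.1) @[n --> \oo] --> 0.
Proof.
move=> Hu Hx C; have [K K0 HK] := ip_coercive hG htr.
have C2 : K * (nrm ip (u n - x) * nrm ip (u n - x)) @[n --> \oo] --> (0 : R).
  rewrite -(mulr0 K); apply: cvgM; first exact: cvg_cst.
  by rewrite -(mulr0 0); apply: cvgM.
apply: squeeze0 C2 => n; rewrite sqn_ge0/=; have Hz := inHB hG htr (Hu n) Hx.
have [h0 _ _ _] := HK _ Hz; move: h0.
by rewrite nr0.unlock lipE -expr2 (nrm_sq ip_nneg Hz).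
Qed.

(** Elements of R(P) agree with their image by P up to null vectors. Replacing the sequence by its
    image makes the second components exactly 0, so the L^2 condition of [H_complete] is trivial. *)
Lemma H_RP_complete (u : nat -> HH) : (forall n, RP inH ip opP (u n)) ->
  (exists C : R, forall n, nrm ip (u n - u n.+1) <= C * 2^-1 ^+ n) ->
  exists2 x, RP inH ip opP x & tendsto ip u x.
Proof.
move=> Hu [C HC]; have Du n := (Hu n).1; have Dp n := opP_stable (Du n).
have Hd m n : nrm ip (opP (u m) - opP (u n)) <= nrm ip (u m - u n).
  have -> : opP (u m) - opP (u n) = opP (u m - u n) by rewrite (P_sub opP_lin).
  by apply: (nrmP inH_0 inH_linear ip_sym ip_linear ip_nneg opP_stable opP_idem opP_selfadjoint); exact: (inHB hG htr).
have Hc := geometric_cauchy inH_0 inH_linear ip_sym ip_linear ip_nneg Dp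
  (fun n => le_trans (Hd n n.+1) (HC n)).
have [||x Hx [cx _]] := H_complete hG htr Dp.
- move=> e e0; have [N HN] := Hc (Num.sqrt e) (ltac:(by rewrite sqrtr_gt0)).
  exists N => m n Nm Nn; rewrite lipE -(sqr_sqrtr (ltW e0)).
  by apply/nrm_le_sqr; [exact: sqrtr_ge0|exact: HN].
- move=> e e0; exists 0%N => m n _ _; rewrite nr3.unlock.
  rewrite (ae_eq0_sqn mOm (f := (opP (u m) - opP (u n)).2)) ?ltW//.
    by apply: aeW => z _; rewrite /= subrr.
  by rewrite /= subrr; exact: measurable_cst.
have tx := tendsto_lip Dp Hx cx.
exists (opP x); first by apply: (RP_P inH_0 ip_linear opP_stable opP_idem).
have tP := tendstoP inH_0 inH_linear ip_sym ip_linear ip_nneg opP_stable opP_lin opP_idem opP_selfadjoint Dp Hx tx.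
apply: cvg_trans tP; apply: near_eq_cvg; apply: nearW => n /=.
have Dpx := opP_stable Hx.
apply: (heqv_nrmE (inHB hG htr (Dp n) Dpx) (inHB hG htr (Du n) Dpx)).
apply: heqvB => //; last exact: heqv_refl.
by apply: heqv_sym => //; case: (Hu n).
Qed.

Lemma H_Phi : inH (Phi R). Proof. exact: (inH_cst hG htr). Qed.

Lemma Phi_gt0 : 0 < ip (Phi R) (Phi R).
Proof.
rewrite -lipE lt_def (ip_ge0 hG htr H_Phi) andbT; apply/eqP => P_zero.
have [P1 _] := lip0_Heq hG htr H_Phi P_zero.
have L1 := dom_cst_L2 hOm 1.
have n0 : N2 (cst 1) = 0 := ae_eq0_sqn mOm P1 (in_L2_meas L1).
have := Rintegral_dom_gt0 hOm L1.
have [oO _ nO _ _] := hOm.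
move=> /(_ Om (fun p _ => ler01) oO nO (fun p H => H) (fun p _ => ltr01)).
suff -> : \int[area]_(x in Om) cst 1 x = N2 (cst 1) by rewrite n0 ltxx.
by rewrite /sqn; apply: eq_area => z _; rewrite /= expr1n.
Qed.

Local Notation hh := (fun x y : HH => hint G x.1 y.1).

Lemma hint_linear k x x' y : inH x -> inH x' -> inH y -> hh (k *: x + x') y = k * hh x y + hh x' y.
Proof. by move=> Hx Hx' Hy; exact: (hint_lin hG k (inH_L2 Hx) (inH_L2 Hx') (inH_L2 Hy)). Qed.

Lemma hint_bounded : exists2 K : R, 0 <= K & forall x y, inH x -> inH y ->
  hh x y ^+ 2 <= K * (ip x x * ip y y).
Proof. by have [K K0 HK] := hint_CS hG htr; exists K => // x y Hx Hy; rewrite -lipE; exact: HK. Qed.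

Section spectrum.
Context (lam : int -> R) (U : int -> fn) (hspec : spectral_data G tr lam U).
Local Notation ph := (fun (b : bool) (n : nat) => phi lam U (idx b n)).
Local Notation la := (fun (b : bool) (n : nat) => lam (idx b n)).

Lemma idx_neq0 b n : idx b n != 0. Proof. by case: b. Qed.

Lemma idx_inj b b' n m : (idx b n == idx b' m) = (b == b') && (n == m).
Proof. by case: b; case: b'; rewrite /idx ?eqr_opp. Qed.

Lemma domA_ph b n : domA G tr (ph b n). Proof. exact: (phi_dom hspec (idx_neq0 b n)). Qed.

Lemma H_ph b n : inH (ph b n). Proof. exact: domA_inH (domA_ph b n). Qed.

Lemma ph_orth b b' n m : ip (ph b n) (ph b' m) = ((b == b') && (n == m))%:R.
Proof.
rewrite -idx_inj; have [e|ne] := eqVneq.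
  rewrite e -(nrm_sq ip_nneg (H_ph b' m)).
  by have := phi_norm hspec (idx_neq0 b' m); rewrite /Hnorm /nrm => ->; rewrite expr1n.
exact: (phi_orth hspec (idx_neq0 _ _) (idx_neq0 _ _) ne).
Qed.

Lemma la_sign b n : 0 < pm R b * la b n.
Proof.
case: b; rewrite /pm /idx/= ?mul1r ?mulN1r.
  by have /andP[] := lam_pos hspec (isT : 0 < n.+1%:Z) (lexx _).
rewrite oppr_gt0; have n0 : - n.+1%:Z < 0 by [].
by have /andP[] := lam_neg hspec (lexx _) n0.
Qed.

Lemma la_far b n : pm R b * la b 0%N <= pm R b * la b n.
Proof.
case: b; rewrite /pm /idx ?mul1r ?mulN1r.
  by have /andP[_] := @lam_pos _ _ _ _ _ hspec 1 n.+1%:Z isT isT.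
rewrite lerN2; have n0 : - 1%:Z < 0 by [].
by have /andP[] := @lam_neg _ _ _ _ _ hspec (- n.+1%:Z) (- 1%:Z) ltac:(by rewrite lerN2) n0.
Qed.

Lemma la_neq0 b n : la b n != 0.
Proof. by apply/eqP => H; have := la_sign b n; rewrite /= H mulr0 ltxx. Qed.

Lemma snd_psum b (a : nat -> R) N :
  (psum ph b a N).2 = (psum ph b (fun n => a n / la b n) N).1.
Proof.
rewrite /psum; elim: N => [|N IH]; first by rewrite !big_ord0.
rewrite !big_ord_recr/= IH; congr (_ + _).
by rewrite scalerA.
Qed.

(* The second component of sum a_n phi_n is the first one of sum (a_n / lam_n) phi_n:
   this bounds it in L^2 without a Poincare inequality. *)
Lemma H_series_complete b (a : nat -> R) :
  (exists M, forall N, \sum_(n < N) a n ^+ 2 <= M) ->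
  exists2 x, inH x & tendsto ip (fun N => \sum_(n < N) a n *: ph b n) x.
Proof.
move=> Ha; have Hu N : inH (psum ph b a N) by exact: (D_psum inH_0 inH_linear H_ph).
have [K K0 HK] := ip_coercive hG htr.
pose l0 := `|la b 0%N|^-1.
have l00 : 0 <= l0 by rewrite invr_ge0.
have sw (w : nat -> R) N : ip (psum ph b w N) (psum ph b w N) = \sum_(n < N) w n ^+ 2.
  exact: (sq_psum inH_0 inH_linear ip_sym ip_linear H_ph ph_orth).
have lal n : (la b n)^-1 ^+ 2 <= l0 ^+ 2.
  rewrite -(real_normK (num_real (la b n)^-1)) lerXn2r ?nnegrE// normfV.
  rewrite lef_pV2 ?posrE ?normr_gt0 ?la_neq0//.
  have := la_far b n; have := la_sign b n; have := la_sign b 0%N.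
  move=> /ltW/ger0_norm <- /ltW/ger0_norm <-.
  by rewrite !normM_pm.
have [||x Hx [cx _]] := H_complete hG htr Hu.
- move=> e e0; have [N HN] := window_small e0 Ha; exists N => m n Nm Nn.
  by rewrite lipE psum_diff sw; exact: HN.
- move=> e e0; pose e' := e / (K * l0 ^+ 2 + 1).
  have d0 : 0 < K * l0 ^+ 2 + 1 by rewrite ltr_wpDl// mulr_ge0 ?sqr_ge0.
  have e'0 : 0 < e' by rewrite divr_gt0.
  have [N HN] := window_small e'0 Ha; exists N => m n Nm Nn.
  rewrite psum_diff; set w := window m n a; set M := maxn m n.
  have Hw : inH (psum ph b (fun i => w i / la b i) M) by exact: (D_psum inH_0 inH_linear H_ph).
  have [h0 _ _ _] := HK _ Hw; move: h0.
  rewrite nr0.unlock nr3.unlock snd_psum lipE sw => h0; apply: le_trans h0 _.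
  apply: (@le_trans _ _ (K * (l0 ^+ 2 * \sum_(i < M) w i ^+ 2))).
    rewrite ler_wpM2l// mulr_sumr; apply: ler_sum => i _.
    by rewrite exprMn mulrC ler_wpM2r// sqr_ge0.
  rewrite mulrA; apply: (@le_trans _ _ ((K * l0 ^+ 2 + 1) * e')).
    apply: ler_pM; [by rewrite mulr_ge0// sqr_ge0|by apply: sumr_ge0 => i _; exact: sqr_ge0| |].
      by rewrite lerDl.
    exact: HN.
  by rewrite /e' mulrCA divff ?mulr1// gt_eqF.
by exists x => //; exact: tendsto_lip cx.
Qed.

Lemma sub_split (W : zmodType) (p q r s : W) : p - q = (p - r) - (q - s) + (r - s).
Proof.
have -> : (p - r) - (q - s) = (p - q) - (r - s) by rewrite opprD addrACA -opprD.
by rewrite subrK.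
Qed.

Lemma Hnorm_sub x y : inH x -> inH y -> nrm ip (x - y) = Hnorm (y - x).
Proof. exact: (nrmB inH_0 inH_linear ip_sym ip_linear). Qed.

Lemma opA_eigen b n : eqv (opA G (ph b n)) (la b n *: ph b n).
Proof.
have HA := opA_inH hG (domA_ph b n); have Hp := H_ph b n.
apply/Heq_eqv => //; last exact: (phi_eigen hspec (idx_neq0 b n)).
by rewrite -[_ *: _]addr0; exact: inH_linear inH_0.
Qed.

Lemma ip_opA_ph b n y : inH y -> ip (opA G (ph b n)) y = la b n * ip (ph b n) y.
Proof.
move=> Hy; have Hp := H_ph b n; have HZ := inH_linear (la b n) Hp inH_0.
rewrite addr0 in HZ; rewrite (heqv_ipl (opA_inH hG (domA_ph b n)) HZ Hy (opA_eigen b n)).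
exact: (ipZl inH_0 ip_linear).
Qed.

(** [lip_opA] writes (A phi_n | phi_m) with h and two divergence terms. By [ipc_opA] each divergence
    term is expressed by h and the first component of A phi, and the eigenvector equation turns the
    latter into lam times a product of first components. *)
Lemma eigen_identity b n m : la b n * (n == m)%:R =
  la b n * ip (opP (ph b n)) (ph b m) + la b m * ip (opP (ph b m)) (ph b n)
  - hh (ph b n) (ph b m).
Proof.
have dn := domA_ph b n; have dm := domA_ph b m; have Hn := H_ph b n; have Hm := H_ph b m.
have A1 := lip_opA hG dn dm.
have A2 := ipc_opA hG dn Hm; have A3 := ipc_opA hG dm Hn.
have P p q (dp : domA G tr (ph b p)) (Hq : inH (ph b q)) :
    ipc G (opA G (ph b p)) (ph b q) = la b p * ip (opP (ph b p)) (ph b q).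
  rewrite -(lip_opP hG htr (opA_inH hG dp) Hq) lipE opP_selfadjoint//; last exact: opA_inH.
  by rewrite ip_opA_ph ?opP_selfadjoint//; [exact: H_ph|exact: opP_stable].
rewrite (P _ _ dn Hm) in A2; rewrite (P _ _ dm Hn) in A3.
rewrite lipE ip_opA_ph// ph_orth eqxx/= in A1.
rewrite A2 A3 A1 (hintC G (ph b m).1).
by move: (hint _ _ _) (dint _ _ _) (dint _ _ _) => p q r; ring.
Qed.

Lemma eigen_Phi : ~ controlled G -> forall b n, hh (ph b n) (Phi R) = la b n * ip (ph b n) (Phi R).
Proof.
move=> nc b n; rewrite -ip_opA_ph; last exact: H_Phi.
by rewrite -lipE; exact: esym (lip_opA_cst1 hG htr nc (domA_ph b n)).
Qed.

(** [s N] keeps only the second component of the partial sum [u N]. It tends to 0 in energy because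
    v is in R(P), while its second component is the first one of [x N], which converges in L^2.
    Hence [H_complete] applies, and the limit, of zero energy, identifies [w.1] with a constant. *)
Lemma null_limit b (a : nat -> R) v w : inH v -> inH w -> eqv v (opP v) ->
  tendsto ip (psum ph b a) v -> tendsto ip (psum ph b (fun n => a n / la b n)) w ->
  exists2 k : R, eqv (opP w) (k *: Phi R) & controlled G -> k = 0.
Proof.
move=> Hv Hw ev cv cw.
have Hu N : inH (psum ph b a N) by exact: (D_psum inH_0 inH_linear H_ph).
have Hx N : inH (psum ph b (fun n => a n / la b n) N) by exact: (D_psum inH_0 inH_linear H_ph).
set u := psum ph b a in Hu cv *; set x := psum ph b _ in Hx cw *.
pose s N := u N - opP (u N).
have Hs N : inH (s N) by exact: (inHB hG htr (Hu N) (opP_stable (Hu N))).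
have cP := tendstoP inH_0 inH_linear ip_sym ip_linear ip_nneg opP_stable opP_lin opP_idem opP_selfadjoint Hu Hv cv.
have s0 : nrm ip (s N) @[N --> \oo] --> (0 : R).
  have C : nrm ip (u N - v) + nrm ip (opP (u N) - opP v) @[N --> \oo] --> (0 : R).
    by rewrite -(addr0 0); exact: cvgD.
  apply: squeeze0 C => N; rewrite nrm_ge0/=.
  have D1 := inHB hG htr (Hu N) Hv; have D2 := inHB hG htr (opP_stable (Hu N)) (opP_stable Hv).
  have D3 := inHB hG htr Hv (opP_stable Hv).
  have e1 : s N = (u N - v) - (opP (u N) - opP v) + (v - opP v).
    exact: sub_split.
  have n3 : nrm ip (v - opP v) = 0 by apply/(nrm_eq0 ip_nneg D3).
  rewrite e1; apply: le_trans (nrmD inH_0 inH_linear ip_sym ip_linear ip_nneg (inHB hG htr D1 D2) D3) _.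
  rewrite n3 addr0.
  have := nrmD inH_0 inH_linear ip_sym ip_linear ip_nneg D1 (dom_opp inH_0 inH_linear D2).
  by rewrite (nrmN inH_0 inH_linear ip_sym ip_linear).
have cau (y : nat -> HH) : (forall N, inH (y N)) -> (exists2 l, inH l & tendsto ip y l) ->
    forall e, 0 < e -> exists N, forall m n, (N <= m)%N -> (N <= n)%N ->
    ip (y m - y n) (y m - y n) <= e.
  move=> Hy [l Hl cl] e e0; have q0 : 0 < Num.sqrt e / 2 by rewrite divr_gt0// sqrtr_gt0.
  have [N HN] := (cvg0P (fun n => nrm_ge0 _ _)).1 cl _ q0; exists N => m n Nm Nn.
  rewrite -(sqr_sqrtr (ltW e0)); apply/nrm_le_sqr; first exact: sqrtr_ge0.
  have h1 := HN m Nm; have h2 := HN n Nn.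
  apply: le_trans (nrm_triangle inH_0 inH_linear ip_sym ip_linear ip_nneg (Hy m) (Hy n) Hl) _.
  rewrite (nrmB inH_0 inH_linear ip_sym ip_linear Hl (Hy n)) [X in _ <= X]splitr.
  move: h1 h2; move: (nrm ip _) (nrm ip _) (Num.sqrt e / 2) => p q r; exact: lerD.
have [K K0 HK] := ip_coercive hG htr.
have K1 : 0 < K + 1 by rewrite ltr_wpDl.
have [||t Ht [ct c3]] := H_complete hG htr Hs.
- move=> e e0; rewrite lipE; apply: (cau s Hs _ e e0); exists 0; first exact: inH_0.
  by rewrite /tendsto; under eq_fun do rewrite subr0.
- move=> e e0; have e1 : 0 < e / (K + 1) by rewrite divr_gt0.
  have [N HN] := cau x Hx (ex_intro2 _ _ w Hw cw) _ e1; exists N => m n Nm Nn.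
  have Hd := inHB hG htr (Hx m) (Hx n).
  have [h0 _ _ _] := HK _ Hd; move: h0; rewrite nr0.unlock nr3.unlock lipE.
  have -> : (s m - s n).2 = (x m - x n).1.
    by rewrite /= !subr0 /u /x !snd_psum.
  move=> h0; apply: le_trans h0 _; apply: (@le_trans _ _ ((K + 1) * (e / (K + 1)))).
    by apply: ler_pM => //; [exact: ip_nneg|rewrite lerDl|exact: HN].
  by rewrite mulrCA divff ?mulr1// gt_eqF.
have t0 : lip G tr t t = 0.
  rewrite lipE; apply/(nrm_eq0 ip_nneg Ht); have tt := tendsto_lip Hs Ht ct.
  have C := tendsto_nrm inH_0 inH_linear ip_sym ip_linear ip_nneg Hs Ht tt.
  by apply: (@cvg_unique _ _ _ _ _ _ C) => //; exact: norm_hausdorff.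
have [_ [tc tn]] := lip0_Heq hG htr Ht t0.
have L1 := dom_cst_L2 hOm.
have Lt : L2 t.2 := H1_L2 (inH_H1 Ht).
have wt : w.1 = t.2 %[ae area in Om].
  apply: (@L2_unique (fun N => (x N).1)) => //; [by move=> N; exact: inH_L2 (Hx N)|exact: inH_L2 Hw|exact: nr0_tendsto|].
  move: c3; apply: cvg_trans; apply: near_eq_cvg; apply: nearW => N /=.
  by rewrite nr3.unlock /= subr0 /u /x snd_psum.
have kE (k : R) : k *: Phi R = (cst k, 0) :> HH.
  congr (_, _); last by rewrite scaler0.
  by apply/funext => p; rewrite -[LHS]/(k * 1) mulr1.
have fin (k : R) : t.2 = cst k %[ae area in Om] -> eqv (opP w) (k *: Phi R).
  move=> tk; rewrite kE; apply/opP_Heq => //; first exact: inH_L2 Hw.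
  exact: ae_eq_trans wt tk.
have [ct'|nc] := pselect (controlled G).
  by exists 0 => //; apply: fin; exact: tc.
have [k tk] := tn nc; exists k => //; apply: fin.
by apply: filterS tk => p H Op; rewrite (H Op) /= add0r.
Qed.

Lemma ranA_D x : ranA G tr x -> inH x. Proof. by case. Qed.

Lemma ranA_D2 x y : ranA G tr x -> ranA G tr y -> ranA G tr (x + y).
Proof.
move=> [Hx kx] [Hy ky]; split=> [|k Hk].
  by rewrite -[x]scale1r; exact: inH_linear.
have Dk : inH k by case: Hk => dk _; exact: domA_inH dk.
by rewrite (ipDl ip_linear Hx Hy Dk) kx// ky// addr0.
Qed.

Lemma ranA_decomp x : ranA G tr x -> tendsto ip
  (fun N => \sum_(n < N) (coef ip ph true x n *: ph true n + coef ip ph false x n *: ph false n)) x.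
Proof.
move=> Rx; have := phi_basis hspec Rx; have Hx := ranA_D Rx.
apply: cvg_trans; apply: near_eq_cvg; apply: nearW => N /=.
have HF i : inH (coef ip ph true x i *: ph true i + coef ip ph false x i *: ph false i).
  apply: inH_linear; first exact: H_ph.
  by rewrite -[_ *: _]addr0; apply: inH_linear; [exact: H_ph|exact: inH_0].
by apply: esym; apply: Hnorm_sub => //; exact: (dom_sum inH_0 inH_linear N HF).
Qed.

(** By symmetry lam (phi | k) = (A phi | k) = (phi | A k) = 0 for k in the kernel, and the
    eigenvalues are nonzero. *)
Lemma spanned_ranA b x : spanned inH ip ph b x -> ranA G tr x.
Proof.
move=> Hx; split=> [|k [dk k0]]; first exact: spanned_D Hx.
have Hk := domA_inH dk; have HA := opA_inH hG dk; have Hx' := spanned_D Hx.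
rewrite ip_sym//; apply: (spanned_orth inH_0 inH_linear ip_sym ip_linear ip_nneg H_ph ph_orth Hk _ Hx) => n.
have Hn := H_ph b n.
have : la b n * ip (ph b n) k = 0.
  rewrite -ip_opA_ph// -lipE (opA_sym hG (domA_ph b n) dk) lipE ip_sym//.
  have e0 : eqv (opA G k) 0 by apply/Heq_eqv => //; exact: inH_0.
  by rewrite (heqv_ipl HA inH_0 Hn e0) (ip0l inH_0 ip_linear).
by move/eqP; rewrite mulf_eq0 (negbTE (la_neq0 b n)) /coef ip_sym//= => /eqP.
Qed.

(** A kernel vector k has a constant first component kappa, so (v | k) = kappa (v | Phi). Either
    kappa vanishes, by control or because the mean of h is nonzero, or (v | Phi) does. *)
Lemma in_range v : RP inH ip opP v ->
  [\/ controlled G, hh (Phi R) (Phi R) != 0 | ip v (Phi R) = 0] -> ranA G tr v.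
Proof.
move=> [Hv ev] Hc; split=> // k kk; have Hk : inH k by case: kk => dk _; exact: domA_inH dk.
have [kappa [k1 kc kn]] := ker_first hG htr kk.
rewrite (heqv_ipl Hv (opP_stable Hv) Hk ev) -lipE (lip_fst_cst hG htr (inH_L2 Hv) Hk k1) lipE.
rewrite -[(v.1, 0)]/(opP v) -[(cst 1, 0)]/(Phi R).
rewrite -(heqv_ipl Hv (opP_stable Hv) H_Phi ev).
have [ct|nc] := pselect (controlled G); first by rewrite (kc ct) mul0r.
case: Hc => [//|m0|->]; last by rewrite mulr0.
have /eqP := kn nc; rewrite (mean_hE G) mulf_eq0 => /orP[/eqP->|]; first by rewrite mul0r.
by rewrite (negbTE m0).
Qed.

Lemma prP b x : inH x -> is_proj inH ip ph b x (Defs.proj G tr lam U b x).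
Proof.
move=> Hx; have := is_proj_exists inH_0 inH_linear ip_sym ip_linear ip_nneg H_ph ph_orth H_series_complete b Hx.
exact: (@xgetPex _ 0 [set y | Rpi G tr lam U b y /\ forall z, Rpi G tr lam U b z -> ip (x - y) z = 0]).
Qed.

Lemma proj_spanned b x : inH x -> spanned inH ip ph b (Defs.proj G tr lam U b x).
Proof. by move=> Hx; case: (prP b Hx). Qed.

Lemma H_pr b x : inH x -> inH (Defs.proj G tr lam U b x).
Proof. by move=> Hx; exact: spanned_D (proj_spanned b Hx). Qed.

Lemma H_piPpi b x : inH x -> inH (piPpi G tr lam U b x).
Proof. by move=> Hx; apply: H_pr; apply: opP_stable; exact: H_pr. Qed.

Section bounded_inverse.
Hypothesis hB : forall b : bool,
  bounded_invertible (Rpi G tr lam U b) (Heq) (Hnorm) (piPpi G tr lam U b).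

(** The bounded inverse concerns [piPpi], which also projects before P; on the closed span that
    first projection changes a vector by a null vector only. *)
Lemma H_coercive b : exists K : R, forall x, spanned inH ip ph b x ->
  forall y, is_proj inH ip ph b (opP x) y -> nrm ip x <= K * nrm ip y.
Proof.
have [_ [K HK]] := hB b; exists K => x Hx y Hy.
apply: le_trans (HK x Hx) _; rewrite le_eqVlt; apply/orP; left; apply/eqP; congr (_ * _).
have Dx := spanned_D Hx; have Dp := H_pr b Dx.
apply: heqv_nrmE; [exact: H_piPpi|exact: spanned_D Hy.1|].
apply: (spanned_eq inH_0 inH_linear ip_sym ip_linear ip_nneg H_ph ph_orth _ Hy.1).
  by apply: proj_spanned; exact: opP_stable.
move=> n; rewrite (is_proj_coef inH_0 inH_linear ip_linear H_ph n (opP_stable Dp) (prP b (opP_stable Dp))).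
rewrite (is_proj_coef inH_0 inH_linear ip_linear H_ph n (opP_stable Dx) Hy).
apply: heqv_ipl; [exact: opP_stable|exact: opP_stable|exact: H_ph|].
apply: (P_eqv inH_0 inH_linear ip_sym ip_linear ip_nneg opP_stable opP_lin opP_idem opP_selfadjoint Dp Dx).
exact: (is_proj_id inH_0 inH_linear ip_sym ip_linear ip_nneg H_ph ph_orth Hx (prP b Dx)).
Qed.

(** The [xget] in [opB] selects a genuine preimage because [piPpi] is onto; testing against z in the
    closed span then removes the outer projections. *)
Lemma opBP b x : inH x -> isB inH ip ph opP b x (opB G tr lam U b x).
Proof.
move=> Hx; have [[_ _ onto] _] := hB b; have Hp := H_pr b Hx.
have [y0 Ry0 Ey0] := onto _ (proj_spanned b Hx).
have [y [Ry Ey ->]] : exists y, [/\ Rpi G tr lam U b y,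
    Heq (piPpi G tr lam U b y) (Defs.proj G tr lam U b x) &
    opB G tr lam U b x = Defs.proj G tr lam U b y].
  set S := [set y | Rpi G tr lam U b y /\ Heq (piPpi G tr lam U b y) (Defs.proj G tr lam U b x)].
  have [r1 r2] : S (xget 0 S) by apply: xgetPex; exists y0.
  by exists (xget 0 S).
have Hy : inH y by case: Ry.
have Hpy := H_pr b Hy.
split=> [|z Sz]; first exact: proj_spanned.
have Hz := spanned_D Sz.
rewrite -(is_proj_ip inH_0 inH_linear ip_linear Hx (prP b Hx) Sz).
have ey : eqv (piPpi G tr lam U b y) (Defs.proj G tr lam U b x).
  exact: (Heq_eqv (H_piPpi b Hy) Hp).1 Ey.
rewrite -(heqv_ipl (H_piPpi b Hy) Hp Hz ey).
exact: esym (is_proj_ip inH_0 inH_linear ip_linear (opP_stable Hpy) (prP b (opP_stable Hpy)) Sz).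
Qed.

(** The factors [decay] are at most 1, so the exponential series converges and the [xget] in [Hsum]
    is a genuine sum. *)
Lemma expA_evolved b L x : 0 < L -> inH x ->
  evolved inH ip ph la b L x (expA G tr lam U b (- pm R b * 2 * L) x).
Proof.
move=> L0 Hx; have [mu mu0 Hmu] := decay_le la_sign la_far.
have [|y [Sy Cy cy _]] := multiplier inH_0 inH_linear ip_sym ip_linear ip_nneg H_ph ph_orth
    H_series_complete b (m := decay la b L) (eta := 1) Hx.
  move=> n; rewrite ger0_norm ?expR_ge0//; apply: le_trans (Hmu b L n L0) _.
  by rewrite -expR0 ler_expR oppr_le0 !mulr_ge0// ltW.
have Hy := spanned_D Sy.
have Hps a N := D_psum inH_0 inH_linear H_ph b a N.
set w := expA G tr lam U b (- pm R b * 2 * L) x.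
have [Hw Cw] : inH w /\ tendsto ip (psum ph b (fun n => coef ip ph b x n * decay la b L n)) w.
  have : [set y | inH y /\ Hnorm (y - psum ph b (fun n => coef ip ph b x n * decay la b L n) N)
      @[N --> \oo] --> 0] w.
    apply: xgetPex; exists y; split => //.
    apply: cvg_trans Cy; apply: near_eq_cvg; apply: nearW => N /=.
    by apply: Hnorm_sub => //; exact: Hps.
  move=> [Hw C]; split => //.
  apply: cvg_trans C; apply: near_eq_cvg; apply: nearW => N /=.
  by apply: esym; apply: Hnorm_sub => //; exact: Hps.
split; first exact: (tendsto_spanned inH_0 inH_linear ip_sym ip_linear H_ph Hw Cw).
by have [] := tendsto_coef inH_0 inH_linear ip_sym ip_linear ip_nneg H_ph ph_orth Hw Cw.
Qed.

Lemma opMP b L x : 0 < L -> inH x -> exists2 e,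
  evolved inH ip ph la b L (opB G tr lam U b x) e & opM G tr lam U b L x = opP e.
Proof.
move=> L0 Hx; exists (expA G tr lam U b (- pm R b * 2 * L) (opB G tr lam U b x)) => //.
by apply: expA_evolved => //; case: (opBP b Hx) => /spanned_D.
Qed.

End bounded_inverse.

End spectrum.
End graetz_hilbert.

(** * The block systems *)

Section graetz_system.
Context (R : realType) (G : graetz_data R) (hG : graetz_hyp G).
Context (tr : (R * R -> R) -> (R * R -> R)) (htr : trace_operator (omega G) tr).
Context (lam : int -> R) (U : int -> (R * R -> R)) (hspec : spectral_data G tr lam U).
Hypothesis hB : forall b : bool,
  bounded_invertible (Rpi G tr lam U b) (Heq G) (Hnorm G tr) (piPpi G tr lam U b).
Local Notation fn := (R * R -> R).
Local Notation HH := (fn * fn)%type.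
Local Notation Om := (omega G).
Local Notation area := (@area R).
Local Notation mOm := (dom_measurable (domain_Om hG)).
Local Notation L2 := (in_L2 area Om).
Local Notation N2 := (sqn area Om).
Local Notation inH := (inH G tr).
Local Notation Heq := (Heq G).
Local Notation ip := (ip G tr).
Local Notation Hnorm := (Hnorm G tr).
Local Notation opP := (@opP R).
Local Notation ph := (fun (b : bool) (n : nat) => phi lam U (idx b n)).
Local Notation la := (fun (b : bool) (n : nat) => lam (idx b n)).
Local Notation hh := (fun x y : HH => hint G x.1 y.1).
Local Notation B := (opB G tr lam U).
Local Notation M := (opM G tr lam U).
Local Notation prj := (Defs.proj G tr lam U).
Local Notation uu := (u_ G tr lam U).
Local Notation RP := (RP inH ip opP).
Local Notation eqv := (eqv ip).
Local Notation evolved := (evolved inH ip ph la).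
Local Notation zrow := (zrow M).
Local Notation zscal := (zscal ip opP B (Phi R) M).
Local Notation sysm := (sysm ip opP B (Phi R) M).
Local Notation solvable := (solvable ip opP B (Phi R)).
Local Notation well_posed := (well_posed inH ip opP B (Phi R) M).

Local Notation nD0 := (@inH_0 R G hG tr htr).
Local Notation nDlin := (@inH_linear R G hG tr htr).
Local Notation nC := (@ip_sym R G hG tr).
Local Notation nlin := (@ip_linear R G hG tr htr).
Local Notation nge0 := (@ip_nneg R G hG tr htr).
Local Notation nph := (@H_ph R G tr lam U hspec).
Local Notation northo := (@ph_orth R G hG tr htr lam U hspec).
Local Notation nser := (@H_series_complete R G hG tr htr lam U hspec).
Local Notation nP := (@opP_stable R G hG tr htr).
Local Notation nPlin := (@opP_lin R).
Local Notation nPP := (@opP_idem R).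
Local Notation nPsym := (@opP_selfadjoint R G hG tr htr).
Local Notation ncoer := (@H_coercive R G hG tr htr lam U hspec hB).
Local Notation nB := (@opBP R G hG tr htr lam U hspec hB).
Local Notation nPhi := (@H_Phi R G hG tr htr).
Local Notation nM := (@opMP R G hG tr htr lam U hspec hB).
Local Notation nsign := (@la_sign R G tr lam U hspec).
Local Notation nfar := (@la_far R G tr lam U hspec).

Lemma Phi_P : opP (Phi R) = Phi R. Proof. by []. Qed.

Lemma in_range_decomp v : RP v ->
  [\/ controlled G, hh (Phi R) (Phi R) != 0 | ip v (Phi R) = 0] -> tendsto ip
  (fun N => \sum_(n < N) (coef ip ph true v n *: ph true n + coef ip ph false v n *: ph false n)) v.
Proof. by move=> Hv Hc; apply: (ranA_decomp hG htr hspec); exact: (in_range hG htr). Qed.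

Lemma dirichlet_sysm k (sg : 'I_k -> bool) g L r p x : 0 < L -> (forall b j, RP (g b j)) ->
  (forall b, inH (p b)) -> inH x -> sysm sg g L (fun b => opP (prj b x)) r p <->
  forall b e, evolved (~~ b) L (prj (~~ b) x) e -> eqv (opP (prj b x) + opP e + cc g b r) (p b).
Proof.
exact: (sysm_dirichlet nD0 nDlin nC nlin nge0 nph northo nser nP nPlin nPP nPsym ncoer nB
  nPhi Phi_P nM (prP hG htr hspec)).
Qed.

Lemma hint_sym (x y : HH) : hh x y = hh y x. Proof. exact: hintC. Qed.

Lemma system_onto k (sg : 'I_k -> bool) g L r p X : 0 < L -> (forall b j, RP (g b j)) ->
  (forall b, RP (X b)) -> (forall b, inH (p b)) ->
  (forall b, [\/ controlled G, (exists j, sg j = b) |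
     ~ controlled G /\ 0 < pm R b * hh (Phi R) (Phi R)]) -> sysm sg g L X r p ->
  exists x, [/\ ranA G tr x, forall b, eqv (opP (prj b x)) (X b) &
                sysm sg g L (fun b => opP (prj b x)) r p].
Proof.
exact: (sysm_onto nD0 nDlin nC nlin nge0 nph northo nser nP nPlin nPP nPsym ncoer nB
  nPhi Phi_P nsign nfar (hint_linear hG (tr := tr)) hint_sym (fun _ _ => erefl) (hint_bounded hG htr)
  (eigen_Phi hG htr hspec) (@null_limit _ _ hG _ htr _ _ hspec) in_range_decomp nM
  (prP hG htr hspec) (ranA_D2 hG htr) (@spanned_ranA _ _ hG _ htr _ _ hspec)).
Qed.

Lemma u_gt0 b : ~ controlled G -> pm R b * mean_h G <= 0 -> 0 < ip (uu b) (uu b).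
Proof.
rewrite (mean_hE G) => nc h0.
exact: (uu_gt0 nD0 nDlin nC nlin nge0 nph northo nser nP nPlin nPP nPsym ncoer nB
  nPhi nsign (hint_linear hG (tr := tr)) hint_sym (fun _ _ => erefl) (hint_bounded hG htr)
  (eigen_identity hG htr hspec) (eigen_Phi hG htr hspec) (Phi_gt0 hG htr) nc h0).
Qed.

Lemma system_RP k (g : bool -> 'I_k -> HH) L X r b : 0 < L -> (forall b j, RP (g b j)) ->
  (forall b, RP (X b)) -> RP (zrow g L X r b).
Proof.
move=> L0 Hg; exact: (RP_zrow nD0 nDlin nC nlin nge0 nP nPlin nPP nM L0 Hg).
Qed.

Lemma system_large k (sg : 'I_k -> bool) (g : R -> bool -> 'I_k -> HH) (K L1 : R) :
  0 <= K -> (forall L b j, RP (g L b j)) -> (forall L, L1 < L -> solvable sg (g L) K) ->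
  exists L0 : R, forall L, 0 < L -> L0 < L -> well_posed sg (g L) L.
Proof.
exact: (well_posed_large nD0 nDlin nC nlin nge0 nph northo nser nP nPlin nPP nPsym ncoer nB
  nPhi nsign nfar nM (H_RP_complete hG htr)).
Qed.

Lemma system_inj k (sg : 'I_k -> bool) (g : bool -> 'I_k -> HH) L X X' r r' : 0 < L ->
  (forall b j, RP (g b j)) -> well_posed sg g L -> (forall b, RP (X b)) -> (forall b, RP (X' b)) ->
  (forall b, eqv (zrow g L X r b) (zrow g L X' r' b)) /\
    (forall j, zscal sg g L X r j = zscal sg g L X' r' j) <->
  (forall b, eqv (X b) (X' b)) /\ forall j, r j = r' j.
Proof.
exact: (well_posed_inj nD0 nDlin nC nlin nge0 nph northo nser nP nPlin nPP nPsym ncoer nB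
  nPhi nM).
Qed.

Lemma system_bound k (sg : 'I_k -> bool) (g : bool -> 'I_k -> HH) L : 0 < L ->
  (forall b j, RP (g b j)) -> well_posed sg g L -> exists C : R, forall X r,
  (forall b, RP (X b)) -> nrm ip (X false) + nrm ip (X true) + \sum_j `|r j| <=
  C * (nrm ip (zrow g L X r false) + nrm ip (zrow g L X r true) +
       \sum_j `|zscal sg g L X r j|).
Proof.
exact: (well_posed_bound nD0 nDlin nC nlin nge0 nph northo nser nP nPlin nPP nPsym ncoer nB
  nPhi nM).
Qed.

Lemma proj_inj x y : ranA G tr x -> ranA G tr y ->
  (forall b, eqv (opP (prj b x)) (opP (prj b y))) <-> eqv x y.
Proof.
exact: (pr_inj nD0 nDlin nC nlin nge0 nph northo nser nP nPlin nPP nPsym ncoer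
  (prP hG htr hspec) (@ranA_D _ G tr) (ranA_decomp hG htr hspec)).
Qed.

Lemma ranP_RP x : ranP G tr x <-> RP x.
Proof.
split=> [[Hx [y Hy xy]]|[Hx ex]]; last first.
  by split => //; exists x => //; apply/(Heq_eqv hG htr) => //; exact: nP.
split=> //; have Py := nP Hy; have Px := nP Hx.
have e := (Heq_eqv hG htr Hx Py).1 xy.
apply: (heqv_trans hG htr Hx Py Px e).
apply: (heqv_sym hG htr Px Py).
exact: (P_eqv nD0 nDlin nC nlin nge0 nP nPlin nPP nPsym Hx Py e).
Qed.

(** Convergence in the energy space implies L^2 convergence of first components, and L^2 limits are
    unique almost everywhere: whatever sum [L2sum] selects agrees with the first component. *)
Lemma L2sum_first b (m : nat -> R) e : inH e -> tendsto ip (psum ph b m) e ->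
  L2sum G (fun n => m n *: U (idx b n)) = e.1 %[ae area in Om] /\
  L2 (L2sum G (fun n => m n *: U (idx b n))).
Proof.
move=> He C; pose F n := m n *: U (idx b n).
have Hu N : inH (psum ph b m N) by exact: (D_psum nD0 nDlin nph).
have fE N : (psum ph b m N).1 = (fun x => \sum_(n < N) F n x).
  rewrite /psum /F; elim: N => [|N IH].
    by rewrite big_ord0; apply/funext => x; rewrite big_ord0.
  by rewrite big_ord_recr/= IH; apply/funext => x; rewrite big_ord_recr.
have C1 := nr0_tendsto hG htr Hu He C.
set S := [set g | in_L2 area Om g /\
    \int[area]_(x in Om) ((g x - \sum_(n < N) F n x) ^+ 2) @[N --> \oo] --> 0].
have : S (L2sum G F).
  apply: xgetPex; exists e.1; split; first exact: inH_L2 He.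
  apply: cvg_trans C1; apply: near_eq_cvg; apply: nearW => N /=.
  by rewrite sqnBC fE.
move=> [Lg Cg]; split => //.
apply: (@L2_unique _ _ hG (fun N => (psum ph b m N).1)) => //.
- by move=> N; exact: inH_L2 (Hu N).
- exact: inH_L2 He.
- apply: cvg_trans Cg; apply: near_eq_cvg; apply: nearW => N /=.
  by rewrite sqnBC fE.
Qed.

Lemma proj_tendsto b x : inH x -> tendsto ip (psum ph b (coef ip ph b x)) (prj b x).
Proof.
move=> Hx; have Hp := proj_spanned hG htr hspec b Hx.
have -> : coef ip ph b x = coef ip ph b (prj b x).
  apply/funext => n; apply: esym.
  exact: (is_proj_coef nD0 nDlin nlin nph n Hx (prP hG htr hspec b Hx)).
exact: (spanned_tendsto nD0 nDlin nC nlin nge0 nph northo Hp).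
Qed.

Lemma evolved_tendsto b L x e : inH x -> evolved b L (prj b x) e ->
  tendsto ip (psum ph b (fun n => coef ip ph b x n * decay la b L n)) e.
Proof.
move=> Hx [He ce].
have -> : (fun n => coef ip ph b x n * decay la b L n) = coef ip ph b e.
  apply/funext => n; rewrite ce; congr (_ * _); apply: esym.
  exact: (is_proj_coef nD0 nDlin nlin nph n Hx (prP hG htr hspec b Hx)).
exact: (spanned_tendsto nD0 nDlin nC nlin nge0 nph northo He).
Qed.

Definition inlet (Tm Tp : fn) (b : bool) : HH := if b then (Tp, 0) else (Tm, 0).

Variable S0 : fn.

Definition cst_part L c1 c2 b : fn := fun x => c1 + c2 * (pm R b * L + S0 x).

Definition mode L psi b z n : fn :=
  (ip psi (phi lam U (idx b n)) * expR (lam (idx b n) * (z - pm R b * L))) *: U (idx b n).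

Lemma TsolE L psi c1 c2 z x : Tsol G tr lam U S0 L psi c1 c2 z x =
  L2sum G (mode L psi false z) x + L2sum G (mode L psi true z) x + (c1 + c2 * (z + S0 x)).
Proof. by rewrite addrA /Tsol /mode /pm mul1r mulN1r opprK. Qed.

Lemma Tsol_trace b L psi c1 c2 e : inH psi -> evolved (~~ b) L (prj (~~ b) psi) e ->
  Tsol G tr lam U S0 L psi c1 c2 (pm R b * L) =
  (prj b psi).1 + e.1 + cst_part L c1 c2 b %[ae area in Om].
Proof.
move=> Hpsi He.
have C1 := proj_tendsto b Hpsi; have C2 := evolved_tendsto Hpsi He.
have H1 := H_pr hG htr hspec b Hpsi; have H2 := spanned_D He.1.
have [E1 _] := L2sum_first H1 C1; have [E2 _] := L2sum_first H2 C2.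
have f1 : mode L psi b (pm R b * L) = (fun n => coef ip ph b psi n *: U (idx b n)).
  by apply/funext => n; rewrite /mode subrr mulr0 expR0 mulr1.
(* The modes of the other sign are normalised at the opposite end, at distance 2 L: the exponent 2 *
   pm b * L * lam is the one of [decay]. *)
have f2 : mode L psi (~~ b) (pm R b * L) =
    (fun n => (coef ip ph (~~ b) psi n * decay la (~~ b) L n) *: U (idx (~~ b) n)).
  apply/funext => n; congr (_ * expR _ *: _).
  have -> : pm R (~~ b) = - pm R b by case: (b); rewrite ?opprK.
  by ring.
rewrite -f1 in E1; rewrite -f2 in E2.
apply: filterS2 E1 E2 => x h1 h2 Ox; have {}h1 := h1 Ox; have {}h2 := h2 Ox.
rewrite -[RHS]/((prj b psi).1 x + e.1 x + (c1 + c2 * (pm R b * L + S0 x))) -h1 -h2 TsolE.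
move: (mode L psi) (pm R b * L) {He C1 C2 H1 H2 f1 f2 h1 h2} => F z.
move: (c1 + _) => q; case: b; rewrite /negb; last by reflexivity.
by rewrite [X in X + q]addrC.
Qed.

(** * A common interface for the three systems *)

Section blocks.
Variables (k : nat) (sg : 'I_k -> bool) (g : R -> bool -> 'I_k -> HH).
Variables (Zf : R -> blk R k -> blk R k) (Xf : HH * R * R -> blk R k).
Variables (bf : fn -> fn -> blk R k) (tup : HH * R * R -> 'I_k -> R).
Definition vpart (X : blk R k) (b : bool) : HH := if b then X.1.2 else X.1.1.
Hypothesis Hg : forall L b j, RP (g L b j).
Hypothesis HZ : forall L X, (forall b, vpart (Zf L X) b = zrow (g L) L (vpart X) (tnth X.2) b) /\
  forall j, tnth (Zf L X).2 j = zscal sg (g L) L (vpart X) (tnth X.2) j.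
Hypothesis HX : forall d, (forall b, vpart (Xf d) b = opP (prj b d.1.1)) /\
  forall j, tnth (Xf d).2 j = tup d j.
Hypothesis Hb : forall Tm Tp, (forall b, vpart (bf Tm Tp) b = inlet Tm Tp b) /\
  forall j, tnth (bf Tm Tp).2 j = ip (inlet Tm Tp (sg j)) (uu (sg j)).
Hypothesis Hcc : forall L d b, Data G tr d ->
  cc (g L) b (tup d) = (cst_part L d.1.2 d.2 b, 0).
Hypothesis Hdata : forall psi r, ranA G tr psi -> exists c1 c2,
  Data G tr (psi, c1, c2) /\ forall j, tup (psi, c1, c2) j = r j.
Hypothesis Htup : forall d d', Data G tr d -> Data G tr d' ->
  (forall j, tup d j = tup d' j) <-> d.1.2 = d'.1.2 /\ d.2 = d'.2.
(** Each sign needs a reason for v = P B_b v: control of the constants, a scalar row of that sign,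
    or the favourable sign of the mean of h. *)
Hypothesis Hcase : forall b, [\/ controlled G, (exists j, sg j = b) |
  ~ controlled G /\ 0 < pm R b * hh (Phi R) (Phi R)].
Hypothesis Hsolv : exists2 K : R, 0 <= K & exists L1 : R, forall L, L1 < L -> solvable sg (g L) K.

Lemma blk_inE (X : blk R k) : blk_in G tr X <-> forall b, RP (vpart X b).
Proof.
split=> [[/ranP_RP h1 /ranP_RP h2] [] //|H].
by split; apply/ranP_RP; [exact: (H false)|exact: (H true)].
Qed.

Lemma blk_eqE (X Y : blk R k) : (forall b, inH (vpart X b)) -> (forall b, inH (vpart Y b)) ->
  blk_eq G X Y <-> (forall b, eqv (vpart X b) (vpart Y b)) /\ forall j, tnth X.2 j = tnth Y.2 j.
Proof.
move=> DX DY; split=> [[h1 h2 h3]|[h1 h2]].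
  split=> [b|j]; last by rewrite h3.
  by case: b; [exact: (Heq_eqv hG htr (DX true) (DY true)).1
              |exact: (Heq_eqv hG htr (DX false) (DY false)).1].
split.
- exact: (Heq_eqv hG htr (DX false) (DY false)).2 (h1 false).
- exact: (Heq_eqv hG htr (DX true) (DY true)).2 (h1 true).
- by apply: eq_from_tnth.
Qed.

Lemma inlet_H Tm Tp b : L2 Tm -> L2 Tp -> inH (inlet Tm Tp b).
Proof. by move=> Lm Lp; case: b; exact: (inH_fst hG htr). Qed.

Lemma half_bf_H Tm Tp b : L2 Tm -> L2 Tp -> inH (vpart (bf Tm Tp) b).
Proof. by move=> Lm Lp; rewrite (Hb Tm Tp).1; exact: inlet_H. Qed.

Lemma Z_RP L X : 0 < L -> (forall b, RP (vpart X b)) -> forall b, RP (vpart (Zf L X) b).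
Proof. by move=> L0 HX' b; rewrite (HZ L X).1; exact: system_RP. Qed.

Lemma Zb_sysm L X Tm Tp : 0 < L -> L2 Tm -> L2 Tp -> (forall b, RP (vpart X b)) ->
  blk_eq G (Zf L X) (bf Tm Tp) <-> sysm sg (g L) L (vpart X) (tnth X.2) (inlet Tm Tp).
Proof.
move=> L0 Lm Lp HX'.
rewrite blk_eqE; [|by move=> b; case: (Z_RP L0 HX' b)|by move=> b; exact: half_bf_H].
split=> -[h1 h2]; split=> [b|j].
- by rewrite -(HZ L X).1 -(Hb Tm Tp).1.
- by rewrite -(HZ L X).2 -(Hb Tm Tp).2.
- by rewrite (HZ L X).1 (Hb Tm Tp).1.
- by rewrite (HZ L X).2 (Hb Tm Tp).2.
Qed.

Lemma X_RP d b : inH d.1.1 -> RP (vpart (Xf d) b).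
Proof.
move=> Hd; rewrite (HX d).1; apply: (RP_P nD0 nlin nP nPP).
exact: (H_pr hG htr hspec).
Qed.

Lemma dirichlet_equiv L Tm Tp d : 0 < L -> L2 Tm -> L2 Tp -> Data G tr d ->
  dirichlet G tr lam U S0 L Tm Tp d <-> blk_eq G (Zf L (Xf d)) (bf Tm Tp).
Proof.
move=> L0 Lm Lp Hd; have [Rpsi _ _] : [/\ ranA G tr d.1.1, True & True].
  by case: d Hd => -[psi c1] c2 [].
have Hpsi := ranA_D Rpsi.
rewrite (Zb_sysm L0 Lm Lp (fun b => X_RP b Hpsi)).
have -> : vpart (Xf d) = (fun b => opP (prj b d.1.1)) by apply/funext => b; rewrite (HX d).1.
have -> : tnth (Xf d).2 = tup d by apply/funext => j; rewrite (HX d).2.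
rewrite (dirichlet_sysm sg _ L0 (Hg L) (fun b => inlet_H b Lm Lp) Hpsi).
have LC b : L2 (cst_part L d.1.2 d.2 b).
  have : RP (cc (g L) b (tup d)) by exact: (RP_cc nD0 nDlin nC nlin nge0 nP nPlin (Hg L)).
  by rewrite Hcc// => -[/inH_L2].
have key b e : evolved (~~ b) L (prj (~~ b) d.1.1) e ->
    eqv (opP (prj b d.1.1) + opP e + cc (g L) b (tup d)) (inlet Tm Tp b) <->
    Tsol G tr lam U S0 L d.1.1 d.1.2 d.2 (pm R b * L) = (if b then Tp else Tm) %[ae area in Om].
  move=> He; have Ht := Tsol_trace d.1.2 d.2 Hpsi He; rewrite Hcc//.
  have H1 := H_pr hG htr hspec b Hpsi; have H2 := spanned_D He.1.
  have Lf := in_L2D mOm (in_L2D mOm (inH_L2 H1) (inH_L2 H2)) (LC b).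
  have -> : opP (prj b d.1.1) + opP e + (cst_part L d.1.2 d.2 b, 0) =
      ((prj b d.1.1).1 + e.1 + cst_part L d.1.2 d.2 b, 0).
    by congr (_, _); rewrite /= !addr0.
  have -> : inlet Tm Tp b = (if b then Tp else Tm, 0) by rewrite /inlet; case: b {He Ht H1 Lf}.
  have Lt : L2 (if b then Tp else Tm) by case: (b).
  rewrite (opP_Heq hG htr Lf Lt); split=> E.
    exact: ae_eq_trans Ht E.
  by apply: ae_eq_trans E; exact: ae_eq_sym.
have ev b : exists e, evolved b L (prj b d.1.1) e.
  by exists (expA G tr lam U b (- pm R b * 2 * L) (prj b d.1.1)); apply: expA_evolved => //;
     exact: H_pr.
have dE : dirichlet G tr lam U S0 L Tm Tp d <-> forall b,
    Tsol G tr lam U S0 L d.1.1 d.1.2 d.2 (pm R b * L) = (if b then Tp else Tm) %[ae area in Om].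
  case: d {Hd Rpsi Hpsi LC key ev} => -[psi c1] c2 /=; split=> [[h1 h2] [|]|H].
  - by rewrite /pm mul1r.
  - by rewrite /pm mulN1r.
  - by split; [have := H false; rewrite /pm mulN1r|have := H true; rewrite /pm mul1r].
rewrite dE; split=> H b; first by move=> e He; apply/key.
by have [e He] := ev (~~ b); apply/(key b e He); exact: H.
Qed.

(** Injectivity is that of psi -> P pi_b psi on the range of A; for surjectivity [system_onto]
    rebuilds psi from a solution, and there the scalar rows are essential. *)
Lemma block_equiv L Tm Tp : 0 < L -> L2 Tm -> L2 Tp ->
  system_equiv G tr lam U S0 L Tm Tp (Zf L) Xf (bf Tm Tp).
Proof.
move=> L0 Lm Lp; have dD d : Data G tr d -> ranA G tr d.1.1.
  by case: d => -[psi c1] c2 [].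
have DE := dirichlet_equiv L0 Lm Lp.
split; first by move=> d Hd; exact: DE.
split=> [d [Hd Hdir]|d d' [Hd _] [Hd' _]|Y [HY HZb]].
- split; last exact/(DE d Hd).
  by apply/blk_inE => b; apply: X_RP; exact: ranA_D (dD d Hd).
- have R1 := dD d Hd; have R2 := dD d' Hd'.
  have X1 b := (X_RP b (ranA_D R1)).1; have X2 b := (X_RP b (ranA_D R2)).1.
  rewrite (blk_eqE X1 X2).
  have hE : (forall b, eqv (vpart (Xf d) b) (vpart (Xf d') b)) <-> eqv d.1.1 d'.1.1.
    rewrite -(proj_inj R1 R2); split=> H b; have := H b.
      by rewrite (HX d).1 (HX d').1.
    by rewrite (HX d).1 (HX d').1.
  have tE : (forall j, tnth (Xf d).2 j = tnth (Xf d').2 j) <-> d.1.2 = d'.1.2 /\ d.2 = d'.2.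
    rewrite -(Htup Hd Hd'); split=> H j; have := H j.
      by rewrite (HX d).2 (HX d').2.
    by rewrite (HX d).2 (HX d').2.
  have qE := Heq_eqv hG htr (ranA_D R1) (ranA_D R2).
  split=> [[/qE/hE h1 h2 h3]|[/hE/qE h1 /tE[h2 h3]]]; last by split.
  by split => //; apply/tE.
- have HY' := (blk_inE Y).1 HY.
  have Hs := (Zb_sysm L0 Lm Lp HY').1 HZb.
  have [psi [Rpsi e Hs']] := system_onto L0 (Hg L) HY' (fun b => inlet_H b Lm Lp) Hcase Hs.
  have [c1 [c2 [Hd Ht]]] := Hdata (tnth Y.2) Rpsi.
  have Hpsi := ranA_D Rpsi.
  have XE : vpart (Xf (psi, c1, c2)) = (fun b => opP (prj b psi)).
    by apply/funext => b; rewrite (HX _).1.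
  have tE : tnth (Xf (psi, c1, c2)).2 = tnth Y.2.
    by apply/funext => j; rewrite (HX _).2 Ht.
  exists (psi, c1, c2).
    split=> //; apply/DE => //; apply/Zb_sysm => //; first by move=> b; exact: X_RP.
    by rewrite XE tE.
  apply/blk_eqE; [by move=> b; case: (X_RP b (d := (psi, c1, c2)) Hpsi)
                 |by move=> b; case: (HY' b)|].
  by split=> [b|j]; [rewrite XE; exact: e|rewrite tE].
Qed.

Lemma blk_normE (X : blk R k) : blk_norm G tr X =
  nrm ip (vpart X false) + nrm ip (vpart X true) + \sum_j `|tnth X.2 j|.
Proof. by []. Qed.

Lemma block_invertible : exists L0 : R, forall L : R, 0 < L -> L0 < L ->
  system_invertible G tr (Zf L).
Proof.
have [K K0 [L1 HK]] := Hsolv; have [L0 HL0] := system_large K0 Hg HK.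
exists L0 => L Lp LL; have Hw := HL0 L Lp LL; split; last first.
  have [C HC] := system_bound Lp (Hg L) Hw; exists C => X /blk_inE HX'.
  rewrite !blk_normE !(HZ L X).1; under [in leRHS]eq_bigr do rewrite (HZ L X).2.
  exact: HC.
split=> [X /blk_inE HX'|X Y /blk_inE HX' /blk_inE HY|Y /blk_inE HY].
- by apply/blk_inE; exact: Z_RP.
- have I := system_inj (tnth X.2) (tnth Y.2) Lp (Hg L) Hw HX' HY.
  rewrite (blk_eqE (fun b => (HX' b).1) (fun b => (HY b).1)).
  rewrite (blk_eqE (fun b => (Z_RP Lp HX' b).1) (fun b => (Z_RP Lp HY b).1)) -I.
  split=> -[h1 h2]; split=> [b|j].
  + by rewrite (HZ L X).1 (HZ L Y).1.
  + by rewrite (HZ L X).2 (HZ L Y).2.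
  + by rewrite -(HZ L X).1 -(HZ L Y).1.
  + by rewrite -(HZ L X).2 -(HZ L Y).2.
- have [X [r [H1 H2 H3]]] := Hw.2 (vpart Y) (tnth Y.2) HY.
  pose W : blk R k := (X false, X true, [tuple r j | j < k]).
  have hW : vpart W = X by apply/funext => -[].
  have tW : tnth W.2 = r by apply/funext => j; rewrite tnth_mktuple.
  have WR b : RP (vpart W b) by rewrite hW.
  exists W; first by apply/blk_inE.
  apply/(blk_eqE (fun b => (Z_RP Lp WR b).1) (fun b => (HY b).1)); split=> [b|j].
    by rewrite (HZ L W).1 hW tW; exact: H2.
  by rewrite (HZ L W).2 hW tW; exact: H3.
Qed.

End blocks.

End graetz_system.

(** * The three cases *)

Section cases.
Context (R : realType) (G : graetz_data R) (hG : graetz_hyp G).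
Context (tr : (R * R -> R) -> (R * R -> R)) (htr : trace_operator (omega G) tr).
Context (lam : int -> R) (U : int -> (R * R -> R)) (hspec : spectral_data G tr lam U).
Hypothesis hB : forall b : bool,
  bounded_invertible (Rpi G tr lam U b) (Heq G) (Hnorm G tr) (piPpi G tr lam U b).
Variable S0 : R * R -> R.
Local Notation fn := (R * R -> R).
Local Notation HH := (fn * fn)%type.
Local Notation L2 := (in_L2 area (omega G)).
Local Notation PhiR := (Phi R).

Lemma sum_swap (W : zmodType) (m w p q : W) : m + w + p + q = w + m + (p + q).
Proof. by rewrite (addrC m) addrA. Qed.

Lemma half_cases (P : bool -> Prop) : P false -> P true -> forall b, P b.
Proof. by move=> ? ? []. Qed.

Lemma RP_Phi : RP (inH G tr) (ip G tr) (@opP R) PhiR.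
Proof. exact: (RP_P (inH_0 hG htr) (@ip_linear _ _ hG _ htr) (@opP_stable _ _ hG _ htr) (@opP_idem R) (H_Phi hG htr)). Qed.

Lemma scale_Phi (k : R) : k *: PhiR = ((fun=> k) : fn, 0 : fn).
Proof.
congr (_, _); last by rewrite scaler0.
by apply/funext => p; rewrite -[LHS]/(k * 1) mulr1.
Qed.

Section controlled_case.
Hypothesis ct : controlled G.

Lemma controlled_system :
  (forall (L : R) (Tm Tp : fn), 0 < L -> L2 Tm -> L2 Tp ->
     system_equiv G tr lam U S0 L Tm Tp
       (Zcont G tr lam U L) (Xcont G tr lam U) (bcont Tm Tp)) /\
  (exists L0 : R, forall L : R, 0 < L -> L0 < L ->
     system_invertible G tr (Zcont G tr lam U L)).
Proof.
(* There are no real unknowns, so these are placeholders on an empty index type. *)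
pose sg (_ : 'I_0) := true; pose g (_ : R) (_ : bool) (_ : 'I_0) : HH := 0.
have Hg L b j : RP (inH G tr) (ip G tr) (@opP R) (g L b j) by case: j.
have HZ L (X : blk R 0) :
    (forall b, vpart (Zcont G tr lam U L X) b =
      zrow (opM G tr lam U) (g L) L (vpart X) (tnth X.2) b) /\
    forall j, tnth (Zcont G tr lam U L X).2 j =
      zscal (ip G tr) (@opP R) (opB G tr lam U) PhiR (opM G tr lam U) sg (g L) L
        (vpart X) (tnth X.2) j.
  split=> [b|[]//]; rewrite /zrow /cc big_ord0 addr0; case: X => -[v w] t.
  by case: b; rewrite /vpart/= // addrC.
have HX (d : HH * R * R) : (forall b, vpart (Xcont G tr lam U d) b =
    opP (Defs.proj G tr lam U b d.1.1)) /\
    forall j, tnth (Xcont G tr lam U d).2 j = (fun _ _ => 0) d j.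
  by case: d => -[psi c1] c2; split=> [[]|[]].
have Hb Tm Tp : (forall b, vpart (bcont Tm Tp) b = inlet Tm Tp b) /\
    forall j, tnth (bcont Tm Tp).2 j = ip G tr (inlet Tm Tp (sg j)) (u_ G tr lam U (sg j)).
  by split=> [[]|[]].
have dz d : Data G tr d -> d.1.2 = 0 /\ d.2 = 0.
  by case: d => -[psi c1] c2 [_ /(_ ct)].
have Hcc L d b : Data G tr d -> cc (g L) b ((fun _ _ => 0) d) = (cst_part S0 L d.1.2 d.2 b, 0).
  move=> /dz[-> ->]; rewrite /cc big_ord0; congr (_, _).
  by apply/funext => p; rewrite /cst_part mul0r addr0.
have Hdata psi (r : 'I_0 -> R) : ranA G tr psi -> exists c1 c2,
    Data G tr (psi, c1, c2) /\ forall j, (fun _ _ => 0) (psi, c1, c2) j = r j.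
  by move=> Rpsi; exists 0, 0; split=> [|[]//]; split.
have Htup d d' : Data G tr d -> Data G tr d' ->
    (forall j : 'I_0, (fun _ _ => 0 : R) d j = (fun _ _ => 0) d' j) <->
    d.1.2 = d'.1.2 /\ d.2 = d'.2.
  by move=> /dz[-> ->] /dz[-> ->].
have Hcase b : [\/ controlled G, (exists j, sg j = b) |
   ~ controlled G /\ 0 < pm R b * hint G PhiR.1 PhiR.1] by exact: Or31.
have Hsolv : exists2 K : R, 0 <= K & exists L1 : R, forall L, L1 < L ->
    solvable (ip G tr) (@opP R) (opB G tr lam U) PhiR sg (g L) K.
  exists 0 => //; exists 0 => L _.
  exact: (solvable0 (inH_0 hG htr) (@ip_linear _ _ hG _ htr)).
split=> [L Tm Tp L0 Lm Lp|].
  exact: (block_equiv hG htr hspec hB Hg HZ HX Hb Hcc Hdata Htup Hcase L0 Lm Lp).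
exact: (block_invertible hG htr hspec hB Hg HZ Hsolv).
Qed.

End controlled_case.

Section positive_case.
Hypothesis nc : ~ controlled G.
Hypothesis mean_pos : 0 < mean_h G.

(** A positive mean of h settles the sign [true], so one scalar row, against u_-, is enough; the
    same positivity is what makes u_- nonzero. *)
Lemma positive_system :
  (forall (L : R) (Tm Tp : fn), 0 < L -> L2 Tm -> L2 Tp ->
     system_equiv G tr lam U S0 L Tm Tp
       (Zpos G tr lam U L) (Xpos G tr lam U) (bpos G tr lam U Tm Tp)) /\
  (exists L0 : R, forall L : R, 0 < L -> L0 < L ->
     system_invertible G tr (Zpos G tr lam U L)).
Proof.
pose sg (_ : 'I_1) := false; pose g (_ : R) (_ : bool) (_ : 'I_1) : HH := PhiR.
pose tup (d : HH * R * R) (_ : 'I_1) : R := d.1.2.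
have Hg L b j : RP (inH G tr) (ip G tr) (@opP R) (g L b j) by exact: RP_Phi.
have HZ L (X : blk R 1) :
    (forall b, vpart (Zpos G tr lam U L X) b =
      zrow (opM G tr lam U) (g L) L (vpart X) (tnth X.2) b) /\
    forall j, tnth (Zpos G tr lam U L X).2 j =
      zscal (ip G tr) (@opP R) (opB G tr lam U) PhiR (opM G tr lam U) sg (g L) L
        (vpart X) (tnth X.2) j.
  case: X => -[v w] t; split=> [b|j].
    rewrite /zrow /cc big_ord1; case: b; rewrite /vpart/= //.
    by congr (_ + _); exact: addrC.
  by rewrite (ord1 j) (tnth_nth 0)/= /zscal /smat big_ord1.
have HX (d : HH * R * R) : (forall b, vpart (Xpos G tr lam U d) b =
    opP (Defs.proj G tr lam U b d.1.1)) /\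
    forall j, tnth (Xpos G tr lam U d).2 j = tup d j.
  by case: d => -[psi c1] c2; split=> [[]//|j]; rewrite (ord1 j) (tnth_nth 0).
have Hb Tm Tp : (forall b, vpart (bpos G tr lam U Tm Tp) b = inlet Tm Tp b) /\
    forall j, tnth (bpos G tr lam U Tm Tp).2 j =
      ip G tr (inlet Tm Tp (sg j)) (u_ G tr lam U (sg j)).
  by split=> [[]//|j]; rewrite (ord1 j) (tnth_nth 0).
have mN : mean_h G != 0 by rewrite gt_eqF.
have dz d : Data G tr d -> d.2 = 0.
  by case: d => -[psi c1] c2 [_ _ /(_ nc mN)].
have Hcc L d b : Data G tr d -> cc (g L) b (tup d) = (cst_part S0 L d.1.2 d.2 b, 0).
  move=> /dz->; rewrite /cc big_ord1 scale_Phi; congr (_, _).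
  by apply/funext => p; rewrite /cst_part mul0r addr0.
have Hdata psi (r : 'I_1 -> R) : ranA G tr psi -> exists c1 c2,
    Data G tr (psi, c1, c2) /\ forall j, tup (psi, c1, c2) j = r j.
  by move=> Rpsi; exists (r ord0), 0; split=> [|j]; [split|rewrite (ord1 j)].
have Htup d d' : Data G tr d -> Data G tr d' ->
    (forall j, tup d j = tup d' j) <-> d.1.2 = d'.1.2 /\ d.2 = d'.2.
  move=> /dz-> /dz->; split=> [H|[H _] j]; last exact: H.
  by split=> //; exact: (H ord0).
have Hcase b : [\/ controlled G, (exists j, sg j = b) |
   ~ controlled G /\ 0 < pm R b * hint G PhiR.1 PhiR.1].
  case: b; last by apply: Or32; exists ord0.
  by apply: Or33; split => //; rewrite mul1r -(mean_hE G).
have Hsolv : exists2 K : R, 0 <= K & exists L1 : R, forall L, L1 < L ->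
    solvable (ip G tr) (@opP R) (opB G tr lam U) PhiR sg (g L) K.
  have u0 : 0 < ip G tr (u_ G tr lam U false) (u_ G tr lam U false).
    apply: (u_gt0 hG htr hspec hB nc).
    by rewrite /pm mulN1r oppr_le0 ltW.
  have [K K0 HK] := solvable1 (inH_0 hG htr) (@inH_linear _ _ hG _ htr) (@ip_sym _ _ hG tr)
    (@ip_linear _ _ hG _ htr) (@opP_stable _ _ hG _ htr) (@opP_idem R) (@opP_selfadjoint _ _ hG _ htr)
    (@opBP _ _ hG _ htr _ _ hspec hB) (H_Phi hG htr) (Phi_P R) u0.
  by exists K => //; exists 0 => L _.
split=> [L Tm Tp L0 Lm Lp|].
  exact: (block_equiv hG htr hspec hB Hg HZ HX Hb Hcc Hdata Htup Hcase L0 Lm Lp).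
exact: (block_invertible hG htr hspec hB Hg HZ Hsolv).
Qed.

End positive_case.

Section balanced_case.
Hypothesis bal : balanced G.
Hypothesis hS0 : is_Delta_inv_h G tr S0.

(** A zero mean settles neither sign, hence two scalar rows; on the other hand the condition of
    [u_gt0] holds with equality for both signs, so u_- and u_+ are both nonzero. *)
Lemma balanced_system :
  (forall (L : R) (Tm Tp : fn), 0 < L -> L2 Tm -> L2 Tp ->
     system_equiv G tr lam U S0 L Tm Tp
       (Zbal G tr lam U S0 L) (Xbal G tr lam U) (bbal G tr lam U Tm Tp)) /\
  (exists L0 : R, forall L : R, 0 < L -> L0 < L ->
     system_invertible G tr (Zbal G tr lam U S0 L)).
Proof.
have [nc m0] := bal; pose g := g2 PhiR (PhiT S0).
pose tup (d : HH * R * R) (j : 'I_2) : R := if j == ord0 then d.1.2 else d.2.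
have ord2 (P : 'I_2 -> Prop) : P ord0 -> P ord_max -> forall j, P j.
  move=> h0 h1 j; have [->//|jN] := eqVneq j ord0.
  suff -> : j = ord_max by [].
  by apply: val_inj => /=; case: j jN => -[|[|]].
have LS : L2 S0 by case: hS0 => /spaceV_H1 /H1_L2.
have HT : inH G tr (PhiT S0) := inH_fst hG htr LS.
have RPT : RP (inH G tr) (ip G tr) (@opP R) (PhiT S0).
  exact: (RP_P (inH_0 hG htr) (@ip_linear _ _ hG _ htr) (@opP_stable _ _ hG _ htr) (@opP_idem R) HT).
have Hg L b j : RP (inH G tr) (ip G tr) (@opP R) (g L b j).
  rewrite /g /g2; case: ifP => _; first exact: RP_Phi.
  exact: (RP_lin (inH_0 hG htr) (@inH_linear _ _ hG _ htr) (@ip_sym _ _ hG tr)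
    (@ip_linear _ _ hG _ htr) (@ip_nneg _ _ hG _ htr) (@opP_stable _ _ hG _ htr) (@opP_lin R)
    _ RP_Phi RPT).
have HZ L (X : blk R 2) :
    (forall b, vpart (Zbal G tr lam U S0 L X) b =
      zrow (opM G tr lam U) (g L) L (vpart X) (tnth X.2) b) /\
    forall j, tnth (Zbal G tr lam U S0 L X).2 j =
      zscal (ip G tr) (@opP R) (opB G tr lam U) PhiR (opM G tr lam U) sg2 (g L) L
        (vpart X) (tnth X.2) j.
  have g1 b : g L b ord_max = (if b then L else - L) *: PhiR + PhiT S0.
    by rewrite /g /g2 /pm; case: b; rewrite ?mul1r ?mulN1r.
  have g0 b : g L b ord0 = PhiR by rewrite /g /g2 eqxx.
  case: X => -[v w] t; split; last first.
    apply: ord2; rewrite (tnth_nth 0) /zscal /smat sum2 !g0 !g1; exact: esym (addrA _ _ _).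
  apply: half_cases; rewrite /zrow /cc sum2 g0 g1.
    exact: esym (addrA _ _ _).
  exact: sum_swap.
have HX (d : HH * R * R) : (forall b, vpart (Xbal G tr lam U d) b =
    opP (Defs.proj G tr lam U b d.1.1)) /\
    forall j, tnth (Xbal G tr lam U d).2 j = tup d j.
  by case: d => -[psi c1] c2; split=> [[]//|]; apply: ord2; rewrite (tnth_nth 0).
have Hb Tm Tp : (forall b, vpart (bbal G tr lam U Tm Tp) b = inlet Tm Tp b) /\
    forall j, tnth (bbal G tr lam U Tm Tp).2 j =
      ip G tr (inlet Tm Tp (sg2 j)) (u_ G tr lam U (sg2 j)).
  by split=> [[]//|]; apply: ord2; rewrite (tnth_nth 0).
have Hcc L d b : Data G tr d -> cc (g L) b (tup d) = (cst_part S0 L d.1.2 d.2 b, 0).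
  move=> _; rewrite /cc sum2 /g /g2/= !scale_Phi /tup/=; congr (_, _).
  by rewrite -[LHS]/(0 + d.2 *: (0 + 0)) add0r addr0 scaler0.
have Hdata psi (r : 'I_2 -> R) : ranA G tr psi -> exists c1 c2,
    Data G tr (psi, c1, c2) /\ forall j, tup (psi, c1, c2) j = r j.
  move=> Rpsi; exists (r ord0), (r ord_max); split; last exact: ord2.
  by split=> // _ /eqP.
have Htup d d' : Data G tr d -> Data G tr d' ->
    (forall j, tup d j = tup d' j) <-> d.1.2 = d'.1.2 /\ d.2 = d'.2.
  move=> _ _; split=> [H|[h1 h2]]; last exact: ord2.
  by split; [exact: (H ord0)|exact: (H ord_max)].
have Hcase b : [\/ controlled G, (exists j, sg2 j = b) |
   ~ controlled G /\ 0 < pm R b * hint G PhiR.1 PhiR.1].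
  by apply: Or32; case: b; [exists ord_max|exists ord0].
have u0 b : 0 < ip G tr (u_ G tr lam U b) (u_ G tr lam U b).
  by apply: (u_gt0 hG htr hspec hB nc); rewrite m0 mulr0.
have Hsolv : exists2 K : R, 0 <= K & exists L1 : R, forall L, L1 < L ->
    solvable (ip G tr) (@opP R) (opB G tr lam U) PhiR sg2 (g L) K.
  exact: (solvable2 (inH_0 hG htr) (@inH_linear _ _ hG _ htr) (@ip_sym _ _ hG tr)
    (@ip_linear _ _ hG _ htr) (@ip_nneg _ _ hG _ htr) (@opP_stable _ _ hG _ htr) (@opP_idem R)
    (@opP_selfadjoint _ _ hG _ htr) (@opBP _ _ hG _ htr _ _ hspec hB) (H_Phi hG htr) (Phi_P R)
    RPT (u0 false) (u0 true)).
split=> [L Tm Tp L0 Lm Lp|].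
  exact: (block_equiv hG htr hspec hB Hg HZ HX Hb Hcc Hdata Htup Hcase L0 Lm Lp).
exact: (block_invertible hG htr hspec hB Hg HZ Hsolv).
Qed.

End balanced_case.
End cases.

Theorem proposition9 (R : realType) (G : graetz_data R) (hG : graetz_hyp G)
  (tr : (R * R -> R) -> (R * R -> R)) (htr : trace_operator (omega G) tr)
  (lam : int -> R) (U : int -> (R * R -> R)) (hspec : spectral_data G tr lam U)
  (hB : forall b : bool,
     bounded_invertible (Rpi G tr lam U b) (Heq G) (Hnorm G tr)
       (piPpi G tr lam U b))
  (S0 : R * R -> R) (hS0 : balanced G -> is_Delta_inv_h G tr S0) :
  [/\ controlled G ->
        (forall (L : R) (Tm Tp : R * R -> R), 0 < L ->
           in_L2 area (omega G) Tm -> in_L2 area (omega G) Tp ->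
           system_equiv G tr lam U S0 L Tm Tp
             (Zcont G tr lam U L) (Xcont G tr lam U) (bcont Tm Tp)) /\
        (exists L0 : R, forall L : R, 0 < L -> L0 < L ->
           system_invertible G tr (Zcont G tr lam U L)),
      ~ controlled G -> 0 < mean_h G ->
        (forall (L : R) (Tm Tp : R * R -> R), 0 < L ->
           in_L2 area (omega G) Tm -> in_L2 area (omega G) Tp ->
           system_equiv G tr lam U S0 L Tm Tp
             (Zpos G tr lam U L) (Xpos G tr lam U) (bpos G tr lam U Tm Tp)) /\
        (exists L0 : R, forall L : R, 0 < L -> L0 < L ->
           system_invertible G tr (Zpos G tr lam U L)) &
      balanced G ->
        (forall (L : R) (Tm Tp : R * R -> R), 0 < L ->
           in_L2 area (omega G) Tm -> in_L2 area (omega G) Tp ->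
           system_equiv G tr lam U S0 L Tm Tp
             (Zbal G tr lam U S0 L) (Xbal G tr lam U) (bbal G tr lam U Tm Tp)) /\
        (exists L0 : R, forall L : R, 0 < L -> L0 < L ->
           system_invertible G tr (Zbal G tr lam U S0 L))].
Proof.
split=> [ct|nc m0|bal].
- exact: controlled_system.
- exact: positive_system.
- exact: (balanced_system hG htr hspec hB bal (hS0 bal)).
Qed.
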